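(* Let $(X,g_X)$ be a connected Kähler manifold with an action of a compact Lie group $G$, satisfying the standing assumption described in the context, with associated function $\varphi_X$. Suppose that there exists an exhaustion function $\varrho_1:X\to\mathbb{R}_{>0}$ such that $\bar\partial\log\varrho_1$ is $L^2$ on $X$. Let $(E,\bar\partial_E)$ be a $G$-equivariant holomorphic vector bundle on $X$ with a $G$-invariant Hermitian metric $h_0$ such that $|\Lambda F(h_0)|_{h_0}\le B\varphi_X$ for some $B>0$ and such that $(E,\bar\partial_E,h_0)$ is analytically stable with respect to the $G$-action. Suppose that $h_1$ and $h_2$ are $G$-invariant Hermitian-Einstein metrics of $(E,\bar\partial_E)$ such that, for $i=1,2$, (i) $\det(h_i)=\det(h_0)$, and (ii) $h_i$ and $h_0$ are mutually bounded. Then $h_1=h_2$.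
   Context: Base space. $G$ is a compact Lie group and $(X,g_X)$ is a connected Kähler manifold of complex dimension $n$, with Kähler form $\omega_X$ and volume form $\mathrm{dvol}_X$; $\int_Xf$ means $\int_Xf\,\mathrm{dvol}_X$. $G$ acts on $X$ from the left by a $C^\infty$-map $\kappa:G\times X\to X$, with $\kappa_a:=\kappa(a,\cdot)$ holomorphic and $\kappa_a^*g_X=g_X$ for each $a\in G$. $\Lambda$ is the adjoint of multiplication by $\omega_X$, and $\Delta_X:=-\sqrt{-1}\Lambda\partial_X\bar\partial_X$ (one half of the nonnegative Riemannian Laplacian). An exhaustion function is a $C^\infty$ function all of whose sublevel sets are compact. Standing assumption on $X$: there exist a $G$-invariant function $\varphi_X:X\to(0,\infty)$ with $\int_X\varphi_X<\infty$ and a function $C_X:\mathbb{R}_{>0}\to\mathbb{R}_{>0}$ such that: if $f:X\to[0,\infty)$ is a bounded function with $\Delta_Xf\le B\varphi_X$ as distributions for a positive number $B$, then $\sup_Xf\le C_X(B)\bigl(1+\int_Xf\varphi_X\bigr)$; moreover, if a bounded function $f$ satisfies $\Delta_Xf\le0$ on $X$, then $\Delta_Xf=0$. (Functions are considered up to null sets and $\sup$ is the essential supremum.) Bundles. A holomorphic vector bundle $(E,\bar\partial_E)$ on $X$ is $G$-equivariant if it is given a $C^\infty$-isomorphism $\Theta:\kappa^{-1}(E)\simeq p_2^{-1}(E)$ over $G\times X$ ($p_2:G\times X\to X$ the projection) such that, with $\Theta_a:=\Theta|_{\{a\}\times X}$, one has $\Theta_{a_1a_2}=\Theta_{a_2}\circ\kappa_{a_2}^{-1}(\Theta_{a_1})$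 and each $\Theta_a:\kappa_a^{-1}(E)\simeq E$ is holomorphic. A Hermitian metric $h$ of $E$ is $G$-invariant if each $\Theta_a$ is an isometry. $F(h)$ is the curvature of the Chern connection of $(E,\bar\partial_E,h)$ and $F(h)^\perp$ its trace-free part; $h$ is Hermitian-Einstein if $\Lambda F(h)^\perp=0$. $\det(h)$ is the metric induced by $h$ on $\det(E)$. Two Hermitian metrics $h,h'$ are mutually bounded if $C^{-1}h\le h'\le Ch$ for some constant $C\ge1$. Stability. Suppose $|\Lambda F(h_0)|_{h_0}\le B\varphi_X$. Put $\deg(E,h_0):=\sqrt{-1}\int_X\mathrm{Tr}(\Lambda F(h_0))$. For an $\mathcal{O}_X$-submodule $V\subset E$ that is saturated ($E/V$ torsion-free), there is a closed complex analytic subset $Z(V)\subset X$ with $\dim Z(V)\le\dim X-2$ such that $V|_{X\setminus Z(V)}$ is locally free; with $h_{0,V}$ the induced metric there, put $\deg(V,h_0):=\sqrt{-1}\int_{X\setminus Z(V)}\mathrm{Tr}(\Lambda F(h_{0,V}))\in\mathbb{R}\cup\{-\infty\}$. $V$ is $G$-equivariant if $\Theta_a(\kappa_a^*V)=V$ for all $a\in G$. $(E,\bar\partial_E,h_0)$ is analytically stable with respect to the $G$-action if $\deg(V,h_0)/\mathrm{rank}\,V<\deg(E,h_0)/\mathrm{rank}\,E$ for every saturated $G$-equivariant $\mathcal{O}_X$-submodule $V\subset E$ with $0<\mathrm{rank}\,V<\mathrm{rank}\,E$. *)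

(* Defs.v *)
Set Warnings "-notation-overridden,-ambiguous-paths,-notation-incompatible-prefix".
From HB Require Import structures.
From mathcomp Require Import all_boot all_order all_algebra.
From mathcomp Require Import complex.
From mathcomp Require Import all_classical all_reals all_analysis ess_sup_inf.

Set Implicit Arguments.
Unset Strict Implicit.
Unset Printing Implicit Defensive.
Import Order.TTheory GRing.Theory Num.Theory numFieldNormedType.Exports.
Local Open Scope classical_set_scope.
Local Open Scope ring_scope.

(** * Smooth manifolds *)

(* [charti a] is only meaningful on the image of [chart a], and [chart a] only
   on [dom a].  [chart_at x] is a choice of chart around [x]; every pointwise
   quantity computed with it below is independent of that choice. *)
Record atlas (R : realType) (d : nat) (X : topologicalType) := Atlas {
  idx : Type;
  dom : idx -> set X;
  chart : idx -> X -> 'rV[R]_d;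
  charti : idx -> 'rV[R]_d -> X;
  chart_at : X -> idx }.

Definition prod_atlas (R : realType) (d e : nat) (X Y : topologicalType)
    (A : atlas R d X) (B : atlas R e Y) : atlas R (d + e) (X * Y)%type :=
  {| idx := (idx A * idx B)%type;
     dom := fun ab => dom ab.1 `*` dom ab.2;
     chart := fun ab p => row_mx (chart ab.1 p.1) (chart ab.2 p.2);
     charti := fun ab v => (charti ab.1 (lsubmx v), charti ab.2 (rsubmx v));
     chart_at := fun p => (chart_at A p.1, chart_at B p.2) |}.

Section Smooth.
Variables (R : realType) (d : nat) (X : topologicalType) (M : atlas R d X).

Definition pderive (a : idx M) (i : 'I_d) (f : X -> R) (x : X) : R :=
  'D_(delta_mx 0 i : 'rV[R]_d) (f \o charti a) (chart a x).

Fixpoint Ck (k : nat) (a : idx M) (U : set X) (f : X -> R) : Prop :=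
  (forall x, U x -> {for x, continuous f}) /\
  if k is k'.+1 then
    forall i : 'I_d,
      (forall x, U x ->
         derivable (f \o charti a) (chart a x) (delta_mx 0 i : 'rV[R]_d)) /\
      Ck k' a U (pderive a i f)
  else True.

Definition smooth_on (U : set X) (f : X -> R) : Prop :=
  forall (a : idx M) (k : nat), Ck k a (U `&` dom a) f.

Definition csmooth_on (U : set X) (f : X -> R[i]) : Prop :=
  smooth_on U (fun x => complex.Re (f x)) /\
  smooth_on U (fun x => complex.Im (f x)).

Record is_manifold : Prop := IsManifold {
  manifold_hausdorff : hausdorff_space X;
  manifold_second_countable : @second_countable X;
  dom_chart_at : forall x, dom (chart_at M x) x;
  dom_open : forall a : idx M, open (dom a);
  chart_open : forall a : idx M, open (chart a @` dom a);
  chartK : forall (a : idx M) x, dom a x -> charti a (chart a x) = x;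
  chart_continuous :
    forall (a : idx M) x, dom a x -> {for x, continuous (chart a)};
  charti_continuous :
    forall (a : idx M) x, dom a x -> {for chart a x, continuous (charti a)};
  chart_smooth : forall (a : idx M) i, smooth_on (dom a) (fun x => chart a x 0 i)
}.

End Smooth.

Definition smooth_map (R : realType) (d e : nat) (X Y : topologicalType)
    (M : atlas R d X) (N : atlas R e Y) (f : X -> Y) : Prop :=
  continuous f /\
  forall (b : idx N) (i : 'I_e),
    smooth_on M (f @^-1` dom b) (fun x => chart b (f x) 0 i).

Record lie_group (R : realType) (m : nat) (G : topologicalType) := LieGroup {
  lie_atlas : atlas R m G;
  gmul : G -> G -> G;
  gone : G;
  ginv : G -> G;
  lie_manifold : is_manifold lie_atlas;
  gmulA : associative gmul;
  gmul1 : left_id gone gmul;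
  gmulV : left_inverse gone ginv gmul;
  gmul_smooth :
    smooth_map (prod_atlas lie_atlas lie_atlas) lie_atlas
               (fun p => gmul p.1 p.2);
  ginv_smooth : smooth_map lie_atlas lie_atlas ginv }.

(** * Complex manifolds *)

(* A chart of a complex n-manifold is a real chart
   (Re z_1, .., Re z_n, Im z_1, .., Im z_n). *)
Section Holomorphic.
Variables (R : realType) (n : nat) (X : topologicalType).
Variable M : atlas R (n + n) X.
Local Notation C := (R[i]).
Local Notation iC := (Complex 0 1 : C).

Definition zcoord (a : idx M) (l : 'I_n) (x : X) : C :=
  Complex (chart a x 0 (lshift n l)) (chart a x 0 (rshift n l)).

Definition cpderive (a : idx M) (i : 'I_(n + n)) (f : X -> C) (x : X) : C :=
  Complex (pderive a i (fun y => complex.Re (f y)) x)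
          (pderive a i (fun y => complex.Im (f y)) x).

Definition dz (a : idx M) (j : 'I_n) (f : X -> C) (x : X) : C :=
  (cpderive a (lshift n j) f x - iC * cpderive a (rshift n j) f x) / 2%:R.

Definition dzbar (a : idx M) (j : 'I_n) (f : X -> C) (x : X) : C :=
  (cpderive a (lshift n j) f x + iC * cpderive a (rshift n j) f x) / 2%:R.

Definition dz_mx (p q : nat) (a : idx M) (j : 'I_n) (f : X -> 'M[C]_(p, q))
    (x : X) : 'M[C]_(p, q) := \matrix_(u, v) dz a j (fun y => f y u v) x.

Definition dzbar_mx (p q : nat) (a : idx M) (j : 'I_n) (f : X -> 'M[C]_(p, q))
    (x : X) : 'M[C]_(p, q) := \matrix_(u, v) dzbar a j (fun y => f y u v) x.

Definition holo_on (U : set X) (f : X -> C) : Prop :=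
  csmooth_on M U f /\
  forall (a : idx M) (j : 'I_n) x, U x -> dom a x -> dzbar a j f x = 0.

Definition holo_map (f : X -> X) : Prop :=
  continuous f /\
  forall (b : idx M) (l : 'I_n),
    holo_on (f @^-1` dom b) (fun x => zcoord b l (f x)).

Definition is_complex_manifold : Prop :=
  is_manifold M /\
  forall (b : idx M) (l : 'I_n), holo_on (dom b) (zcoord b l).

Definition jac (a b : idx M) (f : X -> X) (x : X) : 'M[C]_n :=
  \matrix_(l, j) dz a j (fun y => zcoord b l (f y)) x.

End Holomorphic.

(** * Hermitian matrices *)

Section HermitianMatrices.
Variables (R : realType).
Local Notation C := (R[i]).

Definition adjmx (p q : nat) (A : 'M[C]_(p, q)) : 'M[C]_(q, p) :=
  (map_mx Num.conj A)^T.

(* A Hermitian form is represented by H through (u, v) |-> v^* H u. *)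
Definition hsqnorm (r : nat) (H : 'M[C]_r) (v : 'cV[C]_r) : R :=
  complex.Re ((adjmx v *m H *m v) 0 0).

Definition posdef (r : nat) (H : 'M[C]_r) : Prop :=
  adjmx H = H /\ forall v : 'cV[C]_r, v != 0 -> 0 < hsqnorm H v.

(* |A|^2 = Tr (A A^dagger), A^dagger = H^-1 A^* H being the H-adjoint of A. *)
Definition endo_norm (r : nat) (H A : 'M[C]_r) : R :=
  Num.sqrt (complex.Re (\tr (A *m (invmx H *m adjmx A *m H)))).

Definition trace_free (r : nat) (A : 'M[C]_r) : 'M[C]_r :=
  A - (\tr A / r%:R)%:M.

End HermitianMatrices.

(** * Kaehler manifolds *)

(* Integral over R^d with respect to the Lebesgue measure, as an iterated
   one-dimensional integral (Tonelli); only used for nonnegative Borel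
   functions. *)
Fixpoint lebesgue_int (R : realType) (d : nat) : ('rV[R]_d -> \bar R) -> \bar R :=
  match d return ('rV[R]_d -> \bar R) -> \bar R with
  | 0 => fun f => f 0
  | d'.+1 => fun f =>
      (\int[@lebesgue_measure R]_t
         lebesgue_int (fun v : 'rV[R]_d' => f (row_mx (t%:M : 'rV_1) v)))%E
  end.

Notation borel X := (g_sigma_algebraType (@open X)).

(* [kmetric a x j k] is g_{j kbar} = g(d/dz_j, d/dzbar_k), for the complex
   bilinear extension of the Riemannian metric g: the flat metric of C^n has
   g_{j kbar} = delta_{jk} / 2, and the Kaehler form is
     omega = i \sum g_{j kbar} dz_j /\ dzbar_k.
   [kmetric_transfer] is the transformation law under a change of coordinates,
   and [kmetric_closed] is d omega = 0.  [dvol] is the Borel measure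
     omega^n / n! = 2^n det(g_{j kbar}) dx_1 dy_1 .. dx_n dy_n;
   it is determined by [dvolE]. *)
Record kahler (R : realType) (n : nat) (X : ptopologicalType) := Kahler {
  katlas :> atlas R (n + n) X;
  kmanifold : is_complex_manifold katlas;
  kmetric : idx katlas -> X -> 'M[R[i]]_n;
  kmetric_posdef : forall a x, dom a x -> posdef (kmetric a x);
  kmetric_smooth :
    forall a j k, csmooth_on katlas (dom a) (fun x => kmetric a x j k);
  kmetric_transfer : forall a b x, dom a x -> dom b x ->
    kmetric a x =
      (jac a b idfun x)^T *m kmetric b x *m map_mx Num.conj (jac a b idfun x);
  kmetric_closed : forall a x (j k l : 'I_n), dom a x ->
    dz a l (fun y => kmetric a y j k) x = dz a j (fun y => kmetric a y l k) x;
  dvol : {measure set (borel X) -> \bar R};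
  dvolE : forall (a : idx katlas) (S : set (borel X)),
    measurable S -> S `<=` dom a ->
    dvol S = lebesgue_int (fun v =>
      (\1_(chart a @` S) v *
       (2 ^+ n * complex.Re (\det (kmetric a (charti a v)))))%:E) }.

Arguments kmetric {R n X} K a x : rename.

Section KahlerCalculus.
Variables (R : realType) (n : nat) (X : ptopologicalType) (K : kahler R n X).
Local Notation C := (R[i]).
Local Notation iC := (Complex 0 1 : C).
Local Notation mu := (dvol K).

Definition gmx (x : X) : 'M[C]_n := kmetric K (chart_at K x) x.

Definition holo_isometry (f : X -> X) : Prop :=
  holo_map K f /\
  forall (a b : idx K) x, dom a x -> dom b (f x) ->
    kmetric K a x =
      (jac a b f x)^T *m kmetric K b (f x) *m map_mx Num.conj (jac a b f x).

(* The adjoint of the product with omega, on the (1,1)-form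
   \sum w_{jk} dz_j /\ dzbar_k at x: \Lambda (dz_j /\ dzbar_k) = - i g^{kbar j},
   so that \Lambda omega = n. *)
Definition Lambda (x : X) (w : 'M[C]_n) : C := - iC * \tr (invmx (gmx x) *m w).

Definition Lambda_mx (r : nat) (x : X) (w : 'I_n -> 'I_n -> 'M[C]_r) : 'M[C]_r :=
  \matrix_(u, v) Lambda x (\matrix_(j, k) w j k u v).

Definition laplacian (f : X -> R) (x : X) : R :=
  let a := chart_at K x in
  complex.Re (- iC * Lambda x
    (\matrix_(j, k) dz a j (dzbar a k (fun y => (f y)%:C%C)) x)).

Definition dbar_sqnorm (f : X -> R) (x : X) : R :=
  let b k := dzbar (chart_at K x) k (fun y => (f y)%:C%C) x in
  complex.Re (\sum_j \sum_k invmx (gmx x) k j * b k * Num.conj (b j)).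

Definition test_function (f : X -> R) : Prop :=
  smooth_on K setT f /\ compact (closure [set x | f x != 0]).

(* Delta f <= w, resp. Delta f = 0, as distributions; Delta is self-adjoint. *)
Definition laplacian_le (f w : X -> R) : Prop :=
  forall chi, test_function chi -> (forall x, 0 <= chi x) ->
    (\int[mu]_x (f x * laplacian chi x)%:E <= \int[mu]_x (w x * chi x)%:E)%E.

Definition harmonic (f : X -> R) : Prop :=
  forall chi, test_function chi ->
    (\int[mu]_x (f x * laplacian chi x)%:E)%E = 0%E.

Definition bounded_measurable (f : X -> R) : Prop :=
  measurable_fun setT (f : borel X -> R) /\ exists c, forall x, `|f x| <= c.

Definition exhaustion (f : X -> R) : Prop :=
  smooth_on K setT f /\ forall c : R, compact [set x | f x <= c].

End KahlerCalculus.

(** * Group actions and the standing assumption *)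

Record action (R : realType) (m n : nat) (G : topologicalType)
    (X : ptopologicalType) (L : lie_group R m G) (K : kahler R n X) := Action {
  act :> G -> X -> X;
  act1 : forall x, act (gone L) x = x;
  actM : forall a b x, act (gmul L a b) x = act a (act b x);
  act_smooth : smooth_map (prod_atlas (lie_atlas L) K) K (fun p => act p.1 p.2);
  act_isometry : forall a, holo_isometry K (act a) }.

Definition standing_assumption (R : realType) (m n : nat) (G : topologicalType)
    (X : ptopologicalType) (L : lie_group R m G) (K : kahler R n X)
    (kappa : action L K) (phi : X -> R) : Prop :=
  [/\ measurable_fun setT (phi : borel X -> R) /\ (forall x, 0 < phi x),
      forall a : G, {ae dvol K, forall x, phi (kappa a x) = phi x},
      (\int[dvol K]_x (phi x)%:E < +oo)%E,
      exists c : R -> R, (forall B, 0 < B -> 0 < c B) /\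
        forall (f : X -> R) (B : R), bounded_measurable f ->
          (forall x, 0 <= f x) -> 0 < B ->
          laplacian_le K f (fun x => B * phi x) ->
          (ess_sup (dvol K) (EFin \o f) <=
             (c B)%:E * (1 + \int[dvol K]_x (f x * phi x)%:E))%E
    & forall f : X -> R, bounded_measurable f ->
        laplacian_le K f (fun=> 0) -> harmonic K f].

(** * Holomorphic vector bundles *)

(* The fibres of a bundle of rank r are identified, one point at a time, with
   'cV_r (choose any basis of each fibre; no regularity in the point is asked
   of that choice).  So a section is a function X -> 'cV_r, but neither it nor
   the bundle has a topological or holomorphic meaning in these coordinates:
   those come only from the local holomorphic frames, the basis
   e_1(x), .., e_r(x) of the fibre at x being the columns of [frame j x]. *)
Record vbundle (R : realType) (n : nat) (X : ptopologicalType)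
    (K : kahler R n X) (r : nat) := VBundle {
  vidx : Type;
  vdom : vidx -> set X;
  frame : vidx -> X -> 'M[R[i]]_r;
  frame_at : X -> vidx;
  vdom_frame_at : forall x, vdom (frame_at x) x;
  vdom_open : forall j, open (vdom j);
  frame_unit : forall j x, vdom j x -> frame j x \in unitmx;
  frame_holo : forall i j u v,
    holo_on K (vdom i `&` vdom j) (fun x => (invmx (frame i x) *m frame j x) u v)
}.

Section Bundles.
Variables (R : realType) (n : nat) (X : ptopologicalType) (K : kahler R n X).
Variables (r : nat) (E : vbundle K r).
Local Notation C := (R[i]).
Local Notation iC := (Complex 0 1 : C).

Definition holo_section (U : set X) (s : X -> 'cV[C]_r) : Prop :=
  forall (j : vidx E) u,
    holo_on K (U `&` vdom j) (fun x => (invmx (frame j x) *m s x) u 0).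

(* Matrix (h(s_q, s_p))_{pq} of a fibre metric h in k sections s_1, .., s_k,
   the columns of s. *)
Definition gram (k : nat) (h : X -> 'M[C]_r) (s : X -> 'M[C]_(r, k)) (x : X) :
    'M[C]_k := adjmx (s x) *m h x *m s x.

Definition hermitian_metric (h : X -> 'M[C]_r) : Prop :=
  (forall x, posdef (h x)) /\
  forall (j : vidx E) u v,
    csmooth_on K (vdom j) (fun x => gram h (frame j) x u v).

(* Chern curvature in a holomorphic frame with Gram matrix H: the connection
   form is H^-1 dH (d the (1,0)-differential) and F = dbar (H^-1 dH), whose
   coefficient on dz_j /\ dzbar_k is the matrix below. *)
Definition chern_curvature (k : nat) (H : X -> 'M[C]_k) (x : X) (j l : 'I_n) :
    'M[C]_k :=
  let a := chart_at K x in
  - dzbar_mx a l (fun y => invmx (H y) *m dz_mx a j H y) x.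

Definition LambdaF (k : nat) (H : X -> 'M[C]_k) (x : X) : 'M[C]_k :=
  Lambda_mx K x (chern_curvature H x).

Definition degree_density (k : nat) (H : X -> 'M[C]_k) (x : X) : R :=
  complex.Re (iC * \tr (LambdaF H x)).

Definition gram_at (h : X -> 'M[C]_r) (x : X) : X -> 'M[C]_r :=
  gram h (frame (frame_at E x)).

Definition hermitian_einstein (h : X -> 'M[C]_r) : Prop :=
  forall x, Lambda_mx K x
    (fun j l => trace_free (chern_curvature (gram_at h x) x j l)) = 0.

Definition curvature_bound (h : X -> 'M[C]_r) (w : X -> R) : Prop :=
  {ae dvol K, forall x,
     endo_norm (gram_at h x x) (LambdaF (gram_at h x) x) <= w x}.

Definition degree (h : X -> 'M[C]_r) : \bar R :=
  (\int[dvol K]_x (degree_density (gram_at h x) x)%:E)%E.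

(* The metrics induced on det E: in the basis of det E_x given by the standard
   basis of 'cV_r, the metric of det E_x is the number det (h x). *)
Definition same_det (h h' : X -> 'M[C]_r) : Prop :=
  forall x, \det (h x) = \det (h' x).

Definition mutually_bounded (h h' : X -> 'M[C]_r) : Prop :=
  exists2 c : R, 1 <= c & forall x (v : 'cV[C]_r),
    c^-1 * hsqnorm (h x) v <= hsqnorm (h' x) v <= c * hsqnorm (h x) v.

(** ** Saturated coherent submodules *)

(* Coherent O_X-submodules of the sheaf of holomorphic sections of E:
   [sec U s] says that s restricts to a section over the open set U.
   Coherence of a submodule of a locally free sheaf is local finite
   generation (Oka). *)
Record submodule := Submodule {
  sec : set X -> (X -> 'cV[C]_r) -> Prop;
  sec_holo : forall U s, open U -> sec U s -> holo_section U s;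
  sec_ext : forall U s t, open U -> (forall x, U x -> s x = t x) ->
    sec U s -> sec U t;
  sec_restrict : forall U U' s, open U -> open U' -> U' `<=` U ->
    sec U s -> sec U' s;
  sec_glue : forall U s, open U ->
    (forall x, U x -> exists U', [/\ open U', U' x & sec U' s]) -> sec U s;
  sec0 : forall U, open U -> sec U (fun=> 0);
  secD : forall U s t, open U -> sec U s -> sec U t ->
    sec U (fun x => s x + t x);
  secZ : forall U f s, open U -> holo_on K U f -> sec U s ->
    sec U (fun x => f x *: s x);
  sec_coherent : forall x, exists U (m : nat) (g : 'I_m -> X -> 'cV[C]_r),
    [/\ open U, U x, forall i, sec U (g i)
      & forall y U' t, U y -> open U' -> U' y -> sec U' t ->
          exists W (c : 'I_m -> X -> C),
            [/\ open W, W y, W `<=` U `&` U', forall i, holo_on K W (c i)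
              & forall z, W z -> t z = \sum_i c i z *: g i z]] }.

(* The quotient by V has no torsion: a local section of E whose product with a
   function with nonzero germ at x lies in V lies in V near x. *)
Definition saturated (V : submodule) : Prop :=
  forall U x f s, open U -> U x -> holo_on K U f -> holo_section U s ->
    (forall W, open W -> W x -> exists2 y, (U `&` W) y & f y != 0) ->
    sec V U (fun y => f y *: s y) ->
    exists W, [/\ open W, W x, W `<=` U & sec V W s].

(* Over U, the sheaf V is the subbundle of E of rank k with frame s. *)
Definition subframe (V : submodule) (k : nat) (U : set X)
    (s : X -> 'M[C]_(r, k)) : Prop :=
  [/\ forall i, sec V U (fun x => col i (s x)),
      forall x, U x -> \rank (s x) = k
    & forall W t, open W -> W `<=` U -> sec V W t ->
        exists c : X -> 'cV[C]_k,
          (forall i, holo_on K W (fun x => c x i 0)) /\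
          forall x, W x -> t x = s x *m c x].

Definition subframe_near (V : submodule) (k : nat) (x : X) :
    set (X -> 'M[C]_(r, k)) :=
  [set s | exists U, [/\ open U, U x & subframe V U s]].
Arguments subframe_near V k x : clear implicits.

(* The complement of Z(V), for the smallest Z(V) off which V is a subbundle of
   E.  When V is saturated, it is a closed analytic subset of codimension at
   least 2; enlarging Z(V) to another one does not change the degree, because
   proper analytic subsets are null sets. *)
Definition regular_locus (V : submodule) (k : nat) : set X :=
  [set x | subframe_near V k x !=set0].

Definition has_rank (V : submodule) (k : nat) : Prop :=
  dense (regular_locus V k).

Definition local_subframe (V : submodule) (k : nat) (x : X) :
    X -> 'M[C]_(r, k) := xget (fun=> 0) (subframe_near V k x).

Definition sub_degree (h : X -> 'M[C]_r) (V : submodule) (k : nat) : \bar R :=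
  (\int[dvol K]_(x in regular_locus V k)
     (degree_density (gram h (local_subframe V k x)) x)%:E)%E.

End Bundles.

(** * Equivariance and stability *)

(* [Theta a x] maps the fibre at [kappa a x] to the fibre at [x]. *)
Record equivariant (R : realType) (m n : nat) (G : topologicalType)
    (X : ptopologicalType) (L : lie_group R m G) (K : kahler R n X)
    (kappa : action L K) (r : nat) (E : vbundle K r) := Equivariant {
  Theta :> G -> X -> 'M[R[i]]_r;
  Theta_unit : forall a x, Theta a x \in unitmx;
  Theta_smooth : forall (i j : vidx E) u v,
    csmooth_on (prod_atlas (lie_atlas L) K)
      [set p : G * X | vdom j p.2 /\ vdom i (kappa p.1 p.2)]
      (fun p : G * X => (invmx (frame j p.2) *m Theta p.1 p.2 *m
                         frame i (kappa p.1 p.2)) u v);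
  Theta_holo : forall a (i j : vidx E) u v,
    holo_on K [set x | vdom j x /\ vdom i (kappa a x)]
      (fun x => (invmx (frame j x) *m Theta a x *m frame i (kappa a x)) u v);
  ThetaM : forall a b x,
    Theta (gmul L a b) x = Theta b x *m Theta a (kappa b x) }.

Section Equivariance.
Variables (R : realType) (m n : nat) (G : topologicalType).
Variables (X : ptopologicalType) (L : lie_group R m G) (K : kahler R n X).
Variables (kappa : action L K) (r : nat) (E : vbundle K r).
Variable T : equivariant kappa E.

Definition invariant_metric (h : X -> 'M[R[i]]_r) : Prop :=
  forall a x, adjmx (T a x) *m h x *m T a x = h (kappa a x).

(* Theta_a (kappa_a^* V) = V: every section over U is, in a unique way,
   Theta_a (s o kappa_a) with s defined over kappa_a (U). *)
Definition equivariant_submodule (V : submodule E) : Prop :=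
  forall a U s, open U ->
    sec V (kappa a @` U) s <-> sec V U (fun x => T a x *m s (kappa a x)).

Definition analytically_stable (h : X -> 'M[R[i]]_r) : Prop :=
  forall (V : submodule E) (k : nat),
    saturated V -> equivariant_submodule V -> has_rank V k -> (0 < k < r)%N ->
    ((k%:R^-1)%:E * sub_degree h V k < (r%:R^-1)%:E * degree E h)%E.

End Equivariance.

(* Main.v *)
(** Put [b = h1^-1 h2], [A_i] the Chern connection form of [h_i] in a
   holomorphic frame and [B = A_2 - A_1].  For Hermitian-Einstein metrics with
   the same determinant, [Delta (Tr b)] is minus the square norm of [B] for
   positive definite forms, so the bounded function [Tr b] is subharmonic,
   hence harmonic by the standing assumption, and [B = 0].  Therefore [b] is
   holomorphic and [del b = [b, A_1]]; the same holds for every polynomial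
   [q(b)], and [Tr q(b)] is constant since [X] is connected.

   If [b] is not scalar at some point, let [q] be a real polynomial such that
   [q(b)] is there a nontrivial spectral projection.  Constancy of the traces
   makes [P = q(b)] a holomorphic, equivariant, [h1]-selfadjoint projection of
   constant rank [k], parallel for [A_1], and its image [V] is a saturated
   equivariant submodule (by the identity theorem).  For a local frame [s] of
   [V], the function [f = ln det h0(s, s) - ln det h1(s, s)] does not depend
   on [s]; it is smooth and bounded, and [Delta f] is the degree density of
   [(V, h0)] minus [k / r] times that of [(E, h0)], hence is bounded above by
   a multiple of [phi].  Cutting off by functions of [ln rho1 / N] and using
   that [dbar (ln rho1)] is square integrable gives [\int Delta f = 0], that
   is [deg(V, h0) / k = deg(E, h0) / r], contrary to stability.  So [b] is
   scalar, and [b = 1] because [det b = 1]. *)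
Require Import Defs.
Set Warnings "-notation-overridden,-ambiguous-paths,-notation-incompatible-prefix".
From HB Require Import structures.
From mathcomp Require Import all_boot all_order all_algebra.
From mathcomp Require Import complex spectral sesquilinear.
From mathcomp Require Import all_classical all_reals all_analysis.
From mathcomp Require Import measurable_realfun.
From mathcomp Require Import ring lra zify.
Set Implicit Arguments.
Unset Strict Implicit.
Unset Printing Implicit Defensive.
Import Order.TTheory GRing.Theory Num.Theory numFieldNormedType.Exports.
Local Open Scope classical_set_scope.
Local Open Scope ring_scope.

(** * Lebesgue measure on row vectors *)

(** The polynomial [q] is chosen at one point and never changed. Whether [q(b)] is idempotent
    elsewhere is read off the trace of the square of [(q^2 - q)(b)], which is constant, so
    regularity and multiplicities of eigenvalues never have to be discussed. As the rank of [P] is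
    constant, its image is a subbundle everywhere: the regular locus is all of X, and there is no
    singular set to cut out of the degree integral.

    The main obstacle is [\int Delta f = 0]. Only an upper bound on [Delta f] is available, so its
    integrability is part of the claim. Squared cut-offs give in turn a bound on the weighted energy
    of [f], the decay of the tested integrals, and, by monotone convergence for the bound minus
    [Delta f], integrability.

    The volume is known only through charts, as a density against an iterated integral. Green's
    formula is therefore proved in one chart, where closedness of the Kaehler form puts the
    Laplacian in divergence form, and globalized by a partition of unity. The identity theorem rests
    on a maximum principle on discs instead of an integral formula. *)

Section BorelRow.
Variable R : realType.

Lemma open_measurable_borel (T : ptopologicalType) (U : set (borel T)) :
  open (U : set T) -> measurable U.
Proof. by move=> oU; apply: sub_sigma_algebra. Qed.

Lemma measurable_fun_borel d (S : measurableType d) (T : ptopologicalType)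
    (D : set S) (f : S -> borel T) : measurable D ->
  (forall U, open (U : set T) -> measurable (D `&` f @^-1` U)) ->
  measurable_fun D f.
Proof.
move=> mD mf; apply: (@measurability _ _ S (borel T) D f (@open T)) => //.
by move=> _ [U oU <-]; exact: mf.
Qed.

Lemma measurable_fun_continuous (T : ptopologicalType) (f : T -> R) :
  continuous f -> measurable_fun setT (f : borel T -> R).
Proof.
move=> cf; apply: (measurability _ (RGenOpens.measurableE R)) => //.
move=> _ [_ [a [b ->] <-]]; rewrite setTI; apply: open_measurable_borel.
by apply: open_comp => // x _; exact: cf.
Qed.

Lemma ball_row d (v : 'rV[R]_(1 + d)) e : 0 < e -> ball v e =
  [set w : 'rV[R]_(1 + d) | ball (v 0 0) e (w 0 0)
     /\ ball (rsubmx v) e (rsubmx w)].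
Proof.
move=> e0; apply/seteqP; split=> w /=.
  move=> [_ /= vw]; split; first exact: vw.
  by split=> // i j; rewrite !mxE; exact: vw.
move=> [v0 [_ vw]]; split=> // i j; rewrite (ord1 i).
case: (splitP j) => k jk.
  by have -> : j = 0 by apply: val_inj => /=; rewrite jk (ord1 k).
have -> : j = rshift 1 k by apply: val_inj => /=.
by have := vw 0 k; rewrite !mxE.
Qed.

(** Countability of the family is the point: it makes an open set of [R^(1+d)] a countable union of
    products of balls, hence measurable for the product sigma-algebra, and it later gives second
    countability of [R^d]. *)
Lemma rV_open_bigcup d (U : set 'rV[R]_d) : open U ->
  U = \bigcup_(q in [set q : 'rV[rat]_d * nat |
         ball (map_mx ratr q.1 : 'rV[R]_d) (q.2.+1%:R^-1) `<=` U])
       ball (map_mx ratr q.1 : 'rV[R]_d) (q.2.+1%:R^-1).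
Proof.
move=> oU; apply/seteqP; split=> [v Uv|v [q qU qv]]; last exact: qU.
have /nbhs_ballP[e /= e0 eU] : nbhs v U by exact: open_nbhs_nbhs.
have [N _ Ne] := near_infty_natSinv_lt (PosNum (divr_gt0 e0 (ltr0Sn R 1))).
have N0 : 0 < N.+1%:R^-1 :> R by rewrite invr_gt0.
have qe i : {q : rat | ball (v 0 i) (N.+1%:R^-1) (ratr q : R)}.
  apply: cid; have [] // := @rat_in_itvoo R (v 0 i - N.+1%:R^-1) (v 0 i + N.+1%:R^-1).
    by rewrite ltrD2l gtrN.
  move=> q; rewrite in_itv /= => /andP[q1 q2]; exists q.
  by rewrite /ball /= ltr_distlC q1.
exists (\row_i projT1 (qe i), N) => /=.
  move=> w [_ /= bw]; apply: eU; split => // i j.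
  have := bw i j; rewrite !mxE (ord1 i).
  have := projT2 (qe j); rewrite /ball /= => h1 h2.
  have := Ne N (leqnn N); rewrite /= => h3.
  have -> : v 0 j - w 0 j = (v 0 j - ratr (projT1 (qe j))) +
     (ratr (projT1 (qe j)) - w 0 j) by ring.
  rewrite (splitr e); apply: le_lt_trans (ler_normD _ _) _.
  by apply: ltrD; apply: lt_trans h3.
split=> // i j; rewrite !mxE (ord1 i) .
by have := projT2 (qe j); rewrite /ball /= distrC.
Qed.

(** The splitting of [R^(1+d)] into its first coordinate and the rest, along which [lebesgue_int]
    recurses. *)
Definition rV_cons d (tv : measurableTypeR R * borel 'rV[R]_d) : borel 'rV[R]_(1 + d) :=
  row_mx (tv.1%:M : 'rV_1) tv.2.

Definition rV_uncons d (w : borel 'rV[R]_(1 + d)) : measurableTypeR R * borel 'rV[R]_d :=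
  (w 0 0, rsubmx (w : 'rV[R]_(1 + d))).

Lemma rV_cons00 d tv : @rV_cons d tv 0 0 = tv.1.
Proof.
have -> : 0 = lshift d (0 : 'I_1) by exact: val_inj.
by rewrite /rV_cons row_mxEl !mxE.
Qed.

Lemma rV_consK d : cancel (@rV_cons d) (@rV_uncons d).
Proof. by case=> t v; rewrite /rV_uncons rV_cons00 row_mxKr. Qed.

Lemma rV_unconsK d : cancel (@rV_uncons d) (@rV_cons d).
Proof.
move=> w; rewrite /rV_uncons /rV_cons/= -[RHS]hsubmxK; congr row_mx.
apply/rowP => j; rewrite !mxE (ord1 j) eqxx; congr (w _ _); exact: val_inj.
Qed.

Lemma measurable_rV_cons d : measurable_fun setT (@rV_cons d).
Proof.
apply: measurable_fun_borel => // U /rV_open_bigcup ->.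
rewrite setTI preimage_bigcup bigcup_mkcond.
apply: countable_bigcupT_measurable => [|q]; first exact: countableP.
case: ifPn => // _; rewrite (@ball_row d) ?invr_gt0//.
set q1 := (map_mx _ _ : 'rV[R]_(1 + d)).
set e := _^-1.
rewrite [X in measurable X](_ : _ = ball (q1 0 0) e `*` (ball (rsubmx q1) e)).
  apply: measurableX.
    by apply: open_measurable; apply: ball_open; rewrite invr_gt0.
  by apply: open_measurable_borel; apply: ball_open; rewrite invr_gt0.
by apply/seteqP; split => -[t v] /=; rewrite rV_cons00 row_mxKr.
Qed.

HB.instance Definition _ d :=
  isMeasurableFun.Build _ _ _ _ (@rV_cons d) (@measurable_rV_cons d).

Lemma measurable_rV_coord d (i : 'I_d) :
  measurable_fun setT (fun w : borel 'rV[R]_d => w 0 i).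
Proof. by apply: measurable_fun_continuous; exact: coord_continuous. Qed.

Lemma measurable_rV_uncons d : measurable_fun setT (@rV_uncons d).
Proof.
apply/measurable_fun_pairP; split; first exact: measurable_rV_coord.
apply: measurable_fun_borel => // U oU; rewrite setTI.
apply: open_measurable_borel; apply: open_comp => // x _.
exact: continuous_rsubmx.
Qed.

Definition lebR : {sigma_finite_measure set (measurableTypeR R) -> \bar R} := @lebesgue_measure R.

Section push.
Variables (d : nat) (m : {sigma_finite_measure set (borel 'rV[R]_d) -> \bar R}).

Definition rV_push := pushforward (lebR \x m)%E (@rV_cons d).

HB.instance Definition _ := Measure.copy rV_push
  (measure_function_pushforward__canonical__measure_function_Measure
     (lebesgue_integral_fubini_product_measure1__canonical__measure_function_Measure
        lebR m) (@measurable_rV_cons d)).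

Let rV_push_sigma_finite : sigma_finite setT rV_push.
Proof.
have /sigma_finiteP[F [TF ndF Foo]] := sigma_finiteT lebR.
have /sigma_finiteP[H [TH ndH Hoo]] := sigma_finiteT m.
have mFH n : measurable (F n `*` H n).
  by apply: measurableX; [have [] := Foo n|have [] := Hoo n].
exists (fun n => @rV_uncons d @^-1` (F n `*` H n)).
  rewrite -preimage_bigcup; apply/seteqP; split=> // w _.
  have [i _ Fi] : (\bigcup_i F i) (rV_uncons w).1 by rewrite -TF.
  have [j _ Hj] : (\bigcup_i H i) (rV_uncons w).2 by rewrite -TH.
  exists (maxn i j) => //; split.
    by move: Fi; apply/subsetPset/ndF; rewrite leq_maxl.
  by move: Hj; apply/subsetPset/ndH; rewrite leq_maxr.
move=> n; split.
  by rewrite -[X in measurable X]setTI; exact: measurable_rV_uncons.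
rewrite /rV_push /pushforward.
rewrite (_ : _ @^-1` _ = F n `*` H n).
  rewrite product_measure1E; [|by have [] := Foo n|by have [] := Hoo n].
  by rewrite lte_mul_pinfty// ?ge0_fin_numE//; [have [] := Foo n|have [] := Hoo n].
by apply/seteqP; split=> -[t w] /=; rewrite /rV_uncons rV_cons00 row_mxKr.
Qed.

HB.instance Definition _ :=
  @Measure_isSigmaFinite.Build _ _ _ rV_push rV_push_sigma_finite.

Definition rV_pushS : {sigma_finite_measure set (borel 'rV[R]_d.+1) -> \bar R} :=
  rV_push.
End push.

(** A genuine measure behind the iterated integral [lebesgue_int], so that convergence theorems
    apply. In dimension 0 it is a Dirac mass, matching the evaluation at the only point of [R^0]. *)
Fixpoint rV_lebesgue d : {sigma_finite_measure set (borel 'rV[R]_d) -> \bar R} :=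
  if d is d'.+1 return {sigma_finite_measure set (borel 'rV[R]_d) -> \bar R}
  then rV_pushS (rV_lebesgue d') else @dirac _ (borel 'rV[R]_0) 0 R.

Lemma ge0_integral_rV_lebesgueS d (f : borel 'rV[R]_d.+1 -> \bar R) :
  measurable_fun setT f -> (forall v, 0 <= f v)%E ->
  (\int[rV_lebesgue d.+1]_v f v = \int[lebR \x rV_lebesgue d]_tv
    f (rV_cons tv))%E.
Proof.
move=> mf f0.
exact: (@ge0_integral_pushforward _ _ _ _ R _ (@measurable_rV_cons d)
  (lebesgue_integral_fubini_product_measure1__canonical__measure_function_Measure
     lebR (rV_lebesgue d)) setT f measurableT mf (fun x _ => f0 x)).

Qed.

(** Tonelli, one coordinate at a time. *)
Lemma lebesgue_intE d (f : borel 'rV[R]_d -> \bar R) :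
  measurable_fun setT f -> (forall v, 0 <= f v)%E ->
  lebesgue_int f = (\int[rV_lebesgue d]_v f v)%E.
Proof.
elim: d f => [|d IH] f mf f0 /=.
  by rewrite integral_dirac// diracT mul1e.
rewrite [RHS]ge0_integral_rV_lebesgueS//.
have mfc : measurable_fun setT (f \o @rV_cons d).
  by apply: measurableT_comp => //; exact: measurable_rV_cons.
rewrite [RHS](fubini_tonelli1 _ mfc)//=.
apply: eq_integral => t _; rewrite IH//.
exact: (measurableT_comp mfc (pair1_measurable t)).
Qed.

(** Row vectors carry the sup norm, so a ball is a cube of side [2 * e]. *)
Lemma rV_lebesgue_ball d (v : 'rV[R]_d) e : 0 < e ->
  rV_lebesgue d (ball v e) = ((2 * e) ^+ d)%:E.
Proof.
move=> e0; elim: d v => [|d IH] v.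
  rewrite /= diracE mem_set//.
  by split=> // i [].
rewrite /= /rV_push /pushforward (@ball_row d)//.
rewrite (_ : _ @^-1` _ = ball (v 0 0) e `*` (ball (rsubmx (v : 'rV_(1 + d))) e)); last first.
  by apply/seteqP; split => -[t w] /=; rewrite rV_cons00 row_mxKr.
rewrite product_measure1E.
- by rewrite IH [X in (X * _)%E]lebesgue_measure_ball ?ltW// exprS EFinM !mulr_natl.
- by apply: open_measurable; apply: ball_open.
- by apply: open_measurable_borel; apply: ball_open.
Qed.

Lemma continuous_rV_cons2 d t :
  continuous (fun v => rV_cons (t, v) : 'rV[R]_(1 + d)).
Proof.
move=> v U /nbhs_ballP[e /= e0 eU]; apply: (filterS _ (nbhsx_ballx v e e0)) => v' vv'.
apply: eU; rewrite (@ball_row d)//= !rV_cons00 !row_mxKr.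
by split => //; exact: ballxx.
Qed.

Lemma continuous_rV_cons1 d (v : 'rV[R]_d) :
  continuous (fun t : R => rV_cons (t, v) : 'rV[R]_(1 + d)).
Proof.
move=> t U /nbhs_ballP[e /= e0 eU]; apply: (filterS _ (nbhsx_ballx t e e0)) => t' tt'.
apply: eU; rewrite (@ball_row d)//= !rV_cons00 !row_mxKr.
by split => //; exact: ballxx.
Qed.

Lemma bounded_compact_support (T : topologicalType) (K : set T) (f : T -> R) :
  compact K -> continuous f -> (forall x, ~ K x -> f x = 0) ->
  exists2 C, 0 <= C & forall x, `|f x| <= C.
Proof.
move=> cK cf f0.
have /compact_bounded[M [_ Mb]] : compact (f @` K).
  by apply: continuous_compact => //; exact: continuous_subspaceT.
exists (`|M| + 1); first by rewrite addr_ge0.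
move=> x; have [Kx|nKx] := pselect (K x).
  by apply: Mb; [rewrite ltr_pwDr// ler_norm|exists x].
by rewrite f0// normr0 addr_ge0.
Qed.

Lemma integrable_bounded_support d (T : measurableType d)
    (mu : {measure set T -> \bar R}) (A : set T) (f : T -> R) C :
  measurable A -> (mu A < +oo)%E -> measurable_fun setT f ->
  (forall x, `|f x| <= C) -> (forall x, ~ A x -> f x = 0) ->
  mu.-integrable setT (EFin \o f).
Proof.
move=> mA Afin mf fC f0.
have : mu.-integrable A (EFin \o f).
  apply: measurable_bounded_integrable => //; first exact: measurable_funTS.
  exists C; split; first exact: num_real.
  by move=> M CM x Ax; exact: le_trans (fC x) (ltW CM).
move=> /(integrable_mkcond _ mA); apply: eq_integrable => // x _.
rewrite /patch; case: ifPn => //; rewrite notin_setE => nA.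
by rewrite /= f0.
Qed.

(** A directional derivative only sees the restriction to a line, so it can be carried from one
    ambient space to another along matching parametrized lines. *)
Lemma is_derive_line (U V : normedModType R) (f : U -> R) (g : V -> R)
    (a u : U) (t v : V) (df : R) :
  (forall h : R, g (h *: v + t) = f (h *: u + a)) ->
  is_derive a u f df -> is_derive t v g df.
Proof.
move=> gf [fd fE]; have gf0 : g t = f a by have := gf 0; rewrite !scale0r !add0r.
have E : (fun h : R => h^-1 *: ((g \o shift t) (h *: v) - g t)) =
         (fun h : R => h^-1 *: ((f \o shift a) (h *: u) - f a)).
  by apply/funext => h /=; rewrite gf gf0.
by split; [rewrite /derivable E|rewrite /derive E].
Qed.

Lemma integral_derive1_eq0 (w w' : R -> R) M :
  continuous w' -> (forall t : R, is_derive t 1 w (w' t)) ->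
  (forall t : R, ~ ball 0 M t -> w t = 0 /\ w' t = 0) ->
  (\int[lebR]_t (w' t)%:E = 0)%E.
Proof.
(* Both ends [- N] and [N] lie outside the ball containing the support, so the fundamental theorem
   of calculus leaves no boundary term. *)
move=> cw' dw w0; pose N := `|M| + 1.
have N0 : - N < N by rewrite gtrN// ltr_wpDl.
have cw : continuous w.
  by move=> t; apply/differentiable_continuous/derivable1_diffP; have [] := dw t.
have nball (t : R) : N <= `|t| -> ~ ball 0 M t.
  rewrite /ball/= sub0r normrN => Nt tM.
  by have := le_lt_trans Nt tM; rewrite ltNge (le_trans (ler_norm M))// lerDl.
transitivity (\int[lebR]_(t in `[(- N)%R, N%R]) (w' t)%:E)%E.
  rewrite [RHS]integral_mkcond; apply: eq_integral => t _.
  rewrite /patch; case: ifPn => //; rewrite notin_setE /= in_itv /= => /negP.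
  rewrite -ler_norml -ltNge => /ltW/nball/w0[_ ->] //.
rewrite [LHS](@continuous_FTC2 _ w' w)//.
- have [-> _] := w0 _ (nball N (ler_norm N)).
  have NN : N <= `|- N| by rewrite normrN ler_norm.
  have [-> _] := w0 _ (nball (- N) NN).
  by rewrite subee.
- exact: continuous_subspaceT.
- split.
  + by move=> t _; have [] := dw t.
  + exact/cvg_at_right_filter/cw.
  + exact/cvg_at_left_filter/cw.
- by move=> t _; rewrite derive1E; have [] := dw t.
Qed.

(** Induction on the dimension with Fubini. If [i] is the first coordinate, it is integrated first
    and the one-variable case applies on each line; otherwise the first coordinate is frozen and the
    induction hypothesis applies on each slice. *)
Lemma integral_rV_derive_eq0 d (i : 'I_d) (W D : 'rV[R]_d -> R) M :
  continuous D -> (forall v, is_derive v (delta_mx 0 i : 'rV[R]_d) W (D v)) ->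
  0 < M -> (forall v, ~ ball 0 M v -> W v = 0 /\ D v = 0) ->
  (\int[rV_lebesgue d]_v (D v)%:E = 0)%E.
Proof.
move=> cD dW M0 W0.
elim: d i W D cD dW W0 => [[]//|d IH] i W D cD dW W0.
have mball (v : 'rV[R]_d) : measurable (ball v M : set (borel 'rV[R]_d)).
  by apply: open_measurable_borel; exact: ball_open.
have [C _ DC] : exists2 C, 0 <= C & forall v, `|D v| <= C.
  apply: (@bounded_compact_support _ (closed_ball 0 M)) => //.
    apply: bounded_closed_compact; last exact: closed_ball_closed.
    exists M; split; first exact: num_real.
    move=> e Me v; rewrite closed_ballE// /closed_ball_ /= sub0r normrN => vM.
    exact: le_trans vM (ltW Me).
  by move=> v vM; apply: (W0 _ _).2 => /subset_closed_ball.
have mD : measurable_fun setT (D : borel 'rV[R]_d.+1 -> R).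
  exact: measurable_fun_continuous.
have mDc : measurable_fun setT (D \o @rV_cons d).
  by apply: measurableT_comp mD _; exact: measurable_rV_cons.
pose mul := lebesgue_integral_fubini_product_measure1__canonical__measure_function_Measure
     lebR (rV_lebesgue d).
have W0c tv : ~ (ball (0 : R) M `*` ball (0 : 'rV[R]_d) M) tv ->
    W (rV_cons tv) = 0 /\ D (rV_cons tv) = 0.
  move=> tvM; apply: W0; rewrite (@ball_row d)//= rV_cons00 row_mxKr mxE => -[h1 h2].
  by apply: tvM; split => //; move: h2; congr (ball _ _ _); apply/rowP => j; rewrite !mxE.
have iDc : mul.-integrable setT (EFin \o (D \o @rV_cons d)).
  apply: (@integrable_bounded_support _ _ mul (ball 0 M `*` ball (0 : 'rV[R]_d) M) _ C) => //.
  - by apply: measurableX => //; apply: open_measurable; exact: ball_open.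
  - rewrite /mul/= product_measure1E//; last by apply: open_measurable; exact: ball_open.
    by rewrite rV_lebesgue_ball// [X in (X * _)%E]lebesgue_measure_ball ?ltW// ltry.
  - by move=> tv; exact: DC.
  - by move=> tv /W0c[].
rewrite [LHS](@integral_pushforward _ _ _ _ R _ (@measurable_rV_cons d) mul
  setT (EFin \o D) _ iDc)//; last exact/measurable_EFinP.
rewrite preimage_setT.
have slice t : continuous (fun v : 'rV[R]_d => D (rV_cons (t, v))).
  by move=> v; apply: continuous_comp; [exact: continuous_rV_cons2|exact: cD].
have slice0 v : continuous (fun t : R => D (rV_cons (t, v))).
  by move=> t; apply: continuous_comp; [exact: continuous_rV_cons1|exact: cD].
have consE h (e tv : R * 'rV[R]_d) :
    rV_cons (h *: e + tv) = h *: rV_cons e + rV_cons tv :> 'rV_d.+1.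
  apply: (can_inj (@rV_unconsK d)); rewrite rV_consK /rV_uncons.
  by rewrite linearP/= !row_mxKr mxE [in RHS]mxE !rV_cons00.
case: (unliftP ord0 i) => [j|] ij.
- rewrite -[LHS](integral12_prod_meas1 iDc); apply: integral0_eq => t _.
  apply: (IH j (fun v => W (rV_cons (t, v))) (fun v => D (rV_cons (t, v)))) => //.
    move=> v; apply: is_derive_line (dW _) => h; congr W.
    rewrite ij -[in RHS](_ : rV_cons (0, delta_mx 0 j) = delta_mx 0 (lift ord0 j)).
      by rewrite -consE; congr rV_cons; congr pair => /=; rewrite scaler0 add0r.
    apply: (can_inj (@rV_unconsK d)); rewrite rV_consK /rV_uncons; congr pair.
      by rewrite mxE.
    by apply/rowP => k; rewrite !mxE /=.
  by move=> v vM; apply: W0c => -[].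
- rewrite -[LHS](integral21_prod_meas1 iDc); apply: integral0_eq => v _.
  apply: (@integral_derive1_eq0 (fun t => W (rV_cons (t, v))) (fun t => D (rV_cons (t, v))) M) => //.
  - exact: slice0.
  - move=> t; apply: (@is_derive_line _ _ _ (fun t : R => W (rV_cons (t, v))) _ _ t 1 _ _ (dW _)) => h; congr W.
    rewrite ij -[in RHS](_ : rV_cons (1, 0) = delta_mx 0 ord0).
      by rewrite -consE; congr rV_cons; congr pair => /=; rewrite scaler0 add0r.
    apply: (can_inj (@rV_unconsK d)); rewrite rV_consK /rV_uncons; congr pair.
      by rewrite mxE.
    by apply/rowP => k; rewrite !mxE /=.
  - by move=> t tM; apply: W0c => -[].
Qed.

End BorelRow.

(** * Real calculus in charts *)

Section RowCalculus.
Variable R : realType.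

Lemma rV_coord_le d (v : 'rV[R]_d) j : `|v 0 j| <= `|v|.
Proof.
rewrite -[leRHS]/(mx_norm v) mx_normrE; apply: (le_bigmax _ (fun ij => `|v ij.1 ij.2|) (0, j)).
Qed.

Lemma rV_norm_le d (v : 'rV[R]_d) M : 0 <= M -> (forall j, `|v 0 j| <= M) ->
  `|v| <= M.
Proof.
move=> M0 vM; rewrite -[leLHS]/(mx_norm v) mx_normrE; apply/bigmax_leP; split => // -[i j] _.
by rewrite /= (ord1 i).
Qed.

Lemma norm_delta_le d (i : 'I_d) : `|delta_mx 0 i : 'rV[R]_d| <= 1.
Proof.
by apply: rV_norm_le => // j; rewrite mxE eqxx/=; case: eqP; rewrite ?normr1 ?normr0.
Qed.

Lemma MVT_at0 (f df : R -> R) (b : R) :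
  (forall t : R, `|t| <= `|b| -> is_derive t 1 f (df t)) ->
  exists2 c, `|c| <= `|b| & f b - f 0 = df c * b.
Proof.
move=> fd; have cf t : `|t| <= `|b| -> {for t, continuous f}.
  by move=> /fd[+ _] => /derivable1_diffP/differentiable_continuous.
have [b0|/ltW b0] := leP 0 b.
  have itvb t : t \in `[0, b] -> `|t| <= `|b|.
    by rewrite in_itv/= => /andP[t0 tb]; rewrite !ger0_norm.
  have [| |c cb ->] := @MVT_segment R f df 0 b b0.
  - by move=> t tb; apply: fd; apply: itvb; exact: subset_itv_oo_cc tb.
  - by apply: continuous_in_subspaceT => t /[!inE]/= /itvb; exact: cf.
  - by exists c; [exact: itvb|rewrite subr0].
have itvb t : t \in `[b, 0] -> `|t| <= `|b|.
  by rewrite in_itv/= => /andP[t0 tb]; rewrite !ler0_norm// lerN2.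
have [| |c cb E] := @MVT_segment R f df b 0 b0.
- by move=> t tb; apply: fd; apply: itvb; exact: subset_itv_oo_cc tb.
- by apply: continuous_in_subspaceT => t /[!inE]/= /itvb; exact: cf.
- by exists c; [exact: itvb|rewrite -opprB E sub0r mulrN opprK].
Qed.

Lemma is_derive_to_line d (F : 'rV[R]_d -> R) (u z : 'rV[R]_d) (t df : R) :
  is_derive (t *: u + z) u F df -> is_derive t 1 (fun s : R => F (s *: u + z)) df.
Proof.
apply: is_derive_line => h; rewrite addrA -scalerDl; congr (F (_ *: _ + _)).
by rewrite [h *: _]mulr1.
Qed.

Lemma littleo_differentiable (V W : normedModType R) (f : V -> W)
  (df : {linear V -> W}) x : continuous df ->
  (forall e, 0 < e ->
     \forall u \near (0 : V), `|f (u + x) - (f x + df u)| <= e * `|u|) ->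
  differentiable f x /\ 'd f x = df :> (V -> W).
Proof.
move=> cdf fo; have E : f \o shift x = cst (f x) + df +o_ 0 id by exact/eqaddoP.
have dE := diff_unique cdf E; split => //.
by apply/diff_locallyP; rewrite dE.
Qed.

Section C1.
Variables (d : nat) (F : 'rV[R]_d -> R) (x : 'rV[R]_d).
Hypothesis dF : forall i : 'I_d,
  \forall v \near x, derivable F v (delta_mx 0 i : 'rV[R]_d).
Hypothesis cF : forall i : 'I_d,
  {for x, continuous (fun v => 'D_(delta_mx 0 i : 'rV[R]_d) F v)}.

Let L (u : 'rV[R]_d) : R := \sum_i u 0 i * 'D_(delta_mx 0 i : 'rV[R]_d) F x.

Let L_linear : linear L.
Proof.
move=> a u v; rewrite /L scaler_sumr -big_split/=; apply: eq_bigr => i _.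
by rewrite !mxE mulrDl -mulrA.
Qed.

HB.instance Definition _ := GRing.isLinear.Build R 'rV[R]_d R _ L L_linear.

Let L_continuous : continuous L.
Proof.
have -> : L = \sum_i (fun u : 'rV[R]_d => u 0 i *: ('D_(delta_mx 0 i : 'rV[R]_d) F x : R)).
  by apply/funext => u; rewrite fct_sumE.
move=> v; apply/differentiable_continuous/differentiable_sum => i.
by apply: differentiableZl; exact: differentiable_coord.
Qed.

Let trunc k (u : 'rV[R]_d) : 'rV[R]_d := \row_i (if (i < k)%N then u 0 i else 0).

(** The increment from [x] to [x + u] is taken one coordinate at a time: [trunc k u] is the corner
    reached after [k] steps. The mean value theorem turns each step into a partial derivative at a
    nearby point, and continuity replaces it by the one at [x]. *)
Lemma C1_differentiable : differentiable F x /\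
  forall u, 'D_u F x = \sum_i u 0 i * 'D_(delta_mx 0 i : 'rV[R]_d) F x.
Proof.
have [] := @littleo_differentiable _ _ F L x L_continuous.
  move=> e e0.
  (* Each of the [d] steps may cost [e / d.+1] times the norm of [u]; the successor keeps the
     divisor nonzero in dimension 0. *)
  have : \forall v \near x, forall i : 'I_d, derivable F v (delta_mx 0 i : 'rV[R]_d) /\
      `|'D_(delta_mx 0 i : 'rV[R]_d) F x - 'D_(delta_mx 0 i : 'rV[R]_d) F v| <= e / d.+1%:R.
    have e'0 : 0 < e / d.+1%:R by rewrite divr_gt0.
    have FF : Filter (nbhs x) by exact: nbhs_filter.
    apply: (@filter_forall _ _ _ (nbhs x) FF) => i.
    apply: (@filterI _ (nbhs x) FF); first exact: dF.
    exact: (@cvgr_dist_le _ _ _ (nbhs x) FF _ _ (@cF i) _ e'0).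
  move=> /nbhs_ballP[r /= r0 H].
  apply/nbhs_ballP; exists r => //= u; rewrite -ball_normE/= sub0r normrN => ur.
  have key k : (k <= d)%N -> `|F (trunc k u + x) - (F x + L (trunc k u))| <= e / d.+1%:R * `|u| * k%:R.
    elim: k => [|k IH] kd.
      have -> : trunc 0 u = 0 by apply/rowP => i; rewrite !mxE.
      by rewrite linear0 add0r addr0 subrr normr0 mulr0.
    pose i := Ordinal kd.
    have truncS (s : R) : `|s| <= `|u 0 i| -> `|s *: delta_mx 0 i + trunc k u| <= `|u|.
      move=> su; apply: rV_norm_le => // j; rewrite !mxE eqxx/=.
      case: (eqVneq j i) => [->|ji]; rewrite ?ltnn.
        by rewrite mulr1 addr0; apply: le_trans su _; exact: rV_coord_le.
      by rewrite mulr0 add0r; case: ifP; rewrite ?normr0// rV_coord_le.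
    have -> : trunc k.+1 u = u 0 i *: delta_mx 0 i + trunc k u.
      apply/rowP => j; rewrite !mxE eqxx/= ltnS leq_eqVlt.
      case: (eqVneq j i) => [->|ji]; first by rewrite eqxx ltnn mulr1 addr0.
      by rewrite mulr0 add0r; case: (nat_of_ord j =P k) => // jk; case/eqP: ji; exact: val_inj.
    pose g (s : R) := F (s *: delta_mx 0 i + (trunc k u + x)).
    have [t|c ci gE] := @MVT_at0 g (fun s => 'D_(delta_mx 0 i : 'rV[R]_d) F (s *: delta_mx 0 i + (trunc k u + x))) (u 0 i).
      move=> ti; apply: is_derive_to_line; apply: derivableP.
      apply: (H _ _ i).1; rewrite -ball_normE/= addrA opprD addrCA subrr addr0 normrN.
      exact: le_lt_trans (truncS _ ti) ur.
    rewrite -addrA.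
    have -> : F (u 0 i *: delta_mx 0 i + (trunc k u + x)) - (F x + L (u 0 i *: delta_mx 0 i + trunc k u)) =
      (g (u 0 i) - g 0 - u 0 i * 'D_(delta_mx 0 i : 'rV[R]_d) F x) + (F (trunc k u + x) - (F x + L (trunc k u))).
      rewrite [L (u 0 i *: _ + _)]L_linear /g scale0r add0r.
      have -> : L (delta_mx 0 i) = 'D_(delta_mx 0 i : 'rV[R]_d) F x.
        rewrite /L (bigD1 i)//= mxE !eqxx mul1r big1 ?addr0// => j ji.
        by rewrite mxE eqxx/= (negbTE ji) mul0r.
      have alg (a f0 s D z c0 : R) : a - (f0 + (s * D + z)) =
        (a - c0 - s * D) + (c0 - (f0 + z)) by ring.
      exact: alg.
    have -> : k.+1%:R = k%:R + 1 :> R by rewrite natr1.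
    rewrite mulrDr mulr1 addrC; apply: (le_trans (ler_normD _ _)).
    apply: lerD; first exact: IH (ltnW kd).
    rewrite gE mulrC -mulrBr normrM mulrC distrC; apply: ler_pM => //; last exact: rV_coord_le.
    apply: (H _ _ i).2.
    rewrite -ball_normE/= addrA opprD addrCA subrr addr0 normrN.
    exact: le_lt_trans (truncS _ ci) ur.
  have -> : u = trunc d u by apply/rowP => j; rewrite mxE ltn_ord.
  apply: le_trans (key d (leqnn d)) _.
  have -> : trunc d u = u by apply/rowP => j; rewrite mxE ltn_ord.
  have d1 : d.+1%:R^-1 * d%:R <= 1 :> R.
    by rewrite ler_pdivrMl ?ltr0n// mulr1 ler_nat.
  rewrite mulrAC; apply: ler_wpM2r => //; rewrite -mulrA.
  by apply: ler_piMr => //; exact: ltW.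
move=> dFx dE; split=> // u; rewrite deriveE// dE.
by [].
Qed.

End C1.

(** The second difference [S] of [F] over a square of side [h] equals [h ^+ 2] times either mixed
    derivative, each taken at some point of the square: apply the mean value theorem twice, in the
    two possible orders. Continuity at [x] then compares the two. *)
Lemma clairaut d (F : 'rV[R]_d -> R) (x : 'rV[R]_d) (i j : 'I_d) :
  let ei := delta_mx 0 i : 'rV[R]_d in let ej := delta_mx 0 j : 'rV[R]_d in
  (\forall v \near x, derivable F v ei /\ derivable F v ej) ->
  (\forall v \near x, derivable (fun w => 'D_ei F w) v ej /\ derivable (fun w => 'D_ej F w) v ei) ->
  {for x, continuous (fun v => 'D_ej (fun w => 'D_ei F w) v)} ->
  {for x, continuous (fun v => 'D_ei (fun w => 'D_ej F w) v)} ->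
  'D_ej (fun w => 'D_ei F w) x = 'D_ei (fun w => 'D_ej F w) x.
Proof.
move=> ei ej dF ddF c1 c2.
apply/eqP; rewrite -subr_eq0 -normr_le0; apply/ler_addgt0Pl => e e0; rewrite addr0.
have e20 : 0 < e / 2 by rewrite divr_gt0.
have : \forall v \near x, [/\ derivable F v ei /\ derivable F v ej,
   derivable (fun w => 'D_ei F w) v ej /\ derivable (fun w => 'D_ej F w) v ei,
   `|'D_ej (fun w => 'D_ei F w) x - 'D_ej (fun w => 'D_ei F w) v| <= e / 2 &
   `|'D_ei (fun w => 'D_ej F w) x - 'D_ei (fun w => 'D_ej F w) v| <= e / 2].
  have FF : Filter (nbhs x) by exact: nbhs_filter.
  apply: (@filterS _ (nbhs x) FF _ _ _ (@filterI _ (nbhs x) FF _ _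
    (@filterI _ (nbhs x) FF _ _ dF ddF)
    (@filterI _ (nbhs x) FF _ _ (@cvgr_dist_le _ _ _ (nbhs x) FF _ _ c1 _ e20)
       (@cvgr_dist_le _ _ _ (nbhs x) FF _ _ c2 _ e20)))).
  move=> v [[H1 H2] [H3 H4]].
  by split; [exact: H1|exact: H2|exact: H3|exact: H4].
move=> /nbhs_ballP[r /= r0 H].
(* Two displacements of length at most [r / 3] stay inside the ball of radius [r]. *)
pose h := r / 3; have h0 : 0 < h by rewrite divr_gt0.
have inball s t : `|s| <= h -> `|t| <= h -> ball x r (s *: ei + (t *: ej + x)).
  move=> sh th; rewrite -ball_normE/= addrA opprD addrCA subrr addr0 normrN.
  apply: le_lt_trans (ler_normD _ _) _; rewrite !normrZ.
  have := norm_delta_le i; have := norm_delta_le j; rewrite -/ei -/ej => nj ni.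
  have : `|s| * `|ei| <= h by rewrite -[leRHS]mulr1; exact: ler_pM.
  have : `|t| * `|ej| <= h by rewrite -[leRHS]mulr1; exact: ler_pM.
  rewrite /h; lra.
have inball' s t : `|s| <= h -> `|t| <= h -> ball x r (t *: ej + (s *: ei + x)).
  by move=> sh th; rewrite addrCA; exact: inball.
have nh : `|h| = h by rewrite gtr0_norm.
have hh : `|h| <= h by rewrite nh.
have zh : `|0 : R| <= h by rewrite normr0 ltW.
pose S := F (h *: ei + (h *: ej + x)) - F (h *: ei + x) - F (h *: ej + x) + F x.
have S1 : exists2 v, ball x r v & S = 'D_ej (fun w => 'D_ei F w) v * h ^+ 2.
  pose p (s : R) := F (s *: ei + (h *: ej + x)) - F (s *: ei + x).
  have [t|c ch pE] := @MVT_at0 p (fun s => 'D_ei F (s *: ei + (h *: ej + x)) - 'D_ei F (s *: ei + x)) h.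
    rewrite nh => th; apply: is_deriveB; apply: is_derive_to_line; apply: derivableP.
      by have [[A _] _ _ _] := H _ (inball t h th hh); exact: A.
    by have := inball t 0 th zh; rewrite scale0r add0r => /H[[A _] _ _ _]; exact: A.
  rewrite nh in ch.
  pose q (s : R) := 'D_ei F (s *: ej + (c *: ei + x)).
  have [t|c' ch' qE] := @MVT_at0 q (fun s => 'D_ej (fun w => 'D_ei F w) (s *: ej + (c *: ei + x))) h.
    rewrite nh => th; apply: (@is_derive_to_line _ (fun w => 'D_ei F w)); apply: derivableP.
    by have [_ [A _] _ _] := H _ (inball' c t ch th); exact: A.
  rewrite nh in ch'.
  exists (c' *: ej + (c *: ei + x)); first exact: inball'.
  rewrite expr2 mulrA -qE /q scale0r add0r.
  rewrite [h *: ej + _]addrCA -pE /p scale0r !add0r /S; ring.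
have S2 : exists2 v, ball x r v & S = 'D_ei (fun w => 'D_ej F w) v * h ^+ 2.
  pose p (s : R) := F (s *: ej + (h *: ei + x)) - F (s *: ej + x).
  have [t|c ch pE] := @MVT_at0 p (fun s => 'D_ej F (s *: ej + (h *: ei + x)) - 'D_ej F (s *: ej + x)) h.
    rewrite nh => th; apply: is_deriveB; apply: is_derive_to_line; apply: derivableP.
      by have [[_ A] _ _ _] := H _ (inball' h t hh th); exact: A.
    by have := inball' 0 t zh th; rewrite scale0r add0r => /H[[_ A] _ _ _]; exact: A.
  rewrite nh in ch.
  pose q (s : R) := 'D_ej F (s *: ei + (c *: ej + x)).
  have [t|c' ch' qE] := @MVT_at0 q (fun s => 'D_ei (fun w => 'D_ej F w) (s *: ei + (c *: ej + x))) h.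
    rewrite nh => th; apply: (@is_derive_to_line _ (fun w => 'D_ej F w)); apply: derivableP.
    by have [_ [_ A] _ _] := H _ (inball t c th ch); exact: A.
  rewrite nh in ch'.
  exists (c' *: ei + (c *: ej + x)); first exact: inball.
  rewrite expr2 mulrA -qE /q scale0r add0r.
  rewrite [h *: ei + _]addrCA -pE /p scale0r !add0r /S [h *: ej + (h *: ei + x)]addrCA; ring.
have h2 : h ^+ 2 != 0 by rewrite expf_neq0// gt_eqF.
case: S1 => v xv S1; case: S2 => w xw S2.
have vw : 'D_ej (fun w => 'D_ei F w) v = 'D_ei (fun w => 'D_ej F w) w.
  apply: (mulIf h2); exact: (etrans (esym S1) S2).
have [_ _ A1 _] := H _ xv; have [_ _ _ A2] := H _ xw.
rewrite -[X in X - _](subrK ('D_ej (fun w => 'D_ei F w) v)) -addrA.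
rewrite [X in `|_ + (X - _)|]vw (splitr e).
apply: (le_trans (ler_normD _ _)); apply: lerD; first exact: A1.
by rewrite distrC; exact: A2.
Qed.

(** Restricting [F] to the line through [v] reduces this to the chain rule in one variable, so a
    single directional derivative of [F] suffices. *)
Lemma is_derive_comp1 (V : normedModType R) (F : V -> R) (phi : R -> R)
    (v u : V) (dF dphi : R) :
  is_derive v u F dF -> is_derive (F v) 1 phi dphi ->
  is_derive v u (phi \o F) (dphi * dF).
Proof.
move=> FD phiD; pose g (t : R) := F (t *: u + v).
have gD : is_derive (0 : R) 1 g dF.
  by apply: is_derive_line FD => h; rewrite /g addr0 [h *: 1]mulr1.
have g0 : g 0 = F v by rewrite /g scale0r add0r.
have pgD : is_derive (0 : R) 1 (phi \o g) (dphi * dF).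
  by rewrite -g0 in phiD; apply: is_derive1_comp.
apply: is_derive_line pgD => h /=.
by rewrite /g addr0 [h *: 1]mulr1.
Qed.

Lemma continuous_near_ext (T : topologicalType) (f g : T -> R) (x : T) :
  (\forall y \near x, f y = g y) -> {for x, continuous f} -> {for x, continuous g}.
Proof.
move=> fg cf; have : g @ x --> f x by apply: cvg_trans cf; exact: near_eq_cvg.
by rewrite (nbhs_singleton fg).
Qed.

Lemma is_derive1_rV e (gam : R -> 'rV[R]_e) (t : R) (w : 'rV[R]_e) :
  (forall j, is_derive t 1 (fun s => gam s 0 j) (w 0 j)) ->
  differentiable gam t /\ 'd gam t 1 = w.
Proof.
move=> gw; have gE : gam = \sum_j (fun s => gam s 0 j *: (delta_mx 0 j : 'rV[R]_e)).
  by apply/funext => s; rewrite fct_sumE [LHS]row_sum_delta.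
have dj j : differentiable (fun s => gam s 0 j) t.
  by apply/derivable1_diffP; have [] := gw j.
have ddj j : differentiable (fun s => gam s 0 j *: (delta_mx 0 j : 'rV[R]_e)) t.
  exact: differentiableZl.
have dg : differentiable gam t by rewrite gE; exact: differentiable_sum.
split=> //; rewrite -deriveE// gE derive_sum; last by move=> j; exact: diff_derivable.
rewrite [RHS]row_sum_delta; apply: eq_bigr => j _.
rewrite deriveE// diffZl//= -deriveE//.
by have [_ ->] := gw j.
Qed.

End RowCalculus.

Section ChartCalculus.
Variables (R : realType) (d : nat) (X : topologicalType) (M : atlas R d X).
Hypothesis hM : is_manifold M.
Implicit Types (a : idx M) (U : set X) (f g : X -> R) (k : nat).

Local Notation dble a i f x :=
  (derivable (f \o charti a) (chart a x) (delta_mx 0 i : 'rV[R]_d)).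

Lemma near_charti a x U : open U -> U x -> dom a x ->
  \forall v \near chart a x, U (charti a v).
Proof.
move=> oU Ux ax; apply: (charti_continuous hM ax).
by rewrite chartK//; exact: open_nbhs_nbhs.
Qed.

Lemma near_chart_image a x : dom a x ->
  \forall v \near chart a x, (chart a @` dom a) v.
Proof.
by move=> ax; apply: open_nbhs_nbhs; split; [exact: (chart_open hM)|exists x].
Qed.

Lemma pderive_ext a i f g U x : open U -> U x -> dom a x ->
  (forall y, U y -> f y = g y) -> pderive a i f x = pderive a i g x.
Proof.
move=> oU Ux ax fg; apply: near_eq_derive.
by apply: filterS (near_charti oU Ux ax) => v /fg.
Qed.

Lemma dble_ext a i f g U x : open U -> U x -> dom a x ->
  (forall y, U y -> f y = g y) -> dble a i f x -> dble a i g x.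
Proof.
move=> oU Ux ax fg; apply: near_eq_derivable.
by apply: filterS (near_charti oU Ux ax) => v /fg.
Qed.

Lemma Ck_sub k a U V f : V `<=` U -> Ck k a U f -> Ck k a V f.
Proof.
move=> VU; elim: k f => [|k IH] f [cf H]; split => //=; first by move=> x /VU /cf.
  by move=> x /VU /cf.
by move=> i; have [H1 H2] := H i; split; [move=> x /VU /H1|exact: IH].
Qed.

Lemma Ck_le k l a U f : (k <= l)%N -> Ck l a U f -> Ck k a U f.
Proof.
elim: k l f => [|k IH] [|l] f //= kl [cf H]; split => // i.
by have [H1 H2] := H i; split => //; exact: IH H2.
Qed.

Lemma Ck_local k a U f :
  (forall x, U x -> exists2 W, W x & Ck k a W f) -> Ck k a U f.
Proof.
elim: k f => [|k IH] f H; split => //=.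
- by move=> x /H[W Wx [+ _]]; apply.
- by move=> x /H[W Wx [+ _]]; apply.
- move=> i; split; first by move=> x /H[W Wx [_ /(_ i)[+ _]]]; apply.
  by apply: IH => x /H[W Wx [_ /(_ i)[_ ?]]]; exists W.
Qed.

Lemma continuous_ext_at f g U x : open U -> U x -> (forall y, U y -> f y = g y) ->
  {for x, continuous f} -> {for x, continuous g}.
Proof.
move=> oU Ux fg; apply: continuous_near_ext.
by apply: filterS (open_nbhs_nbhs (conj oU Ux)) => y /fg.
Qed.

Lemma Ck_ext k a U f g : open U -> U `<=` dom a ->
  (forall y, U y -> f y = g y) -> Ck k a U f -> Ck k a U g.
Proof.
move=> oU Ua; elim: k f g => [|k IH] f g fg [cf H].
  by split => // x Ux; exact: continuous_ext_at oU Ux fg (cf x Ux).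
split=> [x Ux|i]; first exact: continuous_ext_at oU Ux fg (cf x Ux).
have [H1 H2] := H i; split.
  by move=> x Ux; exact: dble_ext oU Ux (Ua _ Ux) fg (H1 x Ux).
by apply: IH H2 => y Uy; exact: pderive_ext oU Uy (Ua _ Uy) fg.
Qed.

Lemma Ck_cst k a U (c : R) : Ck k a U (fun=> c).
Proof.
elim: k c => [|k IH] c; split => //=; try by move=> x _; exact: cvg_cst.
move=> i; split; first by move=> x _; exact: derivable_cst.
rewrite (_ : pderive a i (fun=> c) = fun=> 0); first exact: IH.
by apply/funext => x; rewrite /pderive derive_cst.
Qed.

Lemma pderiveD a i f g x : dble a i f x -> dble a i g x ->
  pderive a i (fun y => f y + g y) x = pderive a i f x + pderive a i g x.
Proof. by move=> df dg; rewrite /pderive -deriveD. Qed.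

Lemma pderiveM a i f g x : dom a x -> dble a i f x -> dble a i g x ->
  pderive a i (fun y => f y * g y) x = pderive a i f x * g x + f x * pderive a i g x.
Proof.
move=> ax df dg; rewrite /pderive.
have := deriveM df dg; rewrite /= chartK// => ->.
by rewrite addrC; congr (_ + _); rewrite [_ *: _]mulrC.
Qed.

Lemma dbleN a i f x : dble a i f x -> dble a i (fun y => - f y) x.
Proof. by move=> df; exact: derivableN. Qed.

Lemma dbleM a i f g x : dble a i f x -> dble a i g x -> dble a i (fun y => f y * g y) x.
Proof. by move=> df dg; apply: derivableM; [exact: df|exact: dg]. Qed.

Lemma CkD k a U f g : open U -> U `<=` dom a ->
  Ck k a U f -> Ck k a U g -> Ck k a U (fun y => f y + g y).
Proof.
move=> oU Ua; elim: k f g => [|k IH] f g Cf Cg.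
  by split => // x Ux; apply: cvgD; [exact: Cf.1|exact: Cg.1].
split=> [x Ux|i]; first by apply: cvgD; [exact: Cf.1|exact: Cg.1].
have [H1 H2] := Cf.2 i; have [H1' H2'] := Cg.2 i; split.
  by move=> x Ux; apply: derivableD; [exact: H1|exact: H1'].
apply: (@Ck_ext _ _ _ (fun y => pderive a i f y + pderive a i g y)) => //.
  by move=> y Uy; rewrite pderiveD//; [exact: H1|exact: H1'].
exact: IH.
Qed.

Lemma CkM k a U f g : open U -> U `<=` dom a ->
  Ck k a U f -> Ck k a U g -> Ck k a U (fun y => f y * g y).
Proof.
move=> oU Ua; elim: k f g => [|k IH] f g Cf Cg.
  by split => // x Ux; apply: cvgM; [exact: Cf.1|exact: Cg.1].
split=> [x Ux|i]; first by apply: cvgM; [exact: Cf.1|exact: Cg.1].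
have [H1 H2] := Cf.2 i; have [H1' H2'] := Cg.2 i; split.
  by move=> x Ux; apply: derivableM; [exact: H1|exact: H1'].
apply: (@Ck_ext _ _ _ (fun y => pderive a i f y * g y + f y * pderive a i g y)) => //.
  by move=> y Uy; rewrite pderiveM//; [exact: Ua|exact: H1|exact: H1'].
by apply: CkD => //; apply: IH => //; [exact: Ck_le Cg|exact: Ck_le Cf].
Qed.

Lemma CkN k a U f : open U -> U `<=` dom a ->
  Ck k a U f -> Ck k a U (fun y => - f y).
Proof.
move=> oU Ua Cf; apply: (@Ck_ext _ _ _ (fun y => -1 * f y)) => //.
  by move=> y _; rewrite mulN1r.
by apply: CkM => //; exact: Ck_cst.
Qed.

Lemma Ck_sum (I : Type) (r : seq I) (P : pred I) k a U (F : I -> X -> R) :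
  open U -> U `<=` dom a -> (forall i, P i -> Ck k a U (F i)) ->
  Ck k a U (fun y => \sum_(i <- r | P i) F i y).
Proof.
move=> oU Ua CF; elim: r => [|i r IH].
  by apply: (Ck_ext oU Ua _ (@Ck_cst k a U 0)) => y _; rewrite big_nil.
case Pi: (P i); last first.
  by apply: (Ck_ext oU Ua _ IH) => y _; rewrite big_cons Pi.
by apply: (Ck_ext oU Ua _ (CkD oU Ua (CF i Pi) IH)) => y _; rewrite big_cons Pi.
Qed.

(** [Phi] is a class of one-variable functions closed under differentiation on [O]. Smoothness of
    [phi] is encoded by membership in such a class, which is what the induction on [k] carries
    along. *)
Lemma Ck_comp1 (Phi : set (R -> R)) (O : set R) :
  (forall phi, Phi phi -> exists2 phi', Phi phi' &
     forall t, O t -> is_derive t 1 phi (phi' t)) ->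
  forall k a U f phi, open U -> U `<=` dom a -> Phi phi ->
  (forall x, U x -> O (f x)) -> Ck k a U f -> Ck k a U (phi \o f).
Proof.
move=> HPhi k a U f phi oU Ua Pphi UO; elim: k phi Pphi => [|k IH] phi Pphi Cf.
  have [phi' _ dphi] := HPhi _ Pphi.
  split => // x Ux; apply: continuous_comp; first exact: Cf.1.
  have [+ _] := dphi _ (UO _ Ux).
  by move=> /derivable1_diffP/differentiable_continuous.
have [phi' Pphi' dphi] := HPhi _ Pphi.
have cphi x : U x -> {for f x, continuous phi}.
  move=> Ux; have [+ _] := dphi _ (UO _ Ux).
  by move=> /derivable1_diffP/differentiable_continuous.
have key i x : U x -> is_derive (chart a x) (delta_mx 0 i : 'rV[R]_d)
   ((phi \o f) \o charti a) (phi' (f x) * pderive a i f x).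
  move=> Ux; apply: (@is_derive_comp1 _ _ (f \o charti a) phi).
    by apply: derivableP; exact: (Cf.2 i).1.
  by rewrite /= chartK//; [exact: dphi (UO _ Ux)|exact: Ua].
split=> [x Ux|i]; first by apply: continuous_comp; [exact: Cf.1|exact: cphi].
split; first by move=> x /(key i)[].
apply: (@Ck_ext _ _ _ (fun y => (phi' \o f) y * pderive a i f y)) => //.
  by move=> y /(key i)[_]; rewrite /pderive => ->.
by apply: CkM => //; [apply: IH => //; exact: Ck_le Cf|exact: (Cf.2 i).2].
Qed.

Lemma near_pderive a i f x : dom a x ->
  \forall v \near chart a x,
    (pderive a i f \o charti a) v = 'D_(delta_mx 0 i : 'rV[R]_d) (f \o charti a) v.
Proof.
move=> ax; apply: filterS (near_chart_image ax) => _ [y ay <-].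
by rewrite /pderive /= chartK.
Qed.

Lemma continuous_pderive a i f x : dom a x ->
  {for x, continuous (pderive a i f)} ->
  {for chart a x, continuous (fun v => 'D_(delta_mx 0 i : 'rV[R]_d) (f \o charti a) v)}.
Proof.
move=> ax c; apply: continuous_near_ext (near_pderive i f ax) _.
by apply: continuous_comp; [exact: charti_continuous|rewrite chartK].
Qed.

Lemma near_charti_image a U x : open U -> U `<=` dom a -> U x ->
  \forall v \near chart a x, exists2 y, U y & v = chart a y.
Proof.
move=> oU Ua Ux; have ax := Ua x Ux.
apply: filterS (filterI (near_charti oU Ux ax) (near_chart_image ax)).
by move=> v [Uv [y ay yv]]; exists y; rewrite -yv// chartK in Uv *.
Qed.

Lemma Ck1_differentiable a U f x : open U -> U `<=` dom a -> U x -> Ck 1 a U f ->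
  differentiable (f \o charti a) (chart a x) /\
  forall u : 'rV[R]_d, 'D_u (f \o charti a) (chart a x) = \sum_i u 0 i * pderive a i f x.
Proof.
move=> oU Ua Ux [cf H]; apply: C1_differentiable => i.
  apply: filterS (near_charti_image oU Ua Ux) => _ [y Uy ->].
  by have [+ _] := H i; apply.
have [_ [c _]] := H i.
by apply: continuous_pderive; [exact: Ua|exact: c].
Qed.

(** [pderive a i f] is a function on the manifold; read through [charti a] it agrees with the
    Euclidean partial derivative only near points of the image of the chart. This is enough, since
    every condition of [clairaut] is local. *)
Lemma pderiveC a U f x i j : open U -> U `<=` dom a -> U x -> Ck 2 a U f ->
  pderive a j (pderive a i f) x = pderive a i (pderive a j f) x.
Proof.
move=> oU Ua Ux Cf; have ax := Ua x Ux.
have near2 (k l : 'I_d) y : U y -> \forall v \near chart a y,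
    ((pderive a k f) \o charti a) v = 'D_(delta_mx 0 k : 'rV[R]_d) (f \o charti a) v.
  by move=> Uy; exact: near_pderive (Ua _ Uy).
have pE (k l : 'I_d) y : U y -> pderive a l (pderive a k f) y =
   'D_(delta_mx 0 l : 'rV[R]_d) (fun v => 'D_(delta_mx 0 k : 'rV[R]_d) (f \o charti a) v) (chart a y).
  by move=> Uy; apply: near_eq_derive; exact: near2.
rewrite (pE i j x Ux) (pE j i x Ux).
apply: (@clairaut R d (f \o charti a) (chart a x) i j).
- apply: filterS (near_charti_image oU Ua Ux) => _ [y Uy ->].
  by split; [have [+ _] := Cf.2 i|have [+ _] := Cf.2 j]; apply.
- apply: filterS (near_charti_image oU Ua Ux) => _ [y Uy ->]; split.
    apply: near_eq_derivable (near2 i j y Uy) _.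
    by have [_ [_ /(_ j)[+ _]]] := Cf.2 i; apply.
  apply: near_eq_derivable (near2 j i y Uy) _.
  by have [_ [_ /(_ i)[+ _]]] := Cf.2 j; apply.
- have [_ [_ /(_ j)[_ [c _]]]] := Cf.2 i.
  apply: continuous_near_ext (continuous_pderive ax (c x Ux)).
  apply: filterS (near_charti_image oU Ua Ux) => _ [y Uy ->].
  by rewrite -pE.
- have [_ [_ /(_ i)[_ [c _]]]] := Cf.2 j.
  apply: continuous_near_ext (continuous_pderive ax (c x Ux)).
  apply: filterS (near_charti_image oU Ua Ux) => _ [y Uy ->].
  by rewrite -pE.
Qed.

End ChartCalculus.

Section Composition.
Variables (R : realType) (d e : nat) (X Y : topologicalType).
Variables (M : atlas R d X) (N : atlas R e Y).
Hypotheses (hM : is_manifold M) (hN : is_manifold N).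

(** In the chart [b] the function [f] is totally differentiable, by [C1_differentiable]. It can
    therefore be composed with the single curve [gam], the image under [g] of the [i]-th coordinate
    line, whose velocity consists of the partial derivatives of the coordinates of [g]. *)
Lemma is_derive_comp (a : idx M) (b : idx N) (g : X -> Y) (f : Y -> R) V x i :
  dom a x -> open V -> V `<=` dom b -> V (g x) -> {for x, continuous g} ->
  Ck 1 b V f ->
  (forall j, derivable ((fun y => chart b (g y) 0 j) \o charti a) (chart a x)
     (delta_mx 0 i : 'rV[R]_d)) ->
  is_derive (chart a x) (delta_mx 0 i : 'rV[R]_d) ((f \o g) \o charti a)
    (\sum_j pderive b j f (g x) * pderive a i (fun y => chart b (g y) 0 j) x).
Proof.
move=> ax oV Vb Vgx cg Cf dg.
pose gam (t : R) := chart b (g (charti a (t *: delta_mx 0 i + chart a x))).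
pose w := \row_j pderive a i (fun y => chart b (g y) 0 j) x.
have g0 : gam 0 = chart b (g x) by rewrite /gam scale0r add0r chartK.
have [dgam gamE] : differentiable gam 0 /\ 'd gam 0 1 = w.
  apply: is_derive1_rV => j; rewrite mxE; apply: is_derive_line (derivableP (dg j)) => h.
  by rewrite /gam addr0 [h *: 1]mulr1.
have [dF FE] := Ck1_differentiable hN oV Vb Vgx Cf.
have dcomp : is_derive (0 : R) 1 ((f \o charti b) \o gam)
    (\sum_j pderive b j f (g x) * pderive a i (fun y => chart b (g y) 0 j) x).
  rewrite -g0 in dF; split; first by apply: diff_derivable; exact: differentiable_comp.
  rewrite deriveE; last exact: differentiable_comp.
  rewrite diff_comp//= gamE -deriveE// g0 FE.
  by apply: eq_bigr => j _; rewrite mxE mulrC.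
have ng : \forall t \near (0 : R), ((f \o charti b) \o gam) t =
    (f \o g) (charti a (t *: delta_mx 0 i + chart a x)).
  have nV : \forall v \near chart a x, V (g (charti a v)).
    have : {for chart a x, continuous (g \o charti a)}.
      by apply: continuous_comp; [exact: charti_continuous|rewrite chartK].
    by apply; rewrite /= chartK//; exact: open_nbhs_nbhs.
  have cl : {for (0 : R), continuous (fun t : R => t *: (delta_mx 0 i : 'rV[R]_d) + chart a x)}.
    by apply: cvgD; [apply: cvgZr_tmp; exact: cvg_id|exact: cvg_cst].
  have := cl [set v | V (g (charti a v))]; rewrite scale0r add0r => /(_ nV).
  have FF : Filter (nbhs (0 : R)) by exact: nbhs_filter.
  move=> H0; apply: (@filterS _ _ FF _ _ _ H0) => t /= Vt.
  by rewrite /gam chartK//; exact: Vb.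
have := near_eq_is_derive ng dcomp.
by apply: is_derive_line => h; rewrite addr0 [h *: 1]mulr1.
Qed.

Lemma Ck_comp k (a : idx M) (b : idx N) (g : X -> Y) (f : Y -> R) U V :
  open U -> U `<=` dom a -> open V -> V `<=` dom b ->
  (forall x, U x -> V (g x)) -> (forall x, U x -> {for x, continuous g}) ->
  (forall j, Ck k a U (fun y => chart b (g y) 0 j)) ->
  Ck k b V f -> Ck k a U (f \o g).
Proof.
move=> oU Ua oV Vb UV cg; elim: k f => [|k IH] f Cg Cf.
  split => // x Ux; apply: continuous_comp; first exact: cg.
  by apply: Cf.1; exact: UV.
split=> [x Ux|i].
  by apply: continuous_comp; [exact: cg|apply: Cf.1; exact: UV].
have key x : U x -> is_derive (chart a x) (delta_mx 0 i : 'rV[R]_d) ((f \o g) \o charti a)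
    (\sum_j pderive b j f (g x) * pderive a i (fun y => chart b (g y) 0 j) x).
  move=> Ux; apply: (is_derive_comp (Ua _ Ux) oV Vb (UV _ Ux) (cg _ Ux)).
    exact: Ck_le Cf.
  by move=> j; exact: ((Cg j).2 i).1.
split; first by move=> x /key[].
apply: (@Ck_ext _ _ _ _ hM _ _ _ (fun x => \sum_j pderive b j f (g x) * pderive a i (fun y => chart b (g y) 0 j) x)) => //.
  by move=> y /key[_]; rewrite /pderive => ->.
apply: Ck_sum => // j _; apply: CkM => //; last exact: ((Cg j).2 i).2.
by apply: (IH (pderive b j f)); [move=> l; exact: Ck_le (Cg l)|exact: (Cf.2 j).2].
Qed.

End Composition.

Section SmoothOn.
Variables (R : realType) (d e : nat) (X Y : topologicalType).
Variables (M : atlas R d X) (N : atlas R e Y).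
Hypotheses (hM : is_manifold M) (hN : is_manifold N).

(** [smooth_on] quantifies over all charts. One chart is enough because the identity, read from
    another chart to [b], has the smooth coordinate functions given by [chart_smooth]. *)
Lemma smooth_on_chart (b : idx M) U (f : X -> R) : open U -> U `<=` dom b ->
  (forall k, Ck k b U f) -> smooth_on M U f.
Proof.
move=> oU Ub Cf a k; have oW : open (U `&` dom a).
  by apply: openI => //; exact: dom_open.
apply: (@Ck_comp _ _ _ _ _ _ _ hM hM k a b id f _ U oW _ oU Ub) => //.
- by move=> y [].
- by move=> y _; exact: cvg_id.
- by move=> j; apply: Ck_sub (@chart_smooth _ _ _ _ hM b j a k) => y [/Ub].
Qed.

End SmoothOn.

(** * Complex derivatives in charts *)

Section SmoothReal.
Variable R : realType.

(** One term of the exponential series is kept, of degree [n.+2]: the two extra powers of [x] become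
    the quadratic decay at 0 in [flat_le]. *)
Lemma exprn_expRN_le (x : R) n : 0 < x ->
  x ^+ n * expR (- x) <= n.+2`!%:R / x ^+ 2.
Proof.
move=> x0; have f0 : 0 < n.+2`!%:R :> R by rewrite ltr0n fact_gt0.
rewrite expRN ler_pdivlMr ?exprn_gt0// mulrAC -exprD addn2.
rewrite ler_pdivrMr ?expR_gt0// mulrC -ler_pdivrMr//.
by apply: le_trans (expR_ge1Dxn n.+1 (ltW x0)); rewrite lerDr.
Qed.

(** The functions [p(1/t) exp(-1/t)], extended by 0, with [p] a polynomial: a class closed under
    differentiation that contains the standard flat function. *)
Definition flat (p : {poly R}) (t : R) : R :=
  if 0 < t then p.[t^-1] * expR (- t^-1) else 0.

Lemma flat_le p : exists2 C, 0 <= C & forall t, `|flat p t| <= C * t ^+ 2.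
Proof.
pose C := \sum_(i < size p) `|p`_i| * i.+2`!%:R; exists C.
  by apply: sumr_ge0 => i _; rewrite mulr_ge0.
move=> t; rewrite /flat; case: ifPn => t0; last first.
  by rewrite normr0 mulr_ge0 ?sqr_ge0// sumr_ge0// => i _; rewrite mulr_ge0.
rewrite normrM (ger0_norm (expR_ge0 _)) horner_coef.
apply: le_trans (ler_wpM2r (expR_ge0 _) (ler_norm_sum _ _ _)) _.
rewrite mulr_suml /C mulr_suml; apply: ler_sum => i _.
rewrite normrM -!mulrA; apply: ler_wpM2l => //.
rewrite ger0_norm ?exprn_ge0 ?invr_ge0 ?(ltW t0)//.
have := @exprn_expRN_le t^-1 i; rewrite invr_gt0 => /(_ t0).
by rewrite -exprVn invrK.
Qed.

Lemma is_derive_sqr_bound (f : R -> R) C : (forall t, `|f t| <= C * t ^+ 2) ->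
  is_derive (0 : R) 1 f 0.
Proof.
move=> fC; have f0 : f 0 = 0.
  by apply/eqP; rewrite -normr_le0; have := fC 0; rewrite expr0n mulr0.
have C0 : 0 <= C by have := fC 1; rewrite expr1n mulr1; exact: le_trans.
have H : (fun h : R => h^-1 *: ((f \o shift 0) (h *: 1) - f 0)) @ 0^' --> (0 : R).
  apply/cvgrPdist_le => /= e e0.
  have ce : 0 < e / (C + 1) by rewrite divr_gt0// ltr_wpDl.
  exists (e / (C + 1)) => //= h; rewrite /ball_/= sub0r normrN => hC h0.
  rewrite f0 subr0 sub0r normrN addr0 [h *: 1]mulr1 normrM normfV.
  rewrite ler_pdivrMl ?normr_gt0//; apply: le_trans (fC h) _.
  rewrite -real_normK ?num_real// expr2 mulrA mulrC; apply: ler_wpM2l => //.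
  apply: le_trans (_ : C * (e / (C + 1)) <= _); first by apply: ler_wpM2l => //; exact: ltW.
  by rewrite mulrCA ler_piMr ?ltW// ltr_pdivrMr ?ltr_wpDl// mul1r ltrDl.
by split; [apply/cvg_ex; exists 0|exact: cvg_lim].
Qed.

(** For positive [t] this is the product rule; at 0 the quadratic bound [flat_le] forces the
    derivative to vanish. *)
Lemma is_derive_flat p (t : R) : is_derive t 1 (flat p) (flat ((p - p^`()) * 'X^2) t).
Proof.
have [t0|t0|t0] := ltgtP 0 t.
- have tn0 : t != 0 by rewrite gt_eqF.
  have H : is_derive t 1 (fun s => (horner p \o GRing.inv) s * (expR \o (fun s => - s^-1)) s)
     (flat ((p - p^`()) * 'X^2) t).
    have dV : is_derive t 1 (fun s : R => s^-1) (- t ^- 2 *: 1) by exact: is_deriveV.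
    have dp := is_derive1_comp (is_derive_poly p t^-1) dV.
    have de := @is_derive1_comp R expR (fun s => - s^-1) t _ _
      (is_derive_expR (- t^-1)) (is_deriveN dV).
    apply: (is_derive_eq (is_deriveM dp de)).
    rewrite /flat t0 hornerM hornerD hornerN hornerXn /=.
    have sE (u v : R) : u *: v = u * v by [].
    rewrite !sE exprVn; ring.
  apply: near_eq_is_derive H.
  have : \forall s \near t, 0 < s by exact: lt_nbhsr.
  by apply: filterS => s s0; rewrite /flat s0.
- have : is_derive t 1 (fun=> 0 : R) 0 by exact: is_derive_cst.
  rewrite {2}/flat ltNge (ltW t0)/=; apply: near_eq_is_derive.
  have : \forall s \near t, s < 0 by exact: lt_nbhsl.
  by apply: filterS => s s0; rewrite /flat ltNge ltW.
- rewrite -t0 {2}/flat ltxx; have [C _ H] := flat_le p.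
  exact: is_derive_sqr_bound H.
Qed.

(** This is [exp(-1/t)] for positive [t] and 0 elsewhere. It yields the bumps of the partition of
    unity and is also the profile of the cut-offs in [ln rho], for which monotonicity and a bounded
    derivative matter. *)
Definition flatbump (t : R) : R := flat 1 t.

Lemma flatbump_ge0 t : 0 <= flatbump t.
Proof. by rewrite /flatbump /flat; case: ifP => // _; rewrite hornerC mul1r expR_ge0. Qed.

Lemma flatbump_le1 t : flatbump t <= 1.
Proof.
rewrite /flatbump /flat; case: ifP => // t0; rewrite hornerC mul1r.
by rewrite -expR0 ler_expR oppr_le0 invr_ge0 ltW.
Qed.

Lemma flatbump_gt0 t : 0 < t -> 0 < flatbump t.
Proof. by move=> t0; rewrite /flatbump /flat t0 hornerC mul1r expR_gt0. Qed.

Lemma flatbump_eq0 t : t <= 0 -> flatbump t = 0.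
Proof. by move=> t0; rewrite /flatbump /flat ltNge t0. Qed.

Lemma flatbump_le s t : s <= t -> flatbump s <= flatbump t.
Proof.
move=> st; have [s0|s0] := leP s 0; first by rewrite flatbump_eq0// flatbump_ge0.
have t0 := lt_le_trans s0 st; rewrite /flatbump /flat s0 t0 !hornerC !mul1r ler_expR lerN2.
by rewrite lef_pV2.
Qed.

Lemma continuous_flatbump : continuous flatbump.
Proof.
move=> t; have [dt _] := is_derive_flat 1 t.
by apply: differentiable_continuous; apply/derivable1_diffP.
Qed.

Lemma is_derive_flatbump : exists flatbump' : R -> R, exists C : R,
  (forall t : R, is_derive t 1 flatbump (flatbump' t)) /\ (forall t, `|flatbump' t| <= C).
Proof.
exists (flat ((1 - 1^`()) * 'X^2)), 2; split; first by move=> t; exact: is_derive_flat.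
move=> t; rewrite /flat; case: ifPn => t0; last by rewrite normr0.
rewrite derivC subr0 mul1r hornerXn ger0_norm ?mulr_ge0 ?expR_ge0 ?exprn_ge0 ?invr_ge0 ?(ltW t0)//.
(* The quadratic term of the exponential series at [t^-1] gives the bound 2. *)
have := expR_ge1Dxn 1 (ltW (_ : 0 < t^-1)); rewrite invr_gt0 t0 => /(_ isT).
rewrite expRN ler_pdivrMr ?expR_gt0// !factS fact0 !mul1n muln1.
by rewrite -ler_pdivrMl// mulrC; apply: le_trans; rewrite lerDr.
Qed.

Section Ck1D.
Variables (d : nat) (X : topologicalType) (M : atlas R d X).
Hypothesis hM : is_manifold M.
Variables (k : nat) (a : idx M) (U : set X) (f : X -> R).
Hypotheses (oU : open U) (Ua : U `<=` dom a) (Cf : Ck k a U f).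

Lemma Ck_flatbump : Ck k a U (flatbump \o f).
Proof.
apply: (@Ck_comp1 _ _ _ _ hM (range flat) setT _ k a U f flatbump) => //.
  by move=> _ [p _ <-]; exists (flat ((p - p^`()) * 'X^2)); [exists ((p - p^`()) * 'X^2)|move=> t _; exact: is_derive_flat].
Qed.

(** The logarithm together with the negative powers is closed under differentiation on the positive
    half-line, as [Ck_comp1] requires. *)
Let Phi : set (R -> R) := fun phi => phi = @ln R \/ exists (c : R) n, phi = fun t => c * t ^- n.

Let PhiP phi : Phi phi -> exists2 phi', Phi phi' &
  forall t : R, [set t : R | 0 < t] t -> is_derive t 1 phi (phi' t).
Proof.
case=> [->|[c [n ->]]].
  exists (fun t => 1 * t ^- 1); first by right; exists 1, 1%N.
  by move=> t /= t0; rewrite mul1r expr1; exact: is_derive1_ln.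
exists (fun t => (- (c *+ n)) * t ^- n.+1); first by right; exists (- (c *+ n)), n.+1.
move=> t /= t0; have tn0 : t != 0 by rewrite gt_eqF.
have dV : is_derive t 1 (fun s : R => s ^- n) (- (t ^+ n) ^- 2 *: (n%:R *: t ^+ n.-1 *: 1)).
  apply: (@is_deriveV _ (fun s : R => s ^+ n)); first by rewrite expf_neq0.
  by have /derivableP := @exprn_derivable R n t 1; rewrite exp_derive.
apply: (is_derive_eq (is_deriveZ c dV)).
have sE (u v : R) : u *: v = u * v by [].
rewrite !sE -[c *+ n]mulr_natr mulr1.
case: n {dV} => [|n]; first by rewrite !(mulr0n, mul0r, mulr0, oppr0).
by rewrite /= !exprS; field; rewrite tn0 expf_neq0.
Qed.

Lemma Ck_ln : (forall x, U x -> 0 < f x) -> Ck k a U (@ln R \o f).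
Proof.
by move=> f0; apply: (@Ck_comp1 _ _ _ _ hM Phi _ PhiP k a U f (@ln R)) => //; left.
Qed.

Lemma Ck_inv : (forall x, U x -> 0 < f x) -> Ck k a U (fun x => (f x)^-1).
Proof.
move=> f0; apply: (@Ck_ext _ _ _ _ hM _ _ _ ((fun t => 1 * t ^- 1) \o f)) => //.
  by move=> y _; rewrite /= mul1r expr1.
by apply: (@Ck_comp1 _ _ _ _ hM Phi _ PhiP) => //; right; exists 1, 1%N.
Qed.

End Ck1D.
End SmoothReal.

(** * Complex-valued functions and their derivatives in z and its conjugate *)

Section ComplexParts.
Variable R : realType.
Local Notation C := (R[i]).
Implicit Types z w : C.

Lemma cReD z w : complex.Re (z + w) = complex.Re z + complex.Re w.
Proof. by case: z w => [a b] [c d]. Qed.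
Lemma cImD z w : complex.Im (z + w) = complex.Im z + complex.Im w.
Proof. by case: z w => [a b] [c d]. Qed.
Lemma cReN z : complex.Re (- z) = - complex.Re z.
Proof. by case: z. Qed.
Lemma cImN z : complex.Im (- z) = - complex.Im z.
Proof. by case: z. Qed.
Lemma cReM z w : complex.Re (z * w) =
  complex.Re z * complex.Re w - complex.Im z * complex.Im w.
Proof. by case: z w => [a b] [c d]. Qed.
Lemma cImM z w : complex.Im (z * w) =
  complex.Re z * complex.Im w + complex.Im z * complex.Re w.
Proof. by case: z w => [a b] [c d]. Qed.
Lemma cReJ z : complex.Re (Num.conj z) = complex.Re z.
Proof. by case: z. Qed.
Lemma cImJ z : complex.Im (Num.conj z) = - complex.Im z.
Proof. by case: z. Qed.
Lemma Re_sum (I : Type) (r : seq I) (P : pred I) (F : I -> C) :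
  complex.Re (\sum_(i <- r | P i) F i) = \sum_(i <- r | P i) complex.Re (F i).
Proof. by apply: (big_morph (@complex.Re R)) => // z w; exact: cReD. Qed.
Lemma Im_sum (I : Type) (r : seq I) (P : pred I) (F : I -> C) :
  complex.Im (\sum_(i <- r | P i) F i) = \sum_(i <- r | P i) complex.Im (F i).
Proof. by apply: (big_morph (@complex.Im R)) => // z w; exact: cImD. Qed.
Lemma complex_eq z w : complex.Re z = complex.Re w -> complex.Im z = complex.Im w -> z = w.
Proof. by case: z w => [a b] [c d] /= -> ->. Qed.
Lemma conj_real (x : R) : Num.conj (x%:C%C) = x%:C%C.
Proof. exact: conjc_real. Qed.
Lemma complex_real_eq z : complex.Im z = 0 -> z = (complex.Re z)%:C%C.
Proof. by case: z => a b /= ->. Qed.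
End ComplexParts.

Section DerivationAlgebra.
Variable K : comNzRingType.
Implicit Types a b c e f g p q r s : K.

Lemma derivation_alg_add a1 a2 b1 b2 e c :
  ((a1 + a2) + e * (b1 + b2)) * c = (a1 + e * b1) * c + (a2 + e * b2) * c.
Proof. by ring. Qed.

Lemma derivation_alg_mul a1 a2 b1 b2 e c f g :
  ((a1 * g + f * a2) + e * (b1 * g + f * b2)) * c =
  (a1 + e * b1) * c * g + f * ((a2 + e * b2) * c).
Proof. by ring. Qed.

Lemma derivation_alg_comm p q r s e e' c :
  ((p + e' * q) * c + e * ((r + e' * s) * c)) * c =
  ((p + e * r) * c + e' * ((q + e * s) * c)) * c.
Proof. by ring. Qed.

End DerivationAlgebra.

Fact dd_key : unit. Proof. exact: tt. Qed.

Section ComplexCalculus.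
Variables (R : realType) (n : nat) (X : topologicalType) (M : atlas R (n + n) X).
Hypothesis hM : is_manifold M.
Local Notation C := (R[i]).
Local Notation iC := (Complex 0 1 : C).
Variables (a : idx M) (U : set X).
Hypotheses (oU : open U) (Ua : U `<=` dom a).
Implicit Types (f g : X -> C) (x : X) (s t : bool) (i j : 'I_n).

(* Locked, with [f] outside the lock, so that unification never unfolds
   derivatives down to limits. *)
Definition dd s j f x : C :=
  locked_with dd_key (fun s j f x => if s then dz a j f x else dzbar a j f x) s j f x.

Lemma ddTF s j f x : dd s j f x = if s then dz a j f x else dzbar a j f x.
Proof. by rewrite /dd unlock. Qed.

Definition csm f : Prop :=
  forall k, Ck k a U (fun x => complex.Re (f x)) /\ Ck k a U (fun x => complex.Im (f x)).

Lemma csm_ext f g : (forall y, U y -> f y = g y) -> csm f -> csm g.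
Proof.
move=> fg Cf k; have [h1 h2] := Cf k; split.
  by apply: (Ck_ext hM oU Ua _ h1) => y /fg ->.
by apply: (Ck_ext hM oU Ua _ h2) => y /fg ->.
Qed.

Lemma csm_cst (c : C) : csm (fun=> c).
Proof. by move=> k; split; exact: Ck_cst. Qed.

Lemma csmD f g : csm f -> csm g -> csm (fun y => f y + g y).
Proof.
move=> Cf Cg k; have [h1 h2] := Cf k; have [h3 h4] := Cg k; split.
  by apply: (Ck_ext hM oU Ua _ (CkD hM oU Ua h1 h3)) => y _; rewrite cReD.
by apply: (Ck_ext hM oU Ua _ (CkD hM oU Ua h2 h4)) => y _; rewrite cImD.
Qed.

Lemma csmM f g : csm f -> csm g -> csm (fun y => f y * g y).
Proof.
move=> Cf Cg k; have [h1 h2] := Cf k; have [h3 h4] := Cg k; split.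
  apply: (Ck_ext hM oU Ua _ (CkD hM oU Ua (CkM hM oU Ua h1 h3)
    (CkN hM oU Ua (CkM hM oU Ua h2 h4)))) => y _; by rewrite cReM.
apply: (Ck_ext hM oU Ua _ (CkD hM oU Ua (CkM hM oU Ua h1 h4)
    (CkM hM oU Ua h2 h3))) => y _; by rewrite cImM.
Qed.

Lemma csmN f : csm f -> csm (fun y => - f y).
Proof.
move=> Cf k; have [h1 h2] := Cf k; split.
  by apply: (Ck_ext hM oU Ua _ (CkN hM oU Ua h1)) => y _; rewrite cReN.
by apply: (Ck_ext hM oU Ua _ (CkN hM oU Ua h2)) => y _; rewrite cImN.
Qed.

Lemma csmJ f : csm f -> csm (fun y => Num.conj (f y)).
Proof.
move=> Cf k; have [h1 h2] := Cf k; split.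
  by apply: (Ck_ext hM oU Ua _ h1) => y _; rewrite cReJ.
by apply: (Ck_ext hM oU Ua _ (CkN hM oU Ua h2)) => y _; rewrite cImJ.
Qed.

Lemma csm_real (r : X -> R) : (forall k, Ck k a U r) -> csm (fun y => (r y)%:C%C).
Proof. by move=> Cr k; split => /=; [exact: Cr|exact: Ck_cst]. Qed.

Lemma csm_sum (I : Type) (r : seq I) (P : pred I) (F : I -> X -> C) :
  (forall i : I, P i -> csm (F i)) -> csm (fun y => \sum_(i <- r | P i) F i y).
Proof.
move=> CF; elim: r => [|i r IH].
  by apply: csm_ext (csm_cst 0) => y _; rewrite big_nil.
case Pi: (P i); last by apply: csm_ext IH => y _; rewrite big_cons Pi.
by apply: csm_ext (csmD (CF i Pi) IH) => y _; rewrite big_cons Pi.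
Qed.

Lemma csm_prod (I : Type) (r : seq I) (P : pred I) (F : I -> X -> C) :
  (forall i : I, P i -> csm (F i)) -> csm (fun y => \prod_(i <- r | P i) F i y).
Proof.
move=> CF; elim: r => [|i r IH].
  by apply: csm_ext (csm_cst 1) => y _; rewrite big_nil.
case Pi: (P i); last by apply: csm_ext IH => y _; rewrite big_cons Pi.
by apply: csm_ext (csmM (CF i Pi) IH) => y _; rewrite big_cons Pi.
Qed.

Lemma csm_inv f : (forall y, U y -> f y != 0) -> csm f -> csm (fun y => (f y)^-1).
Proof.
move=> f0 Cf; pose nf y := complex.Re (f y) * complex.Re (f y) +
  complex.Im (f y) * complex.Im (f y).
have Cn : csm (fun y => ((nf y)^-1)%:C%C).
  apply: csm_real => k; have [h1 h2] := Cf k; apply: Ck_inv => //.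
    by apply: CkD => //; apply: CkM.
  move=> x /f0; rewrite /nf; case: (f x) => u v /=; rewrite eq_complex /= negb_and.
  by case/orP => ne; [apply: ltr_pwDl|apply: ltr_wpDl]; rewrite -expr2 ?exprn_even_gt0 ?sqr_ge0.
apply: csm_ext (csmM (csmJ Cf) Cn) => y _; rewrite /nf; case: (f y) => u v.
by apply: complex_eq => /=; rewrite !expr2; ring.
Qed.

Lemma csm_cpderive f (l : 'I_(n + n)) : csm f -> csm (cpderive a l f).
Proof.
move=> Cf k; have [[_ h1] [_ h2]] := Cf k.+1.
by split; [have [] := h1 l|have [] := h2 l].
Qed.

Lemma csm_dd s j f : csm f -> csm (dd s j f).
Proof.
move=> Cf; have h := csm_cpderive (lshift n j) Cf.
have h' := csmM (csm_cst iC) (csm_cpderive (rshift n j) Cf).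
have -> : dd s j f = if s then dz a j f else dzbar a j f.
  by apply/funext => x; rewrite ddTF; case: s.
case: s.
  exact: csmM (csmD h (csmN h')) (csm_cst _).
exact: csmM (csmD h h') (csm_cst _).
Qed.

Lemma csm_derivable f x (l : 'I_(n + n)) : csm f -> U x ->
  derivable ((fun y => complex.Re (f y)) \o charti a) (chart a x) (delta_mx 0 l : 'rV[R]_(n + n)) /\
  derivable ((fun y => complex.Im (f y)) \o charti a) (chart a x) (delta_mx 0 l : 'rV[R]_(n + n)).
Proof.
move=> Cf Ux; have [[_ h1] [_ h2]] := Cf 1%N; have [h _] := h1 l; have [h' _] := h2 l.
by split; [exact: h|exact: h'].
Qed.

Lemma cpderive_ext f g x l : U x -> (forall y, U y -> f y = g y) ->
  cpderive a l f x = cpderive a l g x.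
Proof.
move=> Ux fg; rewrite /cpderive; congr Complex.
  by apply: (pderive_ext hM l oU Ux (Ua Ux)) => y /fg ->.
by apply: (pderive_ext hM l oU Ux (Ua Ux)) => y /fg ->.
Qed.

Lemma cpderiveD f g x l : csm f -> csm g -> U x ->
  cpderive a l (fun y => f y + g y) x = cpderive a l f x + cpderive a l g x.
Proof.
move=> Cf Cg Ux; have [h1 h2] := csm_derivable l Cf Ux; have [h3 h4] := csm_derivable l Cg Ux.
apply: complex_eq; rewrite /= ?cReD ?cImD /= -pderiveD//.
  by apply: (pderive_ext hM l oU Ux (Ua Ux)) => y _; rewrite cReD.
by apply: (pderive_ext hM l oU Ux (Ua Ux)) => y _; rewrite cImD.
Qed.

Lemma pderiveN (r : X -> R) x l : derivable (r \o charti a) (chart a x) (delta_mx 0 l : 'rV[R]_(n + n)) ->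
  pderive a l (fun y => - r y) x = - pderive a l r x.
Proof. by move=> dr; rewrite /pderive -deriveN. Qed.

Lemma cpderiveM f g x l : csm f -> csm g -> U x ->
  cpderive a l (fun y => f y * g y) x = cpderive a l f x * g x + f x * cpderive a l g x.
Proof.
move=> Cf Cg Ux; have [h1 h2] := csm_derivable l Cf Ux; have [h3 h4] := csm_derivable l Cg Ux.
have ax := Ua Ux.
apply: complex_eq => /=.
  rewrite (_ : pderive _ _ _ _ = pderive a l (fun y => complex.Re (f y) * complex.Re (g y) +
     - (complex.Im (f y) * complex.Im (g y))) x); last first.
    by apply: (pderive_ext hM l oU Ux (Ua Ux)) => y _; rewrite cReM.
  rewrite (pderiveD (dbleM h1 h3) (dbleN (dbleM h2 h4))) (pderiveN (dbleM h2 h4)).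
  rewrite (pderiveM hM ax h1 h3) (pderiveM hM ax h2 h4) cReD !cReM /=.
  by rewrite opprD addrACA.
rewrite (_ : pderive _ _ _ _ = pderive a l (fun y => complex.Re (f y) * complex.Im (g y) +
     complex.Im (f y) * complex.Re (g y)) x); last first.
  by apply: (pderive_ext hM l oU Ux (Ua Ux)) => y _; rewrite cImM.
rewrite (pderiveD (dbleM h1 h4) (dbleM h2 h3)).
by rewrite (pderiveM hM ax h1 h4) (pderiveM hM ax h2 h3) cImD !cImM /= addrACA.
Qed.

Lemma cpderiveJ f x l : csm f -> U x ->
  cpderive a l (fun y => Num.conj (f y)) x = Num.conj (cpderive a l f x).
Proof.
move=> Cf Ux; have [h1 h2] := csm_derivable l Cf Ux.
apply: complex_eq => /=.
  by apply: (pderive_ext hM l oU Ux (Ua Ux)) => y _; rewrite cReJ.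
rewrite -pderiveN//.
by apply: (pderive_ext hM l oU Ux (Ua Ux)) => y _; rewrite cImJ.
Qed.

Lemma cpderive_cst (c : C) x l : cpderive a l (fun=> c) x = 0.
Proof. by rewrite /cpderive /pderive !derive_cst. Qed.

Lemma cpderiveC f x l l' : csm f -> U x ->
  cpderive a l (cpderive a l' f) x = cpderive a l' (cpderive a l f) x.
Proof.
move=> Cf Ux; have [h1 h2] := Cf 2%N.
apply: complex_eq.
  by have := @pderiveC _ _ _ _ hM a U (fun x => complex.Re (f x)) x l' l oU Ua Ux h1.
by have := @pderiveC _ _ _ _ hM a U (fun x => complex.Im (f x)) x l' l oU Ua Ux h2.
Qed.

Lemma dd_ext s j f g x : U x -> (forall y, U y -> f y = g y) ->
  dd s j f x = dd s j g x.
Proof. by move=> Ux fg; rewrite !ddTF /dz /dzbar !(cpderive_ext _ Ux fg). Qed.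

Definition dd_sign s : C := if s then - iC else iC.

Lemma ddE s j f x : dd s j f x =
  (cpderive a (lshift n j) f x + dd_sign s * cpderive a (rshift n j) f x) * 2%:R^-1.
Proof. by rewrite ddTF /dd_sign; case: s; rewrite ?mulNr. Qed.

Lemma ddD s j f g x : csm f -> csm g -> U x ->
  dd s j (fun y => f y + g y) x = dd s j f x + dd s j g x.
Proof.
by move=> Cf Cg Ux; rewrite !ddE !cpderiveD//; exact: derivation_alg_add.
Qed.

Lemma ddM s j f g x : csm f -> csm g -> U x ->
  dd s j (fun y => f y * g y) x = dd s j f x * g x + f x * dd s j g x.
Proof.
by move=> Cf Cg Ux; rewrite !ddE !cpderiveM//; exact: derivation_alg_mul.
Qed.

Lemma dd_cst s j (c : C) x : dd s j (fun=> c) x = 0.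
Proof. by rewrite !ddTF /dz /dzbar !cpderive_cst mulr0 subr0 addr0 mul0r; case: s. Qed.

Lemma ddN s j f x : csm f -> U x -> dd s j (fun y => - f y) x = - dd s j f x.
Proof.
move=> Cf Ux; rewrite (@dd_ext s j _ (fun y => -1 * f y))//; last first.
  by move=> y _; rewrite mulN1r.
rewrite ddM//; last exact: csm_cst.
by rewrite dd_cst mul0r add0r mulN1r.
Qed.

Lemma ddJ s j f x : csm f -> U x ->
  dd s j (fun y => Num.conj (f y)) x = Num.conj (dd (~~ s) j f x).
Proof.
move=> Cf Ux; rewrite !ddE !cpderiveJ// rmorphM rmorphD rmorphM fmorphV rmorph_nat.
congr ((_ + _ * _) * _).
by rewrite /dd_sign; case: s; apply: complex_eq => /=; rewrite ?oppr0 ?opprK.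
Qed.

Lemma dd_sum s j (I : Type) (r : seq I) (P : pred I) (F : I -> X -> C) x :
  (forall i : I, P i -> csm (F i)) -> U x ->
  dd s j (fun y => \sum_(i <- r | P i) F i y) x = \sum_(i <- r | P i) dd s j (F i) x.
Proof.
move=> CF Ux; elim: r => [|i r IH].
  rewrite big_nil -[RHS](dd_cst s j 0 x); apply: dd_ext => // y _.
  exact: big_nil.
rewrite big_cons -IH; case Pi: (P i).
  by rewrite -ddD//; [apply: dd_ext => // y _; rewrite big_cons Pi|exact: CF|exact: csm_sum].
by apply: dd_ext => // y _; rewrite big_cons Pi.
Qed.

Lemma ddC s t i j f x : csm f -> U x ->
  dd s i (dd t j f) x = dd t j (dd s i f) x.
Proof.
move=> Cf Ux.
have D u k q : cpderive a q (dd u k f) x =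
    (cpderive a q (cpderive a (lshift n k) f) x +
     dd_sign u * cpderive a q (cpderive a (rshift n k) f) x) * 2%:R^-1.
  have cl := csm_cpderive (lshift n k) Cf.
  have cr := csmM (csm_cst (dd_sign u)) (csm_cpderive (rshift n k) Cf).
  rewrite (@cpderive_ext _ (fun y => (cpderive a (lshift n k) f y +
    dd_sign u * cpderive a (rshift n k) f y) * 2%:R^-1))//; last by move=> y _; rewrite ddE.
  have ccst c := csm_cst c.
  rewrite (cpderiveM _ (csmD cl cr) (ccst _) Ux) cpderive_cst mulr0 addr0.
  rewrite (cpderiveD _ cl cr Ux).
  rewrite (cpderiveM _ (ccst _) (csm_cpderive (rshift n k) Cf) Ux).
  by rewrite cpderive_cst mul0r add0r.
rewrite [LHS]ddE [RHS]ddE (D t j (lshift n i)) (D t j (rshift n i)).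
rewrite (D s i (lshift n j)) (D s i (rshift n j)).
rewrite (cpderiveC (lshift n i) (lshift n j) Cf Ux).
rewrite (cpderiveC (lshift n i) (rshift n j) Cf Ux).
rewrite (cpderiveC (rshift n i) (lshift n j) Cf Ux).
rewrite (cpderiveC (rshift n i) (rshift n j) Cf Ux).
exact: derivation_alg_comm.
Qed.

End ComplexCalculus.

(** * Hermitian linear algebra *)

Section HermitianLinearAlgebra.
Variable R : realType.
Local Notation C := (R[i]).

Lemma adjmxE p q (A : 'M[C]_(p, q)) i j : adjmx A i j = Num.conj (A j i).
Proof. by rewrite !mxE. Qed.
Lemma adjmxM p q s (A : 'M[C]_(p, q)) (B : 'M[C]_(q, s)) :
  adjmx (A *m B) = adjmx B *m adjmx A.
Proof. by rewrite /adjmx map_mxM trmx_mul. Qed.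
Lemma adjmxD p q (A B : 'M[C]_(p, q)) : adjmx (A + B) = adjmx A + adjmx B.
Proof. by rewrite /adjmx map_mxD linearD. Qed.
Lemma adjmxN p q (A : 'M[C]_(p, q)) : adjmx (- A) = - adjmx A.
Proof. by rewrite /adjmx map_mxN linearN. Qed.
Lemma adjmxB p q (A B : 'M[C]_(p, q)) : adjmx (A - B) = adjmx A - adjmx B.
Proof. by rewrite adjmxD adjmxN. Qed.
Lemma adjmxK p q (A : 'M[C]_(p, q)) : adjmx (adjmx A) = A.
Proof. by apply/matrixP => i j; rewrite !adjmxE conjCK. Qed.
Lemma adjmx1 r : adjmx (1%:M : 'M[C]_r) = 1%:M.
Proof. by rewrite /adjmx map_mx1 trmx1. Qed.
Lemma adjmx0 p q : adjmx (0 : 'M[C]_(p, q)) = 0.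
Proof. by rewrite /adjmx map_mx0 trmx0. Qed.
Lemma adjmxZ p q (c : C) (A : 'M[C]_(p, q)) : adjmx (c *: A) = Num.conj c *: adjmx A.
Proof. by rewrite /adjmx map_mxZ linearZ. Qed.
Lemma adjmx_sum p q (I : Type) (r : seq I) (P : pred I) (F : I -> 'M[C]_(p, q)) :
  adjmx (\sum_(i <- r | P i) F i) = \sum_(i <- r | P i) adjmx (F i).
Proof. by apply: (big_morph (@adjmx R p q)); [exact: adjmxD|exact: adjmx0]. Qed.
Lemma det_adjmx r (A : 'M[C]_r) : \det (adjmx A) = Num.conj (\det A).
Proof. by rewrite /adjmx det_tr det_map_mx. Qed.
Lemma tr_adjmx r (A : 'M[C]_r) : \tr (adjmx A) = Num.conj (\tr A).
Proof. by rewrite /adjmx mxtrace_tr trace_map_mx. Qed.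
Lemma adjmx_unit r (A : 'M[C]_r) : (adjmx A \in unitmx) = (A \in unitmx).
Proof. by rewrite !unitmxE det_adjmx !unitfE conjC_eq0. Qed.
Lemma adjmx_inv r (A : 'M[C]_r) : adjmx (invmx A) = invmx (adjmx A).
Proof. by rewrite /adjmx map_invmx trmx_inv. Qed.

Lemma invmx_mul r (A B : 'M[C]_r) : A \in unitmx -> B \in unitmx ->
  invmx (A *m B) = invmx B *m invmx A.
Proof.
move=> uA uB; have uAB : A *m B \in unitmx by rewrite unitmx_mul uA.
have E : invmx B *m invmx A *m (A *m B) = 1%:M by rewrite -mulmxA mulKmx// mulVmx.
by rewrite -[LHS]mul1mx -E mulmxK.
Qed.

Lemma Re_tr_adj_ge0 p q (A : 'M[C]_(p, q)) :
  complex.Re (\tr (adjmx A *m A)) = \sum_i \sum_j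
    (complex.Re (A j i) ^+ 2 + complex.Im (A j i) ^+ 2).
Proof.
rewrite /mxtrace Re_sum; apply: eq_bigr => i _; rewrite mxE Re_sum.
apply: eq_bigr => j _; rewrite adjmxE cReM cReJ cImJ; ring.
Qed.

Lemma tr_adj_ge0 p q (A : 'M[C]_(p, q)) : 0 <= complex.Re (\tr (adjmx A *m A)).
Proof.
rewrite Re_tr_adj_ge0; apply: sumr_ge0 => i _; apply: sumr_ge0 => j _.
by rewrite addr_ge0 ?sqr_ge0.
Qed.

Lemma tr_adj_eq0 p q (A : 'M[C]_(p, q)) : complex.Re (\tr (adjmx A *m A)) = 0 -> A = 0.
Proof.
rewrite Re_tr_adj_ge0 => /eqP.
rewrite psumr_eq0; last by move=> i _; apply: sumr_ge0 => j _; rewrite addr_ge0 ?sqr_ge0.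
move=> /allP H; apply/matrixP => j i; rewrite mxE.
have := H i (mem_index_enum _); rewrite implyTb psumr_eq0; last first.
  by move=> k _; rewrite addr_ge0 ?sqr_ge0.
move=> /allP /(_ j (mem_index_enum _)); rewrite implyTb paddr_eq0 ?sqr_ge0// !sqrf_eq0.
by move=> /andP[/eqP h1 /eqP h2]; apply: complex_eq.
Qed.

Lemma hsqnorm_tr r (H : 'M[C]_r) v : hsqnorm H v = complex.Re (\tr (adjmx v *m H *m v)).
Proof. by rewrite /hsqnorm trace_mx11. Qed.

Lemma hsqnorm_factor r s (S : 'M[C]_(s, r)) v :
  hsqnorm (adjmx S *m S) v = complex.Re (\tr (adjmx (S *m v) *m (S *m v))).
Proof. by rewrite hsqnorm_tr adjmxM !mulmxA. Qed.

Lemma hsqnorm_delta r (M : 'M[C]_r) i :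
  hsqnorm M (delta_mx i 0) = complex.Re (M i i).
Proof.
have -> : M i i = (delta_mx (0 : 'I_1) i *m M *m delta_mx i (0 : 'I_1)) 0 0.
  by rewrite -rowE -colE !mxE.
by rewrite /hsqnorm /adjmx map_delta_mx trmx_delta.
Qed.

Lemma hsqnorm_conj r (S M : 'M[C]_r) v : S \in unitmx ->
  hsqnorm (adjmx S *m M *m S) (invmx S *m v) = hsqnorm M v.
Proof.
move=> uS; rewrite /hsqnorm adjmxM -!mulmxA mulKVmx// [adjmx (invmx S) *m _]mulmxA.
by rewrite -adjmxM mulmxV// adjmx1 mul1mx.
Qed.

Lemma posdef_factorized r (S : 'M[C]_r) : S \in unitmx -> posdef (adjmx S *m S).
Proof.
move=> uS; split; first by rewrite adjmxM adjmxK.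
move=> v v0; rewrite hsqnorm_factor lt0r tr_adj_ge0 andbT.
apply: contra_neq v0 => /tr_adj_eq0 Sv0.
by rewrite -[v]mul1mx -(mulVmx uS) -mulmxA Sv0 mulmx0.
Qed.

Lemma herm_spectral r (H : 'M[C]_r) : adjmx H = H ->
  exists U (d : 'rV[R]_r), adjmx U *m U = 1%:M /\
    H = adjmx U *m diag_mx (map_mx (real_complex R) d) *m U.
Proof.
move=> hH; have hsym : H \is hermsymmx.
  apply/is_hermitianmxP; rewrite expr0 scale1r -{1}hH; by apply/matrixP => i j; rewrite !mxE.
have := orthomx_spectralP (hermitian_normalmx hsym).
set U := spectralmx H; set d := spectral_diag H => HE.
have UE : invmx U = adjmx U.
  by rewrite invmx_unitary ?spectral_unitarymx//; apply/matrixP => i j; rewrite !mxE.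
have UU : adjmx U *m U = 1%:M by rewrite -UE mulVmx// spectral_unit.
pose d' : 'rV[R]_r := \row_j complex.Re (d 0 j).
exists U, d'; split; first exact: UU.
rewrite {1}HE UE; congr (_ *m diag_mx _ *m _); apply/rowP => i; rewrite !mxE.
have /mxOverP/(_ 0 i) := hermitian_spectral_diag_real hsym.
move=> /CrealP dr; apply: complex_real_eq.
have h : - complex.Im (d 0 i) = complex.Im (d 0 i) by rewrite -cImJ dr.
lra.
Qed.

Lemma posdef_unit r (H : 'M[C]_r) : posdef H -> H \in unitmx.
Proof.
move=> [hH pH]; rewrite -row_free_unit; apply/negPn/negP => nf.
have : kermx H != 0 by rewrite kermx_eq0.
move=> /rowV0Pn[v /sub_kermxP vH v0].
have := pH (adjmx v); rewrite /hsqnorm adjmxK vH mul0mx mxE ltxx => /(_ _)/eqP.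
have : adjmx v != 0.
  by apply: contra_neq v0 => /(congr1 (@adjmx R _ _)); rewrite adjmxK adjmx0.
by move=> -> /(_ isT).
Qed.

(** Square roots of the eigenvalues in a unitary diagonalization. Through this factorization,
    positivity statements below become statements about [\tr (adjmx A *m A)]. *)
Lemma posdef_factor r (H : 'M[C]_r) : posdef H ->
  exists2 S, S \in unitmx & H = adjmx S *m S.
Proof.
move=> pH; have [U [d [UU HE]]] := herm_spectral pH.1.
have uU : U \in unitmx by case/mulmx1_unit: UU.
have d0 i : 0 < d 0 i.
  pose v := invmx U *m delta_mx i (0 : 'I_1).
  have v0 : v != 0.
    apply/eqP => /(congr1 (mulmx U)); rewrite mulKVmx// mulmx0 => /matrixP/(_ i 0).
    by rewrite !mxE !eqxx => /eqP; rewrite oner_eq0.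
  have := pH.2 v v0; rewrite HE hsqnorm_conj// hsqnorm_delta.
  by rewrite !mxE eqxx.
pose D := diag_mx (map_mx (real_complex R) (map_mx Num.sqrt d)).
have DD : adjmx D *m D = diag_mx (map_mx (real_complex R) d).
  have -> : adjmx D = D.
    apply/matrixP => i j; rewrite adjmxE !mxE; case: (eqVneq i j) => [->|ij].
      by rewrite mulr1n conj_real.
    by rewrite mulr0n conjC0.
  rewrite mulmx_diag; congr diag_mx; apply/rowP => i; rewrite !mxE -rmorphM/=.
  by rewrite -expr2 sqr_sqrtr// ltW.
exists (D *m U); last by rewrite adjmxM mulmxA -(mulmxA _ (adjmx D)) DD.
rewrite unitmx_mul uU andbT unitmxE det_diag unitfE; apply/prodf_neq0 => i _.
rewrite !mxE; apply/eqP => /(congr1 (@complex.Re R))/= /eqP.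
by rewrite sqrtr_eq0 leNgt d0.
Qed.

(** The spectral theorem applied to [K] written in an [H]-orthonormal basis. *)
Lemma simdiag r (H K : 'M[C]_r) : posdef H -> adjmx K = K ->
  exists S (e : 'rV[R]_r), [/\ S \in unitmx, H = adjmx S *m S &
    K = adjmx S *m diag_mx (map_mx (real_complex R) e) *m S].
Proof.
move=> pH hK; have [S uS HE] := posdef_factor pH.
have [|U [e [UU KE]]] := @herm_spectral r (adjmx (invmx S) *m K *m invmx S).
  by rewrite !adjmxM adjmxK hK !mulmxA.
have uU : U \in unitmx by case/mulmx1_unit: UU.
exists (U *m S), e; split.
- by rewrite unitmx_mul uU.
- by rewrite adjmxM mulmxA -(mulmxA _ (adjmx U)) UU mulmx1.
- rewrite adjmxM !mulmxA -2!(mulmxA (adjmx S)) -KE.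
  rewrite !mulmxA -adjmxM mulVmx// adjmx1 mul1mx -mulmxA mulVmx// mulmx1//.
Qed.

(** Factoring [g = S^* S], [Q = V^* V] and [H = Z^* Z] turns the form into a sum of square norms.
    The same [T] serves for positivity and for definiteness, because it determines [B] by
    invertibility of [S], [V] and [Z]. *)
Lemma trace_form_factor n k r (g : 'M[C]_n) (Q : 'M[C]_k) (H : 'M[C]_r)
    (B : 'I_n -> 'M[C]_(r, k)) : posdef g -> posdef Q -> posdef H ->
  exists T : 'I_n -> 'M[C]_(r, k),
    complex.Re (\sum_l \sum_j invmx g l j *
      \tr (invmx Q *m adjmx (B l) *m H *m B j)) =
      \sum_p complex.Re (\tr (adjmx (T p) *m T p)) /\
    ((forall p, T p = 0) -> forall l, B l = 0).
Proof.
move=> /posdef_factor[S uS ->] /posdef_factor[V uV ->] /posdef_factor[Z uZ ->].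
pose W := invmx S; pose G l := Z *m B l *m invmx V.
have giE l j : invmx (adjmx S *m S) l j = \sum_p W l p * Num.conj (W j p).
  rewrite invmx_mul ?adjmx_unit// -adjmx_inv mxE; apply: eq_bigr => p _.
  by rewrite adjmxE.
exists (fun p => \sum_j Num.conj (W j p) *: G j); split.
  rewrite -Re_sum; congr complex.Re.
  rewrite [RHS](_ : _ = \sum_p \sum_l \sum_j (W l p * Num.conj (W j p)) * \tr (adjmx (G l) *m G j)).
    rewrite [RHS]exchange_big/=; apply: eq_bigr => l _.
    rewrite [RHS]exchange_big/=; apply: eq_bigr => j _.
    rewrite -mulr_suml -giE; congr (_ * _).
    rewrite invmx_mul ?adjmx_unit// -adjmx_inv /G !adjmxM.
    have cyc (v v' : 'M[C]_k) b (z' z : 'M[C]_r) c :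
      \tr (v *m v' *m b *m (z' *m z) *m c) = \tr (v' *m (b *m z') *m (z *m c *m v)).
      by rewrite -!mulmxA (mxtrace_mulC v) !mulmxA.
    exact: cyc.
  apply: eq_bigr => p _; rewrite adjmx_sum mulmx_suml raddf_sum; apply: eq_bigr => l _.
  rewrite mulmx_sumr raddf_sum; apply: eq_bigr => j _.
  rewrite -[LHS]/(\tr (adjmx _ *m _)) adjmxZ conjCK -scalemxAl -scalemxAr scalerA.
  exact: mxtraceZ.
move=> T0 l.
(* As [W] is the inverse of [S], contracting [T] with the conjugate of [S] gives back [G l]. *)
have : \sum_p Num.conj (S p l) *: (\sum_j Num.conj (W j p) *: G j) = G l.
  under eq_bigr do rewrite scaler_sumr.
  rewrite exchange_big (bigD1 l)//= [X in _ + X]big1 ?addr0.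
    under eq_bigr do rewrite scalerA.
    rewrite -scaler_suml (_ : \sum_p _ = Num.conj ((W *m S) l l)).
      by rewrite mulVmx// mxE eqxx conjC1 scale1r.
    by rewrite mxE rmorph_sum; apply: eq_bigr => p _; rewrite rmorphM mulrC.
  move=> j jl; under eq_bigr do rewrite scalerA.
  rewrite -scaler_suml (_ : \sum_p _ = Num.conj ((W *m S) j l)).
    by rewrite mulVmx// mxE (negbTE jl) conjC0 scale0r.
  by rewrite mxE rmorph_sum; apply: eq_bigr => p _; rewrite rmorphM mulrC.
under eq_bigr do rewrite T0 scaler0.
rewrite big1// /G => G0.
have : invmx Z *m (Z *m B l *m invmx V) *m V = 0 by rewrite -G0 mulmx0 mul0mx.
by rewrite -!mulmxA mulVmx// mulmx1 mulKmx.
Qed.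

Lemma trace_form_ge0 n k r (g : 'M[C]_n) (Q : 'M[C]_k) (H : 'M[C]_r)
    (B : 'I_n -> 'M[C]_(r, k)) : posdef g -> posdef Q -> posdef H ->
  0 <= complex.Re (\sum_l \sum_j invmx g l j *
      \tr (invmx Q *m adjmx (B l) *m H *m B j)).
Proof.
move=> pg pQ pH; have [T [-> _]] := trace_form_factor B pg pQ pH.
by apply: sumr_ge0 => p _; exact: tr_adj_ge0.
Qed.

Lemma trace_form_eq0 n k r (g : 'M[C]_n) (Q : 'M[C]_k) (H : 'M[C]_r)
    (B : 'I_n -> 'M[C]_(r, k)) : posdef g -> posdef Q -> posdef H ->
  complex.Re (\sum_l \sum_j invmx g l j *
      \tr (invmx Q *m adjmx (B l) *m H *m B j)) = 0 -> forall l, B l = 0.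
Proof.
move=> pg pQ pH; have [T [-> T0]] := trace_form_factor B pg pQ pH => /eqP.
rewrite psumr_eq0; last by move=> p _; exact: tr_adj_ge0.
move=> /allP TE; apply: T0 => p; apply: tr_adj_eq0; apply/eqP.
by have := TE p (mem_index_enum _); rewrite implyTb.
Qed.

(** The discriminant argument: the square norm of [A + t B] is nonnegative at its minimizer
    [t = - b / c]. *)
Lemma Re_tr_cauchy p q (A B : 'M[C]_(p, q)) c :
  complex.Re (\tr (adjmx B *m B)) = c -> 0 < c ->
  `|complex.Re (\tr (adjmx A *m B))| <=
    Num.sqrt (complex.Re (\tr (adjmx A *m A))) * Num.sqrt c.
Proof.
move=> Bc c0; set b := complex.Re _; set a := complex.Re (\tr (adjmx A *m A)).
have a0 : 0 <= a by exact: tr_adj_ge0.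
have := tr_adj_ge0 (A + (- b / c)%:C%C *: B).
rewrite adjmxD adjmxZ conj_real mulmxDl !mulmxDr -!scalemxAl -!scalemxAr !scalerA.
have tr4 (X Y Z W : 'M[C]_q) (s t : C) : \tr (X + s *: Y + (s *: Z + t *: W)) =
    \tr X + s * \tr Y + (s * \tr Z + t * \tr W).
  by rewrite !mxtraceD !mxtraceZ.
rewrite tr4.
have alg (x y z w : C) (t : R) : complex.Re (x + t%:C%C * y + (t%:C%C * z + t%:C%C * t%:C%C * w)) =
    complex.Re x + t * complex.Re y + (t * complex.Re z + t * t * complex.Re w).
  by case: x y z w => [? ?] [? ?] [? ?] [? ?] /=; ring.
rewrite alg.
have -> : complex.Re (\tr (adjmx B *m A)) = b.
  by rewrite -[adjmx B *m A]adjmxK tr_adjmx cReJ adjmxM adjmxK.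
rewrite Bc -/a -/b => H.
have E : a + - b / c * b + (- b / c * b + - b / c * (- b / c) * c) = a - b ^+ 2 / c.
  by field; rewrite gt_eqF.
rewrite E subr_ge0 ler_pdivrMr// in H.
by rewrite -sqrtrM// -sqrtr_sqr ler_wsqrtr.
Qed.

(** In an [H]-orthonormal basis [P] is a Hermitian projection, of Hilbert-Schmidt norm the square
    root of [k], and [endo_norm] is the Hilbert-Schmidt norm of [A]; the bound is then
    Cauchy-Schwarz. *)
Lemma Re_tr_proj_le r (H A P : 'M[C]_r) k : posdef H -> P *m P = P ->
  adjmx P *m H = H *m P -> \tr P = k%:R -> (0 < k)%N ->
  `|complex.Re (Complex 0 1 * \tr (A *m P))| <= endo_norm H A * Num.sqrt k%:R.
Proof.
move=> /posdef_factor[S uS ->] PP hP trP k0.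
pose A' := S *m A *m invmx S; pose P' := S *m P *m invmx S.
have hP' : adjmx P' = P'.
  have E : adjmx P *m adjmx S = adjmx S *m S *m P *m invmx S.
    by rewrite -hP mulmxA mulmxK.
  rewrite /P' !adjmxM E -!mulmxA [LHS]mulmxA -adjmxM mulmxV// adjmx1 mul1mx.
  by [].
pose B := adjmx ((Complex 0 1 : C) *: A').
have -> : Complex 0 1 * \tr (A *m P) = \tr (adjmx B *m P').
  rewrite /B adjmxK -scalemxAl linearZ/=; congr (_ * _).
  have -> : A' *m P' = S *m (A *m P) *m invmx S.
    by rewrite /A' /P' -!mulmxA mulKmx.
  by rewrite [RHS]mxtrace_mulC mulKmx.
have -> : endo_norm (adjmx S *m S) A = Num.sqrt (complex.Re (\tr (adjmx B *m B))).
  congr Num.sqrt; congr complex.Re; rewrite /B adjmxK adjmxZ -scalemxAl -scalemxAr scalerA.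
  rewrite (_ : _ * Num.conj _ = 1); last by apply: complex_eq => /=; ring.
  have cyc (s s' a a' z z' : 'M[C]_r) :
      \tr (a *m (z *m z' *m a' *m (s' *m s))) = \tr (s *m a *m z *m (z' *m (a' *m s'))).
    by rewrite -!mulmxA [RHS]mxtrace_mulC !mulmxA.
  rewrite scale1r /A' (adjmxM (S *m A)) (adjmxM S A).
  have uS' : adjmx S \in unitmx by rewrite adjmx_unit.
  have -> : invmx (adjmx S *m S) = invmx S *m adjmx (invmx S).
    by rewrite adjmx_inv; exact: invmx_mul.
  exact: cyc.
apply: Re_tr_cauchy; last by rewrite ltr0n.
rewrite hP' /P' !mulmxA mulmxKV// -(mulmxA S P P) PP mxtrace_mulC mulmxA mulVmx// mul1mx.
by rewrite trP raddfMn.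
Qed.

Lemma det_posdef r (H : 'M[C]_r) : posdef H ->
  complex.Im (\det H) = 0 /\ 0 < complex.Re (\det H).
Proof.
move=> /posdef_factor[S uS ->]; rewrite det_mulmx det_adjmx.
have : \det S != 0 by rewrite -unitfE -unitmxE.
case: (\det S) => u v; rewrite eq_complex/= negb_and => uv.
split; first by ring.
rewrite mulNr opprK; by case/orP: uv => ne; [apply: ltr_pwDl|apply: ltr_wpDl];
  rewrite -expr2 ?exprn_even_gt0 ?sqr_ge0.
Qed.

Lemma simdiag_eigen r (S : 'M[C]_r) (e : 'rV[R]_r) i : S \in unitmx ->
  let v := invmx S *m delta_mx i (0 : 'I_1) in
  hsqnorm (adjmx S *m S) v = 1 /\
  hsqnorm (adjmx S *m diag_mx (map_mx (real_complex R) e) *m S) v = e 0 i.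
Proof.
move=> uS v; split.
  by rewrite -[adjmx S]mulmx1 hsqnorm_conj// hsqnorm_delta mxE eqxx.
by rewrite hsqnorm_conj// hsqnorm_delta !mxE eqxx.
Qed.

(** The entries of [e] are the eigenvalues of [K] relative to [H]. Their product and sum give the
    determinant and trace estimates that follow. *)
Lemma simdiag_le r (H K : 'M[C]_r) c : posdef H -> posdef K ->
  (forall v, hsqnorm K v <= c * hsqnorm H v) ->
  exists S (e : 'rV[R]_r), [/\ S \in unitmx, H = adjmx S *m S,
    K = adjmx S *m diag_mx (map_mx (real_complex R) e) *m S &
    forall i, 0 < e 0 i <= c].
Proof.
move=> pH pK KH; have [S [e [uS HE KE]]] := simdiag pH pK.1.
exists S, e; split => // i; have [h1 h2] := simdiag_eigen e i uS.
rewrite -HE -KE in h1 h2; apply/andP; split; last by rewrite -h2 -[leRHS]mulr1 -h1.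
rewrite -h2; apply: pK.2; apply/eqP => v0.
have := h1; rewrite v0 /hsqnorm mulmx0 mxE => /eqP.
by rewrite eq_sym oner_eq0.
Qed.

Lemma det_le_posdef r (H K : 'M[C]_r) c : posdef H -> posdef K ->
  (forall v, hsqnorm K v <= c * hsqnorm H v) ->
  complex.Re (\det K) <= c ^+ r * complex.Re (\det H).
Proof.
move=> pH pK KH; have [S [e [uS HE KE he]]] := simdiag_le pH pK KH.
have -> : complex.Re (\det K) = (\prod_i e 0 i) * complex.Re (\det H).
  rewrite KE HE !det_mulmx det_diag.
  have -> : \prod_i (map_mx (real_complex R) e) 0 i = (\prod_i e 0 i)%:C%C.
    by rewrite rmorph_prod; apply: eq_bigr => i _; rewrite mxE.
  set x := \det (adjmx S); set y := \det S; set t := \prod_i _.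
  by case: x y => [? ?] [? ?] /=; ring.
apply: ler_wpM2r; first by have [_ /ltW] := det_posdef pH.
have -> : c ^+ r = \prod_(i < r) c by rewrite prodr_const card_ord.
by apply: ler_prod => i _; have /andP[/ltW -> ->] := he i.
Qed.

Lemma invmx_adj_mul r (S D : 'M[C]_r) : S \in unitmx ->
  invmx (adjmx S *m S) *m (adjmx S *m D *m S) = invmx S *m (D *m S).
Proof.
move=> uS; have uS' : adjmx S \in unitmx by rewrite adjmx_unit.
by rewrite (invmx_mul uS' uS) -!mulmxA mulKmx.
Qed.

Lemma Re_tr_invmx_le r (H K : 'M[C]_r) c : posdef H -> posdef K ->
  (forall v, hsqnorm K v <= c * hsqnorm H v) ->
  0 <= complex.Re (\tr (invmx H *m K)) <= r%:R * c.
Proof.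
move=> pH pK KH; have [S [e [uS HE KE he]]] := simdiag_le pH pK KH.
have -> : complex.Re (\tr (invmx H *m K)) = \sum_i e 0 i.
  have uS' : adjmx S \in unitmx by rewrite adjmx_unit.
  have -> : invmx H *m K = invmx S *m (diag_mx (map_mx (real_complex R) e) *m S).
    by rewrite KE HE; exact: invmx_adj_mul.
  rewrite mxtrace_mulC mulmxK// mxtrace_diag Re_sum.
  by apply: eq_bigr => i _; rewrite mxE.
apply/andP; split; first by apply: sumr_ge0 => i _; have /andP[/ltW] := he i.
have -> : r%:R * c = \sum_(i < r) c by rewrite sumr_const card_ord mulr_natl.
by apply: ler_sum => i _; have /andP[] := he i.
Qed.

(** In a factorization of [P] through its rank, idempotence forces the product of the factors in the
    other order to be the identity. *)
Lemma mxtrace_idem r (P : 'M[C]_r) : P *m P = P -> \tr P = (\rank P)%:R.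
Proof.
move=> PP; rewrite -[in LHS](mulmx_base P) mxtrace_mulC.
have : row_base P *m col_base P = 1%:M.
  apply: (row_full_inj (col_base_full P)); apply: (row_free_inj (row_base_free P)).
  by rewrite mulmx1 mulmxA mulmx_base -mulmxA mulmx_base PP.
by move=> ->; rewrite mxtrace1.
Qed.

(** In an [H]-orthonormal basis [E] becomes Hermitian, so the trace of its square is its square
    norm. Applied to [P^2 - P], this lets a trace detect that [P] is idempotent. *)
Lemma selfadjoint_idem_eq0 r (H E : 'M[C]_r) : posdef H -> adjmx E *m H = H *m E ->
  \tr (E *m E) = 0 -> E = 0.
Proof.
move=> /posdef_factor[S uS ->] hE trE.
have uS' : adjmx S \in unitmx by rewrite adjmx_unit.
pose F := S *m E *m invmx S.
have EF : adjmx F = F.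
  have h : adjmx E *m adjmx S = adjmx S *m S *m E *m invmx S.
    by rewrite -hE mulmxA mulmxK.
  rewrite /F !adjmxM h -!mulmxA [LHS]mulmxA -adjmxM mulmxV// adjmx1 mul1mx.
  by [].
have F0 : F = 0.
  apply: tr_adj_eq0; rewrite EF.
  have -> : F *m F = S *m (E *m E) *m invmx S by rewrite /F -!mulmxA mulKmx.
  by rewrite mxtrace_mulC mulKmx// trE.
have -> : E = invmx S *m F *m S by rewrite /F !mulmxA mulVmx// mul1mx mulmxKV.
by rewrite F0 mulmx0 mul0mx.
Qed.

Section PolynomialCalculus.
Variable r : nat.
Implicit Types (b : 'M[C]_r.+1) (q : {poly R}).

(** Real coefficients keep a polynomial in [b] selfadjoint for every form for which [b] is. *)
Definition rpoly q b : 'M[C]_r.+1 := horner_mx b (map_poly (real_complex R) q).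

Lemma rpoly_rec q c b : rpoly (q * 'X + c%:P) b = rpoly q b *m b + (c%:C%C)%:M.
Proof.
rewrite /rpoly rmorphD rmorphM/= map_polyX map_polyC/= rmorphD rmorphM/=.
by rewrite horner_mx_X horner_mx_C.
Qed.

Lemma rpoly0 b : rpoly 0 b = 0.
Proof. by rewrite /rpoly !rmorph0. Qed.

Lemma rpolyM q q' b : rpoly (q * q') b = rpoly q b *m rpoly q' b.
Proof. by rewrite /rpoly !rmorphM. Qed.

Lemma rpolyB q q' b : rpoly (q - q') b = rpoly q b - rpoly q' b.
Proof. by rewrite /rpoly !rmorphB. Qed.

Lemma rpoly_conj q b S : S \in unitmx ->
  rpoly q (invmx S *m b *m S) = invmx S *m rpoly q b *m S.
Proof.
move=> uS; elim/poly_ind: q => [|q c IH]; first by rewrite !rpoly0 mulmx0 mul0mx.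
rewrite !rpoly_rec IH mulmxDr mulmxDl; congr (_ + _).
  by rewrite -!mulmxA mulKVmx.
by rewrite scalar_mxC -mulmxA mulVmx// mulmx1.
Qed.

Lemma rpoly_comm q b : rpoly q b *m b = b *m rpoly q b.
Proof.
elim/poly_ind: q => [|q c IH]; first by rewrite !rpoly0 mulmx0 mul0mx.
by rewrite !rpoly_rec mulmxDr mulmxDl mulmxA IH scalar_mxC.
Qed.

Lemma rpoly_selfadjoint q b (H : 'M[C]_r.+1) : adjmx b *m H = H *m b ->
  adjmx (rpoly q b) *m H = H *m rpoly q b.
Proof.
move=> hb; elim/poly_ind: q => [|q c IH]; first by rewrite rpoly0 adjmx0 mulmx0 mul0mx.
rewrite rpoly_rec adjmxD adjmxM mulmxDl mulmxDr -mulmxA IH mulmxA hb.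
rewrite -mulmxA -rpoly_comm; congr (_ + _).
rewrite /adjmx map_scalar_mx tr_scalar_mx /= conj_real.
by rewrite scalar_mxC.
Qed.

Lemma exists_spectral_projection (H K : 'M[C]_r.+1) : posdef H -> adjmx K = K ->
  (forall c, invmx H *m K <> c%:M) ->
  exists q, let P := rpoly q (invmx H *m K) in
    P *m P = P /\ (0 < \rank P < r.+1)%N.
Proof.
move=> pH hK nscal; have [S [e [uS HE KE]]] := simdiag pH hK.
have uS' : adjmx S \in unitmx by rewrite adjmx_unit.
set D := diag_mx (map_mx (real_complex R) e).
have bE : invmx H *m K = invmx S *m D *m S.
  by rewrite KE HE -[RHS]mulmxA; exact: invmx_adj_mul.
have [j ej] : exists j, e 0 j != e 0 0.
  apply/existsP; apply: contra_notT (nscal (e 0 0)%:C%C); rewrite negb_exists => /forallP ee.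
  rewrite bE (_ : D = (e 0 0)%:C%C%:M); last first.
    apply/matrixP => i k; rewrite !mxE; have /negPn/eqP -> := ee i.
    by [].
  by rewrite scalar_mxC -mulmxA mulVmx// mulmx1.
(* Lagrange interpolation: 1 at the eigenvalue [e 0 0] and 0 at all others. A repeated eigenvalue
   only repeats a factor. *)
pose q : {poly R} := \prod_(k | e 0 k != e 0 0) (('X - (e 0 k)%:P) * ((e 0 0 - e 0 k)^-1)%:P).
have qe k : q.[e 0 k] = (e 0 k == e 0 0)%:R.
  rewrite horner_prod; case: (eqVneq (e 0 k) (e 0 0)) => [->|ek].
    apply: big1 => l el; rewrite hornerM hornerXsubC hornerC mulfV// subr_eq0 eq_sym//.
  by rewrite (bigD1 k)//= hornerM hornerXsubC subrr mul0r mul0r.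
have qD : rpoly q D = diag_mx (map_mx (real_complex R) (\row_k (e 0 k == e 0 0)%:R)).
  rewrite /rpoly /D horner_mx_diag; congr diag_mx; apply/rowP => k; rewrite !mxE.
  by rewrite horner_map/= qe.
exists q => P.
have PE : P = invmx S *m rpoly q D *m S by rewrite /P bE rpoly_conj.
have DD : rpoly q D *m rpoly q D = rpoly q D.
  rewrite qD mulmx_diag; congr diag_mx; apply/rowP => k; rewrite !mxE -rmorphM/=.
  by case: eqP; rewrite ?mulr1 ?mulr0.
have PP : P *m P = P.
  have idem (B : 'M[C]_r.+1) : B *m B = B ->
      invmx S *m B *m S *m (invmx S *m B *m S) = invmx S *m B *m S.
    by move=> BB; rewrite -!mulmxA mulKVmx// (mulmxA B) BB.
  by rewrite PE; exact: idem.
split => //; apply/andP; split.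
  rewrite lt0n mxrank_eq0; apply/eqP => P0.
  have : rpoly q D = 0.
    by rewrite -[rpoly q D](mulKVmx uS) -[invmx S *m _](mulmxK uS) -PE P0 mul0mx mulmx0.
  rewrite qD => /matrixP/(_ 0 0); rewrite !mxE !eqxx mulr1n => /(congr1 (@complex.Re R)) /= /eqP.
  by rewrite oner_eq0.
rewrite ltn_neqAle rank_leq_row andbT; apply/negP => rP.
have uP : P \in unitmx by rewrite -row_free_unit.
have P1 : P = 1%:M by rewrite -[P](mulKmx uP) PP mulVmx.
have : rpoly q D = 1%:M.
  by rewrite -[rpoly q D](mulKVmx uS) -[invmx S *m _](mulmxK uS) -PE P1 mul1mx mulmxV.
rewrite qD => /matrixP/(_ j j); rewrite !mxE !eqxx (negbTE ej) !mulr1n => /(congr1 (@complex.Re R)) /= /eqP.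
by rewrite eq_sym oner_eq0.
Qed.

End PolynomialCalculus.
End HermitianLinearAlgebra.

(** * The volume measure *)

Section DensityTransfer.
Local Open Scope ereal_scope.
Context d1 d2 (X : measurableType d1) (Y : measurableType d2) (R : realType).
Variables (mu : {measure set X -> \bar R}) (nu : {measure set Y -> \bar R}).
Variables (D : set X) (O : set Y) (psi : Y -> X) (w : Y -> R).
Hypotheses (mD : measurable D) (mO : measurable O).
Hypotheses (mpsi : measurable_fun O psi) (psiD : forall y, O y -> D (psi y)).
Hypotheses (mw : measurable_fun O w) (w0 : forall y, O y -> (0 <= w y)%R).
Hypothesis muE : forall A, measurable A -> A `<=` D ->
  mu A = \int[nu]_(y in O) (\1_A (psi y) * w y)%:E.

Import HBNNSimple.

Let integral_nnsfun_density (f : {nnsfun X >-> R}) :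
  \int[mu]_(x in D) (f x)%:E = \int[nu]_(y in O) (f (psi y) * w y)%:E.
Proof.
have mfk k : measurable (f @^-1` [set k]) by exact: measurable_sfunP.
have mpre A : measurable A -> measurable_fun O (fun y => \1_A (psi y) : R).
  by move=> mA; apply: measurableT_comp mpsi; exact: measurable_indic.
under eq_integral do rewrite fimfunE -fsumEFin//.
rewrite ge0_integral_fsum//; last 2 first.
  by move=> k; exact/measurable_EFinP/measurable_funTS/measurable_funM.
  by move=> k x _; rewrite nnfun_muleindic_ge0.
under [RHS]eq_integral do rewrite fimfunE mulr_fsuml// -fsumEFin//.
rewrite ge0_integral_fsum//; last 2 first.
  move=> k; apply/measurable_EFinP; apply: measurable_funM => //.
  by apply: measurable_funM => //; exact: mpre.
  move=> k y Oy; rewrite lee_fin mulr_ge0 ?w0//.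
  by have := nnfun_muleindic_ge0 f k (psi y); rewrite lee_fin.
apply: eq_fsbigr => k _.
rewrite integralZl_indic_nnsfun// integral_indic//.
have AD : f @^-1` [set k] `&` D `<=` D by move=> x [].
rewrite (muE (measurableI _ _ (mfk k) mD) AD).
rewrite [RHS](_ : _ = \int[nu]_(y in O) (k%:E * (\1_(f @^-1` [set k]) (psi y) * w y)%:E)); last first.
  by apply: eq_integral => y _; rewrite -EFinM mulrA.
have [k0|k0] := ltP k 0%R.
  rewrite (preimage_nnfun0 f k0) set0I.
  by rewrite !integral0_eq ?mule0// => y _; rewrite indic0 mul0r ?mule0.
rewrite ge0_integralZl//; last 2 first.
  apply/measurable_EFinP; apply: measurable_funM => //; exact: mpre.
  by move=> y Oy; rewrite lee_fin mulr_ge0// w0.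
congr (_ * _); apply: eq_integral => y /[!inE] Oy; congr (_ * _)%:E.
by rewrite !indicE in_setI (mem_set (psiD Oy)) andbT.
Qed.

(** [muE] is the case of indicators; linearity extends it to simple functions and monotone
    convergence to nonnegative ones. The sets [D] and [O] will be the domain and the range of a
    chart. *)
Lemma ge0_integral_density (F : X -> \bar R) : measurable_fun D F ->
  (forall x, D x -> 0 <= F x) ->
  \int[mu]_(x in D) F x = \int[nu]_(y in O) (F (psi y) * (w y)%:E).
Proof.
move=> mF F0; pose f_ := nnsfun_approx mD mF.
transitivity (limn (fun n => \int[mu]_(x in D) (f_ n x)%:E)).
  rewrite -monotone_convergence//.
  - apply: eq_integral => x /[!inE] xD; apply/esym/cvg_lim => //.
    exact: cvg_nnsfun_approx.
  - by move=> n; exact/measurable_EFinP/measurable_funTS.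
  - by move=> n y _; rewrite lee_fin.
  - by move=> y _ m n mn; rewrite lee_fin; exact/lefP/nd_nnsfun_approx.
under eq_fun do rewrite integral_nnsfun_density.
rewrite -monotone_convergence//.
- apply: eq_integral => y /[!inE] Oy; apply/cvg_lim => //.
  under eq_fun do rewrite EFinM.
  apply: cvgeZr => //; exact: (cvg_nnsfun_approx mD mF F0 (psiD Oy)).
- move=> n; apply/measurable_EFinP/measurable_funM => //.
  exact: measurableT_comp mpsi.
- by move=> n y Oy; rewrite lee_fin mulr_ge0// w0.
- move=> y Oy m n mn; rewrite lee_fin ler_wpM2r ?w0//.
  exact/lefP/nd_nnsfun_approx.
Qed.

Lemma integral_density (F : X -> R) : measurable_fun D F ->
  \int[mu]_(x in D) (F x)%:E = \int[nu]_(y in O) (F (psi y) * w y)%:E.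
Proof.
move=> mF; have mFE : measurable_fun D (EFin \o F) by exact/measurable_EFinP.
rewrite integralE [RHS]integralE; congr (_ - _).
  rewrite ge0_integral_density//; last exact: measurable_funepos.
  apply: eq_integral => y /[!inE] Oy; rewrite !funeposE /= -!EFin_max -EFinM.
  by rewrite maxr_pMl ?w0// mul0r.
rewrite ge0_integral_density//; last exact: measurable_funeneg.
apply: eq_integral => y /[!inE] Oy; rewrite !funenegE /= -!EFin_max -EFinM.
by rewrite maxr_pMl ?w0// mul0r mulNr.
Qed.

End DensityTransfer.

Section MatrixSmooth.
Variables (R : realType) (n : nat) (X : topologicalType) (M : atlas R (n + n) X).
Hypothesis hM : is_manifold M.
Variables (a : idx M) (U : set X).
Hypotheses (oU : open U) (Ua : U `<=` dom a).
Local Notation C := (R[i]).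

Lemma csm_det r (A : X -> 'M[C]_r) : (forall i j, csm a U (fun y => A y i j)) ->
  csm a U (fun y => \det (A y)).
Proof.
move=> CA; rewrite /determinant; apply: csm_sum => // s _.
by apply: csmM => //; [exact: csm_cst|apply: csm_prod => // i _].
Qed.

Lemma csmooth_csm V f : csmooth_on M V f -> U `<=` V -> csm a U f.
Proof.
move=> [h1 h2] UV k; split.
  by apply: Ck_sub (h1 a k) => x Ux; split; [exact: UV|exact: Ua].
by apply: Ck_sub (h2 a k) => x Ux; split; [exact: UV|exact: Ua].
Qed.

Lemma csm_csmooth f : csm a U f -> csmooth_on M U f.
Proof.
by move=> Cf; split; apply: (smooth_on_chart hM oU Ua) => k; have [] := Cf k.
Qed.

End MatrixSmooth.

Section KahlerMeasure.
Variables (R : realType) (n : nat) (X : ptopologicalType) (K : kahler R n X).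
Local Notation mu := (dvol K).
Local Notation hM := (kmanifold K).1.

Definition wgt (a : idx K) (x : X) : R := 2 ^+ n * complex.Re (\det (kmetric K a x)).

Lemma wgt_gt0 a x : dom a x -> 0 < wgt a x.
Proof.
move=> ax; apply: mulr_gt0; first by rewrite exprn_gt0.
by have [_] := det_posdef (kmetric_posdef ax).
Qed.

Lemma Ck_wgt k a : Ck k a (dom a) (wgt a).
Proof.
have oa : open (dom a) by exact: (dom_open hM).
have : csm a (dom a) (fun x => \det (kmetric K a x)).
  apply: (csm_det hM oa (@subset_refl _ (dom a))) => i j; apply: csmooth_csm (kmetric_smooth a i j) _; exact: subset_refl.
move=> /(_ k)[h _]; apply: CkM => //; [exact: hM|exact: Ck_cst].
Qed.

Definition chart_range (a : idx K) : set (borel 'rV[R]_(n + n)) := chart a @` dom a.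

Lemma open_charti_preimage a U : open U ->
  open (chart_range a `&` charti a @^-1` U : set 'rV[R]_(n + n)).
Proof.
move=> oU; rewrite openE => _ [[y ay <-]]; rewrite /= chartK//; last exact: hM.
move=> Uy; apply: filterI; first exact: (near_chart_image hM).
exact: (near_charti hM).
Qed.

Lemma measurable_chart_range a : measurable (chart_range a).
Proof. by apply: open_measurable_borel; exact: (chart_open hM). Qed.

Lemma measurable_charti a :
  measurable_fun (chart_range a) (charti a : borel 'rV[R]_(n + n) -> borel X).
Proof.
apply: measurable_fun_borel; first exact: measurable_chart_range.
by move=> U oU; apply: open_measurable_borel; exact: open_charti_preimage.
Qed.

Lemma dom_charti a v : chart_range a v -> dom a (charti a v).
Proof. by move=> [y ay <-]; rewrite chartK//; exact: hM. Qed.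

Lemma chart_charti a v : chart_range a v -> chart a (charti a v) = v.
Proof. by move=> [y ay <-]; rewrite chartK//; exact: hM. Qed.

Lemma measurable_fun_open_continuous (T : ptopologicalType) (D : set T) (f : T -> R) :
  open D -> (forall x, D x -> {for x, continuous f}) ->
  measurable_fun (D : set (borel T)) (f : borel T -> R).
Proof.
move=> oD cf; apply: (measurability _ (RGenOpens.measurableE R)) => //.
move=> _ [_ [a [b ->] <-]]; apply: open_measurable_borel.
rewrite openE => x [Dx fx]; apply: filterI; first exact: open_nbhs_nbhs.
by apply: (cf x Dx); apply: open_nbhs_nbhs; split => //; exact: interval_open.
Qed.

Lemma wgt_charti_continuous a v : chart_range a v ->
  {for v, continuous (wgt a \o charti a)}.
Proof.
move=> [y ay <-]; apply: continuous_comp; first exact: (charti_continuous hM).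
by rewrite chartK//; [have [+ _] := Ck_wgt 0 a; apply|exact: hM].
Qed.

Lemma measurable_wgt a : measurable_fun (chart_range a)
  ((wgt a \o charti a) : borel 'rV[R]_(n + n) -> R).
Proof.
apply: measurable_fun_open_continuous; first exact: (chart_open hM).
exact: wgt_charti_continuous.
Qed.

(** [dvolE] integrates the indicator of the image of [A] over all of [R^2n]. On the range of the
    chart it is the indicator of [A] composed with [charti]; off the range, where [charti] carries
    no information, it vanishes. *)
Lemma dvol_chartE a (A : set (borel X)) : measurable A -> A `<=` dom a ->
  mu A = (\int[rV_lebesgue R (n + n)]_(v in chart_range a)
    (\1_A (charti a v) * wgt a (charti a v))%:E)%E.
Proof.
move=> mA Aa; rewrite (dvolE mA Aa).
have mf : measurable_fun (chart_range a) (fun v => \1_A (charti a v) * wgt a (charti a v)).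
  apply: measurable_funM; last exact: measurable_wgt.
  by apply: measurableT_comp (@measurable_charti a); exact: measurable_indic.
rewrite integral_mkcond -lebesgue_intE.
- congr lebesgue_int; apply/funext => v; rewrite /patch; case: ifPn => [|vO].
    rewrite inE => Ov; congr (_ * _)%:E; rewrite !indicE.
    suff -> : (v \in chart a @` A) = (charti a v \in A) by [].
    have [Av|nAv] := pselect (A (charti a v)).
      by rewrite !mem_set//; exists (charti a v) => //; exact: chart_charti.
    rewrite !memNset// => -[y Ay yv]; apply: nAv.
    by rewrite -yv chartK//; [exact: hM|exact: Aa].
  rewrite indicE memNset ?mul0r// => -[y Ay yv]; move: vO; rewrite notin_setE; apply.
  by exists y => //; exact: Aa.
- by apply/(measurable_restrictT _ (measurable_chart_range a)); exact/measurable_EFinP.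
- move=> v; rewrite /patch; case: ifPn => // /[!inE] /dom_charti av.
  by rewrite lee_fin mulr_ge0// ltW// wgt_gt0.
Qed.

Lemma integral_chartE a (F : borel X -> R) : measurable_fun (dom a : set (borel X)) F ->
  (\int[mu]_(x in dom a) (F x)%:E = \int[rV_lebesgue R (n + n)]_(v in chart_range a)
    (F (charti a v) * wgt a (charti a v))%:E)%E.
Proof.
move=> mF; apply: (@integral_density _ _ _ _ _ mu _ (dom a : set (borel X)) (chart_range a)
  (charti a : borel 'rV[R]_(n + n) -> borel X) (wgt a \o charti a)) => //.
- by apply: open_measurable_borel; exact: (dom_open hM).
- exact: measurable_chart_range.
- exact: measurable_charti.
- exact: dom_charti.
- exact: measurable_wgt.
- by move=> v /dom_charti av; apply: ltW; exact: wgt_gt0.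
- exact: dvol_chartE.
Qed.

(** Near [x] the volume density lies between half and twice its value at [x], so a small coordinate
    cube has a measure comparable to its Lebesgue measure. Positivity on open sets and finiteness on
    compact sets both come from here. *)
Lemma dvol_small_ball x (U : set X) : open U -> U x ->
  exists V : set X, [/\ open V, V x, V `<=` U & (0 < mu V < +oo)%E].
Proof.
move=> oU Ux; pose a := chart_at K x; have ax : dom a x by exact: (dom_chart_at hM).
pose c := wgt a x; have c0 : 0 < c by exact: wgt_gt0.
have Ox : chart_range a (chart a x) by exists x.
have c20 : 0 < c / 2 by rewrite divr_gt0.
have : \forall v \near chart a x, [/\ chart_range a v, U (charti a v) &
    c / 2 <= wgt a (charti a v) <= 2 * c].
  have FF : Filter (nbhs (chart a x)) by exact: nbhs_filter.
  apply: (@filterS _ _ FF _ _ _ (@filterI _ _ FF _ _ (@filterI _ _ FF _ _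
    (near_chart_image hM ax) (near_charti hM oU Ux ax))
    (@cvgr_dist_le _ _ _ _ FF _ _ (wgt_charti_continuous Ox) _ c20))).
  move=> v [[H1 H2]]; rewrite /= chartK//; last exact: hM.
  by rewrite -/c ler_distlC => /andP[h1 h2]; split => //; apply/andP; split; lra.
move=> /nbhs_ballP[e /= e0 H].
pose V := dom a `&` chart a @^-1` (ball (chart a x) e).
have VE v : chart_range a v -> (V (charti a v) <-> ball (chart a x) e v).
  move=> Ov; rewrite /V /= chart_charti//; split => [[]//|bv]; split => //; exact: dom_charti.
have oV : open V.
  rewrite openE => y [ay by_]; apply: filterI.
    by apply: open_nbhs_nbhs; split => //; exact: (dom_open hM).
  apply: (chart_continuous hM ay); apply: open_nbhs_nbhs; split => //.
  exact: ball_open.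
have mV : measurable (V : set (borel X)) by exact: open_measurable_borel.
have mb : measurable (ball (chart a x) e : set (borel 'rV[R]_(n + n))).
  by apply: open_measurable_borel; exact: ball_open.
have bO : ball (chart a x) e `<=` chart_range a by move=> v /H[].
have muV : mu V = (\int[rV_lebesgue R (n + n)]_(v in ball (chart a x) e)
    (wgt a (charti a v))%:E)%E.
  rewrite (@dvol_chartE a V mV) => [|y []//].
  rewrite integral_mkcond [RHS]integral_mkcond; apply: eq_integral => v _.
  rewrite /patch; case: ifPn => [/[!inE] Ov|].
    rewrite indicE; case: ifPn => [|vO].
      rewrite inE => vb; by rewrite mem_set ?mul1r//; exact/VE.
    by rewrite memNset ?mul0r// => /(VE v Ov) vb; move: vO; rewrite notin_setE; apply.
  rewrite notin_setE => Ov; rewrite memNset// => /bO //.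
have mw : measurable_fun (ball (chart a x) e : set (borel 'rV[R]_(n + n)))
     (EFin \o (wgt a \o charti a)).
  apply: (@measurable_funS _ _ _ _ _ _ _ (measurable_chart_range a) bO).
  by apply/measurable_EFinP; exact: measurable_wgt.
exists V; split => //.
- by split => //; exact: ballxx.
- by move=> y [ay yb]; have [_ + _] := H _ yb; rewrite chartK//; exact: hM.
have cb (k : R) : (\int[rV_lebesgue R (n + n)]_(v in ball (chart a x) e) k%:E =
    (k * (2 * e) ^+ (n + n))%:E)%E.
  by rewrite integral_cst// EFinM; congr (_ * _)%E; exact: rV_lebesgue_ball.
rewrite muV; apply/andP; split.
  apply: (@lt_le_trans _ _ (c / 2 * (2 * e) ^+ (n + n))%:E).
    by rewrite lte_fin mulr_gt0// exprn_gt0// mulr_gt0.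
  rewrite -cb; apply: ge0_le_integral => //.
  - by move=> v _; rewrite lee_fin ltW.
  - by move=> v /H[_ _ /andP[]].
apply: (@le_lt_trans _ _ (2 * c * (2 * e) ^+ (n + n))%:E); last by rewrite ltry.
rewrite -cb; apply: ge0_le_integral => //.
- by move=> v /H[Ov _ _]; rewrite lee_fin; apply: ltW; apply: wgt_gt0; exact: dom_charti.
- by move=> v /H[_ _ /andP[]].
Qed.

Lemma dvol_open_gt0 x (U : set X) : open U -> U x -> (0 < mu U)%E.
Proof.
move=> oU Ux; have [V [oV _ VU /andP[V0 _]]] := dvol_small_ball oU Ux.
apply: lt_le_trans V0 _; apply: le_measure => //; rewrite inE; exact: open_measurable_borel.
Qed.

Lemma compact_closed_X (A : set X) : compact A -> closed A.
Proof. by move=> cA; apply: compact_closed => //; exact: (manifold_hausdorff hM). Qed.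

Lemma closed_measurable_borel (A : set (borel X)) : closed (A : set X) -> measurable A.
Proof.
by move=> cA; rewrite -[A]setCK; apply: measurableC; apply: open_measurable_borel; exact: closed_openC.
Qed.

Lemma dvol_compact_fin (A : set X) : compact A -> (mu A < +oo)%E.
Proof.
move=> cA; pose V x := projT1 (cid (dvol_small_ball (@openT X) (I : [set: X] x))).
have VP x := projT2 (cid (dvol_small_ball (@openT X) (I : [set: X] x))).
have : cover_compact A by rewrite -compact_cover.
move=> /(_ X [set: X] V)[|x Ax|D _ AD].
- by move=> x _; have [] := VP x.
- by exists x => //; have [] := VP x.
have mV x : measurable (V x : set (borel X)) by apply: open_measurable_borel; have [] := VP x.
have key (s : seq X) : measurable (\big[setU/set0]_(x <- s) (V x : set (borel X))) /\
    (mu (\big[setU/set0]_(x <- s) V x) < +oo)%E.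
  elim: s => [|x s [ms IH]]; first by rewrite big_nil measure0.
  rewrite big_cons; split; first exact: measurableU.
  apply: le_lt_trans (measureU2 _ _ _) _ => //.
  by rewrite lte_add_pinfty//; have [_ _ _ /andP[]] := VP x.
have [mD] := key (finmap.enum_fset D); apply: le_lt_trans; apply: le_measure.
- by rewrite inE; apply: closed_measurable_borel; exact: compact_closed_X.
- by rewrite inE.
- by move=> x /AD [y yD Vy]; rewrite -bigcup_seq; exists y.
Qed.

Lemma integrable_compact_support (A : set X) (f : X -> R) : compact A ->
  continuous f -> (forall x, ~ A x -> f x = 0) ->
  mu.-integrable setT (fun x => (f x)%:E).
Proof.
move=> cA cf f0; have [C _ fC] := bounded_compact_support cA cf f0.
apply: (@integrable_bounded_support _ _ (borel X) mu A f C) => //.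
- by apply: closed_measurable_borel; exact: compact_closed_X.
- exact: dvol_compact_fin.
- exact: measurable_fun_continuous.
Qed.

End KahlerMeasure.

(** * Matrix-valued functions *)

Section MatrixCalculus.
Variables (R : realType) (n : nat) (X : topologicalType) (M : atlas R (n + n) X).
Hypothesis hM : is_manifold M.
Local Notation C := (R[i]).
Variables (a : idx M) (U : set X).
Hypotheses (oU : open U) (Ua : U `<=` dom a).
Implicit Types (x : X) (s : bool) (j : 'I_n).

Definition dmx s j p q (Y : X -> 'M[C]_(p, q)) x : 'M[C]_(p, q) :=
  \matrix_(u, v) dd a s j (fun y => Y y u v) x.

Definition csx p q (Y : X -> 'M[C]_(p, q)) := forall u v, csm a U (fun y => Y y u v).

Lemma csx_ext p q (A B : X -> 'M[C]_(p, q)) :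
  (forall y, U y -> A y = B y) -> csx A -> csx B.
Proof. by move=> AB CA u v; apply: (csm_ext hM oU Ua _ (CA u v)) => y /AB ->. Qed.

Lemma csx_cst p q (A : 'M[C]_(p, q)) : csx (fun=> A).
Proof. by move=> u v; exact: csm_cst. Qed.

Lemma csxM p q r (A : X -> 'M[C]_(p, q)) (B : X -> 'M[C]_(q, r)) :
  csx A -> csx B -> csx (fun y => A y *m B y).
Proof.
move=> CA CB u v; apply: (csm_ext hM oU Ua (f := fun y => \sum_k A y u k * B y k v)).
  by move=> y _; rewrite mxE.
by apply: (csm_sum hM oU Ua) => k _; exact: csmM.
Qed.

Lemma csxD p q (A B : X -> 'M[C]_(p, q)) : csx A -> csx B -> csx (fun y => A y + B y).
Proof.
move=> CA CB u v; apply: (csm_ext hM oU Ua (f := fun y => A y u v + B y u v)).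
  by move=> y _; rewrite mxE.
exact: csmD.
Qed.

Lemma csxN p q (A : X -> 'M[C]_(p, q)) : csx A -> csx (fun y => - A y).
Proof.
move=> CA u v; apply: (csm_ext hM oU Ua (f := fun y => - A y u v)).
  by move=> y _; rewrite mxE.
exact: csmN.
Qed.

Lemma csx_adj p q (A : X -> 'M[C]_(p, q)) : csx A -> csx (fun y => adjmx (A y)).
Proof.
move=> CA u v; apply: (csm_ext hM oU Ua (f := fun y => Num.conj (A y v u))).
  by move=> y _; rewrite !mxE.
exact: csmJ.
Qed.

Lemma csx_det p (A : X -> 'M[C]_p) : csx A -> csm a U (fun y => \det (A y)).
Proof. exact: csm_det. Qed.

Lemma csx_tr p (A : X -> 'M[C]_p) : csx A -> csm a U (fun y => \tr (A y)).
Proof. by move=> CA; apply: (csm_sum hM oU Ua) => k _; exact: CA. Qed.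

Lemma csx_inv p (A : X -> 'M[C]_p) : (forall y, U y -> A y \in unitmx) ->
  csx A -> csx (fun y => invmx (A y)).
Proof.
move=> uA CA u v.
apply: (csm_ext hM oU Ua (f := fun y => (\det (A y))^-1 * ((-1) ^+ (v + u) *
  \det (row' v (col' u (A y)))))).
  by move=> y Uy; rewrite /invmx uA// !mxE.
apply: (csmM hM oU Ua).
  by apply: (csm_inv hM oU Ua _ (csx_det CA)) => y /uA; rewrite unitmxE unitfE.
apply: (csmM hM oU Ua); first exact: csm_cst.
apply: csx_det => i j; apply: (csm_ext hM oU Ua _ (CA (lift v i) (lift u j))).
by move=> y _; rewrite !mxE.
Qed.

Lemma csx_dmx s j p q (A : X -> 'M[C]_(p, q)) : csx A -> csx (dmx s j A).
Proof.
move=> CA u v; apply: (csm_ext hM oU Ua (f := dd a s j (fun y => A y u v))).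
  by move=> y _; rewrite mxE.
exact: csm_dd.
Qed.

Lemma dmx_ext s j p q (A B : X -> 'M[C]_(p, q)) x : U x ->
  (forall y, U y -> A y = B y) -> dmx s j A x = dmx s j B x.
Proof.
move=> Ux AB; apply/matrixP => u v; rewrite !mxE.
by apply: (dd_ext hM oU Ua) => // y /AB ->.
Qed.

Lemma dmx_cst s j p q (A : 'M[C]_(p, q)) x : dmx s j (fun=> A) x = 0.
Proof. by apply/matrixP => u v; rewrite !mxE; exact: dd_cst. Qed.

Lemma dmxM s j p q r (A : X -> 'M[C]_(p, q)) (B : X -> 'M[C]_(q, r)) x :
  csx A -> csx B -> U x ->
  dmx s j (fun y => A y *m B y) x = dmx s j A x *m B x + A x *m dmx s j B x.
Proof.
move=> CA CB Ux; apply/matrixP => u v; rewrite !mxE.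
rewrite (@dd_ext _ _ _ _ hM a U oU Ua s j _ (fun y => \sum_k A y u k * B y k v))//; last first.
  by move=> y _; rewrite mxE.
rewrite (dd_sum hM oU Ua)//; last by move=> k _; exact: csmM.
rewrite -big_split /=; apply: eq_bigr => k _.
by rewrite !mxE; exact: (ddM hM oU Ua).
Qed.

Lemma dmxD s j p q (A B : X -> 'M[C]_(p, q)) x : csx A -> csx B -> U x ->
  dmx s j (fun y => A y + B y) x = dmx s j A x + dmx s j B x.
Proof.
move=> CA CB Ux; apply/matrixP => u v; rewrite !mxE.
rewrite -(ddD hM oU Ua)//; apply: (dd_ext hM oU Ua) => // y _; by rewrite mxE.
Qed.

Lemma dmxN s j p q (A : X -> 'M[C]_(p, q)) x : csx A -> U x ->
  dmx s j (fun y => - A y) x = - dmx s j A x.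
Proof.
move=> CA Ux; apply/matrixP => u v; rewrite !mxE.
rewrite -(ddN hM oU Ua)//; apply: (dd_ext hM oU Ua) => // y _; by rewrite mxE.
Qed.

Lemma dmx_adj s j p q (A : X -> 'M[C]_(p, q)) x : csx A -> U x ->
  dmx s j (fun y => adjmx (A y)) x = adjmx (dmx (~~ s) j A x).
Proof.
move=> CA Ux; apply/matrixP => u v; rewrite !mxE -(ddJ hM oU Ua)//.
by apply: (dd_ext hM oU Ua) => // y _; rewrite !mxE.
Qed.

(** Differentiate [invmx (A y) *m A y = 1]. *)
Lemma dmx_inv s j p (A : X -> 'M[C]_p) x : (forall y, U y -> A y \in unitmx) ->
  csx A -> U x ->
  dmx s j (fun y => invmx (A y)) x = - (invmx (A x) *m dmx s j A x *m invmx (A x)).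
Proof.
move=> uA CA Ux; have CI := csx_inv uA CA.
have : dmx s j (fun y => invmx (A y) *m A y) x = 0.
  by rewrite -[RHS](dmx_cst s j (1%:M : 'M[C]_p) x); apply: dmx_ext => // y /uA; exact: mulVmx.
rewrite dmxM// => /(congr1 (mulmx^~ (invmx (A x)))).
rewrite mul0mx mulmxDl -[X in X + _ = _]mulmxA mulmxV ?uA// mulmx1 => /eqP.
by rewrite addr_eq0 => /eqP.
Qed.

Lemma dd_tr s j p (A : X -> 'M[C]_p) x : csx A -> U x ->
  dd a s j (fun y => \tr (A y)) x = \tr (dmx s j A x).
Proof.
move=> CA Ux; rewrite /mxtrace (dd_sum hM oU Ua)//.
by apply: eq_bigr => k _; rewrite mxE.
Qed.

Lemma dd_prod s j (I : finType) (F : I -> X -> C) x : (forall i, csm a U (F i)) -> U x ->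
  dd a s j (fun y => \prod_i F i y) x =
  \sum_i dd a s j (F i) x * \prod_(k | k != i) F k x.
Proof.
move=> CF Ux.
suff key (r : seq I) : uniq r -> dd a s j (fun y => \prod_(i <- r) F i y) x =
    \sum_(i <- r) dd a s j (F i) x * \prod_(k <- r | k != i) F k x.
  by rewrite [LHS]key ?index_enum_uniq.
elim: r => [|i r IH] /=.
  rewrite big_nil => _; rewrite -[RHS](dd_cst a s j 1 x); apply: (dd_ext hM oU Ua) => // y _.
  exact: big_nil.
move=> /andP[ir ur].
rewrite (@dd_ext _ _ _ _ hM a U oU Ua s j _ (fun y => F i y * \prod_(i <- r) F i y))//; last first.
  by move=> y _; rewrite big_cons.
rewrite (ddM hM oU Ua)//; last exact: csm_prod.
rewrite big_cons big_cons eqxx /= IH//; congr (_ * _ + _).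
  rewrite big_seq [RHS]big_seq_cond; apply: eq_bigl => k.
  by case kr : (k \in r) => //=; symmetry; apply: contraNneq ir => <-.
rewrite mulr_sumr big_seq [RHS]big_seq; apply: eq_bigr => k kr.
rewrite big_cons ifT; last by apply: contraNneq ir => ->.
exact: mulrCA.
Qed.

(** Jacobi's formula. The product rule differentiates one row at a time, giving the matrices [B i],
    and expansion along that row produces the adjugate. *)
Lemma dd_det s j p (A : X -> 'M[C]_p) x : csx A -> U x ->
  dd a s j (fun y => \det (A y)) x = \tr (dmx s j A x *m \adj (A x)).
Proof.
move=> CA Ux; rewrite /determinant (dd_sum hM oU Ua)//; last first.
  move=> t _; apply: (csmM hM oU Ua); first exact: csm_cst.
  by apply: csm_prod => // i _.
pose B i := \matrix_(u, v) (if u == i then dd a s j (fun y => A y i v) x else A x u v) : 'M[C]_p.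
transitivity (\sum_i \det (B i)).
  rewrite /determinant exchange_big /=; apply: eq_bigr => t _.
  rewrite (ddM hM oU Ua)//; [|exact: csm_cst|by apply: csm_prod].
  rewrite dd_cst mul0r add0r dd_prod// mulr_sumr; apply: eq_bigr => i _; congr (_ * _).
  rewrite [RHS](bigD1 i)//= mxE eqxx; congr (_ * _); apply: eq_bigr => k /negbTE ki.
  by rewrite mxE ki.
rewrite /mxtrace; apply: eq_bigr => i _; rewrite (expand_det_row _ i) mxE.
apply: eq_bigr => k _; rewrite !mxE eqxx; congr (_ * _).
rewrite /cofactor; congr (_ * \det _); apply/matrixP => u v; rewrite !mxE.
by rewrite eq_sym (negbTE (neq_lift _ _)).
Qed.

Lemma dd_det_unit s j p (A : X -> 'M[C]_p) x : csx A -> U x -> A x \in unitmx ->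
  dd a s j (fun y => \det (A y)) x = \det (A x) * \tr (invmx (A x) *m dmx s j A x).
Proof.
move=> CA Ux uA; rewrite dd_det// mxtrace_mulC [invmx _]/invmx uA -scalemxAl mxtraceZ mulrA.
by rewrite divrr ?mul1r// -unitmxE.
Qed.

End MatrixCalculus.

(** * The chain rule for holomorphic maps *)

Section HolomorphicChain.
Variables (R : realType) (n p : nat) (X Y : topologicalType).
Variables (M : atlas R (n + n) X) (N : atlas R (p + p) Y).
Hypotheses (hM : is_manifold M) (hN : is_manifold N).
Local Notation C := (R[i]).
Variables (a : idx M) (b : idx N) (U : set X) (V : set Y) (F : X -> Y).
Hypotheses (oU : open U) (Ua : U `<=` dom a) (oV : open V) (Vb : V `<=` dom b).
Hypotheses (UV : forall x, U x -> V (F x)) (cF : forall x, U x -> {for x, continuous F}).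

Hypothesis CF : forall l : 'I_p, csm a U (fun x => zcoord b l (F x)).

Let CF_coord k l : Ck k a U (fun x => chart b (F x) 0 l).
Proof.
rewrite -(splitK l); case: (fintype.split l) => q /=.
  exact: (CF q k).1.
exact: (CF q k).2.
Qed.

Lemma csm_comp f : csm b V f -> csm a U (f \o F).
Proof.
move=> Cf k; have [h1 h2] := Cf k; split.
  exact: (Ck_comp hM hN oU Ua oV Vb UV cF (CF_coord k) h1).
exact: (Ck_comp hM hN oU Ua oV Vb UV cF (CF_coord k) h2).
Qed.

(** The real chain rule in the coordinates x, y regrouped into z and its conjugate; [i] and [h]
    stand for the imaginary unit and one half. *)
Lemma chain_alg (K : comNzRingType) (p1 p2 c1 c2 d1 d2 i h e : K) :
  i * i = -1 -> h + h = 1 ->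
  ((p1 * c1 + p2 * d1) + e * (p1 * c2 + p2 * d2)) * h =
  (p1 - i * p2) * h * (((c1 + i * d1) + e * (c2 + i * d2)) * h) +
  (p1 + i * p2) * h * (((c1 - i * d1) + e * (c2 - i * d2)) * h).
Proof.
move=> ii hh; rewrite [RHS](_ : _ = (h + h) * h * (p1 * c1 - (i * i) * p2 * d1 + e * (p1 * c2 - (i * i) * p2 * d2))).
  by rewrite ii hh; ring.
ring.
Qed.

Lemma dd_chain s j f x : csm b V f -> U x ->
  dd a s j (f \o F) x = \sum_l
    (dd b true l f (F x) * dd a s j (fun y => zcoord b l (F y)) x +
     dd b false l f (F x) * dd a s j (fun y => Num.conj (zcoord b l (F y))) x).
Proof.
move=> Cf Ux.
have key q : cpderive a q (f \o F) x = \sum_(l < p)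
    (cpderive b (lshift p l) f (F x) * (pderive a q (fun y => chart b (F y) 0 (lshift p l)) x)%:C%C +
     cpderive b (rshift p l) f (F x) * (pderive a q (fun y => chart b (F y) 0 (rshift p l)) x)%:C%C).
  have D (g : Y -> R) : Ck 1 b V g -> pderive a q (g \o F) x = \sum_(l < p)
      (pderive b (lshift p l) g (F x) * pderive a q (fun y => chart b (F y) 0 (lshift p l)) x +
       pderive b (rshift p l) g (F x) * pderive a q (fun y => chart b (F y) 0 (rshift p l)) x).
    move=> Cg; have [_ E] := is_derive_comp hM hN (Ua Ux) oV Vb (UV Ux) (cF Ux) Cg
      (fun l => ((CF_coord 1 l).2 q).1 x Ux).
    by rewrite [LHS]E big_split_ord [RHS]big_split.
  have [h1 h2] := Cf 1%N.
  apply: complex_eq; rewrite /= ?(D _ h1) ?(D _ h2) ?Re_sum ?Im_sum; apply: eq_bigr => l _.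
    by rewrite cReD !cReM /= !mulr0 !subr0.
  by rewrite cImD !cImM /= !mulr0 !add0r.
rewrite ddE !key mulr_sumr -big_split mulr_suml; apply: eq_bigr => l _.
have ii : (Complex 0 1 : C) * Complex 0 1 = -1 by apply: complex_eq => /=; ring.
have hh : 2%:R^-1 + 2%:R^-1 = 1 :> C.
  by rewrite -mulr2n -[_ *+ 2]mulr_natl mulfV// pnatr_eq0.
have cz q : cpderive a q (fun y => zcoord b l (F y)) x =
   (pderive a q (fun y => chart b (F y) 0 (lshift p l)) x)%:C%C +
   Complex 0 1 * (pderive a q (fun y => chart b (F y) 0 (rshift p l)) x)%:C%C.
  by apply: complex_eq; rewrite ?cReD ?cImD ?cReM ?cImM /=; ring.
have czJ q : cpderive a q (fun y => Num.conj (zcoord b l (F y))) x =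
   (pderive a q (fun y => chart b (F y) 0 (lshift p l)) x)%:C%C -
   Complex 0 1 * (pderive a q (fun y => chart b (F y) 0 (rshift p l)) x)%:C%C.
  rewrite (cpderiveJ hM oU Ua _ (CF l) Ux) cz.
  have cg (u v : R) : Num.conj (u%:C%C + Complex 0 1 * v%:C%C) = u%:C%C - Complex 0 1 * v%:C%C.
    by apply: complex_eq; rewrite ?cReJ ?cImJ ?cReD ?cImD ?cReN ?cImN ?cReM ?cImM /=; ring.
  exact: cg.
rewrite !ddE !cz !czJ /= mulNr; exact: (chain_alg _ _ _ _ _ _ _ ii hh).
Qed.

Hypothesis hF : forall l j x, U x -> dd a false j (fun y => zcoord b l (F y)) x = 0.

Lemma dd_chain_holo s j f x : csm b V f -> U x ->
  dd a s j (f \o F) x = \sum_l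
    dd b s l f (F x) * (if s then id else Num.conj) (dd a true j (fun y => zcoord b l (F y)) x).
Proof.
move=> Cf Ux; rewrite dd_chain//; apply: eq_bigr => l _.
rewrite (ddJ hM oU Ua)//; case: s => /=.
  by rewrite hF// rmorph0 mulr0 addr0.
by rewrite hF// mulr0 add0r.
Qed.

(** Second derivatives of [F] drop out: the derivative in z of the conjugate of a derivative of a
    holomorphic function is 0. The complex Hessian thus transforms as a tensor, without correction
    terms. *)
Lemma dd_dd_chain_holo j k f x : csm b V f -> U x ->
  dd a true j (dd a false k (f \o F)) x = \sum_l \sum_m
    dd b true m (dd b false l f) (F x) * dd a true j (fun y => zcoord b m (F y)) x *
      Num.conj (dd a true k (fun y => zcoord b l (F y)) x).
Proof.
move=> Cf Ux.
have CJ l : csm a U (dd a true k (fun y => zcoord b l (F y))) by exact: csm_dd.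
have Cd l : csm b V (dd b false l f) by exact: csm_dd.
rewrite (@dd_ext _ _ _ _ hM a U oU Ua true j _ (fun y => \sum_l (dd b false l f \o F) y *
  Num.conj (dd a true k (fun y => zcoord b l (F y)) y)))//; last first.
  by move=> y Uy; rewrite dd_chain_holo.
rewrite (dd_sum hM oU Ua)//; last first.
  by move=> l _; apply: csmM => //; [exact: csm_comp|exact: csmJ].
apply: eq_bigr => l _; rewrite (ddM hM oU Ua)//; [|exact: csm_comp|exact: csmJ].
have -> : dd a true j (fun y => Num.conj (dd a true k (fun z => zcoord b l (F z)) y)) x = 0.
  rewrite (ddJ hM oU Ua _ _ (CJ l) Ux) (ddC hM oU Ua _ _ _ _ (CF l) Ux).
  have -> : dd a true k (dd a false j (fun y => zcoord b l (F y))) x = dd a true k (fun=> 0) x.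
    by apply: (dd_ext hM oU Ua _ _ Ux) => y Uy; exact: hF.
  by rewrite dd_cst rmorph0.
rewrite mulr0 addr0 (dd_chain_holo true j (Cd l) Ux) mulr_suml.
by apply: eq_bigr.
Qed.

End HolomorphicChain.

(** * The Laplacian *)

Section SmoothGlobal.
Variables (R : realType) (d : nat) (X : ptopologicalType) (M : atlas R d X).
Hypothesis hM : is_manifold M.
Implicit Types (f g : X -> R) (U V : set X).

Lemma smooth_on_sub U V f : V `<=` U -> smooth_on M U f -> smooth_on M V f.
Proof. by move=> VU sf a k; apply: Ck_sub (sf a k) => x [/VU]. Qed.

Lemma smooth_on_local U f :
  (forall x, U x -> exists V, [/\ open V, V x & smooth_on M V f]) -> smooth_on M U f.
Proof.
move=> H a k; apply: Ck_local => x [/H[V [oV Vx sV]] ax].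
by exists (V `&` dom a) => //; apply: openI => //; exact: (dom_open hM).
Qed.

Lemma smooth_on_ext U f g : open U -> (forall x, U x -> f x = g x) ->
  smooth_on M U f -> smooth_on M U g.
Proof.
move=> oU fg sf a k; apply: (Ck_ext hM _ _ _ (sf a k)).
- by apply: openI => //; exact: (dom_open hM).
- by move=> x [].
- by move=> x [/fg].
Qed.

Lemma smooth_on_chart_local U f :
  (forall x, U x -> exists (a : idx M) V, [/\ open V, V x, V `<=` dom a & forall k, Ck k a V f]) ->
  smooth_on M U f.
Proof.
move=> H; apply: smooth_on_local => x /H[a [V [oV Vx Va CV]]].
by exists V; split => //; exact: (smooth_on_chart hM oV Va).
Qed.

Lemma smooth_on_cst U (c : R) : smooth_on M U (fun=> c).
Proof. by move=> a k; exact: Ck_cst. Qed.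

Let oUa U (a : idx M) : open U -> open (U `&` dom a).
Proof. by move=> oU; apply: openI => //; exact: (dom_open hM). Qed.

Lemma smooth_onD U f g : open U -> smooth_on M U f -> smooth_on M U g ->
  smooth_on M U (fun x => f x + g x).
Proof. by move=> oU sf sg a k; apply: (CkD hM (oUa a oU)) => //; move=> x []. Qed.

Lemma smooth_onM U f g : open U -> smooth_on M U f -> smooth_on M U g ->
  smooth_on M U (fun x => f x * g x).
Proof. by move=> oU sf sg a k; apply: (CkM hM (oUa a oU)) => //; move=> x []. Qed.

Lemma smooth_onN U f : open U -> smooth_on M U f -> smooth_on M U (fun x => - f x).
Proof. by move=> oU sf a k; apply: (CkN hM (oUa a oU)) => //; move=> x []. Qed.

Lemma smooth_on_flatbump U f : open U -> smooth_on M U f -> smooth_on M U (fun x => flatbump (f x)).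
Proof. by move=> oU sf a k; apply: (Ck_flatbump hM (oUa a oU)) => //; move=> x []. Qed.

Lemma smooth_on_ln U f : open U -> (forall x, U x -> 0 < f x) -> smooth_on M U f ->
  smooth_on M U (fun x => ln (f x)).
Proof.
by move=> oU f0 sf a k; apply: (Ck_ln hM (oUa a oU)) => //; move=> x [] // /f0.
Qed.

Lemma smooth_on_inv U f : open U -> (forall x, U x -> 0 < f x) -> smooth_on M U f ->
  smooth_on M U (fun x => (f x)^-1).
Proof.
by move=> oU f0 sf a k; apply: (Ck_inv hM (oUa a oU)) => //; move=> x [] // /f0.
Qed.

Lemma smooth_on_sum U (I : Type) (r : seq I) (F : I -> X -> R) : open U ->
  (forall i, smooth_on M U (F i)) -> smooth_on M U (fun x => \sum_(i <- r) F i x).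
Proof. by move=> oU sF a k; apply: (Ck_sum hM) => //; [exact: oUa|by move=> i _; exact: sF]. Qed.

Lemma smooth_on_continuous f : smooth_on M setT f -> continuous f.
Proof.
move=> sf x; have [+ _] := sf (chart_at M x) 0%N; apply; split => //; exact: (dom_chart_at hM).
Qed.

Lemma smooth_zero_ext V (A : set X) f : open V -> closed A -> A `<=` V ->
  smooth_on M V f -> (forall x, ~ A x -> f x = 0) -> smooth_on M setT f.
Proof.
move=> oV cA AV sf f0; apply: smooth_on_local => x _.
have [Ax|nAx] := pselect (A x).
  by exists V; split => //; exact: AV.
exists (~` A); split => //; first exact: closed_openC.
by apply: (smooth_on_ext (closed_openC cA) _ (smooth_on_cst _ 0)) => y /f0.
Qed.

Lemma smooth_test_bump (a : idx M) x : dom a x -> exists (rho : X -> R) (A : set X),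
  [/\ smooth_on M setT rho, forall y, 0 <= rho y, compact A, A `<=` dom a &
    (forall y, ~ A y -> rho y = 0) /\ 0 < rho x].
Proof.
move=> ax; pose v0 := chart a x; pose q (v : 'rV[R]_d) := \sum_l (v 0 l - v0 0 l) ^+ 2.
have FF : Filter (nbhs v0) by exact: nbhs_filter.
have /nbhs_ballP[e /= e0 ball_e] := near_chart_image hM ax.
(* With radius [e / 2] the sublevel set of [q] is compact inside the ball of radius [e], which lies
   in the range of the chart. *)
pose c := (e / 2) ^+ 2; have c0 : 0 < c by rewrite exprn_gt0// divr_gt0.
have cq : continuous q.
  have cl l : continuous (fun v : 'rV[R]_d => (v 0 l - v0 0 l) ^+ 2).
    move=> v; have h : (fun v : 'rV[R]_d => v 0 l - v0 0 l) w @[w --> v] --> v 0 l - v0 0 l.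
      have FFv : Filter (nbhs v) by exact: nbhs_filter.
      exact: (@cvgB _ _ _ _ FFv _ _ _ _ (@coord_continuous R 1 d 0 l v) (cvg_cst _)).
    have -> : (fun v : 'rV[R]_d => (v 0 l - v0 0 l) ^+ 2) =
       (fun v => (v 0 l - v0 0 l) * (v 0 l - v0 0 l)) by apply/funext => w; rewrite expr2.
    have FFv : Filter (nbhs v) by exact: nbhs_filter.
    by apply: (@cvgM _ _ _ FFv); exact: h.
  rewrite /q; elim: (index_enum _) => [|l s IH] v.
    have -> : (fun v : 'rV[R]_d => \sum_(l <- [::]) (v 0 l - v0 0 l) ^+ 2) = (fun=> 0 : R).
      by apply/funext => w; rewrite big_nil.
    exact: cst_continuous.
  have -> : (fun v : 'rV[R]_d => \sum_(l <- l :: s) (v 0 l - v0 0 l) ^+ 2) =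
      (fun v => (v 0 l - v0 0 l) ^+ 2 + \sum_(l <- s) (v 0 l - v0 0 l) ^+ 2).
    by apply/funext => w; rewrite big_cons.
  have FFv : Filter (nbhs v) by exact: nbhs_filter.
  by apply: (@cvgD _ _ _ _ FFv); [exact: cl|exact: IH].
have qball v : q v <= c -> ball v0 e v.
  move=> qc; rewrite -ball_normE /=; apply: (@le_lt_trans _ _ (e / 2)); last by lra.
  rewrite distrC; apply: rV_norm_le => [|l]; first by rewrite divr_ge0// ltW.
  rewrite !mxE -ler_sqr ?nnegrE// ?divr_ge0// ?(ltW e0)// real_normK ?num_real//.
  apply: le_trans qc; rewrite /q (bigD1 l)//= lerDl; apply: sumr_ge0 => *; exact: sqr_ge0.
pose B := [set v | q v <= c].
have cB : compact B.
  apply: bounded_closed_compact; last first.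
    have -> : B = q @^-1` [set t | t <= c] by [].
    by apply: closed_comp; [move=> v _; exact: cq|exact: closed_le].
  exists (`|v0| + e); split; first exact: num_real.
  move=> t et v /qball; rewrite -ball_normE /= => vb; apply: ltW; apply: le_lt_trans et.
  rewrite -[v](subrK v0) addrC; apply: (le_trans (ler_normD _ _)).
  by rewrite lerD2l distrC ltW.
pose A := charti a @` B.
have Aa : A `<=` dom a by move=> _ [v /qball/ball_e[y ay <-] <-]; rewrite (chartK hM).
pose rho y := if pselect (dom a y) then flatbump (c - q (chart a y)) else 0.
have rhoE y : dom a y -> rho y = flatbump (c - q (chart a y)) by rewrite /rho; case: pselect.
have rho0 y : ~ A y -> rho y = 0.
  rewrite /rho; case: pselect => // ay nA; apply: flatbump_eq0; rewrite subr_le0.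
  have [//|qc] := leP c (q (chart a y)); exfalso; apply: nA; exists (chart a y) => //.
    exact: ltW.
  exact: (chartK hM).
have cA : compact A.
  apply: continuous_compact => //; apply: continuous_in_subspaceT => v.
  rewrite inE => /qball/ball_e[y ay <-]; exact: (charti_continuous hM).
exists rho, A; split => //; last split => //.
- apply: (@smooth_zero_ext (dom a) A) => //; first exact: (dom_open hM).
    by apply: compact_closed => //; exact: (manifold_hausdorff hM).
  have oa := dom_open hM a.
  apply: (smooth_on_ext oa (f := fun y => flatbump (c - q (chart a y)))) => [y /rhoE//|].
  apply: smooth_on_flatbump => //; apply: smooth_onD => //; first exact: smooth_on_cst.
  apply: smooth_onN => //; apply: smooth_on_sum => // l.
  apply: (smooth_on_ext oa (f := fun y => (chart a y 0 l - v0 0 l) * (chart a y 0 l - v0 0 l))).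
    by move=> y _; rewrite expr2.
  have sl : smooth_on M (dom a) (fun y => chart a y 0 l - v0 0 l).
    by apply: smooth_onD => //; [exact: (chart_smooth hM)|exact: smooth_on_cst].
  exact: smooth_onM.
- by move=> y; rewrite /rho; case: (pselect (dom a y)) => // ay; exact: flatbump_ge0.
- rewrite rhoE//; apply: flatbump_gt0; rewrite subr_gt0 /q big1// => l _.
  by rewrite subrr expr0n.
Qed.

(** A partition of unity in the form of an induction principle: finitely many bumps [r i] have a sum
    [T] that is positive on the support, and [f] is the sum of the [r i * (f / T)], each supported
    in one chart. *)
Lemma test_function_ind (P : (X -> R) -> Prop) :
  P (fun=> 0) ->
  (forall f g, smooth_on M setT f -> smooth_on M setT g -> P f -> P g -> P (fun x => f x + g x)) ->
  (forall (a : idx M) A f, compact A -> A `<=` dom a -> smooth_on M setT f ->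
    (forall x, ~ A x -> f x = 0) -> P f) ->
  forall f, smooth_on M setT f -> compact (closure [set x | f x != 0]) -> P f.
Proof.
move=> P0 PD Pa f sf; set S := closure _ => cS.
have fS x : ~ S x -> f x = 0.
  by move=> nS; apply/eqP; apply: contra_notT nS => ?; exact: subset_closure.
pose r x := projT1 (cid (smooth_test_bump (dom_chart_at hM x))).
have rP x := projT2 (cid (smooth_test_bump (dom_chart_at hM x))).
have sr x : smooth_on M setT (r x) by have [A []] := rP x.
have r0 x y : 0 <= r x y by have [A [_ + _ _ _]] := rP x; apply.
have rx x : 0 < r x x by have [A [_ _ _ _ []]] := rP x.
have oV x : open [set y | 0 < r x y].
  have -> : [set y | 0 < r x y] = r x @^-1` [set t | 0 < t] by [].
  by apply: open_comp; [move=> y _; exact: smooth_on_continuous|exact: open_gt].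
have : cover_compact S by rewrite -compact_cover.
move=> /(_ X setT (fun x => [set y | 0 < r x y]))[//|x Sx|D _ SD]; first by exists x => //; exact: rx.
pose s := finmap.enum_fset D; pose T y := \sum_(i <- s) r i y.
have T0 y : 0 <= T y by exact: sumr_ge0.
have ST y : S y -> 0 < T y.
  move=> /SD[i iD /= ri]; rewrite /T (big_rem i)//=; apply: ltr_pwDl => //.
  exact: sumr_ge0.
have sT : smooth_on M setT T by apply: smooth_on_sum => //; exact: openT.
have oT : open [set y | 0 < T y].
  have -> : [set y | 0 < T y] = T @^-1` [set t | 0 < t] by [].
  by apply: open_comp; [move=> y _; exact: smooth_on_continuous|exact: open_gt].
pose g y := f y * (T y)^-1.
have sg : smooth_on M setT g.
  apply: (@smooth_zero_ext [set y | 0 < T y] S) => //; first exact: closed_closure.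
    apply: smooth_onM => //; first exact: smooth_on_sub sf.
    by apply: smooth_on_inv => //; exact: smooth_on_sub sT.
  by move=> x /fS; rewrite /g => ->; rewrite mul0r.
have -> : f = fun y => \sum_(i <- s) r i y * g y.
  apply/funext => y; rewrite -mulr_suml /g -/(T y).
  have [Sy|/fS->] := pselect (S y); last by rewrite mul0r mulr0.
  by rewrite mulrCA divff ?mulr1// gt_eqF// ST.
suff [] : smooth_on M setT (fun y => \sum_(i <- s) r i y * g y) /\
  P (fun y => \sum_(i <- s) r i y * g y) by [].
move: g sg => g; elim: s {T T0 ST sT oT} => [|i s IH] sg.
  have -> : (fun y => \sum_(i <- [::]) r i y * g y) = fun=> 0.
    by apply/funext => y; rewrite big_nil.
  by split => //; exact: smooth_on_cst.
have -> : (fun y => \sum_(j <- i :: s) r j y * g y) =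
    fun y => r i y * g y + \sum_(j <- s) r j y * g y.
  by apply/funext => y; rewrite big_cons.
have [h1 h2] := IH sg; have h3 : smooth_on M setT (fun y => r i y * g y).
  by apply: smooth_onM => //; exact: openT.
split; first by apply: smooth_onD => //; exact: openT.
apply: PD => //; have [A [_ _ cA Ai [rA _]]] := rP i.
by apply: (Pa (chart_at M i) A) => // x /rA; rewrite /r => ->; rewrite mul0r.
Qed.

End SmoothGlobal.

Lemma posdef1 (R : realType) r : posdef (1%:M : 'M[R[i]]_r).
Proof. by have := @posdef_factorized R r 1%:M (unitmx1 _ _); rewrite adjmx1 mulmx1. Qed.

Section LaplacianChart.
Variables (R : realType) (n : nat) (X : ptopologicalType) (K : kahler R n X).
Local Notation C := (R[i]).
Local Notation hM := (kmanifold K).1.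
Implicit Types (a b : idx K) (U : set X) (x : X).

Definition lap (f : X -> R) x : R := locked_with dd_key (laplacian K) f x.

Lemma lapE f x : laplacian K f x = lap f x.
Proof. by rewrite /lap unlock. Qed.

Definition hess a (f : X -> C) x : 'M[C]_n :=
  \matrix_(j, k) dd a true j (dd a false k f) x.

Lemma hessE a f x j k : hess a f x j k = dd a true j (dd a false k f) x.
Proof. exact: mxE. Qed.

Lemma laplacianE (f : X -> R) x :
  lap f x = - complex.Re (\tr (invmx (gmx K x) *m
    hess (chart_at K x) (fun y => (f y)%:C%C) x)).
Proof.
have E (z : C) : complex.Re (- Complex 0 1 * (- Complex 0 1 * z)) = - complex.Re z.
  by case: z => u v /=; ring.
rewrite -lapE [LHS]E; suff -> : \matrix_(j, k) dz (chart_at K x) j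
    (dzbar (chart_at K x) k (fun y => (f y)%:C%C)) x =
    hess (chart_at K x) (fun y => (f y)%:C%C) x by [].
have E2 k : dzbar (chart_at K x) k (fun y => (f y)%:C%C) = dd (chart_at K x) false k (fun y => (f y)%:C%C).
  by apply/funext => y; rewrite ddTF.
by apply/matrixP => j k; rewrite hessE mxE ddTF E2.
Qed.

Lemma dzbarE a j f x : dzbar a j f x = dd a false j f x.
Proof. by rewrite ddTF. Qed.

Lemma smooth_csm U V (f : X -> R) a : smooth_on K U f -> V `<=` U -> V `<=` dom a ->
  csm a V (fun y => (f y)%:C%C).
Proof.
move=> sf VU Va; apply: csm_real => k; apply: Ck_sub (sf a k) => x Vx.
by split; [exact: VU|exact: Va].
Qed.

Lemma zcoord_csm U a b l : U `<=` dom a -> U `<=` dom b -> csm a U (zcoord b l).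
Proof.
by move=> Ua Ub; apply: csmooth_csm ((kmanifold K).2 b l).1 _.
Qed.

Lemma zcoord_holo a b l j x : dom a x -> dom b x -> dd a false j (zcoord b l) x = 0.
Proof. move=> ax bx; rewrite ddTF; exact: ((kmanifold K).2 b l).2. Qed.

Lemma csm_chart U a b f : open U -> U `<=` dom a -> U `<=` dom b ->
  csm a U f -> csm b U f.
Proof.
by move=> oU Ua Ub /(csm_csmooth hM oU Ua) sf; apply: csmooth_csm sf _.
Qed.

Lemma kmetric_unit a x : dom a x -> kmetric K a x \in unitmx.
Proof. by move=> /(kmetric_posdef)/posdef_unit. Qed.

Lemma mxtrace_transfer (g g' J W W' : 'M[C]_n) : g \in unitmx -> g' \in unitmx ->
  g = J^T *m g' *m map_mx Num.conj J -> W = J^T *m W' *m map_mx Num.conj J ->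
  \tr (invmx g *m W) = \tr (invmx g' *m W').
Proof.
move=> ug ug' gE WE.
have : g \in unitmx by []. rewrite {1}gE !unitmx_mul => /andP[/andP[uJ _] uJc].
rewrite gE WE !invmx_mul ?unitmx_mul ?uJ ?ug'// !mulmxA.
rewrite mxtrace_mulC !mulmxA mulmxV// mul1mx -!mulmxA; congr (\tr _).
by congr (_ *m _); rewrite mulmxA mulVmx// mul1mx.
Qed.

Lemma hess_transfer U a b f x : open U -> U `<=` dom a -> U `<=` dom b -> U x ->
  csm a U f ->
  hess a f x = (jac a b idfun x)^T *m hess b f x *m map_mx Num.conj (jac a b idfun x).
Proof.
move=> oU Ua Ub Ux Cf; have Cb := csm_chart oU Ua Ub Cf.
apply/matrixP => j k; rewrite [LHS]mxE.
have -> := @dd_dd_chain_holo R n n X X K K hM hM a b U U id oU Ua oU Ub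
  (fun _ => id) (fun x _ => @cvg_id _ _) (fun l => zcoord_csm l Ua Ub)
  (fun l j x Ux => zcoord_holo l j (Ua x Ux) (Ub x Ux)) j k f x Cb Ux.
rewrite mxE; apply: eq_bigr => l _; rewrite mxE mulr_suml; apply: eq_bigr => m _.
by rewrite !mxE !ddTF; congr (_ * _); exact: mulrC.
Qed.

(** [laplacian] uses at each point the chart chosen there, with no regularity in the point. The
    Hessian and the metric transform by the same Jacobian, which cancels in the trace, so one fixed
    chart can be used on an open set. *)
Lemma laplacian_chart U a (f : X -> R) x : open U -> U x -> dom a x -> smooth_on K U f ->
  lap f x =
  - complex.Re (\tr (invmx (kmetric K a x) *m hess a (fun y => (f y)%:C%C) x)).
Proof.
move=> oU Ux ax sf; rewrite laplacianE; apply: (congr1 (fun z => - complex.Re z)).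
set b := chart_at K x; have bx : dom b x by exact: (dom_chart_at hM).
pose W := U `&` dom a `&` dom b.
have oW : open W.
  by apply: openI; [apply: openI => //|]; exact: (dom_open hM).
have Wb : W `<=` dom b by move=> y [].
have Wa : W `<=` dom a by move=> y [[]].
have Cf : csm b W (fun y => (f y)%:C%C) by apply: smooth_csm sf _ _ => // y [[]].
apply: mxtrace_transfer (kmetric_transfer bx ax) (hess_transfer oW Wb Wa _ Cf) => //.
- exact: kmetric_unit.
- exact: kmetric_unit.
Qed.

Lemma csx_kmetric a : csx a (dom a) (kmetric K a).
Proof. by move=> j k; apply: csmooth_csm (kmetric_smooth a j k) _. Qed.

Lemma csx_hess U a f : open U -> U `<=` dom a -> csm a U f -> csx a U (hess a f).
Proof.
move=> oU Ua Cf j k; apply: (csm_ext hM oU Ua (f := dd a true j (dd a false k f))).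
  by move=> y _; rewrite mxE.
exact: (csm_dd hM oU Ua true j (csm_dd hM oU Ua false k Cf)).
Qed.

Lemma csx_sub a U V p q (A : X -> 'M[C]_(p, q)) : V `<=` U -> csx a U A -> csx a V A.
Proof. by move=> VU CA u v k; have [h1 h2] := CA u v k; split; apply: Ck_sub VU _. Qed.

Lemma csx_kmetric_inv a U : U `<=` dom a -> csx a U (fun x => invmx (kmetric K a x)).
Proof.
move=> Ua; apply: (csx_sub Ua); apply: (csx_inv hM (dom_open hM a)) => //.
  by move=> y; exact: kmetric_unit.
exact: csx_kmetric.
Qed.

Lemma laplacian_smooth U (f : X -> R) : open U -> smooth_on K U f ->
  smooth_on K U (lap f).
Proof.
move=> oU sf; apply: (smooth_on_chart_local hM) => x Ux.
pose a := chart_at K x; exists a, (U `&` dom a).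
have oW : open (U `&` dom a) by apply: openI => //; exact: (dom_open hM).
have Wa : U `&` dom a `<=` dom a by move=> y [].
split => //; first by split => //; exact: (dom_chart_at hM).
move=> k.
have Cf : csm a (U `&` dom a) (fun y => (f y)%:C%C) by apply: smooth_csm sf _ _ => // y [].
have := csmN hM oW Wa (csx_tr hM oW Wa (csxM hM oW Wa (csx_kmetric_inv Wa) (csx_hess oW Wa Cf))).
move=> /(_ k)[h _]; apply: (Ck_ext hM oW Wa _ h) => y [Uy ay].
by rewrite (laplacian_chart oU Uy ay sf) cReN.
Qed.

Lemma laplacian_ext U (f g : X -> R) x : open U -> U x -> (forall y, U y -> f y = g y) ->
  lap f x = lap g x.
Proof.
move=> oU Ux fg; rewrite !laplacianE; apply: (congr1 (fun A => - complex.Re (\tr (invmx (gmx K x) *m A)))).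
set b := chart_at K x; have bx : dom b x by exact: (dom_chart_at hM).
have oW : open (U `&` dom b) by apply: openI => //; exact: (dom_open hM).
have Wb : U `&` dom b `<=` dom b by move=> y [].
apply/matrixP => j k; rewrite !hessE; apply: (dd_ext hM oW Wb); first by split.
by move=> y Wy; apply: (dd_ext hM oW Wb _ _ Wy) => z [Uz _]; rewrite fg.
Qed.

Lemma laplacian_cst (c : R) x : lap (fun=> c) x = 0.
Proof.
rewrite laplacianE (_ : hess _ _ _ = 0) ?mulmx0 ?mxtrace0 ?oppr0//.
apply/matrixP => j k; rewrite hessE mxE.
have -> : dd (chart_at K x) false k (fun=> c%:C%C) = fun=> 0 by apply/funext => y; exact: dd_cst.
exact: dd_cst.
Qed.

Lemma hessD U a f g x : open U -> U `<=` dom a -> U x -> csm a U f -> csm a U g ->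
  hess a (fun y => f y + g y) x = hess a f x + hess a g x.
Proof.
move=> oU Ua Ux Cf Cg; apply/matrixP => j k; rewrite [RHS]mxE !hessE.
have Cdf := csm_dd hM oU Ua false k Cf; have Cdg := csm_dd hM oU Ua false k Cg.
rewrite -(ddD hM oU Ua _ _ Cdf Cdg Ux); apply: (dd_ext hM oU Ua _ _ Ux) => y Uy.
exact: (ddD hM oU Ua _ _ Cf Cg Uy).
Qed.

Lemma laplacianD U (f g : X -> R) x : open U -> U x -> smooth_on K U f -> smooth_on K U g ->
  lap (fun y => f y + g y) x = lap f x + lap g x.
Proof.
move=> oU Ux sf sg; rewrite !laplacianE -opprD -cReD -mxtraceD -mulmxDr.
set b := chart_at K x; have bx : dom b x by exact: (dom_chart_at hM).
have oW : open (U `&` dom b) by apply: openI => //; exact: (dom_open hM).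
have Wb : U `&` dom b `<=` dom b by move=> y [].
have Cf : csm b (U `&` dom b) (fun y => (f y)%:C%C) by apply: smooth_csm sf _ _ => // y [].
have Cg : csm b (U `&` dom b) (fun y => (g y)%:C%C) by apply: smooth_csm sg _ _ => // y [].
have Wx : (U `&` dom b) x by split.
rewrite -(hessD oW Wb Wx Cf Cg).
suff -> : (fun y => (f y + g y)%:C%C) = (fun y => (f y)%:C%C + (g y)%:C%C) by [].
by apply/funext => y; apply: complex_eq; rewrite ?cReD ?cImD /= ?addr0.
Qed.

(** The carre du champ of the nonnegative Laplacian, that is, the polarization of the square norm of
    the differential. Defining it from [lap] makes it independent of charts and gives smoothness and
    bilinearity for free. *)
Definition gam (f g : X -> R) x : R :=
  (f x * lap g x + g x * lap f x - lap (fun y => f y * g y) x) / 2.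

Lemma gamC f g x : gam f g x = gam g f x.
Proof.
have E : (fun y => f y * g y) = (fun y => g y * f y) by apply/funext => y; rewrite mulrC.
by rewrite /gam E [X in X - _]addrC.
Qed.

Definition grad_pair a (f g : X -> R) x : 'M[C]_n :=
  \matrix_(j, k) (dd a true j (fun y => (f y)%:C%C) x * dd a false k (fun y => (g y)%:C%C) x).

Lemma hessM U a f g x : open U -> U `<=` dom a -> U x -> csm a U f -> csm a U g ->
  hess a (fun y => f y * g y) x = \matrix_(j, k)
    (hess a f x j k * g x + dd a false k f x * dd a true j g x +
     dd a true j f x * dd a false k g x + f x * hess a g x j k).
Proof.
move=> oU Ua Ux Cf Cg; apply/matrixP => j k; rewrite [RHS]mxE !hessE.
have Cdf := csm_dd hM oU Ua false k Cf; have Cdg := csm_dd hM oU Ua false k Cg.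
have -> : dd a true j (dd a false k (fun y => f y * g y)) x =
    dd a true j (fun y => dd a false k f y * g y + f y * dd a false k g y) x.
  by apply: (dd_ext hM oU Ua _ _ Ux) => y Uy; exact: (ddM hM oU Ua _ _ Cf Cg Uy).
rewrite (ddD hM oU Ua _ _ (csmM hM oU Ua Cdf Cg) (csmM hM oU Ua Cf Cdg) Ux).
by rewrite (ddM hM oU Ua _ _ Cdf Cg Ux) (ddM hM oU Ua _ _ Cf Cdg Ux) !addrA.
Qed.

Lemma Re_tr_herm (A B : 'M[C]_n) : adjmx A = A ->
  complex.Re (\tr (A *m adjmx B)) = complex.Re (\tr (A *m B)).
Proof.
move=> hA; rewrite -[RHS]cReJ; congr complex.Re.
rewrite -{1}hA -adjmxM tr_adjmx; congr (Num.conj _); exact: mxtrace_mulC.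
Qed.

Lemma gam_alg (I A B D : 'M[C]_n) (c c' : R) : adjmx I = I ->
  (c' * - complex.Re (\tr (I *m B)) + c * - complex.Re (\tr (I *m A)) -
   - complex.Re (\tr (I *m (c%:C%C *: A + (adjmx D + D + c'%:C%C *: B))))) / 2 =
  complex.Re (\tr (I *m D)).
Proof.
move=> hI; rewrite !mulmxDr -!scalemxAr !mxtraceD !mxtraceZ !cReD (Re_tr_herm _ hI) !cReM.
by rewrite /= !mul0r !subr0; field.
Qed.

Lemma gam_chart U a (f g : X -> R) x : open U -> U x -> dom a x ->
  smooth_on K U f -> smooth_on K U g ->
  gam f g x = complex.Re (\tr (invmx (kmetric K a x) *m grad_pair a f g x)).
Proof.
move=> oU Ux ax sf sg.
have sfg := smooth_onM hM oU sf sg.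
rewrite /gam (laplacian_chart oU Ux ax sf) (laplacian_chart oU Ux ax sg) (laplacian_chart oU Ux ax sfg).
have oW : open (U `&` dom a) by apply: openI => //; exact: (dom_open hM).
have Wb : U `&` dom a `<=` dom a by move=> y [].
have Cf : csm a (U `&` dom a) (fun y => (f y)%:C%C) by apply: smooth_csm sf _ _ => // y [].
have Cg : csm a (U `&` dom a) (fun y => (g y)%:C%C) by apply: smooth_csm sg _ _ => // y [].
have Wx : (U `&` dom a) x by [].
have -> : (fun y => (f y * g y)%:C%C) = (fun y => (f y)%:C%C * (g y)%:C%C).
  by apply/funext => y; apply: complex_eq => /=; ring.
rewrite (hessM oW Wb Wx Cf Cg).
have -> : \matrix_(j, k) (hess a (fun y => (f y)%:C%C) x j k * (g x)%:C%C +
      dd a false k (fun y => (f y)%:C%C) x * dd a true j (fun y => (g y)%:C%C) x +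
      dd a true j (fun y => (f y)%:C%C) x * dd a false k (fun y => (g y)%:C%C) x +
      (f x)%:C%C * hess a (fun y => (g y)%:C%C) x j k) =
    (g x)%:C%C *: hess a (fun y => (f y)%:C%C) x + (adjmx (grad_pair a f g x) + grad_pair a f g x +
     (f x)%:C%C *: hess a (fun y => (g y)%:C%C) x).
  have cE (h : X -> R) : (fun y => Num.conj (h y)%:C%C) = (fun y => (h y)%:C%C).
    by apply/funext => y; exact: conj_real.
  have E1 j k : adjmx (grad_pair a f g x) j k =
      dd a false k (fun y => (f y)%:C%C) x * dd a true j (fun y => (g y)%:C%C) x.
    rewrite adjmxE mxE rmorphM.
    have := ddJ hM oW Wb false k Cf Wx; rewrite cE => ->.
    by have := ddJ hM oW Wb true j Cg Wx; rewrite cE => ->.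
  have alg (p q r1 r2 s1 s2 : C) : p * q + r1 + r2 + s1 * s2 = q * p + (r1 + r2 + s1 * s2).
    by ring.
  have E2 (A B D D' : 'M[C]_n) c c' j k : (c *: D' + (A + B + c' *: D)) j k =
      c * D' j k + (A j k + B j k + c' * D j k) by rewrite !mxE.
  by apply/matrixP => j k; rewrite E2 [LHS]mxE E1 [grad_pair a f g x j k]mxE; exact: alg.
have hg : adjmx (invmx (kmetric K a x)) = invmx (kmetric K a x).
  by rewrite adjmx_inv (kmetric_posdef ax).1.
exact: gam_alg.
Qed.

Lemma dbar_sqnormE U f x : open U -> U x -> smooth_on K U f ->
  dbar_sqnorm K f x = gam f f x.
Proof.
move=> oU Ux sf; have ax := dom_chart_at hM x.
rewrite (gam_chart oU Ux ax sf sf) /dbar_sqnorm /gmx; congr complex.Re.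
set a := chart_at K x.
have oW : open (U `&` dom a) by apply: openI => //; exact: (dom_open hM).
have Wb : U `&` dom a `<=` dom a by move=> y [].
have Cf : csm a (U `&` dom a) (fun y => (f y)%:C%C) by apply: smooth_csm sf _ _ => // y [].
rewrite exchange_big /mxtrace; apply: eq_bigr => k _; rewrite mxE; apply: eq_bigr => j _.
rewrite mxE -mulrA [_ * Num.conj _]mulrC; congr (_ * (_ * _)); last exact: dzbarE.
rewrite !dzbarE -(ddJ hM oW Wb true j Cf)//.
suff -> : (fun y => Num.conj (f y)%:C%C) = (fun y => (f y)%:C%C) by [].
by apply/funext => y; exact: conj_real.
Qed.

(** The case of 1-by-1 matrices in [trace_form_ge0]. *)
Lemma gam_ge0 U f x : open U -> U x -> smooth_on K U f -> 0 <= gam f f x.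
Proof.
move=> oU Ux sf; have ax := dom_chart_at hM x; set a := chart_at K x in ax.
have oW : open (U `&` dom a) by apply: openI => //; exact: (dom_open hM).
have Wb : U `&` dom a `<=` dom a by move=> y [].
have Cf : csm a (U `&` dom a) (fun y => (f y)%:C%C) by apply: smooth_csm sf _ _ => // y [].
have Wx : (U `&` dom a) x by [].
rewrite (gam_chart oU Ux ax sf sf).
pose B j : 'M[C]_1 := (dd a true j (fun y => (f y)%:C%C) x)%:M.
have := trace_form_ge0 B (kmetric_posdef ax) (posdef1 R 1) (posdef1 R 1).
suff -> : \tr (invmx (kmetric K a x) *m grad_pair a f f x) =
  \sum_l \sum_j invmx (kmetric K a x) l j * \tr (invmx 1%:M *m adjmx (B l) *m 1%:M *m B j) by [].
apply: eq_bigr => l _; rewrite mxE; apply: eq_bigr => j _; congr (_ * _).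
rewrite mxE invmx1 mulmx1 mul1mx mul_mx_scalar mxtraceZ /mxtrace big_ord1 adjmxE mxE eqxx mulr1n.
by congr (_ * _); rewrite -(ddJ hM oW Wb false l Cf Wx); congr (dd a false l _ x); apply/funext => y; rewrite conj_real.
Qed.

End LaplacianChart.

(** * Green's formula *)

Lemma continuous_compact_support_ext (R : realType) d (O B : set 'rV[R]_d) (D : 'rV[R]_d -> R) :
  open O -> closed B -> (forall v, O v -> {for v, continuous D}) -> B `<=` O ->
  (forall v, ~ B v -> D v = 0) -> continuous D.
Proof.
move=> oO cB cD BO D0 v; have [Bv|nBv] := pselect (B v); first by apply: cD; exact: BO.
apply: (continuous_near_ext (f := fun=> 0)); last exact: cst_continuous.
have FF : Filter (nbhs v) by exact: nbhs_filter.
have nB : nbhs v (~` B) by apply: open_nbhs_nbhs; split => //; exact: closed_openC.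
by apply: (@filterS _ _ FF _ _ _ nB) => w /D0.
Qed.

Section Divergence.
Variables (R : realType) (n : nat) (X : ptopologicalType) (K : kahler R n X).
Local Notation C := (R[i]).
Local Notation mu := (dvol K).
Local Notation hM := (kmanifold K).1.

(** Against Lebesgue measure, [G] becomes the Euclidean divergence of [Y]. Extended by 0 outside the
    range of the chart, the components of [Y] are functions on all of [R^2n] with compact support,
    and each partial derivative integrates to 0. *)
Lemma chart_real_divergence (a : idx K) (A : set X) (Y : 'I_(n + n) -> X -> R) (G : X -> R) :
  compact A -> A `<=` dom a -> (forall i, Ck 1 a (dom a) (Y i)) ->
  (forall i x, dom a x -> ~ A x -> Y i x = 0) ->
  continuous G -> (forall x, ~ A x -> G x = 0) ->
  (forall x, dom a x -> G x * wgt a x = \sum_i pderive a i (Y i) x) ->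
  (\int[mu]_x (G x)%:E = 0)%E.
Proof.
move=> cA Aa CY Y0 cG G0 GE.
pose O := chart_range a; have oO : open (O : set 'rV[R]_(n + n)) by exact: (chart_open hM).
have oa := dom_open hM a.
pose B := chart a @` A.
have cB : compact B.
  apply: continuous_compact => //; apply: continuous_in_subspaceT => x.
  by rewrite inE => /Aa ax; exact: (chart_continuous hM).
have clB : closed B by apply: compact_closed => //; exact: norm_hausdorff.
have BO : B `<=` O by move=> _ [x Ax <-]; exists x => //; exact: Aa.
have nBA v : O v -> ~ B v -> ~ A (charti a v).
  by move=> Ov nB Av; apply: nB; exists (charti a v) => //; exact: chart_charti.
pose W i (v : 'rV[R]_(n + n)) := if pselect (O v) then Y i (charti a v) else 0.
pose D i (v : 'rV[R]_(n + n)) := if pselect (O v) then pderive a i (Y i) (charti a v) else 0.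
have WE i v : O v -> W i v = Y i (charti a v) by rewrite /W; case: (pselect (O v)).
have DE i v : O v -> D i v = pderive a i (Y i) (charti a v) by rewrite /D; case: (pselect (O v)).
have nearO v : O v -> \forall w \near v, O w by move=> Ov; apply: open_nbhs_nbhs.
have W0 i v : ~ B v -> W i v = 0.
  rewrite /W; case: (pselect (O v)) => // Ov nB; apply: Y0; first exact: dom_charti.
  exact: nBA.
have D0 i v : ~ B v -> D i v = 0.
  rewrite /D; case: (pselect (O v)) => // Ov nB; have av := dom_charti Ov.
  have oW : open (~` A) by apply: closed_openC; exact: (@compact_closed_X _ _ _ K).
  rewrite (pderive_ext hM i (g := fun=> 0) (openI oW oa) _ av).
  - by rewrite /pderive derive_cst.
  - by split => //; exact: nBA.
  - by move=> y [nA ay]; exact: Y0.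
have cD i : continuous (D i).
  apply: (continuous_compact_support_ext oO clB _ BO (D0 i)) => v Ov.
  have FF : Filter (nbhs v) by exact: nbhs_filter.
  apply: (continuous_near_ext (f := pderive a i (Y i) \o charti a)).
    by apply: (@filterS _ _ FF _ _ _ (nearO v Ov)) => w Ow; rewrite /= DE.
  have av := dom_charti Ov; have E := chart_charti Ov.
  apply: continuous_comp; first by rewrite -E; exact: (charti_continuous hM).
  exact: ((CY i).2 i).2.1.
have dW i v : is_derive v (delta_mx 0 i : 'rV[R]_(n + n)) (W i) (D i v).
  have FF : Filter (nbhs v) by exact: nbhs_filter.
  have [Ov|nOv] := pselect (O v).
    rewrite DE//; apply: (near_eq_is_derive (f := Y i \o charti a)).
      by apply: (@filterS _ _ FF _ _ _ (nearO v Ov)) => w Ow; rewrite /= WE.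
    have av := dom_charti Ov; have [dY _] := (CY i).2 i.
    by have := dY _ av; rewrite /pderive chart_charti// => /derivableP.
  have nB : ~ B v by move=> /BO.
  have d0 : is_derive v (delta_mx 0 i : 'rV[R]_(n + n)) (fun=> 0 : R) (0 : R).
    exact: is_derive_cst.
  rewrite D0//; apply: near_eq_is_derive d0.
  have nnB : nbhs v (~` B) by apply: open_nbhs_nbhs; split => //; exact: closed_openC.
  by apply: (@filterS _ _ FF _ _ _ nnB) => w /W0 ->.
have [M M0 BM] : exists2 M : R, 0 < M & B `<=` ball 0 M.
  have [M [_ HM]] := compact_bounded cB; exists (`|M| + 2); first by rewrite ltr_wpDl.
  move=> v Bv; rewrite -ball_normE /= sub0r normrN.
  apply: (@le_lt_trans _ _ (`|M| + 1)); last by rewrite ltrD2l ltrDl.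
  by apply: HM => //; apply: (le_lt_trans (ler_norm M)); rewrite ltrDl.
have oaX : measurable (dom a : set (borel X)) by exact: open_measurable_borel.
transitivity (\int[mu]_(x in (dom a : set (borel X))) (G x)%:E)%E.
  rewrite [RHS]integral_mkcond; apply: eq_integral => x _; rewrite /patch; case: ifPn => //.
  by rewrite notin_setE => nax; rewrite G0// => /Aa.
rewrite (integral_chartE (a := a)); last first.
  by apply: measurable_funTS; exact: measurable_fun_continuous.
transitivity (\int[rV_lebesgue R (n + n)]_v \sum_i (D i v)%:E)%E.
  rewrite integral_mkcond; apply: eq_integral => v _; rewrite /patch; case: ifPn.
    rewrite inE => Ov; rewrite GE; last exact: dom_charti.
    by rewrite sumEFin; congr _%:E; apply: eq_bigr => i _; rewrite DE.
  by rewrite notin_setE => nOv; rewrite big1// => i _; rewrite D0// => /BO.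
rewrite integral_sum//.
  rewrite big1// => i _; apply: (integral_rV_derive_eq0 (cD i) (dW i) M0) => v nM.
  by rewrite W0 ?D0// => /BM.
move=> i; have [c _ Dc] := bounded_compact_support cB (cD i) (D0 i).
apply: (@integrable_bounded_support _ _ (borel 'rV[R]_(n + n)) (rV_lebesgue R (n + n)) (ball 0 M) (D i) c) => //.
- by apply: open_measurable_borel; exact: ball_open.
- by rewrite [X in (X < _)%E](rV_lebesgue_ball (0 : 'rV[R]_(n + n)) M0) ltry.
- exact: measurable_fun_continuous.
- by move=> v nM; rewrite D0// => /BM.
Qed.

Lemma chart_divergence (a : idx K) (A : set X) (Z : 'I_n -> X -> C) (G : X -> R) :
  compact A -> A `<=` dom a -> (forall j, csm a (dom a) (Z j)) ->
  (forall j x, dom a x -> ~ A x -> Z j x = 0) ->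
  continuous G -> (forall x, ~ A x -> G x = 0) ->
  (forall x, dom a x -> G x * wgt a x = complex.Re (\sum_j dd a true j (Z j) x)) ->
  (\int[mu]_x (G x)%:E = 0)%E.
Proof.
move=> cA Aa CZ Z0 cG G0 GE; have oa := dom_open hM a.
have aa : dom a `<=` dom a by [].
(* The real part of the z-derivative of [Z] is half of the x-derivative of its real part plus the
   y-derivative of its imaginary part. *)
pose Y (i : 'I_(n + n)) x := 2^-1 * match fintype.split i with
  | inl j => complex.Re (Z j x) | inr j => complex.Im (Z j x) end.
have YE1 j x : Y (lshift n j) x = 2^-1 * complex.Re (Z j x).
  by rewrite /Y (unsplitK (inl j)).
have YE2 j x : Y (rshift n j) x = 2^-1 * complex.Im (Z j x).
  by rewrite /Y (unsplitK (inr j)).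
have dhalf k i (f : X -> R) x : Ck 1 a (dom a) f -> dom a x ->
    k = 2^-1 :> R -> pderive a i (fun y => k * f y) x = k * pderive a i f x.
  move=> Cf ax _; have dk : derivable ((fun=> k) \o charti a) (chart a x) (delta_mx 0 i : 'rV[R]_(n + n)).
    exact: derivable_cst.
  rewrite (pderiveM hM ax dk ((Cf.2 i).1 x ax)).
  by rewrite [X in X * _ + _]derive_cst mul0r add0r.
apply: (@chart_real_divergence a A Y G) => //.
- move=> i; rewrite -(splitK i); case: (fintype.split i) => j.
    rewrite -[unsplit _]/(lshift n j) (_ : Y _ = fun x => 2^-1 * complex.Re (Z j x)); last exact/funext.
    apply: CkM => //; [exact: hM|exact: Ck_cst|exact: (CZ j 1%N).1].
  rewrite -[unsplit _]/(rshift n j) (_ : Y _ = fun x => 2^-1 * complex.Im (Z j x)); last exact/funext.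
  apply: CkM => //; [exact: hM|exact: Ck_cst|exact: (CZ j 1%N).2].
- move=> i x ax nA; rewrite -(splitK i); case: (fintype.split i) => j /=.
    by rewrite YE1 Z0// mulr0.
  by rewrite YE2 Z0// mulr0.
move=> x ax; rewrite GE// Re_sum.
transitivity (\sum_j (pderive a (lshift n j) (Y (lshift n j)) x +
    pderive a (rshift n j) (Y (rshift n j)) x)); last by rewrite big_split big_split_ord.
apply: eq_bigr => j _.
have [C1 C2] := CZ j 1%N.
rewrite [in RHS](_ : Y (lshift n j) = fun y => 2^-1 * complex.Re (Z j y)); last exact/funext.
rewrite [in RHS](_ : Y (rshift n j) = fun y => 2^-1 * complex.Im (Z j y)); last exact/funext.
rewrite !dhalf// ddE /cpderive.
have half : (2%:R^-1 : C) = (2^-1)%:C%C by rewrite rmorphV ?unitfE ?pnatr_eq0// rmorph_nat.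
have alg (p q u v : R) : complex.Re ((Complex p u + - Complex 0 1 * Complex q v) * (2^-1)%:C%C) =
    2^-1 * p + 2^-1 * v by rewrite /=; ring.
by rewrite half; exact: alg.
Qed.

End Divergence.

Section Green.
Variables (R : realType) (n : nat) (X : ptopologicalType) (K : kahler R n X).
Local Notation C := (R[i]).
Local Notation mu := (dvol K).
Local Notation hM := (kmanifold K).1.

(** Closedness of the Kaehler form makes the derivatives of the metric symmetric in two indices, so
    the contribution of the determinant cancels that of the inverse. This is what gives the
    Laplacian its divergence form. *)
Lemma kahler_identity (a : idx K) k x : dom a x ->
  \sum_j dd a true j (fun y => \det (kmetric K a y) * invmx (kmetric K a y) k j) x = 0.
Proof.
move=> ax; have oa := dom_open hM a; have aa : dom a `<=` dom a by [].
have Cg := csx_kmetric (K := K) a; have CI := csx_kmetric_inv aa.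
have ug y : dom a y -> kmetric K a y \in unitmx by exact: kmetric_unit.
pose I := invmx (kmetric K a x); pose D j := dmx a true j (kmetric K a) x.
have DC j p q : D j p q = D p j q by rewrite /D !mxE !ddTF; exact: kmetric_closed.
have E j : dd a true j (fun y => \det (kmetric K a y) * invmx (kmetric K a y) k j) x =
  \det (kmetric K a x) * (\tr (I *m D j) * I k j - (I *m D j *m I) k j).
  rewrite (ddM hM oa aa _ _ (csx_det hM oa aa Cg) (CI k j) ax).
  rewrite (dd_det_unit hM oa aa _ _ Cg ax (ug x ax)) -/I -/(D j).
  have -> : dd a true j (fun y => invmx (kmetric K a y) k j) x =
      dmx a true j (fun y => invmx (kmetric K a y)) x k j by rewrite mxE.
  rewrite (dmx_inv hM oa aa _ _ ug Cg ax) -/I -/(D j) mxE.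
  by rewrite -mulrA -mulrDr.
rewrite (eq_bigr _ (fun j _ => E j)) -mulr_sumr sumrB.
rewrite (_ : \sum_j _ = \sum_j (I *m D j *m I) k j) ?subrr ?mulr0//.
transitivity (\sum_j \sum_q \sum_p I k j * (D p j q * I q p)).
  apply: eq_bigr => j _; rewrite /mxtrace mulr_suml; apply: eq_bigr => q _.
  rewrite mxE mulr_suml; apply: eq_bigr => p _; rewrite DC.
  have alg (u v w : C) : u * v * w = w * (v * u) by ring.
  exact: alg.
rewrite (exchange_big_dep predT)//=.
transitivity (\sum_q \sum_p \sum_j I k j * (D p j q * I q p)).
  by apply: eq_bigr => q _; rewrite exchange_big.
rewrite exchange_big /=; apply: eq_bigr => p _; rewrite mxE; apply: eq_bigr => q _.
rewrite mxE mulr_suml; apply: eq_bigr => j _; exact: mulrA.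
Qed.

(** The integrand times the volume density is the real divergence of the field [Z j];
    [kahler_identity] removes the terms that differentiate the metric. The factor [2 ^+ n] is that
    of the volume density, and the sign that of the Laplacian. Either function may carry the
    support, because both orders are needed in [green]. *)
Lemma green_chart (a : idx K) (A : set X) (chi f : X -> R) :
  compact A -> A `<=` dom a -> smooth_on K setT chi -> smooth_on K setT f ->
  (forall x, ~ A x -> chi x = 0) \/ (forall x, ~ A x -> f x = 0) ->
  (\int[mu]_x (chi x * lap K f x - gam K chi f x)%:E = 0)%E.
Proof.
move=> cA Aa schi sf supp; have oa := dom_open hM a; have aa : dom a `<=` dom a by [].
have oT := @openT X.
have Cchi : csm a (dom a) (fun y => (chi y)%:C%C) by apply: smooth_csm schi _ _.
have Cf : csm a (dom a) (fun y => (f y)%:C%C) by apply: smooth_csm sf _ _.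
have Cdet := csx_det hM oa aa (csx_kmetric (K := K) a); have CI := csx_kmetric_inv aa.
pose W k j y := \det (kmetric K a y) * invmx (kmetric K a y) k j.
have CW k j : csm a (dom a) (W k j) by exact: (csmM hM oa aa Cdet (CI k j)).
have Cdf k : csm a (dom a) (dd a false k (fun y => (f y)%:C%C)) by exact: (csm_dd hM oa aa).
have Ccdf k := csmM hM oa aa Cchi (Cdf k).
pose c : C := - (2 ^+ n)%:C%C.
pose Z j y := c * \sum_k W k j y * ((chi y)%:C%C * dd a false k (fun y => (f y)%:C%C) y).
have CS j : csm a (dom a) (fun y => \sum_k W k j y * ((chi y)%:C%C * dd a false k (fun y => (f y)%:C%C) y)).
  by apply: (csm_sum hM oa aa) => k _; exact: (csmM hM oa aa).
have CZ j : csm a (dom a) (Z j) by apply: (csmM hM oa aa) => //; exact: csm_cst.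
have clA : closed A by exact: (@compact_closed_X _ _ _ K).
have oAa : open (~` A `&` dom a) by apply: openI => //; exact: closed_openC.
have suppd s k g x : (forall x, ~ A x -> g x = 0) -> dom a x -> ~ A x ->
    dd a s k (fun y => (g y)%:C%C) x = 0.
  move=> g0 ax nA; have E : dd a s k (fun y => (g y)%:C%C) x = dd a s k (fun=> 0) x.
    apply: (dd_ext hM oAa (fun y Wy => Wy.2)); first by split.
    by move=> y [nAy _]; rewrite g0.
  by rewrite E; exact: dd_cst.
pose G x := chi x * lap K f x - gam K chi f x.
have sG : smooth_on K setT G.
  have slap g : smooth_on K setT g -> smooth_on K setT (lap K g) by exact: laplacian_smooth.
  apply: (smooth_onD hM) => //; first by apply: (smooth_onM hM) => //; exact: slap.
  apply: (smooth_onN hM) => //; rewrite /gam.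
  apply: (smooth_onM hM) => //; last exact: smooth_on_cst.
  apply: (smooth_onD hM) => //; last first.
    by apply: (smooth_onN hM) => //; apply: slap; exact: (smooth_onM hM).
  by apply: (smooth_onD hM) => //; apply: (smooth_onM hM) => //; exact: slap.
have GE x : dom a x -> G x = - complex.Re (\tr (invmx (kmetric K a x) *m
    ((chi x)%:C%C *: hess a (fun y => (f y)%:C%C) x + grad_pair a chi f x))).
  move=> ax; rewrite /G (laplacian_chart oT I ax sf) (gam_chart oT I ax schi sf).
  rewrite mulmxDr -scalemxAr mxtraceD mxtraceZ cReD cReM /= mul0r subr0.
  by rewrite opprD mulrN.
apply: (@chart_divergence _ _ _ K a A Z G) => //.
- move=> j x ax nA; rewrite /Z big1 ?mulr0// => k _.
  by case: supp => s0; [rewrite s0// mul0r mulr0|rewrite suppd// !mulr0].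
- exact: (smooth_on_continuous hM sG).
- move=> x nA; case: supp => s0.
    have z0 : forall y, (~` A) y -> chi y = (fun=> 0) y by move=> y; exact: s0.
    have z1 : forall y, (~` A) y -> chi y * f y = (fun=> 0) y by move=> y /s0 ->; rewrite mul0r.
    have oA : open (~` A) by exact: closed_openC.
    rewrite /G /gam (laplacian_ext K oA nA z0) (laplacian_ext K oA nA z1) s0//.
    by rewrite laplacian_cst; ring.
  have z0 : forall y, (~` A) y -> f y = (fun=> 0) y by move=> y; exact: s0.
  have z1 : forall y, (~` A) y -> chi y * f y = (fun=> 0) y by move=> y /s0 ->; rewrite mulr0.
  have oA : open (~` A) by exact: closed_openC.
  rewrite /G /gam (laplacian_ext K oA nA z0) (laplacian_ext K oA nA z1) s0//.
  by rewrite laplacian_cst; ring.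
move=> x ax; have dZ j : dd a true j (Z j) x = c * \sum_k (dd a true j (W k j) x *
    ((chi x)%:C%C * dd a false k (fun y => (f y)%:C%C) x) +
    W k j x * (dd a true j (fun y => (chi y)%:C%C) x * dd a false k (fun y => (f y)%:C%C) x +
     (chi x)%:C%C * dd a true j (dd a false k (fun y => (f y)%:C%C)) x)).
  rewrite /Z (ddM hM oa aa _ _ _ (CS j) ax); last exact: csm_cst.
  rewrite dd_cst mul0r add0r (dd_sum hM oa aa); [|by move=> k _; exact: (csmM hM oa aa)|by []].
  congr (_ * _); apply: eq_bigr => k _; rewrite (ddM hM oa aa _ _ (CW k j) (Ccdf k) ax).
  by rewrite (ddM hM oa aa _ _ Cchi (Cdf k) ax).
rewrite (eq_bigr _ (fun j _ => dZ j)) -mulr_sumr exchange_big /=.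
set S := \sum_k _.
have SE : S = \det (kmetric K a x) * \tr (invmx (kmetric K a x) *m
    ((chi x)%:C%C *: hess a (fun y => (f y)%:C%C) x + grad_pair a chi f x)).
  rewrite /S /mxtrace mulr_sumr; apply: eq_bigr => k _; rewrite big_split /= -mulr_suml.
  rewrite kahler_identity// mul0r add0r mxE mulr_sumr; apply: eq_bigr => j _.
  have E2 (A' B : 'M[C]_n) z : (z *: A' + B) j k = z * A' j k + B j k by rewrite !mxE.
  by rewrite E2 hessE [grad_pair a chi f x j k]mxE /W -mulrA [_ + _ * _]addrC.
have [d0 d1] := det_posdef (kmetric_posdef ax).
rewrite GE// SE /wgt /c; set t := \tr _; move: d0 d1; case: (\det _) => u v /= -> _.
by case: t => p q /=; ring.
Qed.

Lemma gam_smooth (f g : X -> R) : smooth_on K setT f -> smooth_on K setT g ->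
  smooth_on K setT (gam K f g).
Proof.
move=> sf sg; have oT := @openT X.
have slap h : smooth_on K setT h -> smooth_on K setT (lap K h) by exact: laplacian_smooth.
apply: (smooth_onM hM) => //; last exact: smooth_on_cst.
apply: (smooth_onD hM) => //; last first.
  by apply: (smooth_onN hM) => //; apply: slap; exact: (smooth_onM hM).
by apply: (smooth_onD hM) => //; apply: (smooth_onM hM) => //; exact: slap.
Qed.

Lemma gamDl (f g h : X -> R) x : smooth_on K setT f -> smooth_on K setT g ->
  smooth_on K setT h -> gam K (fun y => f y + g y) h x = gam K f h x + gam K g h x.
Proof.
move=> sf sg sh; have oT := @openT X; have Tx : [set: X] x by [].
have E : (fun y => (f y + g y) * h y) = (fun y => f y * h y + g y * h y).
  by apply/funext => y; rewrite mulrDl.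
rewrite /gam E (laplacianD oT Tx sf sg).
rewrite (laplacianD oT Tx (smooth_onM hM oT sf sh) (smooth_onM hM oT sg sh)).
by field.
Qed.

Lemma lap_off_support (A : set X) (f : X -> R) x : closed A -> (forall y, ~ A y -> f y = 0) ->
  ~ A x -> lap K f x = 0.
Proof.
move=> cA f0 nA; rewrite -(laplacian_cst K 0 x).
by apply: (laplacian_ext K (closed_openC cA) nA) => y; exact: f0.
Qed.

Lemma gam_off_support (A : set X) (f g : X -> R) x : closed A -> (forall y, ~ A y -> f y = 0) ->
  ~ A x -> gam K f g x = 0.
Proof.
move=> cA f0 nA; have fg0 y : ~ A y -> f y * g y = 0 by move=> /f0 ->; rewrite mul0r.
by rewrite /gam f0// (lap_off_support cA f0 nA) (lap_off_support cA fg0 nA); ring.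
Qed.

Lemma off_support (f : X -> R) x : ~ closure [set x | f x != 0] x -> f x = 0.
Proof. by move=> nS; apply/eqP; apply: contra_notT nS => ?; exact: subset_closure. Qed.

(** Induction over a partition of unity for [chi]. Integrability is carried along in [P], since the
    integrals of the pieces must add up. *)
Lemma green (chi f : X -> R) : smooth_on K setT chi -> smooth_on K setT f ->
  compact (closure [set x | chi x != 0]) ->
  (\int[mu]_x (chi x * lap K f x - gam K chi f x)%:E = 0)%E /\
  (\int[mu]_x (f x * lap K chi x - gam K f chi x)%:E = 0)%E.
Proof.
move=> schi sf cS; have oT := @openT X.
have slap h : smooth_on K setT h -> smooth_on K setT (lap K h) by exact: laplacian_smooth.
pose B g h x := g x * lap K h x - gam K g h x.
have sB g h : smooth_on K setT g -> smooth_on K setT h -> smooth_on K setT (B g h).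
  move=> sg sh; apply: (smooth_onD hM) => //; first by apply: (smooth_onM hM) => //; exact: slap.
  by apply: (smooth_onN hM) => //; exact: gam_smooth.
pose P g := [/\ mu.-integrable setT (fun x => (B g f x)%:E), mu.-integrable setT (fun x => (B f g x)%:E),
  (\int[mu]_x (B g f x)%:E = 0)%E & (\int[mu]_x (B f g x)%:E = 0)%E].
have B0 x : B (fun=> 0) f x = 0 /\ B f (fun=> 0) x = 0.
  have E : gam K (fun=> 0) f x = 0.
    rewrite /gam (_ : (fun y => 0 * f y) = (fun=> 0)) ?laplacian_cst; first by ring.
    by apply/funext => y; rewrite mul0r.
  by rewrite /B [gam K f _ x]gamC E laplacian_cst; split; ring.
suff [_ _ ? ?] : P chi by [].
apply: (@test_function_ind _ _ X K hM P) => //.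
- rewrite /P (_ : (fun x => (B (fun=> 0) f x)%:E) = fun=> 0%E); last first.
    by apply/funext => x; rewrite (B0 x).1.
  rewrite (_ : (fun x => (B f (fun=> 0) x)%:E) = fun=> 0%E); last first.
    by apply/funext => x; rewrite (B0 x).2.
  by split; [exact: integrable0|exact: integrable0|exact: integral0|exact: integral0].
- move=> g h sg sh [g1 g2 g3 g4] [h1 h2 h3 h4].
  have E1 : (fun x => (B (fun x => g x + h x) f x)%:E) = (fun x => (B g f x)%:E + (B h f x)%:E)%E.
    by apply/funext => x; rewrite /B gamDl// -EFinD; congr _%:E; ring.
  have E2 : (fun x => (B f (fun x => g x + h x) x)%:E) = (fun x => (B f g x)%:E + (B f h x)%:E)%E.
    apply/funext => x; rewrite /B (gamC K f) gamDl// !(gamC K _ f).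
    by rewrite (laplacianD oT I sg sh) -EFinD; congr _%:E; ring.
  rewrite /P E1 E2; split; [exact: integrableD|exact: integrableD| |].
    by rewrite integralD// g3 h3 adde0.
  by rewrite integralD// g4 h4 adde0.
move=> a A g cA Aa sg g0; have clA : closed A by exact: (@compact_closed_X _ _ _ K).
have B1 x : ~ A x -> B g f x = 0.
  by move=> nA; rewrite /B g0// (gam_off_support f clA g0 nA); ring.
have B2 x : ~ A x -> B f g x = 0.
  move=> nA; rewrite /B (gamC K f) (gam_off_support f clA g0 nA) (lap_off_support clA g0 nA); ring.
split.
- apply: (integrable_compact_support K cA _ B1); exact: (smooth_on_continuous hM (sB _ _ sg sf)).
- apply: (integrable_compact_support K cA _ B2); exact: (smooth_on_continuous hM (sB _ _ sf sg)).
- by apply: (green_chart cA Aa) => //; left.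
- by apply: (green_chart cA Aa) => //; right.
Qed.

Lemma integrable_test (chi g : X -> R) : compact (closure [set x | chi x != 0]) ->
  continuous g -> (forall x, ~ closure [set x | chi x != 0] x -> g x = 0) ->
  mu.-integrable setT (fun x => (g x)%:E).
Proof. by move=> cS cg g0; exact: integrable_compact_support g0. Qed.

Lemma integral_lap_gam (chi f : X -> R) : smooth_on K setT chi -> smooth_on K setT f ->
  compact (closure [set x | chi x != 0]) ->
  (\int[mu]_x (chi x * lap K f x)%:E = \int[mu]_x (gam K chi f x)%:E)%E /\
  (\int[mu]_x (f x * lap K chi x)%:E = \int[mu]_x (gam K chi f x)%:E)%E.
Proof.
move=> schi sf cS; have oT := @openT X.
have slap h : smooth_on K setT h -> smooth_on K setT (lap K h) by exact: laplacian_smooth.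
have clS := @closed_closure _ [set x | chi x != 0].
have s0 := @off_support chi.
have i1 : mu.-integrable setT (fun x => (chi x * lap K f x)%:E).
  apply: (integrable_test cS) => [|x nS]; last by rewrite s0// mul0r.
  by apply: (smooth_on_continuous hM); apply: (smooth_onM hM) => //; exact: slap.
have i2 : mu.-integrable setT (fun x => (f x * lap K chi x)%:E).
  apply: (integrable_test cS) => [|x nS]; last by rewrite (lap_off_support clS s0 nS) mulr0.
  by apply: (smooth_on_continuous hM); apply: (smooth_onM hM) => //; exact: slap.
have i3 : mu.-integrable setT (fun x => (gam K chi f x)%:E).
  apply: (integrable_test cS) => [|x nS]; last exact: (gam_off_support f clS s0 nS).
  by apply: (smooth_on_continuous hM); exact: gam_smooth.
have key (u v : X -> R) : mu.-integrable setT (fun x => (u x)%:E) ->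
    mu.-integrable setT (fun x => (v x)%:E) ->
    (\int[mu]_x (u x - v x)%:E = 0)%E -> (\int[mu]_x (u x)%:E = \int[mu]_x (v x)%:E)%E.
  move=> iu iv; under eq_integral do rewrite EFinB.
  rewrite integralB//; have := integrable_fin_num measurableT iu.
  have := integrable_fin_num measurableT iv.
  case: (\int[mu]_x _)%E => // p _; case: (\int[mu]_x _)%E => // q _.
  by rewrite -EFinB => -[/eqP]; rewrite subr_eq0 => /eqP ->.
have [g1 g2] := green schi sf cS.
split; first exact: key.
by apply: key => //; rewrite -g2; apply: eq_integral => x _; rewrite (gamC K f).
Qed.

End Green.

(** * Curvature of Gram matrices *)

Section OneVariableChain.
Variables (R : realType) (n : nat) (X : topologicalType) (M : atlas R (n + n) X).
Hypothesis hM : is_manifold M.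
Local Notation C := (R[i]).

Lemma pderive_comp1 d (N : atlas R d X) (a : idx N) i (phi : R -> R) (f : X -> R) x c : is_manifold N ->
  dom a x -> derivable (f \o charti a) (chart a x) (delta_mx 0 i : 'rV[R]_d) ->
  is_derive (f x) 1 phi c -> pderive a i (phi \o f) x = c * pderive a i f x.
Proof.
move=> hN ax df dphi; have E : (f \o charti a) (chart a x) = f x by rewrite /= (chartK hN).
rewrite -E in dphi; have [_ <-] := is_derive_comp1 (derivableP df) dphi; by [].
Qed.

Lemma dd_comp1 (a : idx M) U s j (phi : R -> R) (f : X -> R) x c : open U -> U `<=` dom a ->
  Ck 1 a U f -> U x -> is_derive (f x) 1 phi c ->
  dd a s j (fun y => (phi (f y))%:C%C) x = c%:C%C * dd a s j (fun y => (f y)%:C%C) x.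
Proof.
move=> oU Ua Cf Ux dphi; have E i : cpderive a i (fun y => (phi (f y))%:C%C) x =
    c%:C%C * cpderive a i (fun y => (f y)%:C%C) x.
  rewrite /cpderive /= (pderive_comp1 hM (Ua _ Ux) ((Cf.2 i).1 x Ux) dphi).
  have -> : pderive a i (fun=> 0) x = 0 by rewrite /pderive derive_cst.
  by apply: complex_eq => /=; ring.
have alg (u v w p q : C) : (u * v + w * (u * p)) * q = u * ((v + w * p) * q) by ring.
by rewrite !ddE !E; exact: alg.
Qed.

End OneVariableChain.

Section Curvature.
Variables (R : realType) (n : nat) (X : ptopologicalType) (K : kahler R n X).
Local Notation C := (R[i]).
Local Notation hM := (kmanifold K).1.

(** This is [i Lambda F], so that [degree_density] is the real part of its trace. *)
Definition contraction r x (F : 'I_n -> 'I_n -> 'M[C]_r) : 'M[C]_r :=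
  \sum_l \sum_j invmx (gmx K x) l j *: F j l.

Lemma Lambda_mxE r x (F : 'I_n -> 'I_n -> 'M[C]_r) :
  Lambda_mx K x F = - Complex 0 1 *: contraction x F.
Proof.
apply/matrixP => u v; rewrite [RHS]mxE mxE /Lambda; congr (_ * _).
rewrite /contraction summxE; apply: eq_bigr => l _; rewrite summxE mxE.
by apply: eq_bigr => j _; rewrite !mxE.
Qed.

Lemma degree_densityE k (H : X -> 'M[C]_k) x :
  degree_density K H x = complex.Re (\tr (contraction x (chern_curvature K H x))).
Proof.
rewrite /degree_density /LambdaF Lambda_mxE mxtraceZ.
by case: (\tr _) => p q /=; ring.
Qed.

Lemma tr_contraction r x (F : 'I_n -> 'I_n -> 'M[C]_r) (P : 'M[C]_r) :
  \tr (contraction x F *m P) = \sum_l \sum_j invmx (gmx K x) l j * \tr (F j l *m P).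
Proof.
rewrite /contraction mulmx_suml raddf_sum; apply: eq_bigr => l _.
rewrite mulmx_suml raddf_sum; apply: eq_bigr => j _.
by rewrite -scalemxAl; exact: mxtraceZ.
Qed.

Variables (x : X) (U : set X).
Let a := chart_at K x.
Hypotheses (oU : open U) (Ux : U x) (Ua : U `<=` dom a).

Let A r (H : X -> 'M[C]_r) j y := invmx (H y) *m dmx a true j H y.

Lemma chernE r (H : X -> 'M[C]_r) j l :
  chern_curvature K H x j l = - dmx a false l (A H j) x.
Proof.
rewrite /chern_curvature; congr (- _); apply/matrixP => u v; rewrite !mxE ddTF /=.
have -> // : (fun y => (invmx (H y) *m dz_mx a j H y) u v) = (fun y => A H j y u v).
apply/funext => y; rewrite /A; suff -> : dz_mx a j H y = dmx a true j H y by [].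
by apply/matrixP => p q; rewrite !mxE ddTF.
Qed.

Let csxA r (H : X -> 'M[C]_r) j : csx a U H -> (forall y, U y -> H y \in unitmx) ->
  csx a U (A H j).
Proof.
move=> CH uH; apply: (csxM hM oU Ua); first exact: (csx_inv hM oU Ua).
exact: (csx_dmx hM oU Ua).
Qed.

(** The trace of the connection form [H^-1 del H] is the derivative of [ln det H]. Degree densities
    thereby become Laplacians of functions and depend on the metric only through its determinant. *)
Lemma degree_density_lap r (H : X -> 'M[C]_r) : csx a U H -> (forall y, U y -> posdef (H y)) ->
  degree_density K H x = lap K (fun y => ln (complex.Re (\det (H y)))) x.
Proof.
move=> CH pH; have uH y : U y -> H y \in unitmx by move=> /pH/posdef_unit.
have Cdet := csx_det hM oU Ua CH.
have CR k : Ck k a U (fun y => complex.Re (\det (H y))) by exact: (Cdet k).1.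
have R0 y : U y -> 0 < complex.Re (\det (H y)) by move=> /pH/det_posdef[].
have CL : csm a U (fun y => (ln (complex.Re (\det (H y))))%:C%C).
  by apply: csm_real => k; exact: (Ck_ln hM oU Ua).
have detE y : U y -> \det (H y) = (complex.Re (\det (H y)))%:C%C.
  by move=> /pH/det_posdef[/complex_real_eq].
have dL j y : U y -> dd a true j (fun y => (ln (complex.Re (\det (H y))))%:C%C) y = \tr (A H j y).
  move=> Uy; have := is_derive1_ln (R0 y Uy) => dl.
  rewrite (@dd_comp1 _ _ _ _ hM a U true j _ _ _ _ oU Ua (CR 1%N) Uy dl).
  have -> : dd a true j (fun y => (complex.Re (\det (H y)))%:C%C) y =
            dd a true j (fun y => \det (H y)) y.
    by apply: (dd_ext hM oU Ua _ _ Uy) => z /detE.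
  rewrite (dd_det_unit hM oU Ua _ _ CH Uy (uH y Uy)) -/(A H j y) [in X in _ * X]detE//.
  rewrite mulrA -rmorphM mulVf ?mul1r// gt_eqF//; exact: R0.
have trN (B : 'M[C]_r) : \tr (- B) = - \tr B by exact: raddfN.
rewrite degree_densityE -[contraction _ _]mulmx1 tr_contraction laplacianE -cReN.
congr complex.Re; rewrite /mxtrace -sumrN; apply: eq_bigr => l _.
rewrite mxE -sumrN; apply: eq_bigr => j _; rewrite -/(mxtrace _) mulmx1 chernE hessE trN mulrN.
congr (- (_ * _)); rewrite -(dd_tr hM oU Ua _ _ (csxA j CH uH) Ux).
rewrite (ddC hM oU Ua _ _ _ _ CL Ux); apply: (dd_ext hM oU Ua _ _ Ux) => y Uy.
by rewrite dL.
Qed.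

(** The bracket on the right is the covariant derivative of [sig]; holomorphy of [sig] removes the
    derivative of its adjoint. *)
Lemma dd_gram r k (H : X -> 'M[C]_r) (sig : X -> 'M[C]_(r, k)) j y : csx a U H ->
  (forall y, U y -> H y \in unitmx) -> csx a U sig ->
  (forall l y, U y -> dmx a false l sig y = 0) -> U y ->
  dmx a true j (fun y => adjmx (sig y) *m H y *m sig y) y =
  adjmx (sig y) *m H y *m (dmx a true j sig y + A H j y *m sig y).
Proof.
move=> CH uH Cs hs Uy; have Cas := csx_adj hM oU Ua Cs.
rewrite (dmxM hM oU Ua _ _ (csxM hM oU Ua Cas CH) Cs Uy) (dmxM hM oU Ua _ _ Cas CH Uy).
rewrite (dmx_adj hM oU Ua _ _ Cs Uy) /= hs// adjmx0 mul0mx add0r.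
by rewrite [RHS]mulmxDr [LHS]addrC /A !mulmxA mulmxK// uH.
Qed.

Lemma curvature_gram_alg r k (I : 'M[C]_k) (S' N' : 'M[C]_(k, r)) (H F : 'M[C]_r)
    (sg N : 'M[C]_(r, k)) :
  - (- (I *m (N' *m H *m sg) *m I) *m (S' *m H *m N) +
     I *m (N' *m H *m N + S' *m H *m - (F *m sg))) =
  I *m S' *m H *m F *m sg - I *m N' *m H *m (N - sg *m I *m S' *m H *m N).
Proof.
rewrite mulmxDr mulmxBr !mulmxN mulNmx !mulmxA opprD opprD !opprK opprD opprK.
by rewrite addrA addrC; congr (_ + _); exact: addrC.
Qed.

Lemma tr_curvature_gram_alg r k (I : 'M[C]_k) (H F : 'M[C]_r) (sg N N' : 'M[C]_(r, k)) :
  adjmx H = H -> adjmx I = I -> adjmx sg *m H *m sg *m I = 1%:M ->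
  let P := sg *m I *m adjmx sg *m H in
  \tr (I *m adjmx sg *m H *m F *m sg - I *m adjmx N' *m H *m (N - P *m N)) =
  \tr (F *m P) - \tr (I *m adjmx (N' - P *m N') *m H *m (N - P *m N)).
Proof.
move=> aH aI uQ P; have trB (B B' : 'M[C]_k) : \tr (B - B') = \tr B - \tr B' by exact: raddfB.
rewrite trB; apply: (f_equal2 (fun u v : C => u - v)).
  by rewrite mxtrace_mulC [RHS]mxtrace_mulC /P !mulmxA mxtrace_mulC !mulmxA.
have PH : adjmx P *m H = H *m P by rewrite /P !adjmxM adjmxK aH aI !mulmxA.
have sP : adjmx sg *m H *m P = adjmx sg *m H by rewrite /P !mulmxA uQ mul1mx.
have PP : P *m P = P by rewrite {1}/P -!mulmxA (mulmxA (adjmx _)) sP /P !mulmxA.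
have HE : adjmx (N' - P *m N') *m H *m (N - P *m N) = adjmx N' *m H *m (N - P *m N).
  rewrite adjmxB adjmxM !mulmxBl -[adjmx N' *m adjmx P *m _]mulmxA PH.
  rewrite [X in _ - X](_ : _ = 0) ?subr0//.
  have hN : P *m (N - P *m N) = 0 by rewrite mulmxBr mulmxA PP subrr.
  by rewrite -[_ *m (H *m P) *m _]mulmxA -[H *m P *m _]mulmxA hN !mulmx0.
by rewrite -[in RHS]mulmxA -[in RHS]mulmxA [in RHS](mulmxA (adjmx _)) HE !mulmxA.
Qed.

(** The Gauss-Codazzi equation for the subbundle framed by [sig]: [P] is the orthogonal projection
    onto it, [N] the covariant derivative of the frame, and [N - P *m N] the second fundamental
    form, which enters with a minus sign. *)
Lemma tr_curvature_gram r k (H : X -> 'M[C]_r) (sig : X -> 'M[C]_(r, k)) j l : csx a U H ->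
  (forall y, U y -> posdef (H y)) -> csx a U sig ->
  (forall l y, U y -> dmx a false l sig y = 0) ->
  (forall y, U y -> adjmx (sig y) *m H y *m sig y \in unitmx) ->
  let Q := fun y => adjmx (sig y) *m H y *m sig y in
  let N i := dmx a true i sig x + A H i x *m sig x in
  let P := sig x *m invmx (Q x) *m adjmx (sig x) *m H x in
  \tr (chern_curvature K Q x j l) = \tr (chern_curvature K H x j l *m P) -
    \tr (invmx (Q x) *m adjmx (N l - P *m N l) *m H x *m (N j - P *m N j)).
Proof.
move=> CH pH Cs hs uQ Q N P; have uH y : U y -> H y \in unitmx by move=> /pH/posdef_unit.
have aH y : U y -> adjmx (H y) = H y by move=> /pH[].
have Cas := csx_adj hM oU Ua Cs.
have CasH := csxM hM oU Ua Cas CH.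
have CQ : csx a U Q by exact: (csxM hM oU Ua CasH Cs).
pose Nf i y := dmx a true i sig y + A H i y *m sig y.
have CN i : csx a U (Nf i).
  apply: (csxD hM oU Ua); first exact: (csx_dmx hM oU Ua).
  by apply: (csxM hM oU Ua) => //; exact: csxA.
have dQ i y : U y -> dmx a true i Q y = adjmx (sig y) *m H y *m Nf i y.
  by move=> Uy; exact: dd_gram.
have aQ y : U y -> adjmx (Q y) = Q y.
  by move=> Uy; rewrite /Q !adjmxM adjmxK aH// mulmxA.
have dQb i y : U y -> dmx a false i Q y = adjmx (Nf i y) *m H y *m sig y.
  move=> Uy; have -> : dmx a false i Q y = dmx a false i (fun y => adjmx (Q y)) y.
    by apply: (dmx_ext hM oU Ua _ _ Uy) => z /aQ.
  rewrite (dmx_adj hM oU Ua _ _ CQ Uy) /= dQ// !adjmxM adjmxK aH// mulmxA//.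
have dsH : dmx a false l (fun y => adjmx (sig y) *m H y) x = adjmx (Nf l x) *m H x.
  have CHs : csx a U (fun y => H y *m sig y) by exact: (csxM hM oU Ua).
  have -> : dmx a false l (fun y => adjmx (sig y) *m H y) x =
      dmx a false l (fun y => adjmx (H y *m sig y)) x.
    by apply: (dmx_ext hM oU Ua _ _ Ux) => z Uz; rewrite adjmxM aH.
  rewrite (dmx_adj hM oU Ua _ _ CHs Ux) /= (dmxM hM oU Ua _ _ CH Cs Ux) -[in RHS](aH x Ux) -adjmxM.
  by rewrite /Nf mulmxDr /A !mulmxA mulmxV ?uH// mul1mx addrC.
have dN : dmx a false l (Nf j) x = - (chern_curvature K H x j l *m sig x).
  have CA := csxA j CH uH.
  rewrite (dmxD hM oU Ua _ _ (csx_dmx hM oU Ua _ _ Cs) (csxM hM oU Ua CA Cs) Ux).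
  rewrite (dmxM hM oU Ua _ _ CA Cs Ux) hs// mulmx0 addr0 chernE mulNmx opprK.
  suff -> : dmx a false l (dmx a true j sig) x = 0 by rewrite add0r.
  apply/matrixP => u v; rewrite !mxE.
  have -> : dd a false l (fun y => dmx a true j sig y u v) x =
      dd a false l (dd a true j (fun y => sig y u v)) x.
    by apply: (dd_ext hM oU Ua _ _ Ux) => y _; rewrite mxE.
  rewrite (ddC hM oU Ua _ _ _ _ (Cs u v) Ux) -(dd_cst a true j 0 x).
  apply: (dd_ext hM oU Ua _ _ Ux) => y Uy.
  by have := congr1 (fun B : 'M[C]_(r, k) => B u v) (hs l y Uy); rewrite !mxE.
have CIQ := csx_inv hM oU Ua uQ CQ.
have CsHN : csx a U (fun y => adjmx (sig y) *m H y *m Nf j y) by exact: (csxM hM oU Ua).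
have FE : chern_curvature K Q x j l =
    invmx (Q x) *m adjmx (sig x) *m H x *m chern_curvature K H x j l *m sig x -
    invmx (Q x) *m adjmx (N l) *m H x *m (N j - P *m N j).
  rewrite [LHS]chernE.
  have -> : dmx a false l (A Q j) x =
      dmx a false l (fun y => invmx (Q y) *m (adjmx (sig y) *m H y *m Nf j y)) x.
    by apply: (dmx_ext hM oU Ua _ _ Ux) => y Uy; rewrite /A dQ.
  rewrite (dmxM hM oU Ua _ _ CIQ CsHN Ux) (dmx_inv hM oU Ua _ _ uQ CQ Ux) dQb//.
  rewrite (dmxM hM oU Ua _ _ CasH (CN j) Ux) dsH dN.
  exact: curvature_gram_alg.
rewrite FE; apply: tr_curvature_gram_alg; [exact: aH|by rewrite adjmx_inv aQ|].
by rewrite mulmxV// uQ.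
Qed.

End Curvature.

(** * Bounded functions with Laplacian bounded above *)

Section GradientCalculus.
Variables (R : realType) (n : nat) (X : ptopologicalType) (K : kahler R n X).
Local Notation C := (R[i]).
Local Notation mu := (dvol K).
Local Notation hM := (kmanifold K).1.
Implicit Types f g chi : X -> R.

Lemma gam_comp1 (phi : R -> R) f g x c : smooth_on K setT f ->
  smooth_on K setT (phi \o f) -> smooth_on K setT g -> is_derive (f x) 1 phi c ->
  gam K (phi \o f) g x = c * gam K f g x.
Proof.
move=> sf sphi sg dphi; have oT := @openT X; have Tx : [set: X] x by [].
have ax := dom_chart_at hM x; set a := chart_at K x in ax.
have oa := dom_open hM a; have aa : dom a `<=` dom a by [].
rewrite (gam_chart oT Tx ax sphi sg) (gam_chart oT Tx ax sf sg).
suff -> : grad_pair a (phi \o f) g x = c%:C%C *: grad_pair a f g x.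
  by rewrite -scalemxAr mxtraceZ cReM /= mul0r subr0.
apply/matrixP => j k; rewrite !mxE.
have Cf : Ck 1 a (dom a) f by apply: Ck_sub (sf a 1%N) => y ay.
by rewrite (dd_comp1 hM true j oa aa Cf ax dphi) mulrA.
Qed.

Lemma is_derive_sqr (t : R) : is_derive t 1 (fun s : R => s * s) (2 * t).
Proof. by apply: is_derive_eq; rewrite /GRing.scale /=; ring. Qed.

Lemma gam_sqrl f g x : smooth_on K setT f -> smooth_on K setT g ->
  gam K (fun y => f y * f y) g x = 2 * f x * gam K f g x.
Proof.
move=> sf sg; rewrite -(gam_comp1 sf _ sg (is_derive_sqr (f x)))//.
exact: (smooth_onM hM (@openT X)).
Qed.

Lemma gamZl (c : R) f g x : smooth_on K setT f -> smooth_on K setT g ->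
  gam K (fun y => c * f y) g x = c * gam K f g x.
Proof.
move=> sf sg; have dc : is_derive (f x) 1 (fun s : R => c * s) c.
  by apply: is_derive_eq; rewrite /GRing.scale /=; ring.
rewrite -(gam_comp1 sf _ sg dc)//.
by apply: (smooth_onM hM (@openT X)) => //; exact: smooth_on_cst.
Qed.

(** Positivity of [gam] on [c f + g]; it replaces Cauchy-Schwarz in the absorption arguments
    below. *)
Lemma gam_amgm (c : R) f g x : smooth_on K setT f -> smooth_on K setT g ->
  0 <= c * c * gam K f f x + 2 * c * gam K f g x + gam K g g x.
Proof.
move=> sf sg; have oT := @openT X; have Tx : [set: X] x by [].
have scf : smooth_on K setT (fun y => c * f y).
  by apply: (smooth_onM hM) => //; exact: smooth_on_cst.
have sh := smooth_onD hM oT scf sg.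
have := gam_ge0 oT Tx sh.
rewrite gamDl// (gamC K (fun y => c * f y)) (gamC K g) !gamDl// !(gamC K _ (fun y => c * f y)).
rewrite !gamZl// (gamC K f (fun y => c * f y)) gamZl//.
by set p := gam _ _ _ _; set q := gam _ _ _ _; set r := gam _ _ _ _ => h; lra.
Qed.

Lemma lap_sqr f x : lap K (fun y => f y * f y) x = 2 * (f x * lap K f x - gam K f f x).
Proof. by rewrite /gam; field. Qed.

End GradientCalculus.

Section LaplacianIntegral.
Variables (R : realType) (n : nat) (X : ptopologicalType) (K : kahler R n X).
Local Notation C := (R[i]).
Local Notation mu := (dvol K).
Local Notation hM := (kmanifold K).1.

Variables (rho : X -> R) (f w : X -> R) (m : R).
Hypotheses (hrho : exhaustion K rho) (rho_gt0 : forall x, 0 < rho x).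
Hypothesis rhoL2 : (\int[mu]_x (dbar_sqnorm K (fun y => ln (rho y)) x)%:E < +oo)%E.
Hypotheses (sf : smooth_on K setT f) (f0 : forall x, 0 <= f x <= m).
Hypotheses (mw : measurable_fun setT (w : borel X -> R)) (w0 : forall x, 0 <= w x).
Hypothesis wint : (\int[mu]_x (w x)%:E < +oo)%E.
Hypothesis lapw : forall x, lap K f x <= w x.

Let oT := @openT X.
Let L x := ln (rho x).
Let sL : smooth_on K setT L.
Proof. by apply: (smooth_on_ln hM oT) => //; exact: hrho.1. Qed.

(** It vanishes where [ln rho] is at least [N.+1], hence has compact support, and it tends pointwise
    to the constant [flatbump 1], which is positive but not 1. *)
Let chi N x := flatbump (1 - N.+1%:R^-1 * L x).

Let s_aff N : smooth_on K setT (fun x => 1 - N.+1%:R^-1 * L x).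
Proof.
apply: (smooth_onD hM oT); first exact: smooth_on_cst.
by apply: (smooth_onN hM oT); apply: (smooth_onM hM oT) => //; exact: smooth_on_cst.
Qed.

Let s_chi N : smooth_on K setT (chi N).
Proof. exact: (smooth_on_flatbump hM oT). Qed.

Let S N := [set x | rho x <= expR N.+1%:R].
Let cS N : compact (S N). Proof. exact: hrho.2. Qed.

Let chi_S N x : ~ S N x -> chi N x = 0.
Proof.
move=> /negP; rewrite -ltNge => h; apply: flatbump_eq0; rewrite subr_le0.
have : N.+1%:R < L x by rewrite /L -(expRK N.+1%:R) ltr_ln ?posrE ?expR_gt0.
by move=> /ltW h1; rewrite ler_pdivlMl ?ltr0Sn// mulr1.
Qed.

Let chi_ge0 N x : 0 <= chi N x. Proof. exact: flatbump_ge0. Qed.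
Let chi_le1 N x : chi N x <= 1. Proof. exact: flatbump_le1. Qed.

Let suppS N g : (forall x, ~ S N x -> g x = 0 :> R) -> compact (closure [set x | g x != 0]).
Proof.
move=> g0; have clS : closed (S N) by apply: (@compact_closed_X _ _ _ K); exact: cS.
apply: (subclosed_compact (@closed_closure _ _) (@cS N)).
rewrite (iffLR (closure_id _) clS); apply: closure_subset => x /= gx.
by apply: contrapT => /g0 E; move: gx; rewrite E eqxx.
Qed.

Let intS N g : smooth_on K setT g -> (forall x, ~ S N x -> g x = 0) ->
  mu.-integrable setT (EFin \o g).
Proof.
move=> sg g0; have cg := smooth_on_continuous hM sg; exact: (integrable_compact_support K (@cS N) cg g0).
Qed.

Let wi : mu.-integrable setT (EFin \o w).
Proof.
apply/integrableP; split; first exact/measurable_EFinP.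
rewrite (eq_integral (fun x : borel X => (w x)%:E))// => x _.
by rewrite /= ger0_norm.
Qed.

Let Lg x := gam K L L x.
Let Lg0 x : 0 <= Lg x. Proof. exact: (gam_ge0 oT I sL). Qed.
Let iLg : mu.-integrable setT (EFin \o Lg).
Proof.
apply/integrableP; split.
  apply/measurable_EFinP; apply: measurable_fun_continuous.
  by apply: (smooth_on_continuous hM); exact: gam_smooth.
rewrite (eq_integral (fun x : borel X => (dbar_sqnorm K L x)%:E))// => x _.
by rewrite /= ger0_norm// (dbar_sqnormE oT I sL).
Qed.

(** The chain rule gives the square of the bound on the derivative of [flatbump], divided by the
    square of [N.+1]; one power of [N.+1] is enough in what follows. *)
Let gam_chi : exists2 c : R, 0 <= c & forall N x, gam K (chi N) (chi N) x <= c / N.+1%:R * Lg x.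
Proof.
have [b' [c [db bc]]] := is_derive_flatbump R.
have c0 : 0 <= c by apply: le_trans (bc 0).
exists (c * c); first exact: mulr_ge0.
move=> N x; pose phi (t : R) := flatbump (1 - N.+1%:R^-1 * t).
have dphi (t : R) : is_derive t 1 phi (b' (1 - N.+1%:R^-1 * t) * - N.+1%:R^-1).
  have dt : is_derive t (1 : R) (fun s : R => 1 - N.+1%:R^-1 * s) (- N.+1%:R^-1).
    by apply: is_derive_eq; rewrite /GRing.scale /=; ring.
  exact: (is_derive_comp1 dt (db _)).
rewrite -[chi N]/(phi \o L) (gam_comp1 sL (s_chi N) (s_chi N) (dphi (L x))).
rewrite (gamC K L) (gam_comp1 sL (s_chi N) sL (dphi (L x))) mulrA -/(Lg x).
apply: ler_wpM2r => //.
rewrite mulrACA mulrNN; apply: ler_pM.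
- by rewrite -expr2 sqr_ge0.
- by rewrite mulr_ge0// invr_ge0.
- by apply: (le_trans (ler_norm _)); rewrite normrM; apply: ler_pM.
- by rewrite ler_piMr// ?invr_ge0// invf_le1// ler1n.
Qed.

Let u x := lap K f x.
Let su : smooth_on K setT u. Proof. exact: laplacian_smooth. Qed.
Let chi2 N x := chi N x * chi N x.
Let s_chi2 N : smooth_on K setT (chi2 N). Proof. exact: (smooth_onM hM). Qed.
Let m0 : 0 <= m. Proof. by have /andP[h1 h2] := f0 point; exact: le_trans h1 h2. Qed.

Let I1 N g := (\int[mu]_x (chi2 N x * g x))%R.

Let int_chi2 N g : smooth_on K setT g -> mu.-integrable setT (EFin \o (fun x => chi2 N x * g x)).
Proof.
move=> sg; apply: (intS (N := N)); first exact: (smooth_onM hM).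
by move=> x nS; rewrite /chi2 chi_S// !mul0r.
Qed.

Let int_gam N g h : smooth_on K setT g -> smooth_on K setT h -> (forall x, ~ S N x -> g x = 0) ->
  mu.-integrable setT (EFin \o (gam K g h)).
Proof.
move=> sg sh g0; apply: (intS (N := N)); first exact: gam_smooth.
move=> x nS; apply: (@gam_off_support _ _ _ K (S N) g h x _ g0 nS); apply: (@compact_closed_X _ _ _ K); exact: cS.
Qed.

Let Rgreen N g : smooth_on K setT g -> I1 N (lap K g) = (\int[mu]_x gam K (chi2 N) g x)%R.
Proof.
move=> sg; rewrite /I1 /Rintegral.
have c0 : compact (closure [set x | chi2 N x != 0]).
  by apply: (suppS (N := N)) => x nS; rewrite /chi2 chi_S// mul0r.
by have [-> _] := integral_lap_gam (s_chi2 N) sg c0.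
Qed.

Let iw : R := (\int[mu]_x w x)%R.
Let iL : R := (\int[mu]_x Lg x)%R.

(* Caccioppoli: the weighted energy of [f] stays bounded. *)
Let energy_bound : exists D : R, forall N, I1 N (gam K f f) <= D.
Proof.
have [c c0 gchi] := gam_chi.
(* [m] may be 0, whereas [m1] is divided by below. *)
have [m1 [m1_gt0 mm1]] : exists m1 : R, 0 < m1 /\ m <= m1.
  by exists (m + 1); rewrite ltr_wpDl// lerDl.
exists (2 * m * iw + 4 * m1 * m1 * c * iL) => N.
have sff := smooth_onM hM oT sf sf.
have sgf := gam_smooth sf sf.
pose Z x := chi2 N x * lap K (fun y => f y * f y) x - gam K (chi2 N) (fun y => f y * f y) x.
(* [Z] has integral 0 by Green. Expanding it produces twice the weighted energy; one copy absorbs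
   the cross term [4 f chi gam(chi, f)], and the other is the quantity to bound. *)
have key x : chi2 N x * gam K f f x <= 2 * m * w x + 4 * m1 * m1 * c * Lg x - Z x.
  rewrite /Z lap_sqr (gamC K (chi2 N)) (gam_sqrl _ sf (s_chi2 N)) (gamC K f (chi2 N)).
  rewrite (gam_sqrl _ (s_chi N) sf) -/(u x) /chi2.
  set t := chi N x; set p := gam K (chi N) f x; set g := gam K f f x.
  have hs s : 0 <= s * s * g + 2 * s * p + gam K (chi N) (chi N) x.
    by have := gam_amgm s x sf (s_chi N); rewrite (gamC K f (chi N)).
  have hg : gam K (chi N) (chi N) x <= c * Lg x.
    apply: le_trans (gchi N x) _; apply: ler_wpM2r => //.
    by rewrite ler_pdivrMr ?ltr0Sn// ler_peMr// ler1n.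
  have /andP[fx0 fxm] := f0 x.
  have h1 : t * t * (f x * u x) <= m * w x.
    apply: (@le_trans _ _ (t * t * (f x * w x))).
      apply: ler_wpM2l; first exact: mulr_ge0 (chi_ge0 _ _) (chi_ge0 _ _).
      exact: ler_wpM2l.
    rewrite mulrA; apply: ler_wpM2r => //.
    apply: (@le_trans _ _ (1 * f x)); last by rewrite mul1r.
    apply: ler_wpM2r => //.
    by apply: mulr_ile1; [exact: chi_ge0|exact: chi_ge0|exact: chi_le1|exact: chi_le1].
  have h2 : - (4 * f x * t * p) <= t * t * g + 4 * m1 * m1 * (c * Lg x).
    have h3 : - (4 * f x * t * p) <= 4 * f x * `|t * p|.
      rewrite -mulrN -[X in X <= _]mulrA -[X in X <= _]mulrA -[X in _ <= X]mulrA.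
      apply: ler_wpM2l => //; rewrite mulrA -mulrA; apply: ler_wpM2l => //.
      by rewrite mulrN; apply: (le_trans (ler_norm _)); rewrite normrN.
    apply: le_trans h3 _.
    have h4 : 4 * m1 * `|t * p| <= t * t * g + 4 * m1 * m1 * (c * Lg x).
      (* [hs] at plus and minus [t / (2 m1)], multiplied by [4 m1^2], bounds the cross term for both
         of its signs. *)
      have k0 : 0 < (2 * m1)^-1 by rewrite invr_gt0 mulr_gt0.
      have e1 : 4 * m1 * m1 * ((2 * m1)^-1 * t * ((2 * m1)^-1 * t) * g) = t * t * g.
        by field; rewrite gt_eqF.
      have e2 : 4 * m1 * m1 * (2 * ((2 * m1)^-1 * t) * p) = 4 * m1 * (t * p).
        by field; rewrite gt_eqF.
      have m2 : 0 <= 4 * m1 * m1 by rewrite !mulr_ge0// ltW.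
      have hA := ler_wpM2l m2 (hs ((2 * m1)^-1 * t)).
      have hB := ler_wpM2l m2 (hs (- ((2 * m1)^-1 * t))).
      have hC := ler_wpM2l m2 hg.
      rewrite mulr0 !mulrDr in hA; rewrite mulr0 !mulrDr mulrNN in hB.
      rewrite e1 e2 in hA; rewrite e1 mulrN mulNr mulrN e2 in hB.
      case: (ger0P (t * p)) => _; lra.
    apply: le_trans h4; apply: ler_wpM2r => //.
    by rewrite ler_pM2l//; exact: (le_trans fxm).
  by lra.
have iZ1 : mu.-integrable setT (EFin \o (fun x => chi2 N x * lap K (fun y => f y * f y) x)).
  by apply: int_chi2; exact: laplacian_smooth.
have iZ2 : mu.-integrable setT (EFin \o gam K (chi2 N) (fun y => f y * f y)).
  by apply: (int_gam (N := N)) => // x nS; rewrite /chi2 chi_S// mul0r.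
have iZ : mu.-integrable setT (EFin \o Z) by exact: (integrableB measurableT iZ1 iZ2).
have Z0 : (\int[mu]_x Z x)%R = 0.
  by rewrite /Z RintegralB// -(Rgreen N sff) subrr.
have i1 : mu.-integrable setT (EFin \o (fun x => 2 * m * w x)).
  exact: (integrableZl measurableT (2 * m) wi).
have i2 : mu.-integrable setT (EFin \o (fun x => 4 * m1 * m1 * c * Lg x)).
  exact: (integrableZl measurableT (4 * m1 * m1 * c) iLg).
have i12 : mu.-integrable setT (EFin \o (fun x => 2 * m * w x + 4 * m1 * m1 * c * Lg x)).
  exact: (integrableD measurableT i1 i2).
apply: (@le_trans _ _ (\int[mu]_x (2 * m * w x + 4 * m1 * m1 * c * Lg x - Z x))%R).
  apply: le_Rintegral => //; first exact: int_chi2.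
  exact: (integrableB measurableT i12 iZ).
by rewrite RintegralB// Z0 subr0 RintegralD// !RintegralZl.
Qed.

(** By Green the tested integral is that of [2 chi gam(chi, f)]. Weighting the two factors by [e]
    and its inverse bounds it by [e] times the energy plus a term of order [1 / N]; the choice
    [e = d / (|D| + 1)] makes the first part at most [d]. *)
Let chi2u_bound (d : R) : 0 < d -> exists D, forall N, `|I1 N u| <= d + D / N.+1%:R.
Proof.
move=> d0; have [c c0 gchi] := gam_chi; have [D HD] := energy_bound.
pose e := d / (`|D| + 1); have D1 : 0 < `|D| + 1 by rewrite ltr_wpDl.
have e0 : 0 < e by exact: divr_gt0.
exists (e^-1 * (c * iL)) => N.
rewrite /u Rgreen//.
have ig : mu.-integrable setT (EFin \o gam K (chi2 N) f).
  by apply: (int_gam (N := N)) => // x nS; rewrite /chi2 chi_S// mul0r.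
have sgf := gam_smooth sf sf.
have iE : mu.-integrable setT (EFin \o (fun x => e * (chi2 N x * gam K f f x))).
  exact: (integrableZl measurableT e (int_chi2 N sgf)).
have iG : mu.-integrable setT (EFin \o (fun x => e^-1 * (c / N.+1%:R) * Lg x)).
  exact: (integrableZl measurableT (e^-1 * (c / N.+1%:R)) iLg).
apply: (le_trans (le_normr_Rintegral measurableT ig)).
apply: (@le_trans _ _ (\int[mu]_x (e * (chi2 N x * gam K f f x) + e^-1 * (c / N.+1%:R) * Lg x))%R).
  apply: le_Rintegral => //; first exact: (integrable_norm ig).
    exact: (integrableD measurableT iE iG).
  move=> x _; rewrite (gam_sqrl _ (s_chi N) sf) /chi2 -mulrA.
  set t := chi N x; set p := gam K (chi N) f x; set g := gam K f f x.
  have hs s : 0 <= s * s * g + 2 * s * p + gam K (chi N) (chi N) x.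
    by have := gam_amgm s x sf (s_chi N); rewrite (gamC K f (chi N)).
  have e1 : 0 <= e^-1 by rewrite invr_ge0 ltW.
  have hA := ler_wpM2l e1 (hs (e * t)); have hB := ler_wpM2l e1 (hs (- (e * t))).
  have hC : e^-1 * gam K (chi N) (chi N) x <= e^-1 * (c / N.+1%:R) * Lg x.
    by rewrite -[X in _ <= X]mulrA; exact: ler_wpM2l.
  have E1 : e^-1 * (e * t * (e * t) * g) = e * (t * t * g) by field; rewrite gt_eqF.
  have E2 : e^-1 * (2 * (e * t) * p) = 2 * (t * p) by field; rewrite gt_eqF.
  rewrite mulr0 !mulrDr E1 E2 in hA; rewrite mulr0 !mulrDr mulrNN E1 mulrN mulNr mulrN E2 in hB.
  move: hA hB hC; move: (e * (t * t * g)) (2 * (t * p)) (e^-1 * gam K (chi N) (chi N) x) => a b a'.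
  by move: (e^-1 * (c / N.+1%:R) * Lg x) => b''; case: (ger0P b) => _; lra.
rewrite RintegralD// !RintegralZl//; last exact: int_chi2.
apply: lerD.
  apply: (@le_trans _ _ (e * D)); first by apply: ler_wpM2l; [exact: ltW|exact: HD].
  rewrite /e -mulrA [_^-1 * _]mulrC mulrA ler_pdivrMr// ler_pM2l//.
  by apply: (le_trans (ler_norm _)); rewrite lerDl.
by rewrite -/iL -!mulrA [_^-1 * iL]mulrC.
Qed.

Let I1_cvg : (fun N => I1 N u) @ \oo --> (0 : R).
Proof.
apply/cvgrPdist_le => e e0.
have [D HD] := chi2u_bound (divr_gt0 e0 (ltr0Sn R 1)).
have FF : Filter \oo by exact: eventually_filter.
have hD : \forall N \near \oo, D / N.+1%:R <= e / 2.
  exists (Num.truncn (`|D| * 2 / e)) => // N /= hN.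
  rewrite ler_pdivrMr ?ltr0Sn//; apply: (le_trans (ler_norm D)).
  rewrite -ler_pdivrMl ?divr_gt0//.
  have h := truncnS_gt (`|D| * 2 / e).
  rewrite (_ : (e / 2)^-1 * `|D| = `|D| * 2 / e); last by field; rewrite gt_eqF.
  by apply: (le_trans (ltW h)); rewrite ler_nat ltnS.
apply: (@filterS _ _ FF _ _ _ hD) => N hN.
rewrite sub0r normrN; apply: (le_trans (HD N)).
by apply: (le_trans (lerD (lexx _) hN)); rewrite -splitr.
Qed.

Let v x := w x - u x.
Let v0 x : 0 <= v x. Proof. by rewrite subr_ge0. Qed.
Let mu_ : measurable_fun setT (u : borel X -> R).
Proof. apply: measurable_fun_continuous; exact: (smooth_on_continuous hM su). Qed.
Let mv : measurable_fun setT (v : borel X -> R).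
Proof. exact: measurable_funB. Qed.

(** [v] is nonnegative, so it is enough to bound its integrals over the sublevel sets [B k]
    uniformly. On [B k] the squared cut-off is at least [b] for a suitable [N], which reduces the
    bound to the tested integrals of [w] and [u]. *)
Let iv : mu.-integrable setT (EFin \o v).
Proof.
have [D HD] := chi2u_bound (@ltr01 R).
pose B k := [set x : X | L x <= k%:R].
have cL := smooth_on_continuous hM sL.
have mB k : measurable (B k : set (borel X)).
  apply: closed_measurable_borel; rewrite /B.
  have -> : [set x | L x <= k%:R] = L @^-1` [set t | t <= k%:R] by [].
  by apply: closed_comp; [move=> x _; exact: cL|exact: closed_le].
pose g k x := (\1_(B k) x * v x)%:E.
have mg k : measurable_fun setT (g k : borel X -> \bar R).
  by apply/measurable_EFinP; apply: measurable_funM => //; exact: measurable_indic.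
have g0 k x : (0 <= g k x)%E by rewrite lee_fin mulr_ge0.
have ndg x : {homo (fun k => g k x) : k l / (k <= l)%N >-> (k <= l)%E}.
  move=> k l kl; rewrite lee_fin; apply: ler_wpM2r => //; rewrite !indicE ler_nat.
  case: (boolP (x \in B k)) => // /set_mem Bx; rewrite mem_set//.
  by apply: (le_trans Bx); rewrite ler_nat.
have lg x : limn (fun k => g k x) = (v x)%:E.
  apply/cvg_lim => //; apply: cvg_near_cst.
  exists (Num.truncn `|L x|).+1 => // k /= hk; rewrite /g indicE mem_set ?mul1r//.
  apply: (le_trans (ler_norm _)); apply: ltW; apply: (lt_le_trans (truncnS_gt _)).
  by rewrite ler_nat.
have b0 : 0 < flatbump 2^-1 :> R by apply: flatbump_gt0; rewrite invr_gt0.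
pose b : R := flatbump 2^-1 * flatbump 2^-1.
have b2 : 0 < b by exact: mulr_gt0.
have key k : (\int[mu]_x g k x <= (b^-1 * (iw + (1 + `|D|)))%:E)%E.
  (* Then [ln rho <= k] gives [ln rho / N.+1 <= 1/2], hence [chi N >= flatbump 2^-1] on [B k]. *)
  pose N := k.*2.
  have iu := int_chi2 N su.
  have iw' : mu.-integrable setT (EFin \o (fun x => chi2 N x * w x)).
    apply: (le_integrable measurableT _ _ wi).
      apply/measurable_EFinP; apply: measurable_funM => //.
      apply: measurable_fun_continuous; exact: (smooth_on_continuous hM (s_chi2 N)).
    move=> x _; rewrite lee_fin /= normrM ler_piMl// ger0_norm ?mulr_ge0//.
    by apply: mulr_ile1; [exact: chi_ge0|exact: chi_ge0|exact: chi_le1|exact: chi_le1].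
  have ivN : mu.-integrable setT (EFin \o (fun x => b^-1 * (chi2 N x * w x - chi2 N x * u x))).
    have ii := integrableB measurableT iw' iu.
    exact: (integrableZl measurableT b^-1 ii).
  apply: (@le_trans _ _ (\int[mu]_x (b^-1 * (chi2 N x * w x - chi2 N x * u x))%:E)%E).
    apply: ge0_le_integral => //.
      by apply/measurable_EFinP; move: (measurable_int mu ivN) => /measurable_EFinP.
    move=> x _; rewrite /g lee_fin -mulrBr -/(v x) mulrA; apply: ler_wpM2r => //.
    rewrite indicE; case: (boolP (x \in B k)) => [/set_mem Bx|_]; last first.
      by rewrite mulr_ge0// ?invr_ge0 ?(ltW b2)// /chi2 mulr_ge0.
    rewrite -ler_pdivrMl ?invr_gt0// invrK mulr1 /b /chi2.
    suff h : flatbump 2^-1 <= chi N x by apply: ler_pM => //; exact: ltW.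
    apply: flatbump_le.
    suff : N.+1%:R^-1 * L x <= 2^-1 by move: (_ * L x) => z; lra.
    rewrite ler_pdivrMl ?ltr0Sn//; apply: (le_trans Bx).
    by rewrite /N -[k.*2.+1]addn1 natrD -muln2 natrM mulrDl mulfK// lerDl mul1r.
  have -> : (\int[mu]_x (b^-1 * (chi2 N x * w x - chi2 N x * u x))%:E)%E =
    (\int[mu]_x (b^-1 * (chi2 N x * w x - chi2 N x * u x)))%R%:E.
    by rewrite /Rintegral fineK//; exact: integrable_fin_num ivN.
  rewrite lee_fin RintegralZl//; last exact: (integrableB measurableT iw' iu).
  apply: ler_wpM2l; first by rewrite invr_ge0 ltW.
  rewrite (RintegralB measurableT iw' iu); apply: lerD.
    apply: le_Rintegral => // x _; rewrite ler_piMl//.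
    by apply: mulr_ile1; [exact: chi_ge0|exact: chi_ge0|exact: chi_le1|exact: chi_le1].
  apply: (le_trans (ler_norm _)); rewrite normrN.
  apply: (le_trans (HD N)); rewrite lerD2l ler_pdivrMr ?ltr0Sn//.
  by apply: (le_trans (ler_norm D)); rewrite ler_peMr// ler1n.
apply/integrableP; split; first exact/measurable_EFinP.
have H := cvg_monotone_convergence measurableT mg (fun k x _ => g0 k x) (fun x _ => ndg x).
rewrite (eq_integral (fun x : borel X => limn (fun k => g k x))); last first.
  by move=> x _; rewrite lg /= ger0_norm.
rewrite -(cvg_lim _ (H mu))//; apply: (@le_lt_trans _ _ (b^-1 * (iw + (1 + `|D|)))%:E); last exact: ltry.
apply: lime_le; first by apply/cvg_ex; eexists; exact: (H mu).
by apply: nearW => k; exact: key.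
Qed.

(* Tested against [chi N ^ 2] with [chi N = flatbump (1 - ln rho / N)], whose
   differential tends to 0 in L^2. *)
Lemma integral_laplacian_eq0 : mu.-integrable setT (fun x => (lap K f x)%:E) /\
  (\int[mu]_x (lap K f x)%:E = 0)%E.
Proof.
have iu : mu.-integrable setT (EFin \o u).
  have -> : EFin \o u = EFin \o (fun x => w x - v x).
    by apply/funext => x; rewrite /= /v opprB addrCA subrr addr0.
  exact: (integrableB measurableT wi iv).
split; first exact: iu.
(* The squared cut-offs tend to [b], not to 1, so dominated convergence only shows that [b] times
   the integral is 0; positivity of [b] finishes. *)
pose b : R := flatbump 1 * flatbump 1.
have b0 : 0 < b by apply: mulr_gt0; exact: flatbump_gt0.
have H : (\int[mu]_x (chi2 N x * u x)%:E)%E @[N --> \oo] --> (\int[mu]_x (b * u x)%:E)%E.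
  apply: (@dominated_cvg _ _ _ mu setT measurableT _ _ (fun x => `|(u x)%:E|)%E).
  - by move=> N; apply: (measurable_int mu); exact: (int_chi2 N su).
  - move=> x _; apply: cvg_EFin; first exact: nearW.
    rewrite (_ : fine \o _ = fun N => chi2 N x * u x)//.
    apply: cvgM; last exact: cvg_cst.
    have cx : (fun N => chi N x) @ \oo --> (flatbump 1 : R).
      have cb : {for (1 : R), continuous (@flatbump R)} by exact: continuous_flatbump.
      have ca : (fun N => 1 - N.+1%:R^-1 * L x) @ \oo --> (1 : R).
        rewrite -[X in _ --> X]subr0; apply: cvgB; first exact: cvg_cst.
        rewrite -[X in _ --> X](mul0r (L x)); apply: cvgM; last exact: cvg_cst.
        exact: cvg_harmonic.
      exact: (cvg_comp _ _ ca cb).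
    exact: cvgM.
  - by [].
  - exact: (integrable_abse iu).
  - move=> N x _; rewrite lee_fin normrM ler_piMl// ger0_norm ?mulr_ge0//.
    by apply: mulr_ile1; [exact: chi_ge0|exact: chi_ge0|exact: chi_le1|exact: chi_le1].
have H0 : (\int[mu]_x (chi2 N x * u x)%:E)%E @[N --> \oo] --> (0 : \bar R).
  have -> : (fun N => \int[mu]_x (chi2 N x * u x)%:E)%E = (fun N => (I1 N u)%:E).
    apply/funext => N; rewrite /I1 /Rintegral fineK//; exact: integrable_fin_num (int_chi2 N su).
  by apply: cvg_EFin; [exact: nearW|exact: I1_cvg].
have E := cvg_unique _ H H0.
have : (b%:E * \int[mu]_x (u x)%:E = 0)%E.
  by rewrite -(integralZl measurableT iu) -[RHS]E.
move=> /eqP; rewrite mule_eq0 eqe (gt_eqF b0) /= => /eqP; exact.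
Qed.

End LaplacianIntegral.

(** * Holomorphic functions and the identity theorem *)

(** If [c] were positive, [g1] would increase through 0. When [g1 0 >= 0] it is positive just to the
    right, otherwise negative just to the left; either way [g] exceeds [g 0] nearby. *)
Lemma second_derive_max_le0 (R : realType) (g g1 : R -> R) (c r : R) : 0 < r ->
  (forall t : R, `|t| < r -> is_derive t 1 g (g1 t)) -> is_derive (0 : R) 1 g1 c ->
  (forall t, `|t| < r -> g t <= g 0) -> c <= 0.
Proof.
move=> r0 dg [dg1 dg1E] gmax; rewrite leNgt; apply/negP => c0.
have cg t : `|t| < r -> {for t, continuous g}.
  by move=> /dg[+ _] => /derivable1_diffP/differentiable_continuous.
have c20 : 0 < c / 2 by exact: divr_gt0.
have : (fun h : R => h^-1 *: (g1 (h *: 1 + 0) - g1 0)) @ 0^' --> c.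
  by rewrite -dg1E; exact: dg1.
move=> /cvgrPdist_lt /(_ _ c20).
rewrite /nbhs /= /dnbhs /within /= => /nbhs_ballP[d /= d0 H].
have {}H h : h != 0 -> `|h| < d -> `|c - h^-1 * (g1 h - g1 0)| < c / 2.
  move=> h0 hd; have := H h; rewrite /ball /= sub0r normrN => /(_ hd h0).
  by rewrite addr0 [h *: 1]mulr1.
pose b := Num.min d r / 2; have b0 : 0 < b by rewrite divr_gt0// lt_min d0.
have bd : b < d by rewrite /b ltr_pdivrMr// mulr_natr mulr2n; apply: (@le_lt_trans _ _ d); rewrite ?ge_min ?lexx// ltrDl.
have br : b < r by rewrite /b ltr_pdivrMr// mulr_natr mulr2n; apply: (@le_lt_trans _ _ r); rewrite ?ge_min ?lexx ?orbT// ltrDl.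
have key h : h != 0 -> `|h| < d -> c / 2 < h^-1 * (g1 h - g1 0).
  by move=> h0 hd; have := H h h0 hd; rewrite ltr_norml => /andP[_]; lra.
have [g10|g10] := leP 0 (g1 0).
- have [||t] := @MVT _ g g1 0 b b0.
  + by move=> t; rewrite in_itv/= => /andP[t0 tb]; apply: dg; rewrite ger0_norm ?(ltW t0)//; exact: lt_trans br.
  + apply: continuous_in_subspaceT => t; rewrite inE /= in_itv/= => /andP[t0 tb]; apply: cg.
    by rewrite ger0_norm//; exact: le_lt_trans br.
  rewrite in_itv/= => /andP[t0 tb] E.
  have nt : `|t| < d by rewrite ger0_norm ?(ltW t0)//; exact: lt_trans bd.
  have := key t (lt0r_neq0 t0) nt; rewrite ltr_pdivlMl// => k1.
  have h1 : 0 < g1 t.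
    have : 0 < t * (c / 2) by exact: mulr_gt0.
    by move: k1; move: (t * _) => z; lra.
  have : 0 < g1 t * (b - 0) by rewrite subr0 mulr_gt0.
  rewrite -E subr_gt0 ltNge gmax// ger0_norm ?(ltW b0)//.
- have nb0 : - b < 0 by rewrite oppr_lt0.
  have [||t] := @MVT _ g g1 (- b) 0 nb0.
  + move=> t; rewrite in_itv/= => /andP[t0 tb]; apply: dg; rewrite ltr0_norm//.
    by rewrite ltrNl; apply: lt_trans t0; rewrite ltrN2.
  + apply: continuous_in_subspaceT => t; rewrite inE /= in_itv/= => /andP[t0 tb]; apply: cg.
    by rewrite ler0_norm// ltrNl; apply: lt_le_trans t0; rewrite ltrN2.
  rewrite in_itv/= => /andP[t0 tb] E.
  have nt : `|t| < d by rewrite ltr0_norm// ltrNl; apply: lt_trans t0; rewrite ltrN2.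
  have := key t (ltr0_neq0 tb) nt; rewrite ltr_ndivlMl// => k1.
  have h1 : g1 t < 0.
    have : t * (c / 2) < 0 by rewrite nmulr_rlt0.
    by move: k1; move: (t * _) => z; lra.
  have : g1 t * (0 - - b) < 0 by rewrite sub0r opprK nmulr_rlt0.
  rewrite -E subr_lt0 ltNge gmax// normrN ger0_norm ?(ltW b0)//.
Qed.

Section FlatAtlas.
Variables (R : realType) (d : nat).

(** [R^d] with one global chart, so that the calculus of charts applies to functions on a disc of
    the complex line. *)
Definition flat_atlas : atlas R d 'rV[R]_d :=
  @Atlas R d _ unit (fun=> setT) (fun=> id) (fun=> id) (fun=> tt).

Lemma is_derive_coord (a : idx flat_atlas) i l x :
  is_derive (chart a x) (delta_mx 0 i : 'rV[R]_d)
    ((fun v : 'rV[R]_d => v 0 l) \o charti a) ((i == l)%:R : R).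
Proof.
have lin : is_derive (0 : R) 1 (fun t : R => t * (i == l)%:R + x 0 l) ((i == l)%:R : R).
  by apply: is_derive_eq; rewrite /GRing.scale /=; ring.
apply: is_derive_line lin => h.
by rewrite /= !mxE eqxx /= addr0 [h *: 1]mulr1 [l == i]eq_sym.
Qed.

Lemma pderive_coord (a : idx flat_atlas) i l x :
  pderive a i (fun v : 'rV[R]_d => v 0 l) x = (i == l)%:R.
Proof. by have [_ <-] := is_derive_coord a i l x. Qed.

Lemma Ck_flat_coord k (a : idx flat_atlas) l : Ck k a setT (fun v : 'rV[R]_d => v 0 l).
Proof.
have cc : continuous (fun v : 'rV[R]_d => v 0 l) by exact: coord_continuous.
case: k => [|k]; first by split=> // x _; exact: cc.
split=> [x _|i]; first exact: cc.
split=> [x _|]; first by have [] := is_derive_coord a i l x.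
rewrite (_ : pderive a i _ = fun=> (i == l)%:R); first exact: Ck_cst.
by apply/funext => x; exact: pderive_coord.
Qed.

Lemma rV_second_countable : @second_countable 'rV[R]_d.
Proof.
pose b (q : 'rV[rat]_d * nat) := ball (map_mx ratr q.1 : 'rV[R]_d) (q.2.+1%:R^-1).
exists (range b); first exact: sub_countable (card_image_le _ _) (countableP _).
split; first by move=> _ [q _ <-]; exact: ball_open.
move=> x A; rewrite nbhsE => -[U [oU Ux] UA].
have := rV_open_bigcup oU; move: Ux => /[swap] {1}-> [q qU qx].
exists (b q); first by split => //; exists q.
by move=> y /qU; exact: UA.
Qed.

Lemma flat_manifold : is_manifold flat_atlas.
Proof.
split => //=.
- exact: rV_second_countable.
- by move=> _; exact: openT.
- by move=> _; rewrite image_id; exact: openT.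
- by move=> _ x _; exact: cvg_id.
- by move=> _ x _; exact: cvg_id.
- by move=> a i b k; rewrite setIT; exact: Ck_flat_coord.
Qed.

End FlatAtlas.

Section HolomorphicFunctions.
Variables (R : realType) (n : nat) (X : ptopologicalType) (M : atlas R (n + n) X).
Hypothesis hM : is_manifold M.
Local Notation C := (R[i]).
Implicit Types (U V : set X) (f g : X -> C).

Lemma holoP U f : holo_on M U f <->
  forall a : idx M, csm a (U `&` dom a) f /\ forall j x, U x -> dom a x -> dd a false j f x = 0.
Proof.
split=> [[[s1 s2] h] a|H].
  split=> [k|j x Ux ax]; first by split; [exact: s1|exact: s2].
  by rewrite ddTF; exact: h.
split; first by split=> a k; [exact: ((H a).1 k).1|exact: ((H a).1 k).2].
by move=> a j x Ux ax; have := (H a).2 j x Ux ax; rewrite ddTF.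
Qed.

Let oUa U (a : idx M) : open U -> open (U `&` dom a).
Proof. by move=> oU; apply: openI => //; exact: (dom_open hM). Qed.
Let sUa U (a : idx M) : U `&` dom a `<=` dom a. Proof. by move=> x []. Qed.

Lemma holo_sub U V f : V `<=` U -> holo_on M U f -> holo_on M V f.
Proof.
move=> VU [[s1 s2] h]; split; last by move=> a j x /VU; exact: h.
by split; [exact: smooth_on_sub VU s1|exact: smooth_on_sub VU s2].
Qed.

Lemma holo_ext U f g : open U -> (forall x, U x -> f x = g x) -> holo_on M U f -> holo_on M U g.
Proof.
move=> oU fg /holoP H; apply/holoP => a; have [Cf hf] := H a; split.
  by apply: (csm_ext hM (oUa a oU) (@sUa U a) _ Cf) => y [/fg].
move=> j x Ux ax; rewrite -(hf j x Ux ax); apply: (dd_ext hM (oUa a oU) (@sUa U a)) => //.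
by move=> y [/fg ->].
Qed.

Lemma holo_cst U (c : C) : holo_on M U (fun=> c).
Proof.
by apply/holoP => a; split; [exact: csm_cst|move=> *; exact: dd_cst].
Qed.

Lemma holoD U f g : open U -> holo_on M U f -> holo_on M U g -> holo_on M U (fun x => f x + g x).
Proof.
move=> oU /holoP Hf /holoP Hg; apply/holoP => a; have [Cf hf] := Hf a; have [Cg hg] := Hg a.
split; first exact: (csmD hM (oUa a oU) (@sUa U a)).
by move=> j x Ux ax; rewrite (ddD hM (oUa a oU) (@sUa U a))// hf// hg// addr0.
Qed.

Lemma holoN U f : open U -> holo_on M U f -> holo_on M U (fun x => - f x).
Proof.
move=> oU /holoP Hf; apply/holoP => a; have [Cf hf] := Hf a.
split; first exact: (csmN hM (oUa a oU) (@sUa U a)).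
by move=> j x Ux ax; rewrite (ddN hM (oUa a oU) (@sUa U a))// hf// oppr0.
Qed.

Lemma holoM U f g : open U -> holo_on M U f -> holo_on M U g -> holo_on M U (fun x => f x * g x).
Proof.
move=> oU /holoP Hf /holoP Hg; apply/holoP => a; have [Cf hf] := Hf a; have [Cg hg] := Hg a.
split; first exact: (csmM hM (oUa a oU) (@sUa U a)).
by move=> j x Ux ax; rewrite (ddM hM (oUa a oU) (@sUa U a))// hf// hg// mulr0 mul0r addr0.
Qed.

Lemma holo_inv U f : open U -> (forall x, U x -> f x != 0) -> holo_on M U f ->
  holo_on M U (fun x => (f x)^-1).
Proof.
move=> oU f0 /holoP Hf; apply/holoP => a; have [Cf hf] := Hf a.
have Ci : csm a (U `&` dom a) (fun x => (f x)^-1).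
  by apply: (csm_inv hM (oUa a oU) (@sUa U a)) => // y [/f0].
split=> // j x Ux ax; have Wx : (U `&` dom a) x by [].
have : dd a false j (fun y => f y * (f y)^-1) x = 0.
  rewrite -(dd_cst a false j 1 x); apply: (dd_ext hM (oUa a oU) (@sUa U a) _ _ Wx).
  by move=> y [/f0 fy _]; rewrite mulfV.
rewrite (ddM hM (oUa a oU) (@sUa U a) _ _ Cf Ci Wx) hf// mul0r add0r => /eqP.
by rewrite mulf_eq0 (negbTE (f0 x Ux)) => /eqP.
Qed.

Lemma holo_sum U (I : Type) (r : seq I) (P : pred I) (F : I -> X -> C) : open U ->
  (forall i, P i -> holo_on M U (F i)) -> holo_on M U (fun x => \sum_(i <- r | P i) F i x).
Proof.
move=> oU HF; elim: r => [|i r IH].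
  by apply: holo_ext (holo_cst U 0) => // y _; rewrite big_nil.
case Pi: (P i); last by apply: holo_ext IH => // y _; rewrite big_cons Pi.
by apply: holo_ext (holoD oU (HF i Pi) IH) => // y _; rewrite big_cons Pi.
Qed.

Lemma holo_prod U (I : Type) (r : seq I) (P : pred I) (F : I -> X -> C) : open U ->
  (forall i, P i -> holo_on M U (F i)) -> holo_on M U (fun x => \prod_(i <- r | P i) F i x).
Proof.
move=> oU HF; elim: r => [|i r IH].
  by apply: holo_ext (holo_cst U 1) => // y _; rewrite big_nil.
case Pi: (P i); last by apply: holo_ext IH => // y _; rewrite big_cons Pi.
by apply: holo_ext (holoM oU (HF i Pi) IH) => // y _; rewrite big_cons Pi.
Qed.

Definition holo_mx U p q (Y : X -> 'M[C]_(p, q)) := forall u v, holo_on M U (fun x => Y x u v).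

Lemma holo_mx_sub U V p q (Y : X -> 'M[C]_(p, q)) : V `<=` U -> holo_mx U Y -> holo_mx V Y.
Proof. by move=> VU HY u v; exact: holo_sub VU (HY u v). Qed.

Lemma holo_mx_ext U p q (Y Z : X -> 'M[C]_(p, q)) : open U ->
  (forall x, U x -> Y x = Z x) -> holo_mx U Y -> holo_mx U Z.
Proof. by move=> oU YZ HY u v; apply: holo_ext (HY u v) => // x /YZ ->. Qed.

Lemma holo_mx_cst U p q (A : 'M[C]_(p, q)) : holo_mx U (fun=> A).
Proof. by move=> u v; exact: holo_cst. Qed.

Lemma holo_mxM U p q r (Y : X -> 'M[C]_(p, q)) (Z : X -> 'M[C]_(q, r)) : open U ->
  holo_mx U Y -> holo_mx U Z -> holo_mx U (fun x => Y x *m Z x).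
Proof.
move=> oU HY HZ u v; apply: (holo_ext oU (f := fun x => \sum_k Y x u k * Z x k v)).
  by move=> x _; rewrite mxE.
by apply: holo_sum => // k _; exact: holoM.
Qed.

Lemma holo_mxD U p q (Y Z : X -> 'M[C]_(p, q)) : open U ->
  holo_mx U Y -> holo_mx U Z -> holo_mx U (fun x => Y x + Z x).
Proof.
move=> oU HY HZ u v; apply: (holo_ext oU (f := fun x => Y x u v + Z x u v)).
  by move=> x _; rewrite mxE.
exact: holoD.
Qed.

Lemma holo_mxN U p q (Y : X -> 'M[C]_(p, q)) : open U -> holo_mx U Y -> holo_mx U (fun x => - Y x).
Proof.
move=> oU HY u v; apply: (holo_ext oU (f := fun x => - Y x u v)).
  by move=> x _; rewrite mxE.
exact: holoN.
Qed.

Lemma holo_det U p (Y : X -> 'M[C]_p) : open U -> holo_mx U Y -> holo_on M U (fun x => \det (Y x)).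
Proof.
move=> oU HY; rewrite /determinant; apply: holo_sum => // s _.
by apply: holoM => //; [exact: holo_cst|apply: holo_prod => // i _; exact: HY].
Qed.

Lemma holo_mx_inv U p (Y : X -> 'M[C]_p) : open U -> (forall x, U x -> Y x \in unitmx) ->
  holo_mx U Y -> holo_mx U (fun x => invmx (Y x)).
Proof.
move=> oU uY HY u v.
apply: (holo_ext oU (f := fun y => (\det (Y y))^-1 * ((-1) ^+ (v + u) *
  \det (row' v (col' u (Y y)))))).
  by move=> y Uy; rewrite /invmx uY// !mxE.
apply: holoM => //.
  by apply: (holo_inv oU _ (holo_det oU HY)) => y /uY; rewrite unitmxE unitfE.
apply: holoM => //; first exact: holo_cst.
apply: holo_det => // i j; apply: holo_ext (HY (lift v i) (lift u j)) => //.
by move=> y _; rewrite !mxE.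
Qed.

End HolomorphicFunctions.

Section HolomorphicMaps.
Variables (R : realType) (n : nat) (X : ptopologicalType) (M : atlas R (n + n) X).
Hypothesis hC : is_complex_manifold M.
Local Notation C := (R[i]).
Local Notation hM := hC.1.
Implicit Types (U V : set X) (f g : X -> C).

Lemma csm_local (a : idx M) U f :
  (forall x, U x -> exists V, [/\ open V, V x & csm a V f]) -> csm a U f.
Proof.
move=> H k; split; apply: Ck_local => x /H[V [oV Vx CV]]; exists V => //.
  exact: (CV k).1.
exact: (CV k).2.
Qed.

Lemma holo_comp U f (F : X -> X) : holo_map M F -> open U -> holo_on M U f ->
  holo_on M (F @^-1` U) (f \o F).
Proof.
move=> [cF hF] oU /holoP Hf.
have key (a : idx M) x : U (F x) -> dom a x -> exists W, [/\ open W, W x, W `<=` dom a,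
    csm a W (f \o F) & forall j, dd a false j (f \o F) x = 0].
  move=> Ux ax; pose b := chart_at M (F x); have bFx : dom b (F x) by exact: (dom_chart_at hM).
  have oV : open (U `&` dom b) by apply: openI => //; exact: (dom_open hM).
  have Vb : U `&` dom b `<=` dom b by move=> y [].
  pose W := F @^-1` (U `&` dom b) `&` dom a.
  have oW : open W by apply: openI; [exact: open_comp|exact: (dom_open hM)].
  have Wa : W `<=` dom a by move=> y [].
  have Cz l : csm a W (fun y => zcoord b l (F y)).
    have [Cz _] := (holoP _ _ _).1 (hF b l) a.
    by move=> k; have [h1 h2] := Cz k; split; [apply: Ck_sub h1|apply: Ck_sub h2] => y [[_ ?] ?].
  have hz l j y : W y -> dd a false j (fun y => zcoord b l (F y)) y = 0.
    by move=> [[_ by_] ay]; exact: ((holoP _ _ _).1 (hF b l) a).2.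
  have WV y : W y -> (U `&` dom b) (F y) by move=> [].
  have cW y : W y -> {for y, continuous F} by move=> _; exact: cF.
  exists W; split => //; first exact: (csm_comp hM hM oW Wa oV Vb WV cW Cz (Hf b).1).
  move=> j; have Wx : W x by [].
  rewrite (dd_chain_holo hM hM oW Wa oV Vb WV cW Cz hz false j (Hf b).1 Wx) big1// => l _.
  by rewrite ((Hf b).2 l (F x) Ux bFx) mul0r.
apply/holoP => a; split; last by move=> j x Ux ax; have [W []] := key a x Ux ax.
by apply: csm_local => x [Ux ax]; have [W [oW Wx _ CW _]] := key a x Ux ax; exists W.
Qed.

(** Under a holomorphic change of coordinates the derivatives of type [s] are combinations of
    derivatives of the same type [s] only. *)
Lemma dd_chart_eq0 (a b : idx M) s U f x j : open U -> U x -> U `<=` dom a -> U `<=` dom b ->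
  csm b U f -> (forall l, dd b s l f x = 0) -> dd a s j f x = 0.
Proof.
move=> oU Ux Ua Ub Cf f0.
have Cz l : csm a U (zcoord b l).
  have [Cz _] := (holoP _ _ _).1 (hC.2 b l) a.
  move=> k; have [h1 h2] := Cz k.
  by split; [apply: Ck_sub h1|apply: Ck_sub h2] => y Uy; (split; [exact: Ub|exact: Ua]).
have hz l i y : U y -> dd a false i (fun y => zcoord b l (id y)) y = 0.
  by move=> Uy; apply: ((holoP _ _ _).1 (hC.2 b l) a).2; [exact: Ub|exact: Ua].
have := @dd_chain_holo R n n X X M M hM hM a b U U id oU Ua oU Ub (fun _ => id)
  (fun x _ => @cvg_id _ _) Cz hz s j f x Cf Ux.
by move=> ->; rewrite big1// => l _; rewrite f0 mul0r.
Qed.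

Lemma holo_on_chart_at U f : open U -> csmooth_on M U f ->
  (forall x l, U x -> dd (chart_at M x) false l f x = 0) -> holo_on M U f.
Proof.
move=> oU sf f0; split => // a j x Ux ax; have bx := dom_chart_at hM x.
set b := chart_at M x in bx; pose W := U `&` dom a `&` dom b.
have oW : open W by apply: openI; [apply: openI => //|]; exact: (dom_open hM).
have Wa : W `<=` dom a by move=> y [[]].
have Wb : W `<=` dom b by move=> y [].
suff : dd a false j f x = 0 by rewrite ddTF.
apply: (@dd_chart_eq0 a b false W) => //; last by move=> l; exact: f0.
by apply: csmooth_csm sf _ => // y [[]].
Qed.

End HolomorphicMaps.

Lemma continuous_sum_sqr (R : realType) (T : topologicalType) (f g : T -> R) x :
  {for x, continuous f} -> {for x, continuous g} ->
  {for x, continuous (fun y => f y ^+ 2 + g y ^+ 2)}.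
Proof.
move=> cf cg; have FF : Filter (nbhs x) by exact: nbhs_filter.
have c2 (h : T -> R) : {for x, continuous h} -> (fun y => h y ^+ 2) @ x --> h x ^+ 2.
  by move=> ch; rewrite expr2; under eq_fun do rewrite expr2; exact: (@cvgM _ _ _ FF _ _ _ _ ch ch).
exact: (@cvgD _ _ _ _ FF _ _ _ _ (c2 _ cf) (c2 _ cg)).
Qed.

Section IdentityTheorem.
Variable R : realType.
Local Notation C := (R[i]).
Local Notation P1 := (flat_atlas R (1 + 1)).
Local Notation hP := (flat_manifold R (1 + 1)).
Local Notation a0 := (tt : idx P1).
Local Notation o := (ord0 : 'I_1).

Definition sqmod (z : C) : R := complex.Re z ^+ 2 + complex.Im z ^+ 2.

Lemma sqmodE (z : C) : z * Num.conj z = (sqmod z)%:C%C.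
Proof. by rewrite /sqmod; case: z => u v; apply: complex_eq => /=; ring. Qed.

Lemma sqmodM (z w : C) : sqmod (z * w) = sqmod z * sqmod w.
Proof. by rewrite /sqmod; case: z w => u v [u' v'] /=; ring. Qed.

Lemma sqmod_ge0 (z : C) : 0 <= sqmod z.
Proof. by rewrite addr_ge0// sqr_ge0. Qed.

Lemma sqmod_eq0 (z : C) : sqmod z = 0 -> z = 0.
Proof.
case: z => u v /eqP; rewrite /sqmod /= paddr_eq0 ?sqr_ge0// !sqrf_eq0.
by case/andP => /eqP -> /eqP ->.
Qed.

Let w : 'rV[R]_(1 + 1) -> C := zcoord a0 o.

Lemma csm_plane U : csm a0 U w.
Proof.
move=> k; split.
  exact: Ck_sub (@subsetT _ U) (Ck_flat_coord k a0 _).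
exact: Ck_sub (@subsetT _ U) (Ck_flat_coord k a0 _).
Qed.

Lemma dd_plane s x : dd a0 s o w x = if s then 1 else 0.
Proof.
have E l : cpderive a0 l w x = Complex (l == lshift 1 o)%:R (l == rshift 1 o)%:R.
  by rewrite /cpderive /=; congr Complex; exact: pderive_coord.
rewrite ddE !E /dd_sign; case: s; apply: complex_eq => /=.
all: rewrite ?eqxx ?(_ : lshift 1 o == rshift 1 o = false) ?(_ : rshift 1 o == lshift 1 o = false) //=.
all: by field.
Qed.

Section Domain.
Variables (D : set 'rV[R]_(1 + 1)).
Hypothesis oD : open D.
Let Da : D `<=` dom a0. Proof. by []. Qed.

Lemma laplace_sqmod (G : 'rV[R]_(1 + 1) -> C) x : csm a0 D G ->
  (forall y, D y -> dd a0 false o G y = 0) -> D x ->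
  dd a0 true o (dd a0 false o (fun y => (sqmod (G y))%:C%C)) x = (sqmod (dd a0 true o G x))%:C%C.
Proof.
move=> CG hG Dx; have CJ := csmJ hP oD Da CG.
have CdJ : csm a0 D (fun y => Num.conj (dd a0 true o G y)).
  by apply: (csmJ hP oD Da); exact: (csm_dd hP oD Da).
have -> : dd a0 true o (dd a0 false o (fun y => (sqmod (G y))%:C%C)) x =
    dd a0 true o (fun y => G y * Num.conj (dd a0 true o G y)) x.
  apply: (dd_ext hP oD Da _ _ Dx) => y Dy.
  have -> : dd a0 false o (fun y => (sqmod (G y))%:C%C) y =
      dd a0 false o (fun y => G y * Num.conj (G y)) y.
    by apply: (dd_ext hP oD Da _ _ Dy) => z _; rewrite sqmodE.
  by rewrite (ddM hP oD Da _ _ CG CJ Dy) hG// mul0r add0r (ddJ hP oD Da _ _ CG Dy).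
rewrite (ddM hP oD Da _ _ CG CdJ Dx) (ddJ hP oD Da _ _ (csm_dd hP oD Da true o CG) Dx) /=.
rewrite (ddC hP oD Da _ _ _ _ CG Dx).
have -> : dd a0 true o (dd a0 false o G) x = dd a0 true o (fun=> 0) x.
  by apply: (dd_ext hP oD Da _ _ Dx).
by rewrite dd_cst rmorph0 mulr0 addr0 sqmodE.
Qed.

(** The left side is a quarter of the sum of the two pure second derivatives, and each of these is
    nonpositive at a maximum. *)
Lemma laplace_max_le0 (phi : 'rV[R]_(1 + 1) -> R) x (e : R) : (forall k, Ck k a0 D phi) ->
  D x -> 0 < e -> ball x e `<=` D -> (forall y, ball x e y -> phi y <= phi x) ->
  complex.Re (dd a0 true o (dd a0 false o (fun y => (phi y)%:C%C)) x) <= 0.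
Proof.
move=> Cphi Dx e0 eD phimax.
have second l : pderive a0 l (pderive a0 l phi) x <= 0.
  pose line (t : R) : 'rV[R]_(1 + 1) := t *: delta_mx 0 l + x.
  have lball t : `|t| < e -> ball x e (line t).
    move=> te; rewrite -ball_normE /= opprD addrCA subrr addr0 normrN normrZ.
    by apply: le_lt_trans te; rewrite ler_piMr// norm_delta_le.
  apply: (@second_derive_max_le0 _ (fun t => phi (line t)) (fun t => pderive a0 l phi (line t)) _ e e0).
  - move=> t te; have [_ /(_ l)[dphi _]] := Cphi 1%N.
    have := dphi _ (eD _ (lball t te)); rewrite /= => /derivableP.
    by apply: is_derive_to_line.
  - have [_ /(_ l)[_ [_ /(_ l)[d2 _]]]] := Cphi 2%N.
    have := d2 _ Dx; rewrite /= => /derivableP dl.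
    by apply: is_derive_to_line; rewrite /line scale0r add0r.
  - by move=> t te; rewrite {2}/line scale0r add0r; apply: phimax; exact: lball.
have D1 l y : D y ->
    derivable (phi \o charti a0) (chart a0 y) (delta_mx 0 l : 'rV[R]_(1 + 1)) by move=> Dy; have [_ /(_ l)[dphi _]] := Cphi 1%N; exact: dphi.
have D2 k l y : D y ->
    derivable (pderive a0 k phi \o charti a0) (chart a0 y) (delta_mx 0 l : 'rV[R]_(1 + 1)).
  by move=> Dy; have [_ /(_ k)[_ [_ /(_ l)[d2 _]]]] := Cphi 2%N; exact: d2.
have p0 l y : pderive a0 l (fun=> 0 : R) y = 0 by rewrite /pderive; exact: derive_cst.
have E y : D y -> dd a0 false o (fun y => (phi y)%:C%C) y =
    Complex (2^-1 * pderive a0 (lshift 1 o) phi y) (2^-1 * pderive a0 (rshift 1 o) phi y).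
  by move=> Dy; rewrite ddE /cpderive /= !p0 /dd_sign; apply: complex_eq => /=; field.
have half k l : pderive a0 l (fun y => 2^-1 * pderive a0 k phi y) x =
    2^-1 * pderive a0 l (pderive a0 k phi) x.
  have -> : pderive a0 l (fun y => 2^-1 * pderive a0 k phi y) x =
      pderive a0 l (fun=> 2^-1) x * pderive a0 k phi x + 2^-1 * pderive a0 l (pderive a0 k phi) x.
    by apply: (pderiveM hP) => //; [exact: derivable_cst|exact: D2].
  by rewrite /pderive derive_cst mul0r add0r.
have R1 l : complex.Re (cpderive a0 l (dd a0 false o (fun y => (phi y)%:C%C)) x) =
   2^-1 * pderive a0 l (pderive a0 (lshift 1 o) phi) x.
  by rewrite /cpderive /= -half; apply: (pderive_ext hP l oD Dx) => // y Dy; rewrite E.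
have R2 l : complex.Im (cpderive a0 l (dd a0 false o (fun y => (phi y)%:C%C)) x) =
   2^-1 * pderive a0 l (pderive a0 (rshift 1 o) phi) x.
  by rewrite /cpderive /= -half; apply: (pderive_ext hP l oD Dx) => // y Dy; rewrite E.
have alg (u v : C) : complex.Re ((u + dd_sign R true * v) * 2%:R^-1) = (complex.Re u + complex.Im v) / 2.
  by rewrite /dd_sign; case: u v => u1 u2 [v1 v2] /=; field.
rewrite ddE alg R1 R2.
have := second (lshift 1 o); have := second (rshift 1 o).
move: (pderive _ _ _ _) => u; move: (pderive _ _ _ _) => v; lra.
Qed.

End Domain.

Lemma holo_plane U : holo_on P1 U w.
Proof.
apply/holoP => a; case: a; split; first exact: csm_plane.
by move=> j x _ _; rewrite ord1; exact: dd_plane.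
Qed.

Lemma holo_exp U (f : 'rV[R]_(1 + 1) -> C) N : open U -> holo_on P1 U f ->
  holo_on P1 U (fun x => f x ^+ N).
Proof.
move=> oU hf; elim: N => [|N IH]; first exact: holo_cst.
by apply: (holo_ext hP oU _ (holoM hP oU hf IH)) => x _; rewrite exprS.
Qed.

Lemma sqmodX (z : C) N : sqmod (z ^+ N) = sqmod z ^+ N.
Proof.
elim: N => [|N IH]; last by rewrite !exprS sqmodM IH.
by rewrite !expr0 /sqmod /= expr0n expr1n addr0.
Qed.

Let q v := sqmod (w v).
Let cq : continuous q.
Proof.
move=> v; rewrite /q /sqmod /w /zcoord /=.
by apply: continuous_sum_sqr; exact: coord_continuous.
Qed.

Let qE (v : 'rV[R]_(1 + 1)) : q v = v 0 (lshift 1 o) ^+ 2 + v 0 (rshift 1 o) ^+ 2. Proof. by []. Qed.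

Lemma plane_norm_lt (v : 'rV[R]_(1 + 1)) (c : R) : 0 < c -> sqmod (w v) < c ^+ 2 -> `|v| < c.
Proof.
move=> c0 qc; rewrite -[ltLHS]/(mx_norm v) mx_normrE; apply/bigmax_ltP; split => // -[i j] _ /=.
rewrite ord1 -(@ltr_pXn2r _ 2) ?nnegrE ?(ltW c0)// real_normK ?num_real//.
apply: le_lt_trans qc; rewrite -/(q v) qE; case: (split_ordP j) => k ->; rewrite ord1.
  by rewrite lerDl sqr_ge0.
by rewrite lerDr sqr_ge0.
Qed.

(* The maximum principle for [|F / z^N|^2 + eps |z|^2] on the disc of radius 2
   bounds [|F 1|^2] by [M / 4^N + 4 eps]. *)
Theorem disc_identity D (F : 'rV[R]_(1 + 1) -> C) (e : R) : open D ->
  (forall v, q v <= 4 -> D v) -> holo_on P1 D F -> 0 < e ->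
  (forall v, `|v| < e -> F v = 0) -> F (delta_mx 0 (lshift 1 o)) = 0.
Proof.
move=> oD qD hF e0 F0; set p := delta_mx 0 _.
have q0 v : 0 <= q v by exact: sqmod_ge0.
have qp : q p = 1 by rewrite qE !mxE eqxx /= expr1n expr0n addr0.
apply: sqmod_eq0; apply/eqP; rewrite eq_le sqmod_ge0 andbT leNgt; apply/negP.
set m := sqmod _ => m0.
(* As [d < e], the function [F] vanishes on the inner circle; as [d <= 1], the point [p], of modulus
   1, lies in the annulus [A]. *)
pose d := Num.min (e / 2) 1.
have d0 : 0 < d by rewrite lt_min divr_gt0//=.
have d1 : d ^+ 2 <= 1 by rewrite expr_le1// ?(ltW d0)// ge_min lexx orbT.
have de : d < e by rewrite (@le_lt_trans _ _ (e / 2)) ?ge_min ?lexx// ltr_pdivrMr// mulr_natr mulr2n ltrDl.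
pose A := [set v | d ^+ 2 <= q v <= 4].
have Ap : A p by rewrite /A /= qp d1 /=; lra.
have cA : compact A.
  apply: bounded_closed_compact.
    exists 3; split; first exact: num_real.
    move=> c c3 v [/andP[_ q4]] /=; apply/ltW/(lt_trans _ c3)/plane_norm_lt => //.
    by apply: le_lt_trans q4 _; rewrite expr2; lra.
  rewrite (_ : A = q @^-1` `[d ^+ 2, 4]%classic); last first.
    by apply/seteqP; split=> v; rewrite /A /= in_itv.
  by apply: preimage_closed => [v _|]; [exact: cq|exact: interval_closed].
have AD : A `<=` D by move=> v; rewrite /A /= => /andP[_]; exact: qD.
pose D0 := D `&` [set v | q v != 0].
have oD0 : open D0.
  apply: openI => //.
  rewrite (_ : [set _ | _] = q @^-1` (~` [set 0])); last first.
    by apply/seteqP; split=> v /= /eqP.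
  by apply: open_comp => [v _|]; [exact: cq|apply: closed_openC; apply: accessible_closed_set1; exact/hausdorff_accessible/norm_hausdorff].
have D00 : D0 `<=` dom a0 by [].
have AD0 : A `<=` D0.
  move=> v Av; split; first exact: AD.
  by move: Av => /andP[+ _]; apply: contraTneq => ->; rewrite -ltNge exprn_gt0.
have w0 v : D0 v -> w v != 0.
  by move=> [_]; apply: contra_neq; rewrite /q => ->; rewrite /sqmod /= expr0n addr0.
have cF v : A v -> {for v, continuous (fun v => sqmod (F v))}.
  move=> /AD Dv; have [/(_ 0%N)[[c1 _] [c2 _]] _] := (holoP _ _ _).1 hF a0.
  have {}c1 := c1 v (conj Dv I); have {}c2 := c2 v (conj Dv I).
  exact: continuous_sum_sqr c1 c2.
have A0 : A !=set0 by exists p.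
have [x1 Ax1 max1] := compact_EVT_max A0 cA (continuous_in_subspaceT (fun v => fun (h : v \in A) => cF v (set_mem h))).
pose M := sqmod (F x1).
(* Chosen so that on the circle of radius 2 the quotient [|F|^2 / 4^N] is below [m / 2]. *)
pose N := Num.Def.archi_bound (2 * M / m).
have MN : M < m / 2 * 4 ^+ N.
  have M0 : 0 <= 2 * M / m by rewrite divr_ge0 ?(ltW m0)// mulr_ge0// sqmod_ge0.
  have h1 : 2 * M / m < 4 ^+ N.
    apply: (lt_le_trans (archi_boundP M0)); rewrite -natrX ler_nat.
    exact/ltnW/ltn_expl.
  by move: h1; rewrite ltr_pdivrMr//; move: (4 ^+ N) => z; lra.
(* With [q] at most 4 on [A], the perturbation stays below [m / 4]. *)
pose ep := m / 16; have ep0 : 0 < ep by rewrite divr_gt0.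
pose G v := F v * (w v)^-1 ^+ N.
have hG : holo_on P1 D0 G.
  apply: (holoM hP) => //; first by apply: holo_sub hF => v [].
  by apply: holo_exp => //; apply: (holo_inv hP) => //; exact: holo_plane.
have GF v : D0 v -> sqmod (G v) * q v ^+ N = sqmod (F v).
  by move=> /w0 v0; rewrite /q -sqmodX -sqmodM /G -mulrA -exprMn mulVf// expr1n mulr1.
pose phi v := sqmod (G v) + ep * q v.
have CG : csm a0 D0 G by have [+ _] := (holoP _ _ _).1 hG a0; rewrite setIT.
have dG y : D0 y -> dd a0 false o G y = 0.
  by move=> Dy; have [_ /(_ o y Dy)] := (holoP _ _ _).1 hG a0; exact.
have Cw : csm a0 D0 w by exact: csm_plane.
have CsG (H : 'rV[R]_(1 + 1) -> C) : csm a0 D0 H -> csm a0 D0 (fun v => (sqmod (H v))%:C%C).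
  move=> CH; apply: (csm_ext hP oD0 D00 _ (csmM hP oD0 D00 CH (csmJ hP oD0 D00 CH))).
  by move=> y _; rewrite sqmodE.
have CG2 := CsG _ CG; have Cw2 := CsG _ Cw.
have Cew : csm a0 D0 (fun v => ep%:C%C * (q v)%:C%C).
  by apply: (csmM hP oD0 D00 _ Cw2); exact: csm_cst.
have realDM (t u v : R) : t%:C%C + u%:C%C * v%:C%C = (t + u * v)%:C%C.
  by apply: complex_eq => /=; ring.
have Cphi : csm a0 D0 (fun v => (phi v)%:C%C).
  by apply: (csm_ext hP oD0 D00 _ (csmD hP oD0 D00 CG2 Cew)) => y _; exact: realDM.
have Rphi k : Ck k a0 D0 phi by have [] := Cphi k.
have cphi v : A v -> {for v, continuous phi} by move=> /AD0 Dv; have [+ _] := Rphi 0%N; exact.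
have [x Ax maxx] := compact_EVT_max A0 cA (continuous_in_subspaceT (fun v => fun (h : v \in A) => cphi v (set_mem h))).
have phip : m < phi x.
  apply: (@lt_le_trans _ _ (phi p)); last by apply: maxx; exact/mem_set.
  have := GF p (AD0 p Ap); rewrite qp expr1n mulr1 => Gp.
  by rewrite /phi Gp qp mulr1 ltrDl.
have /andP[x1' x4] : d ^+ 2 <= q x <= 4 by exact: set_mem Ax.
have phi4 : ep * q x <= m / 4.
  have h4 : ep * q x <= ep * 4 by rewrite ler_pM2l.
  by apply: le_trans h4 _; rewrite /ep; lra.
(* The maximum of [phi] exceeds [m]. On the inner circle [F] is 0 and [phi] is at most [m / 4]; on
   the outer one [phi] is below [m / 2 + m / 4]. In between, the second derivative would be
   nonpositive, while the perturbation makes it at least [ep]. *)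
have [xd|xd] := leP (q x) (d ^+ 2).
  have Fx : F x = 0 by apply: F0; apply: plane_norm_lt => //; apply: le_lt_trans xd _; rewrite ltrXn2r// ltW.
  have : phi x <= m / 4 by rewrite /phi /G Fx mul0r {1}/sqmod /= expr0n addr0 add0r.
  by lra.
have [x4'|x4'] := leP 4 (q x).
  have qx : q x = 4 by apply/eqP; rewrite eq_le x4.
  have := GF x (AD0 x (set_mem Ax)); rewrite qx => Gx.
  have FM : sqmod (F x) <= M by exact: max1.
  have : sqmod (G x) < m / 2.
    by rewrite -(ltr_pM2r (exprn_gt0 N (ltr0n _ 4))) Gx; exact: le_lt_trans FM MN.
  by move: phip; rewrite /phi; lra.
have D0x : D0 x by exact/AD0/set_mem.
have : nbhs x [set v | d ^+ 2 < q v < 4].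
  rewrite (_ : [set _ | _] = q @^-1` `]d ^+ 2, 4[%classic); last first.
    by apply/seteqP; split=> v; rewrite /= in_itv.
  apply: open_nbhs_nbhs; split; last by rewrite /= in_itv /= xd.
  by apply: open_comp => [v _|]; [exact: cq|exact: interval_open].
move=> /nbhs_ballP[b /= b0 bA].
have bA' : ball x b `<=` A by move=> v /bA /= /andP[h1 h2]; rewrite /A /= !ltW.
have := laplace_max_le0 oD0 Rphi D0x b0 (subset_trans bA' AD0)
  (fun y by_ => maxx y (mem_set (bA' y by_))).
have -> : dd a0 true o (dd a0 false o (fun y => (phi y)%:C%C)) x =
    dd a0 true o (fun y => dd a0 false o (fun v => (sqmod (G v))%:C%C) y +
       ep%:C%C * dd a0 false o (fun v => (q v)%:C%C) y) x.
  apply: (dd_ext hP oD0 D00 _ _ D0x) => y Dy.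
  have -> : dd a0 false o (fun y => (phi y)%:C%C) y =
      dd a0 false o (fun v => (sqmod (G v))%:C%C + ep%:C%C * (q v)%:C%C) y.
    by apply: (dd_ext hP oD0 D00 _ _ Dy) => v _; rewrite realDM.
  rewrite (ddD hP oD0 D00 _ _ CG2 Cew Dy); apply: (congr1 (fun z => _ + z)).
  by rewrite (ddM hP oD0 D00 _ _ (csm_cst _ _ _) Cw2 Dy) dd_cst mul0r add0r.
have Cd2 := csm_dd hP oD0 D00 false o Cw2.
rewrite (ddD hP oD0 D00 _ _ (csm_dd hP oD0 D00 false o CG2)
  (csmM hP oD0 D00 (csm_cst _ _ _) Cd2) D0x).
rewrite (ddM hP oD0 D00 _ _ (csm_cst _ _ _) Cd2 D0x) dd_cst mul0r add0r.
rewrite (laplace_sqmod oD0 CG dG D0x) (laplace_sqmod oD0 Cw _ D0x); last by move=> y _; exact: dd_plane.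
rewrite dd_plane; have := sqmod_ge0 (dd a0 true o G x); move: (sqmod (dd _ _ _ _ _)) => z z0.
by rewrite /sqmod /= expr1n expr0n /=; lra.
Qed.

End IdentityTheorem.

Section Identity.
Variables (R : realType) (n : nat) (X : ptopologicalType) (M : atlas R (n + n) X).
Hypothesis hC : is_complex_manifold M.
Local Notation C := (R[i]).
Local Notation hM := hC.1.
Local Notation PP := (flat_atlas R (1 + 1)).
Local Notation hP := (flat_manifold R (1 + 1)).
Local Notation o := (ord0 : 'I_1).

Lemma open_chart_image (a : idx M) U : open U -> U `<=` dom a -> open (chart a @` U).
Proof.
move=> oU Ua; rewrite openE => _ [x Ux <-]; have ax := Ua x Ux.
have := near_charti hM oU Ux ax; have := near_chart_image hM ax.
apply: filterS2 => v [y ay <-] /=; rewrite (chartK hM)// => Uy.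
by exists y.
Qed.

Lemma holo_neq0_near U f x : open U -> U x -> holo_on M U f -> f x != 0 ->
  nbhs x [set y | f y != 0].
Proof.
move=> oU Ux hf fx; pose a := chart_at M x; have ax : dom a x by exact: (dom_chart_at hM).
have [/(_ 0%N)[[c1 _] [c2 _]] _] := (holoP _ _ _).1 hf a.
have q0 : sqmod (f x) != 0 by apply: contra_neq fx; exact: sqmod_eq0.
have cq : {for x, continuous (fun y => sqmod (f y))} by apply: continuous_sum_sqr; [exact: c1|exact: c2].
have : nbhs (sqmod (f x)) (~` [set 0]).
  apply: open_nbhs_nbhs; split; last exact/eqP.
  by apply: closed_openC; apply: accessible_closed_set1; exact/hausdorff_accessible/norm_hausdorff.
move=> h; have := cq _ h; rewrite /nbhs /=; apply: filterS => y /= fy; apply/eqP => fy0; apply: fy.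
by rewrite fy0 /sqmod /= expr0n addr0.
Qed.

(** Some [y1] near [x] has [f y1] nonzero, so [g] vanishes around [y1]. Any other nearby point [z]
    lies with [y1] on a complex line in the chart, parametrized so that 0 goes to [y1] and 1 to [z];
    [disc_identity] on that line gives [g z = 0]. *)
Theorem holo_identity U x f g : open U -> U x -> holo_on M U f -> holo_on M U g ->
  (forall W, open W -> W x -> exists2 y, (U `&` W) y & f y != 0) ->
  (forall y, U y -> f y * g y = 0) ->
  exists W, [/\ open W, W x, W `<=` U & forall y, W y -> g y = 0].
Proof.
move=> oU Ux hf hg f0 fg; pose a := chart_at M x; have ax : dom a x by exact: (dom_chart_at hM).
pose V := U `&` dom a; have oV : open V by apply: openI => //; exact: (dom_open hM).
have Va : V `<=` dom a by move=> y [].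
have oI := open_chart_image oV Va.
have : nbhs (chart a x) (chart a @` V) by apply: open_nbhs_nbhs; split => //; exists x.
move=> /nbhs_ballP[e10 /= e100 HB].
(* With [|d| < 2 e] and both coordinates of the parameter at most [9 / 4], the line stays within
   [e + 2 * (9 / 4) * 2 e = 10 e] of the centre. *)
pose e := e10 / 10; have e0 : 0 < e by rewrite divr_gt0.
have ee : e10 = 10 * e by rewrite /e; field.
pose W := V `&` chart a @^-1` ball (chart a x) e.
have oW : open W.
  rewrite openE => y [Vy by_].
  have : nbhs y (chart a @^-1` ball (chart a x) e).
    apply: (chart_continuous hM (Va y Vy)); apply: open_nbhs_nbhs; split => //; exact: ball_open.
  have : nbhs y V by exact: open_nbhs_nbhs.
  exact: filterI.
have Wx : W x by split => //; exact: ballxx.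
exists W; split => //; first by move=> y [[]].
have [y1 [_ [Vy1 by1]] fy1] := f0 W oW Wx.
pose Z := [set y | V y /\ f y != 0].
have gZ y : Z y -> g y = 0.
  by move=> [[Uy _] fy]; have /eqP := fg y Uy; rewrite mulf_eq0 (negbTE fy) => /eqP.
have nZ : nbhs y1 Z.
  by apply: filterI; [exact: open_nbhs_nbhs|exact: (holo_neq0_near oU Vy1.1 hf fy1)].
move=> z [Vz bz].
pose p := chart a y1; pose d := chart a z - p.
(* Multiplication of [d] by the imaginary unit in the coordinates (Re z, Im z). *)
pose J : 'rV[R]_(n + n) := row_mx (- rsubmx d) (lsubmx d).
pose Phi (v : 'rV[R]_(1 + 1)) := p + v 0 (lshift 1 o) *: d + v 0 (rshift 1 o) *: J.
have nJ : `|J| <= `|d|.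
  rewrite /J; move: (d) => u.
  apply: rV_norm_le => // j; case: (split_ordP j) => k ->; rewrite ?row_mxEl ?row_mxEr !mxE ?normrN; exact: rV_coord_le.
have nd : `|d| < 2 * e.
  have -> : d = (chart a x - p) - (chart a x - chart a z) by rewrite /d opprB [RHS]addrC addrA subrK.
  apply: (le_lt_trans (ler_normB _ _)); move: by1 bz; rewrite -ball_normE /= -/p; lra.
(* An open neighbourhood of the closed disc of radius 2 required by [disc_identity]. *)
pose D := ball (0 : 'rV[R]_(1 + 1)) (9 / 4).
have PhiI v : D v -> (chart a @` V) (Phi v).
  rewrite /D -ball_normE /= sub0r normrN => v9; apply: HB.
  rewrite -ball_normE /= ee /Phi !opprD !addrA.
  have b1 i : `|v 0 i| <= 9 / 4 by apply: le_trans (rV_coord_le v i) (ltW v9).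
  have k1 i (w : 'rV[R]_(n + n)) : `|w| <= `|d| -> `|v 0 i *: w| <= 9 / 4 * `|d|.
    by move=> wd; rewrite normrZ ler_pM.
  apply: (le_lt_trans (ler_normB _ _)).
  have := ler_normB (chart a x - p) (v 0 (lshift 1 o) *: d).
  have := k1 (lshift 1 o) d (lexx _); have := k1 (rshift 1 o) J nJ.
  by move: by1; rewrite -ball_normE /= -/p; lra.
have cPhi : continuous Phi.
  move=> v; have FF : Filter (nbhs v) by exact: nbhs_filter.
  apply: (@cvgD _ _ _ _ FF); [apply: (@cvgD _ _ _ _ FF); first exact: cvg_cst|].
    by apply: cvgZr_tmp; exact: coord_continuous.
  by apply: cvgZr_tmp; exact: coord_continuous.
have oD : open D by exact: ball_open.
have DaP : D `<=` dom (tt : idx PP) by [].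
pose G v := charti a (Phi v).
have VG v : D v -> V (G v) by move=> /PhiI[y Vy yE]; rewrite /G -yE (chartK hM)//; exact: Va.
have chG v : D v -> chart a (G v) = Phi v.
  by move=> /PhiI[y Vy yE]; rewrite /G -yE (chartK hM)//; exact: Va.
have cG v : D v -> {for v, continuous G}.
  move=> Dv; have [y Vy yE] := PhiI v Dv.
  apply: (@continuous_comp _ _ _ Phi (charti a)); first exact: cPhi.
  by rewrite -yE; exact: (charti_continuous hM (Va y Vy)).
pose P l := Complex (p 0 (lshift n l)) (p 0 (rshift n l)).
pose Q l := Complex (d 0 (lshift n l)) (d 0 (rshift n l)).
have hz l : holo_on PP D (fun v => zcoord a l (G v)).
  apply: (holo_ext hP oD (f := fun v => P l + zcoord (tt : idx PP) o v * Q l)).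
    move=> v Dv; rewrite /zcoord chG// /Phi /J !mxE.
    rewrite -/(lshift n l) (unsplitK (inl l)) (unsplitK (inr l)) !mxE.
    by apply: complex_eq => /=; rewrite /d !mxE; ring.
  apply: (holoD hP oD); first exact: holo_cst.
  by apply: (holoM hP oD); [exact: holo_plane|exact: holo_cst].
have Cz l : csm (tt : idx PP) D (fun v => zcoord a l (G v)).
  by have [+ _] := (holoP _ _ _).1 (hz l) tt; rewrite setIT.
have hz' l (j : 'I_1) v : D v -> dd (tt : idx PP) false j (fun v => zcoord a l (G v)) v = 0.
  by move=> Dv; have [_] := (holoP _ _ _).1 (hz l) tt; exact.
have [Cg hg0] := (holoP _ _ _).1 hg a.
have hF : holo_on PP D (g \o G).
  apply/holoP => -[]; rewrite setIT; split.
    exact: (csm_comp hP hM oD DaP oV Va VG cG Cz Cg).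
  move=> j v Dv _; rewrite (dd_chain_holo hP hM oD DaP oV Va VG cG Cz hz' false j Cg Dv).
  by rewrite big1// => l _; have [Uv av] := VG v Dv; rewrite hg0// mul0r.
have Phi0 : Phi 0 = p by rewrite /Phi !mxE !scale0r !addr0.
have D0 : D 0 by rewrite /D; apply: ballxx; lra.
have : nbhs (G 0) Z by rewrite /G Phi0 (chartK hM)//; exact: Va.
move=> /(cG 0 D0) /nbhs_ballP[b /= b0 bZ].
have qD v : sqmod (zcoord (tt : idx PP) o v) <= 4 -> D v.
  move=> q4; rewrite /D -ball_normE /= sub0r normrN; apply: plane_norm_lt; first lra.
  by apply: le_lt_trans q4 _; rewrite expr2; lra.
have := disc_identity oD qD hF b0.
have -> : (g \o G) (delta_mx 0 (lshift 1 o)) = g z.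
  rewrite /= /G /Phi !mxE eqxx /= scale1r scale0r addr0 /d addrC subrK.
  by rewrite (chartK hM)//; exact: Va.
apply=> v vb; apply: gZ; apply: bZ; by rewrite -ball_normE /= sub0r normrN.
Qed.

End Identity.

(** * Two Hermitian metrics *)

Section LocallyConstant.
Variables (R : realType) (d : nat) (X : ptopologicalType) (M : atlas R d X).
Hypothesis hM : is_manifold M.

Lemma constant_near (a : idx M) U (f : X -> R) x : open U -> U `<=` dom a -> U x -> Ck 1 a U f ->
  (forall i y, U y -> pderive a i f y = 0) -> nbhs x [set y | f y = f x].
Proof.
move=> oU Ua Ux Cf f0; have ax := Ua x Ux.
have : nbhs (chart a x) [set v | (chart a @` dom a) v /\ U (charti a v)].
  exact: filterI (near_chart_image hM ax) (near_charti hM oU Ux ax).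
move=> /nbhs_ballP[e /= e0 HB].
have : nbhs x (U `&` chart a @^-1` ball (chart a x) e).
  apply: filterI; first exact: open_nbhs_nbhs.
  by apply: (chart_continuous hM ax); apply: open_nbhs_nbhs; split; [exact: ball_open|exact: ballxx].
apply: filterS => y [Uy by_] /=.
pose u := chart a y - chart a x.
have [t t1|c c1] := @MVT_at0 R (fun t => (f \o charti a) (t *: u + chart a x)) (fun=> 0) 1.
  apply: is_derive_to_line.
  have bt : ball (chart a x) e (t *: u + chart a x).
    rewrite -ball_normE /= opprD addrCA subrr addr0 normrN normrZ.
    move: by_; rewrite /= -ball_normE /= distrC -/u; apply: le_lt_trans.
    by rewrite ler_piMl// (le_trans t1)// normr1.
  have [[z az zE] Uz] := HB _ bt; rewrite -zE in Uz *; rewrite (chartK hM az) in Uz.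
  have [df DE] := Ck1_differentiable hM oU Ua Uz Cf.
  have := DE u; rewrite big1 => [D0|i _]; last by rewrite f0// mulr0.
  by split; [exact: diff_derivable|exact: D0].
rewrite mul0r => /eqP; rewrite subr_eq0 => /eqP.
by rewrite /= scale1r scale0r add0r /u subrK !(chartK hM)//; exact: Ua.
Qed.

Lemma connected_constant (T : Type) (f : X -> T) : connected [set: X] ->
  (forall x, nbhs x [set y | f y = f x]) -> forall x y, f x = f y.
Proof.
move=> cX fc x y; pose B := [set z | f z = f x].
have oB : open B.
  by rewrite openE => z Bz; apply: filterS (fc z) => w /= E; rewrite /B /= E.
have cB : closed B.
  rewrite -openC openE => z Bz; apply: filterS (fc z) => w /= E; rewrite /B /= E; exact: Bz.
have : B = setT.
  by apply: cX; [exists x|exists B => //; rewrite setTI|exists B => //; rewrite setTI].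
by move=> /seteqP[_ /(_ y I)] ->.
Qed.

End LocallyConstant.

Section DdConstant.
Variables (R : realType) (n : nat) (X : ptopologicalType) (M : atlas R (n + n) X).
Hypothesis hC : is_complex_manifold M.
Local Notation C := (R[i]).
Local Notation hM := hC.1.

Lemma dd_eq0_constant (f : X -> C) : connected [set: X] -> csmooth_on M setT f ->
  (forall x s j, dd (chart_at M x) s j f x = 0) -> forall x y, f x = f y.
Proof.
move=> cX sf f0; apply: (connected_constant cX) => x.
pose a := chart_at M x; have ax : dom a x by exact: (dom_chart_at hM).
have oa := dom_open hM a.
have Cf : csm a (dom a) f by apply: csmooth_csm sf _.
have d0 y s j : dom a y -> dd a s j f y = 0.
  move=> ay; pose b := chart_at M y; have by_ : dom b y by exact: (dom_chart_at hM).
  apply: (@dd_chart_eq0 _ _ _ _ hC a b s (dom a `&` dom b)) => //.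
  - by apply: openI => //; exact: (dom_open hM).
  - by apply: csmooth_csm sf _.
  - by move=> l; exact: f0.
(* The derivatives in x and y are recovered from those in z and its conjugate. *)
have alg (u v : C) : (u + dd_sign R true * v) * 2%:R^-1 = 0 ->
    (u + dd_sign R false * v) * 2%:R^-1 = 0 -> u = 0 /\ v = 0.
  rewrite /dd_sign => h1 h2; split.
    have -> : u = (u + - Complex 0 1 * v) * 2%:R^-1 + (u + Complex 0 1 * v) * 2%:R^-1 by field.
    by rewrite h1 h2 addr0.
  have -> : v = Complex 0 1 * ((u + - Complex 0 1 * v) * 2%:R^-1 - (u + Complex 0 1 * v) * 2%:R^-1).
    by case: (u) (v) => u1 u2 [v1 v2]; apply: complex_eq => /=; field.
  by rewrite h1 h2 subrr mulr0.
have c0 i y : dom a y -> cpderive a i f y = 0.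
  move=> ay; have k j := alg _ _ (eq_trans (esym (ddE a true j f y)) (d0 y true j ay))
    (eq_trans (esym (ddE a false j f y)) (d0 y false j ay)).
  by case: (split_ordP i) => j ->; have [] := k j.
have [C1 C2] := Cf 1%N.
have N1 := constant_near hM oa (fun _ h => h) ax C1
  (fun i y ay => congr1 (@complex.Re R) (c0 i y ay)).
have N2 := constant_near hM oa (fun _ h => h) ax C2
  (fun i y ay => congr1 (@complex.Im R) (c0 i y ay)).
apply: filterS2 N1 N2 => y /= h1 h2; exact: complex_eq.
Qed.

End DdConstant.

Section TwoMetrics.
Variables (R : realType) (n : nat) (X : ptopologicalType) (K : kahler R n X).
Local Notation C := (R[i]).
Local Notation hM := (kmanifold K).1.
Variables (x : X) (U : set X).
Let a := chart_at K x.
Hypotheses (oU : open U) (Ux : U x) (Ua : U `<=` dom a).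
Variables (r : nat) (H1 H2 : X -> 'M[C]_r).
Hypotheses (CH1 : csx a U H1) (CH2 : csx a U H2).
Hypotheses (pH1 : forall y, U y -> posdef (H1 y)) (pH2 : forall y, U y -> posdef (H2 y)).

Definition mconn (H : X -> 'M[C]_r) j y := invmx (H y) *m dmx a true j H y.
Let b y := invmx (H1 y) *m H2 y.
Let B j y := mconn H2 j y - mconn H1 j y.
Let u1 y : U y -> H1 y \in unitmx. Proof. by move=> /pH1/posdef_unit. Qed.
Let u2 y : U y -> H2 y \in unitmx. Proof. by move=> /pH2/posdef_unit. Qed.
Let CI1 := csx_inv hM oU Ua u1 CH1.
Let Cb : csx a U b. Proof. exact: (csxM hM oU Ua). Qed.

Lemma csx_mconn (H : X -> 'M[C]_r) j : csx a U H -> (forall y, U y -> posdef (H y)) ->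
  csx a U (mconn H j).
Proof.
move=> CH pH; apply: (csxM hM oU Ua); last exact: (csx_dmx hM oU Ua).
by apply: (csx_inv hM oU Ua) => // y /pH/posdef_unit.
Qed.

Lemma dmx_false_metric (H : X -> 'M[C]_r) l y : csx a U H -> (forall y, U y -> posdef (H y)) ->
  U y -> dmx a false l H y = adjmx (mconn H l y) *m H y.
Proof.
move=> CH pH Uy; have -> : dmx a false l H y = dmx a false l (fun y => adjmx (H y)) y.
  by apply: (dmx_ext hM oU Ua _ _ Uy) => z /pH[->].
rewrite (dmx_adj hM oU Ua _ _ CH Uy) /= -[in RHS](pH y Uy).1 -adjmxM /mconn mulKVmx//.
exact/posdef_unit/pH.
Qed.

Lemma dmx_true_ratio j y : U y -> dmx a true j b y = b y *m mconn H2 j y - mconn H1 j y *m b y.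
Proof.
move=> Uy; rewrite (dmxM hM oU Ua _ _ CI1 CH2 Uy) (dmx_inv hM oU Ua _ _ u1 CH1 Uy).
by rewrite /b /mconn !mulNmx -!mulmxA mulKVmx ?u2// addrC.
Qed.

Lemma dmx_false_ratio l y : U y -> dmx a false l b y = invmx (H1 y) *m adjmx (B l y) *m H2 y.
Proof.
move=> Uy; rewrite (dmxM hM oU Ua _ _ CI1 CH2 Uy) (dmx_inv hM oU Ua _ _ u1 CH1 Uy).
rewrite !dmx_false_metric// /B adjmxB mulmxBr mulmxBl !mulNmx addrC !mulmxA.
by rewrite mulmxK ?u1.
Qed.

(** By cyclicity of the trace, [del_j (Tr b) = Tr (b B_j)]. Applying the conjugate derivative to [b]
    yields the quadratic term in [B]; applying it to [B_j] yields the curvature of [H1] minus that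
    of [H2]. *)
Lemma lap_tr_ratio (f : X -> R) : (forall y, U y -> f y = complex.Re (\tr (b y))) ->
  lap K f x = - complex.Re (\sum_l \sum_j invmx (gmx K x) l j *
      \tr (invmx (H1 x) *m adjmx (B l x) *m H2 x *m B j x)) -
    complex.Re (\tr (contraction K x (fun j l =>
       chern_curvature K H1 x j l - chern_curvature K H2 x j l) *m b x)).
Proof.
move=> fE; have CB j : csx a U (B j).
  by apply: (csxD hM oU Ua); [exact: csx_mconn|apply: (csxN hM oU Ua); exact: csx_mconn].
have trb y : U y -> (f y)%:C%C = \tr (b y).
  move=> Uy; rewrite fE//; apply/esym/complex_real_eq.
  have : Num.conj (\tr (b y)) = \tr (b y).
    rewrite -tr_adjmx /b adjmxM adjmx_inv (pH1 Uy).1 (pH2 Uy).1; exact: mxtrace_mulC.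
  by case: (\tr _) => p q [] /= ; lra.
have Ctr := csx_tr hM oU Ua Cb.
have trN (D : 'M[C]_r) : \tr (- D) = - \tr D by exact: raddfN.
have trD (D D' : 'M[C]_r) : \tr (D + D') = \tr D + \tr D' by exact: raddfD.
have hE j l : hess a (fun y => (f y)%:C%C) x j l =
    \tr (invmx (H1 x) *m adjmx (B l x) *m H2 x *m B j x) +
    \tr ((chern_curvature K H1 x j l - chern_curvature K H2 x j l) *m b x).
  rewrite hessE.
  have -> : dd a true j (dd a false l (fun y => (f y)%:C%C)) x = dd a true j (dd a false l (fun y => \tr (b y))) x.
    apply: (dd_ext hM oU Ua _ _ Ux) => y Uy; apply: (dd_ext hM oU Ua _ _ Uy) => z; exact: trb.
  rewrite (ddC hM oU Ua _ _ _ _ Ctr Ux).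
  have -> : dd a false l (dd a true j (fun y => \tr (b y))) x =
      dd a false l (fun y => \tr (b y *m B j y)) x.
    apply: (dd_ext hM oU Ua _ _ Ux) => y Uy; rewrite (dd_tr hM oU Ua _ _ Cb Uy) dmx_true_ratio// trD trN.
    by rewrite [X in _ - X]mxtrace_mulC -trN -trD /B mulmxBr.
  rewrite (dd_tr hM oU Ua _ _ (csxM hM oU Ua Cb (CB j)) Ux) (dmxM hM oU Ua _ _ Cb (CB j) Ux) trD.
  rewrite dmx_false_ratio//; apply: (congr1 (fun z => _ + z)); rewrite mxtrace_mulC.
  apply: (congr1 (fun z => \tr (z *m _))).
  have CN1 := csx_mconn j CH1 pH1; have CN2 := csx_mconn j CH2 pH2.
  rewrite (dmxD hM oU Ua _ _ CN2 (csxN hM oU Ua CN1) Ux) (dmxN hM oU Ua _ _ CN1 Ux).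
  rewrite !chernE opprK addrC//.
rewrite laplacianE -opprD -cReD; apply: (congr1 (fun z => - complex.Re z)).
rewrite tr_contraction -big_split /mxtrace; apply: eq_bigr => l _.
rewrite mxE -big_split; apply: eq_bigr => j _ /=; by rewrite hE mulrDr.
Qed.

End TwoMetrics.

(** * The image of a holomorphic projection *)

Section RankFactorization.
Variable F : fieldType.

(** An invertible k-by-k compression of [p]. Unlike the rank factorization it comes from, it stays
    invertible when [p] varies continuously, and so yields local frames of the image. *)
Lemma rank_minor r k (p : 'M[F]_r) : \rank p = k ->
  exists (A : 'M[F]_(r, k)) (D : 'M[F]_(k, r)), D *m p *m A = 1%:M.
Proof.
move=> <-; exists (pinvmx (row_base p)), (pinvmx (col_base p)).
transitivity (pinvmx (col_base p) *m (col_base p *m row_base p) *m pinvmx (row_base p)).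
  by rewrite mulmx_base.
by rewrite mulmxA (mulVpmx (col_base_full p)) mul1mx mulmxVp// row_base_free.
Qed.

(** The columns of [s] lie in the image of [p] and have the same rank, so they span it. *)
Lemma col_span r k (p : 'M[F]_r) (s : 'M[F]_(r, k)) : p *m s = s ->
  \rank p = k -> \rank s = k -> exists Z : 'M[F]_(k, r), p = s *m Z.
Proof.
move=> ps rp rs; have : (s^T <= p^T)%MS by rewrite -ps trmx_mul submxMl.
move=> /mxrank_leqif_sup[_]; rewrite !mxrank_tr rp rs eqxx => /esym/submxP[Z ZE].
by exists Z^T; rewrite -[p]trmxK ZE trmx_mul trmxK.
Qed.

Lemma mxrank_unit_mul r k (A : 'M[F]_r) (B : 'M[F]_(r, k)) : A \in unitmx ->
  \rank (A *m B) = \rank B.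
Proof.
by move=> uA; rewrite -mxrank_tr trmx_mul mxrankMfree ?mxrank_tr// row_free_unit unitmx_tr.
Qed.

End RankFactorization.

Section HolomorphicSections.
Variables (R : realType) (n : nat) (X : ptopologicalType) (K : kahler R n X).
Local Notation C := (R[i]).
Local Notation hC := (kmanifold K).
Local Notation hM := (kmanifold K).1.
Variables (r : nat) (E : vbundle K r).

Lemma holo_local (U : set X) (f : X -> C) :
  (forall x, U x -> exists V, [/\ open V, V x & holo_on K V f]) -> holo_on K U f.
Proof.
move=> H; split; last by move=> a j x Ux; have [V [_ Vx [_ hV]]] := H x Ux; exact: hV.
split; apply: smooth_on_local => x Ux; have [V [oV Vx [[s1 s2] _]]] := H x Ux; by exists V.
Qed.

Definition holo_secs U k (s : X -> 'M[C]_(r, k)) :=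
  forall j : vidx E, holo_mx K (U `&` vdom j) (fun x => invmx (frame j x) *m s x).

Lemma holo_sectionE U (s : X -> 'cV[C]_r) : holo_section E U s <-> holo_secs U s.
Proof.
split=> H j u; last exact: H.
by move=> v; rewrite ord1; exact: H.
Qed.

Lemma holo_secs_frame U k (s : X -> 'M[C]_(r, k)) (i : vidx E) : open U -> U `<=` vdom i ->
  holo_mx K U (fun x => invmx (frame i x) *m s x) -> holo_secs U s.
Proof.
move=> oU Ui hs j; have oj : open (U `&` vdom j) by apply: openI => //; exact: vdom_open.
apply: (holo_mx_ext hM oj
  (Y := fun x => (invmx (frame j x) *m frame i x) *m (invmx (frame i x) *m s x))).
  by move=> x [Ux _]; rewrite mulmxA mulmxK// frame_unit//; exact: Ui.
apply: (holo_mxM hM oj); last by apply: holo_mx_sub hs => x [].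
by move=> u v; apply: holo_sub (frame_holo j i u v) => x [/Ui].
Qed.

Lemma holo_secs_sub U V k (s : X -> 'M[C]_(r, k)) : V `<=` U -> holo_secs U s -> holo_secs V s.
Proof. by move=> VU hs j; apply: holo_mx_sub (hs j) => x [/VU]. Qed.

Lemma holo_secs_local U k (s : X -> 'M[C]_(r, k)) :
  (forall x, U x -> exists V, [/\ open V, V x & holo_secs V s]) -> holo_secs U s.
Proof.
move=> H j u v; apply: holo_local => x [/H[V [oV Vx hV]] jx].
exists (V `&` vdom j); split => //; last exact: hV.
by apply: openI => //; exact: vdom_open.
Qed.

Lemma holo_secs_ext U k (s t : X -> 'M[C]_(r, k)) : open U -> (forall x, U x -> s x = t x) ->
  holo_secs U s -> holo_secs U t.
Proof.
move=> oU st hs j; apply: (holo_mx_ext hM _ _ (hs j)); last by move=> x [/st ->].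
by apply: openI => //; exact: vdom_open.
Qed.

End HolomorphicSections.

Section ProjectionSubmodule.
Variables (R : realType) (n : nat) (X : ptopologicalType) (K : kahler R n X).
Local Notation C := (R[i]).
Local Notation hC := (kmanifold K).
Local Notation hM := (kmanifold K).1.
Variables (r : nat) (E : vbundle K r) (P : X -> 'M[C]_r) (k : nat).
Hypothesis PP : forall x, P x *m P x = P x.
Hypothesis rkP : forall x, \rank (P x) = k.
Hypothesis hP : forall j : vidx E,
  holo_mx K (vdom j) (fun x => invmx (frame j x) *m P x *m frame j x).

Let oI U (j : vidx E) : open U -> open (U `&` vdom j).
Proof. by move=> oU; apply: openI => //; exact: vdom_open. Qed.

Lemma holo_secs_proj U q (s : X -> 'M[C]_(r, q)) : open U -> holo_secs E U s ->
  holo_secs E U (fun x => P x *m s x).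
Proof.
move=> oU hs j; have oj := oI j oU.
apply: (holo_mx_ext hM oj
  (Y := fun x => (invmx (frame j x) *m P x *m frame j x) *m (invmx (frame j x) *m s x))).
  by move=> x [_ jx]; rewrite -!mulmxA mulKVmx// frame_unit.
by apply: (holo_mxM hM oj) => //; apply: holo_mx_sub (hP j) => x [].
Qed.

Definition proj_sec U (s : X -> 'cV[C]_r) :=
  holo_section E U s /\ forall x, U x -> P x *m s x = s x.

Let secE U s : holo_section E U s <-> holo_secs E U s. Proof. exact: holo_sectionE. Qed.

Lemma proj_sec_holo U s : open U -> proj_sec U s -> holo_section E U s.
Proof. by move=> _ []. Qed.

Lemma proj_sec_ext U s t : open U -> (forall x, U x -> s x = t x) -> proj_sec U s -> proj_sec U t.
Proof.
move=> oU st [hs Ps]; split; last by move=> x Ux; rewrite -st// Ps.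
by apply/secE; apply: (holo_secs_ext oU st); exact/secE.
Qed.

Lemma proj_sec_restrict U U' s : open U -> open U' -> U' `<=` U -> proj_sec U s -> proj_sec U' s.
Proof.
move=> _ _ U'U [hs Ps]; split; last by move=> x /U'U; exact: Ps.
by apply/secE; apply: (holo_secs_sub U'U); exact/secE.
Qed.

Lemma proj_sec_glue U s : open U ->
  (forall x, U x -> exists U', [/\ open U', U' x & proj_sec U' s]) -> proj_sec U s.
Proof.
move=> _ H; split; last by move=> x Ux; have [U' [_ U'x [_]]] := H x Ux; exact.
apply/secE; apply: holo_secs_local => x /H[V [oV Vx [hs _]]]; exists V; split => //.
exact/secE.
Qed.

Lemma proj_sec0 U : open U -> proj_sec U (fun=> 0).
Proof.
move=> oU; split; last by move=> x _; rewrite mulmx0.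
move=> j u; apply: (holo_ext hM (oI j oU) _ (holo_cst _ _ 0)) => x _.
by rewrite mulmx0 mxE.
Qed.

Lemma proj_secD U s t : open U -> proj_sec U s -> proj_sec U t -> proj_sec U (fun x => s x + t x).
Proof.
move=> oU [hs Ps] [ht Pt]; split; last by move=> x Ux; rewrite mulmxDr Ps// Pt.
move=> j u; apply: (holo_ext hM (oI j oU) _ (holoD hM (oI j oU) (hs j u) (ht j u))) => x _.
by rewrite mulmxDr [RHS]mxE.
Qed.

Lemma proj_secZ U f s : open U -> holo_on K U f -> proj_sec U s -> proj_sec U (fun x => f x *: s x).
Proof.
move=> oU hf [hs Ps]; split; last by move=> x Ux; rewrite -scalemxAr Ps.
move=> j u; have hf' : holo_on K (U `&` vdom j) f by apply: holo_sub hf => x [].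
apply: (holo_ext hM (oI j oU) _ (holoM hM (oI j oU) hf' (hs j u))) => x _.
by rewrite -scalemxAr [RHS]mxE.
Qed.

Lemma holo_secs_frame_cols (j : vidx E) : holo_secs E (vdom j) (frame j).
Proof.
apply: (holo_secs_frame (i := j)) => //; first exact: vdom_open.
apply: (holo_mx_ext hM (vdom_open j) _ (holo_mx_cst _ _ _)) => x jx.
by rewrite mulVmx// frame_unit.
Qed.

Lemma holo_secsMc U q q' (s : X -> 'M[C]_(r, q)) (A : X -> 'M[C]_(q, q')) : open U ->
  holo_secs E U s -> holo_mx K U A -> holo_secs E U (fun x => s x *m A x).
Proof.
move=> oU hs hA j; apply: (holo_mx_ext hM (oI j oU)
  (Y := fun x => (invmx (frame j x) *m s x) *m A x)); first by move=> x _; rewrite mulmxA.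
by apply: (holo_mxM hM (oI j oU)) => //; apply: holo_mx_sub hA => x [].
Qed.

Lemma holo_secs_col U q (s : X -> 'M[C]_(r, q)) i : open U -> holo_secs E U s ->
  holo_section E U (fun x => col i (s x)).
Proof.
move=> oU hs j u; apply: (holo_ext hM (oI j oU) _ (hs j u i)) => x _.
by rewrite colE mulmxA -colE [RHS]mxE.
Qed.

(** The columns of [P] times a holomorphic frame generate: a section [t = P t] is their combination
    with the coordinates of [t] as coefficients. *)
Lemma proj_sec_coherent x : exists U (m : nat) (g : 'I_m -> X -> 'cV[C]_r),
    [/\ open U, U x, forall i, proj_sec U (g i)
      & forall y U' t, U y -> open U' -> U' y -> proj_sec U' t ->
          exists W (c : 'I_m -> X -> C),
            [/\ open W, W y, W `<=` U `&` U', forall i, holo_on K W (c i)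
              & forall z, W z -> t z = \sum_i c i z *: g i z]].
Proof.
pose j := frame_at E x; have oj : open (vdom j) by exact: vdom_open.
have hs := holo_secs_proj oj (holo_secs_frame_cols j).
exists (vdom j), r, (fun i y => col i (P y *m frame j y)); split => //.
- exact: vdom_frame_at.
- move=> i; split; first exact: holo_secs_col.
  by move=> y _; rewrite colE !mulmxA PP.
move=> y U' t jy oU' U'y [ht Pt].
exists (U' `&` vdom j), (fun i z => (invmx (frame j z) *m t z) i 0); split => //.
- exact: oI.
- by move=> z [].
move=> z [U'z jz]; rewrite -[LHS]Pt// -[in LHS](mulKVmx (frame_unit jz) (t z)) (mulmxA (P z)).
move: (P z *m frame j z) (invmx (frame j z) *m t z) => A v; apply/matrixP => p q; rewrite ord1 mxE summxE.
by apply: eq_bigr => l _; rewrite !mxE mulrC.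
Qed.

Definition proj_submodule : submodule E := @Submodule _ _ _ _ _ E proj_sec
  proj_sec_holo proj_sec_ext proj_sec_restrict proj_sec_glue proj_sec0 proj_secD proj_secZ
  proj_sec_coherent.

(** If [f s] is fixed by [P], then [f] annihilates every coordinate of [P s - s]. These coordinates
    are holomorphic, and since the germ of [f] at [x] is nonzero, the identity theorem makes them
    vanish near [x]. *)
Lemma proj_submodule_saturated : saturated proj_submodule.
Proof.
move=> U x f s oU Ux hf hs f0 [_ Pfs].
pose j := frame_at E x; have jx : vdom j x by exact: vdom_frame_at.
pose V := U `&` vdom j; have oV : open V by exact: oI.
pose g y := invmx (frame j y) *m P y *m s y - invmx (frame j y) *m s y.
have hg : holo_mx K V g.
  have h1 := holo_secs_proj oU (iffLR (secE U s) hs) j.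
  have h2 := iffLR (secE U s) hs j.
  apply: (holo_mx_ext hM oV _ (holo_mxD hM oV h1 (holo_mxN hM oV h2))) => y _.
  by rewrite /g mulmxA.
have fg y u : V y -> f y * g y u 0 = 0.
  move=> [Uy jy]; have E1 := Pfs y Uy.
  have : f y *: g y = 0.
    by rewrite /g scalerBr -[_ *m P y *m _]mulmxA !scalemxAr E1 subrr.
  by move=> /(congr1 (fun A : 'cV[C]_r => A u 0)); rewrite !mxE.
have gN u : nbhs x [set y | g y u 0 = 0].
  have [||||W [oW Wx WV gW]] := @holo_identity _ _ _ _ hC V x f (fun y => g y u 0) oV (conj Ux jx).
  - by apply: holo_sub hf => y [].
  - exact: hg.
  - move=> W oW Wx; have [|y [Uy [Wy jy]] fy] := f0 (W `&` vdom j) (oI j oW); first by [].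
    by exists y.
  - by move=> y; exact: fg.
  apply: filterS (open_nbhs_nbhs (conj oW Wx)) => y; exact: gW.
have : nbhs x [set y | (forall u, g y u 0 = 0) /\ V y].
  by apply: filterI; [exact: filter_forall|exact: open_nbhs_nbhs].
rewrite nbhsE => -[W [oW Wx] WH]; exists W; split => //.
  by move=> y /WH[_ []].
split; first by apply/secE; apply: holo_secs_sub (iffLR (secE U s) hs) => y /WH[_ []].
move=> y /WH[g0 [Uy jy]]; have : g y = 0 by apply/matrixP => u v; rewrite ord1 g0 mxE.
move=> /eqP; rewrite subr_eq0 => /eqP; rewrite -mulmxA => /(congr1 (mulmx (frame j y))).
by rewrite !mulKVmx// frame_unit.
Qed.

(** In a frame, [P] becomes a holomorphic matrix [p]. Where the compression [D p A] chosen at [x]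
    stays invertible, the columns of [P] times the frame times [A] form a frame of the image, and
    [(D p A)^-1 D] recovers the coefficients of a section holomorphically. *)
Lemma proj_subframe_near (x : X) : @subframe_near _ _ _ _ _ _ proj_submodule k x !=set0.
Proof.
pose j := frame_at E x; have jx : vdom j x by exact: vdom_frame_at.
pose p y := invmx (frame j y) *m P y *m frame j y.
have rp y : vdom j y -> \rank (p y) = k.
  move=> jy; rewrite /p mxrankMfree ?row_free_unit ?frame_unit//.
  by rewrite mxrank_unit_mul ?unitmx_inv ?frame_unit.
have pp y : vdom j y -> p y *m p y = p y.
  by move=> jy; rewrite /p !mulmxA mulmxK ?frame_unit// -[_ *m P y *m P y]mulmxA PP.
have [A [D DA]] := rank_minor (rp x jx).
have hDA : holo_mx K (vdom j) (fun y => D *m p y *m A).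
  apply: (holo_mxM hM); [exact: vdom_open| |exact: holo_mx_cst].
  by apply: (holo_mxM hM); [exact: vdom_open|exact: holo_mx_cst|exact: hP].
have hd := holo_det hM (vdom_open j) hDA.
have nd : nbhs x [set y | \det (D *m p y *m A) != 0].
  by apply: (holo_neq0_near hC (vdom_open j) jx hd); rewrite DA det1 oner_neq0.
have : nbhs x [set y | \det (D *m p y *m A) != 0 /\ vdom j y].
  by apply: filterI => //; apply: open_nbhs_nbhs; split => //; exact: vdom_open.
rewrite nbhsE => -[U [oU Ux] UH].
have Uj y : U y -> vdom j y by move=> /UH[].
have uD y : U y -> D *m p y *m A \in unitmx by move=> /UH[dn _]; rewrite unitmxE unitfE.
pose s y := P y *m frame j y *m A.
have hs : holo_secs E U s.
  apply: (holo_secsMc oU); last exact: holo_mx_cst.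
  by apply: (holo_secs_proj oU); apply: holo_secs_sub (holo_secs_frame_cols j) => y /Uj.
have fs y : U y -> invmx (frame j y) *m s y = p y *m A by rewrite /s /p !mulmxA.
have rs y : U y -> \rank (s y) = k.
  move=> Uy; apply/eqP; rewrite eqn_leq rank_leq_col /=.
  have := mxrankM_maxr (D *m invmx (frame j y)) (s y).
  by rewrite -mulmxA fs// mulmxA mxrank_unit// uD.
exists s; exists U; split => //; split => //.
  by move=> i; split; [exact: holo_secs_col|move=> y Uy; rewrite colE /s !mulmxA PP].
move=> W t oW WU [ht Pt].
exists (fun y => invmx (D *m p y *m A) *m (D *m (invmx (frame j y) *m t y))); split.
  have hc : holo_mx K W (fun y => invmx (D *m p y *m A) *m (D *m (invmx (frame j y) *m t y))).
    apply: (holo_mxM hM oW).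
      apply: (holo_mx_inv hM oW); first by move=> y /WU/uD.
      by apply: holo_mx_sub hDA => y /WU/Uj.
    apply: (holo_mxM hM oW); first exact: holo_mx_cst.
    by apply: holo_mx_sub (iffLR (secE W t) ht j) => y Wy; split => //; exact/Uj/WU.
  by move=> i; exact: hc.
move=> y /[dup] Wy /WU Uy; have jy := Uj y Uy.
have rpA : \rank (p y *m A) = k.
  by rewrite -fs// mxrank_unit_mul ?unitmx_inv ?frame_unit ?rs.
have ppA : p y *m (p y *m A) = p y *m A by rewrite mulmxA pp.
have [Z pE] := col_span ppA (rp y jy) rpA.
have pt : p y *m (invmx (frame j y) *m t y) = invmx (frame j y) *m t y.
  by rewrite /p -!mulmxA mulKVmx ?frame_unit// Pt.
have tE : invmx (frame j y) *m t y = p y *m A *m (Z *m (invmx (frame j y) *m t y)).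
  by rewrite mulmxA -pE pt.
rewrite -[t y](mulKVmx (frame_unit jy)) {1}tE.
have -> : invmx (D *m p y *m A) *m (D *m (invmx (frame j y) *m (frame j y *m (invmx (frame j y) *m t y)))) =
    Z *m (invmx (frame j y) *m t y).
  rewrite mulKmx ?frame_unit//; move: (p y) (invmx (frame j y) *m t y) tE (uD y Uy) => q v E1 uq.
  have -> : D *m v = D *m q *m A *m (Z *m v) by rewrite {1}E1 !mulmxA.
  by rewrite mulKmx.
have <- : frame j y *m (p y *m A) = s y by rewrite -fs// mulKVmx// frame_unit.
by move: (p y *m A) (Z *m _) => B v; exact: mulmxA.
Qed.

Lemma proj_regular_locus : regular_locus proj_submodule k = setT.
Proof. by apply/seteqP; split => // x _; exact: proj_subframe_near. Qed.

Lemma proj_has_rank : has_rank proj_submodule k.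
Proof. by rewrite /has_rank proj_regular_locus => U [x Ux] _; exists x. Qed.

End ProjectionSubmodule.

(** * Equivariance of the image of an equivariant projection *)

Section EquivariantProjection.
Variables (R : realType) (m n : nat) (G : topologicalType) (X : ptopologicalType).
Variables (L : lie_group R m G) (K : kahler R n X) (kappa : action L K).
Local Notation C := (R[i]).
Local Notation hC := (kmanifold K).
Local Notation hM := (kmanifold K).1.
Variables (r : nat) (E : vbundle K r) (T : equivariant kappa E).

Lemma gmulVr g : gmul L g (ginv L g) = gone L.
Proof.
have h := gmulV L (ginv L g).
rewrite -[LHS](gmul1 L) -h -(gmulA L) (gmulA L (ginv L g) g) (gmulV L) (gmul1 L).
by [].
Qed.

Lemma Theta1 x : T (gone L) x = 1%:M.
Proof.
have := ThetaM T (gone L) (gone L) x; rewrite (gmul1 L) act1 => E1.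
have := mulKmx (Theta_unit T (gone L) x) (T (gone L) x).
by rewrite -E1 mulVmx ?Theta_unit// => ->.
Qed.

Lemma act_continuous g : continuous (kappa g).
Proof. by have [[]] := act_isometry kappa g. Qed.

Lemma act_inv g x : kappa (ginv L g) (kappa g x) = x.
Proof. by rewrite -actM gmulV act1. Qed.

Lemma act_invr g x : kappa g (kappa (ginv L g) x) = x.
Proof. by rewrite -actM gmulVr act1. Qed.

Lemma act_image g U : kappa g @` U = kappa (ginv L g) @^-1` U.
Proof.
apply/seteqP; split=> [_ [x Ux <-]|y Uy] /=; first by rewrite act_inv.
by exists (kappa (ginv L g) y) => //; rewrite act_invr.
Qed.

Lemma act_image_open g U : open U -> open (kappa g @` U).
Proof. by move=> oU; rewrite act_image; apply: open_comp => // x _; exact: act_continuous. Qed.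

Lemma holo_secs_pullback g U q (s : X -> 'M[C]_(r, q)) : open U ->
  holo_secs E (kappa g @` U) s -> holo_secs E U (fun x => T g x *m s (kappa g x)).
Proof.
move=> oU hs; apply: holo_secs_local => x Ux.
pose i := frame_at E (kappa g x); have ix : vdom i (kappa g x) by exact: vdom_frame_at.
pose j := frame_at E x; have jx : vdom j x by exact: vdom_frame_at.
have og := act_image_open g oU.
have oi : open (kappa g @` U `&` vdom i) by apply: openI => //; exact: vdom_open.
have oj : open (vdom j) by exact: vdom_open.
pose V := U `&` (vdom j `&` kappa g @^-1` (kappa g @` U `&` vdom i)).
have oV : open V.
  apply: openI => //; apply: openI => //; apply: open_comp => // y _; exact: act_continuous.
exists V; split; [exact: oV|exact: (conj Ux (conj jx (conj (ex_intro2 _ _ x Ux erefl) ix)))|].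
apply: (holo_secs_frame (i := j)) => //; first by move=> y [_ []].
apply: (holo_mx_ext hM oV (Y := fun y => (invmx (frame j y) *m T g y *m frame i (kappa g y)) *m
    (invmx (frame i (kappa g y)) *m s (kappa g y)))).
  by move=> y [_ [_ [_ iy]]]; rewrite mulmxA mulmxK ?frame_unit// mulmxA.
apply: (holo_mxM hM oV) => u v.
  by apply: holo_sub (Theta_holo T g i j u v) => y [_ [? [_ ?]]].
have [hg _] := act_isometry kappa g.
by apply: holo_sub (holo_comp hC hg oi (hs i u v)) => y [_ [_ ?]].
Qed.

Variables (P : X -> 'M[C]_r) (k : nat).
Hypothesis PP : forall x, P x *m P x = P x.
Hypothesis hP : forall j : vidx E,
  holo_mx K (vdom j) (fun x => invmx (frame j x) *m P x *m frame j x).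
Hypothesis PT : forall g x, T g x *m P (kappa g x) = P x *m T g x.

Lemma proj_sec_pullback g U s : open U -> proj_sec E P (kappa g @` U) s ->
  proj_sec E P U (fun x => T g x *m s (kappa g x)).
Proof.
move=> oU [hs Ps]; split.
  by apply/holo_sectionE; apply: holo_secs_pullback => //; apply/holo_sectionE.
by move=> x Ux; rewrite mulmxA -PT -mulmxA Ps//; exists x.
Qed.

Lemma proj_submodule_equivariant : equivariant_submodule T (proj_submodule PP hP).
Proof.
move=> g U s oU; split; first exact: proj_sec_pullback.
move=> H; have og := act_image_open g oU.
have UE : kappa (ginv L g) @` (kappa g @` U) = U.
  by apply/seteqP; split=> [_ [_ [x Ux <-] <-]|x Ux]; [rewrite act_inv|exists (kappa g x); rewrite ?act_inv//; exists x].
(* The converse is the direct implication for the inverse of [g], applied over the translate of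
   [U]. *)
have := @proj_sec_pullback (ginv L g) (kappa g @` U) (fun x => T g x *m s (kappa g x)) og.
rewrite UE => /(_ H); apply: proj_sec_ext => // y _.
by rewrite mulmxA -ThetaM gmulVr Theta1 mul1mx act_invr.
Qed.

End EquivariantProjection.

(** * Hermitian-Einstein metrics with the same determinant *)

Lemma tr_ratio_real (R : realType) r (H1 H2 : 'M[R[i]]_r) : posdef H1 -> posdef H2 ->
  \tr (invmx H1 *m H2) = (complex.Re (\tr (invmx H1 *m H2)))%:C%C.
Proof.
move=> pH1 pH2; apply: complex_real_eq.
have : Num.conj (\tr (invmx H1 *m H2)) = \tr (invmx H1 *m H2).
  by rewrite -tr_adjmx adjmxM adjmx_inv pH1.1 pH2.1; exact: mxtrace_mulC.
by case: (\tr _) => p q [] /= ; lra.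
Qed.

(** [A - B] is a scalar matrix whose scalar has real part 0, and [M] has real trace. With [A], [B]
    the contracted curvatures of two Hermitian-Einstein metrics, this removes the curvature term
    from the Laplacian of [Tr b]. *)
Lemma Re_tr_scalar_diff (R : realType) r (A B M : 'M[R[i]]_r) :
  A = (\tr A / r%:R)%:M -> B = (\tr B / r%:R)%:M ->
  complex.Re (\tr A) = complex.Re (\tr B) -> \tr M = (complex.Re (\tr M))%:C%C ->
  complex.Re (\tr ((A - B) *m M)) = 0.
Proof.
move=> AE BE uv trM; rewrite AE BE; move: (\tr A) (\tr B) uv => u v uv.
rewrite -raddfB mul_scalar_mx mxtraceZ trM; move: (\tr M) => t /=.
have -> : r%:R^-1 = (r%:R^-1 : R)%:C%C :> R[i] by rewrite fmorphV rmorph_nat.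
move: (r%:R^-1) (complex.Re t) => d e; case: u v uv => u1 u2 [v1 v2] /= ->; ring.
Qed.

Section BundleMetric.
Variables (R : realType) (n : nat) (X : ptopologicalType) (K : kahler R n X).
Local Notation C := (R[i]).
Local Notation hC := (kmanifold K).
Local Notation hM := (kmanifold K).1.

Lemma posdef_gram r k (H : 'M[C]_r) (s : 'M[C]_(r, k)) : posdef H -> \rank s = k ->
  posdef (adjmx s *m H *m s).
Proof.
move=> [aH pH] rs; split; first by rewrite !adjmxM adjmxK aH mulmxA.
move=> v v0; have -> : hsqnorm (adjmx s *m H *m s) v = hsqnorm H (s *m v).
  by rewrite /hsqnorm adjmxM !mulmxA.
apply: pH; apply: contra_neq v0 => sv0; apply: trmx_inj; rewrite trmx0; apply/eqP.
rewrite -(@mulmx_free_eq0 _ _ _ _ _ s^T) ?/row_free ?mxrank_tr ?rs//.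
by rewrite -trmx_mul sv0 trmx0.
Qed.

Lemma csx_holo (a : idx K) U p q (Y : X -> 'M[C]_(p, q)) : U `<=` dom a -> holo_mx K U Y ->
  csx a U Y /\ forall l y, U y -> dmx a false l Y y = 0.
Proof.
move=> Ua hY; split=> [u v|l y Uy].
  by have [+ _] := (holoP _ _ _).1 (hY u v) a; rewrite (setIidl Ua).
apply/matrixP => u v; rewrite !mxE; have [_ ->] := (holoP _ _ _).1 (hY u v) a => //.
exact: Ua.
Qed.

Variables (r : nat) (E : vbundle K r).

Lemma csx_gram_frame h (a : idx K) (j : vidx E) U : hermitian_metric E h ->
  U `<=` dom a -> U `<=` vdom j -> csx a U (gram h (frame j)).
Proof. by move=> [_ sh] Ua Uj u v; exact: (csmooth_csm Ua (sh j u v)). Qed.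

Lemma posdef_gram_frame h (j : vidx E) y : hermitian_metric E h -> vdom j y ->
  posdef (gram h (frame j) y).
Proof. by move=> [ph _] jy; apply: posdef_gram => //; exact/mxrank_unit/frame_unit. Qed.

Definition chart_frame_dom x : set X := dom (chart_at K x) `&` vdom (frame_at E x).

Lemma chart_frame_dom_open x : open (chart_frame_dom x).
Proof. by apply: openI; [exact: (dom_open hM)|exact: vdom_open]. Qed.

Lemma chart_frame_dom_self x : chart_frame_dom x x.
Proof. by split; [exact: (dom_chart_at hM)|exact: vdom_frame_at]. Qed.

Lemma chart_frame_dom_sub x : chart_frame_dom x `<=` dom (chart_at K x). Proof. by move=> y []. Qed.

Lemma csx_gram_at h x : hermitian_metric E h -> csx (chart_at K x) (chart_frame_dom x) (gram_at E h x).
Proof. by move=> hh; apply: csx_gram_frame => // y []. Qed.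

Lemma posdef_gram_at h x y : hermitian_metric E h -> chart_frame_dom x y -> posdef (gram_at E h x y).
Proof. by move=> hh [_ jy]; exact: posdef_gram_frame. Qed.

Lemma gram_ratio h1 h2 (j : vidx E) y : hermitian_metric E h1 -> vdom j y ->
  invmx (gram h1 (frame j) y) *m gram h2 (frame j) y =
  invmx (frame j y) *m (invmx (h1 y) *m h2 y) *m frame j y.
Proof.
move=> [ph1 _] jy; have ue := frame_unit jy; have uh := posdef_unit (ph1 y).
have ua : adjmx (frame j y) \in unitmx by rewrite adjmx_unit.
rewrite /gram invmx_mul ?unitmx_mul ?ua// invmx_mul// -!mulmxA; congr (_ *m (_ *m _)).
by rewrite mulKmx.
Qed.

Lemma det_gram_frame h (j : vidx E) y :
  \det (gram h (frame j) y) = Num.conj (\det (frame j y)) * \det (frame j y) * \det (h y).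
Proof. by rewrite /gram !det_mulmx det_adjmx; ring. Qed.

(** By [degree_density_lap] only the determinants of the Gram matrices enter. *)
Lemma degree_density_same_det h1 h2 x : hermitian_metric E h1 -> hermitian_metric E h2 ->
  same_det h1 h2 -> degree_density K (gram_at E h1 x) x = degree_density K (gram_at E h2 x) x.
Proof.
move=> hh1 hh2 sd; have oN := @chart_frame_dom_open x; have Nx := @chart_frame_dom_self x; have Nd := @chart_frame_dom_sub x.
rewrite (degree_density_lap oN Nx Nd (csx_gram_at x hh1)); last by move=> y; exact: posdef_gram_at.
rewrite (degree_density_lap oN Nx Nd (csx_gram_at x hh2)); last by move=> y; exact: posdef_gram_at.
by apply: (laplacian_ext K oN Nx) => y _; rewrite /gram_at !det_gram_frame sd.
Qed.

Lemma contraction_einstein h x : hermitian_einstein E h ->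
  let A := contraction K x (chern_curvature K (gram_at E h x) x) in
  A = (\tr A / r%:R)%:M.
Proof.
move=> /(_ x); rewrite Lambda_mxE => /eqP; rewrite scaler_eq0 => /orP[/eqP[]|/eqP].
  by move=> _ /eqP; rewrite oppr_eq0 oner_eq0.
move=> c0 A; apply/eqP; rewrite -subr_eq0; apply/eqP; rewrite -[RHS]c0.
rewrite /A -[\tr _]/(\tr (contraction K x (chern_curvature K (gram_at E h x) x))).
have trE : \tr (contraction K x (chern_curvature K (gram_at E h x) x)) =
    \sum_l \sum_j invmx (gmx K x) l j * \tr (chern_curvature K (gram_at E h x) x j l).
  rewrite -[contraction _ _ _]mulmx1 tr_contraction; apply: eq_bigr => l _.
  by apply: eq_bigr => j _; rewrite mulmx1.
rewrite trE mulr_suml raddf_sum -sumrB; apply: eq_bigr => l _ /=.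
rewrite mulr_suml raddf_sum -sumrB; apply: eq_bigr => j _ /=.
by rewrite /trace_free scalerBr scale_scalar_mx mulrA.
Qed.

End BundleMetric.

Section Harmonic.
Variables (R : realType) (n : nat) (X : ptopologicalType) (K : kahler R n X).
Local Notation mu := (dvol K).
Local Notation hM := (kmanifold K).1.

Lemma laplacian_le_smooth (f : X -> R) : smooth_on K setT f -> (forall x, lap K f x <= 0) ->
  laplacian_le K f (fun=> 0).
Proof.
move=> sf lf chi [schi cS] chi0; rewrite (eq_integral (fun x : borel X => (f x * lap K chi x)%:E)); last first.
  by move=> x _; rewrite lapE.
have [E1 E2] := integral_lap_gam schi sf cS; rewrite E2 -E1.
under [leRHS]eq_integral do rewrite mul0r.
rewrite integral0.
have -> : (\int[mu]_x (chi x * lap K f x)%:E = \int[mu]_x (- (- (chi x * lap K f x))%:E))%E.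
  by apply: eq_integral => x _; rewrite -EFinN opprK.
have g0 x : 0 <= - (chi x * lap K f x) by rewrite oppr_ge0 mulr_ge0_le0.
rewrite integral_ge0N; last by move=> x _; rewrite lee_fin.
by rewrite oppe_le0; apply: integral_ge0 => x _; rewrite lee_fin.
Qed.

(** Testing against a bump at a point where the Laplacian is negative gives a continuous integrand
    of one sign with integral 0, although it is nonzero on an open set, which has positive
    volume. *)
Lemma harmonic_smooth_le (f : X -> R) : smooth_on K setT f -> (forall x, lap K f x <= 0) ->
  Defs.harmonic K f -> forall x, lap K f x = 0.
Proof.
move=> sf lf hf x; apply/eqP; rewrite eq_le lf leNgt; apply/negP => lx.
have ax : dom (chart_at K x) x by exact: (dom_chart_at hM).
have [chi [A [schi chi0 cA Aa [A0 chix]]]] := smooth_test_bump hM ax.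
have clA : closed A by exact: (compact_closed_X K).
have cS : compact (closure [set x | chi x != 0]).
  apply: (subclosed_compact _ cA); first exact: closed_closure.
  move=> y cy; apply: clA; move: y cy; apply: closureS => y /= cy.
  by apply: contrapT => /A0 E; rewrite E eqxx in cy.
have [E1 E2] := integral_lap_gam schi sf cS.
have := hf chi (conj schi cS).
rewrite (eq_integral (fun x : borel X => (f x * lap K chi x)%:E)); last by move=> y _; rewrite lapE.
rewrite E2 -E1 => I0.
have slf : smooth_on K setT (lap K f) by apply: laplacian_smooth => //; exact: openT.
pose g y := - (chi y * lap K f y).
have sg : smooth_on K setT g by apply: (smooth_onN hM openT); exact: (smooth_onM hM openT).
have cg : continuous g by exact: (smooth_on_continuous hM).
have g0 y : 0 <= g y by rewrite /g oppr_ge0 mulr_ge0_le0.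
have mg : measurable_fun setT (g : borel X -> R).
  exact: measurable_fun_continuous.
have Ig : (\int[mu]_y (g y)%:E = 0)%E.
  have : (\int[mu]_y (- (g y)%:E))%E = 0%E.
    rewrite -[RHS]I0; apply: eq_integral => y _; by rewrite -EFinN /g opprK.
  rewrite integral_ge0N; last by move=> y _; rewrite lee_fin.
  by move=> /eqP; rewrite oppe_eq0 => /eqP.
have gx : 0 < g x by rewrite /g oppr_gt0 pmulr_rlt0.
pose U := [set y | g x / 2 < g y].
have oU : open U.
  rewrite (_ : U = g @^-1` `]g x / 2, +oo[%classic); last by apply/seteqP; split=> y; rewrite /= in_itv/= andbT.
  by apply: open_comp => [y _|]; [exact: cg|exact: interval_open].
have Ux : U x by rewrite /U /= ltr_pdivrMr// mulr_natr mulr2n ltrDl.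
have := dvol_open_gt0 K oU Ux; apply/negP; rewrite -leNgt.
have mU : measurable (U : set (borel X)) by exact: sub_sigma_algebra.
have H : ((g x / 2)%:E * mu U <= 0)%E.
  rewrite -Ig -integral_cst//; apply: (@le_trans _ _ (\int[mu]_(y in U) (g y)%:E)%E).
    apply: ge0_le_integral => //; try by move=> y _; rewrite lee_fin ?divr_ge0// ltW.
    - by apply/measurable_EFinP; exact: measurable_funS mg.
    - by move=> y Uy; rewrite lee_fin ltW.
  apply: ge0_subset_integral => //; first exact/measurable_EFinP.
  by move=> y _; rewrite lee_fin.
have g2 : 0 < g x / 2 by rewrite divr_gt0.
rewrite leNgt; apply/negP => mU0; move: H; rewrite leNgt => /negP; apply.
by rewrite mule_gt0.
Qed.

End Harmonic.

Section TwoBundleMetrics.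
Variables (R : realType) (n : nat) (X : ptopologicalType) (K : kahler R n X).
Local Notation C := (R[i]).
Local Notation mu := (dvol K).
Local Notation hC := (kmanifold K).
Local Notation hM := (kmanifold K).1.
Variables (r' : nat) (E : vbundle K r'.+1) (h1 h2 : X -> 'M[C]_r'.+1) (c : R).
Hypotheses (hh1 : hermitian_metric E h1) (hh2 : hermitian_metric E h2).
Hypotheses (he1 : hermitian_einstein E h1) (he2 : hermitian_einstein E h2).
Hypothesis sd : same_det h1 h2.
Hypothesis h12 : forall x v, hsqnorm (h2 x) v <= c * hsqnorm (h1 x) v.
Hypothesis maximum_principle : forall f : X -> R, bounded_measurable f ->
  laplacian_le K f (fun=> 0) -> Defs.harmonic K f.

(** The endomorphism in the arbitrary fibre bases, where it has no regularity but all purely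
    algebraic statements can be made. [ratio_at x] is the same endomorphism in the holomorphic frame
    chosen at [x], where it can be differentiated; the two are conjugate. *)
Definition metric_ratio y := invmx (h1 y) *m h2 y.
Definition ratio_at x y := invmx (gram_at E h1 x y) *m gram_at E h2 x y.

Lemma ratio_atE x y : chart_frame_dom E x y ->
  ratio_at x y = invmx (frame (frame_at E x) y) *m metric_ratio y *m frame (frame_at E x) y.
Proof. by move=> [_ jy]; exact: gram_ratio. Qed.

Lemma tr_rpoly_ratio q x y : chart_frame_dom E x y -> \tr (rpoly q (ratio_at x y)) = \tr (rpoly q (metric_ratio y)).
Proof.
move=> Ny; have ue : frame (frame_at E x) y \in unitmx by apply: frame_unit; have [] := Ny.
by rewrite ratio_atE// rpoly_conj// mxtrace_mulC mulmxA mulmxV// mul1mx.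
Qed.

Let pd1 x y : chart_frame_dom E x y -> posdef (gram_at E h1 x y).
Proof. by move=> Ny; exact: posdef_gram_at. Qed.
Let pd2 x y : chart_frame_dom E x y -> posdef (gram_at E h2 x y).
Proof. by move=> Ny; exact: posdef_gram_at. Qed.

Let oN x := chart_frame_dom_open E x.
Let Nd x := @chart_frame_dom_sub _ _ _ _ _ E x.

Lemma csx_ratio_at x : csx (chart_at K x) (chart_frame_dom E x) (ratio_at x).
Proof.
apply: (csxM hM (oN x) (@Nd x)); last exact: csx_gram_at.
apply: (csx_inv hM (oN x) (@Nd x)); last exact: csx_gram_at.
by move=> y /pd1/posdef_unit.
Qed.

Lemma rpolyX (q : 'M[C]_r'.+1) : rpoly 'X q = q.
Proof. by rewrite /rpoly map_polyX horner_mx_X. Qed.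

Let f y := complex.Re (\tr (metric_ratio y)).

Lemma tr_ratio_at x y : chart_frame_dom E x y -> \tr (ratio_at x y) = \tr (metric_ratio y).
Proof. by move=> Ny; have := tr_rpoly_ratio 'X Ny; rewrite !rpolyX. Qed.

Lemma smooth_tr_ratio : smooth_on K setT f.
Proof.
apply: smooth_on_local => x _; exists (chart_frame_dom E x); split; [exact: chart_frame_dom_open|exact: chart_frame_dom_self|].
have Ctr := csx_tr hM (oN x) (@Nd x) (csx_ratio_at x).
have [s1 _] := csm_csmooth hM (oN x) (@Nd x) Ctr.
apply: (smooth_on_ext hM _ _ s1); first exact: chart_frame_dom_open.
by move=> y Ny; rewrite tr_ratio_at.
Qed.

Lemma tr_ratio_bound x : 0 <= f x <= r'.+1%:R * c.
Proof. by apply: Re_tr_invmx_le; [exact: hh1.1|exact: hh2.1|exact: h12]. Qed.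

Let form x := complex.Re (\sum_l \sum_j invmx (gmx K x) l j *
  \tr (invmx (gram_at E h1 x x) *m
    adjmx (mconn K x (gram_at E h2 x) l x - mconn K x (gram_at E h1 x) l x) *m
    gram_at E h2 x x *m (mconn K x (gram_at E h2 x) j x - mconn K x (gram_at E h1 x) j x))).

Let pg x : posdef (gmx K x).
Proof. by apply: kmetric_posdef; exact: (dom_chart_at hM). Qed.

Let Nx x : chart_frame_dom E x x. Proof. exact: chart_frame_dom_self. Qed.

Lemma lap_tr_einstein x : lap K f x = - form x.
Proof.
rewrite (@lap_tr_ratio _ _ _ K x (chart_frame_dom E x) (oN x) (Nx x) (@Nd x) _
  (gram_at E h1 x) (gram_at E h2 x) (csx_gram_at x hh1) (csx_gram_at x hh2) (@pd1 x) (@pd2 x));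
  last by move=> y Ny; rewrite -[f y]/(complex.Re (\tr (metric_ratio y))) -(tr_ratio_at Ny).
rewrite -/(form x); set Z := complex.Re (\tr (_ *m _)); suff -> : Z = 0 by rewrite subr0.
have CE F G : contraction K x (fun j l : 'I_n => F j l - G j l) = contraction K x F - contraction K x G :> 'M[C]_r'.+1.
  rewrite /contraction -sumrB; apply: eq_bigr => l _; rewrite -sumrB.
  by apply: eq_bigr => j _; rewrite scalerBr.
have dE := degree_density_same_det x hh1 hh2 sd; rewrite !degree_densityE in dE.
rewrite /Z CE; apply: Re_tr_scalar_diff dE _.
- exact: contraction_einstein.
- exact: contraction_einstein.
- exact: tr_ratio_real (pd1 (Nx x)) (pd2 (Nx x)).
Qed.

Lemma mconn_eq x j : mconn K x (gram_at E h2 x) j x = mconn K x (gram_at E h1 x) j x.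
Proof.
have form_ge0 y : 0 <= form y by apply: trace_form_ge0; [exact: pg|exact: pd1|exact: pd2].
have lf y : lap K f y <= 0 by rewrite lap_tr_einstein oppr_le0.
have bf : bounded_measurable f.
  split; first by apply: measurable_fun_continuous; exact: (smooth_on_continuous hM smooth_tr_ratio).
  exists (r'.+1%:R * c) => y; have /andP[f0 fc] := tr_ratio_bound y; by rewrite ger0_norm.
have hf := maximum_principle bf (laplacian_le_smooth smooth_tr_ratio lf).
have := harmonic_smooth_le smooth_tr_ratio lf hf x; rewrite lap_tr_einstein => /eqP.
rewrite oppr_eq0 => /eqP f0; apply/eqP; rewrite -subr_eq0; apply/eqP.
exact: (trace_form_eq0 (pg x) (pd1 (Nx x)) (pd2 (Nx x)) f0 j).
Qed.

Let p q x y := rpoly q (ratio_at x y).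

Lemma csx_rpoly q x : csx (chart_at K x) (chart_frame_dom E x) (p q x).
Proof.
rewrite /p; elim/poly_ind: q => [|q e IH].
  apply: (csx_ext hM (oN x) (@Nd x) _ (csx_cst _ _ 0)) => y _; by rewrite rpoly0.
apply: (csx_ext hM (oN x) (@Nd x) _ (csxD hM (oN x) (@Nd x)
  (csxM hM (oN x) (@Nd x) IH (csx_ratio_at x)) (csx_cst _ _ (e%:C%C)%:M))) => y _.
by rewrite rpoly_rec.
Qed.

(** For [ratio_at] itself both formulas follow from equality of the connection forms; the Leibniz
    rule extends them to polynomials because a commutator is a derivation. They are claimed only at
    the centre [x], which is enough: constancy and holomorphy are tested at each point in its own
    chart and frame. *)
Lemma dmx_rpoly q x : (forall l, dmx (chart_at K x) false l (p q x) x = 0) /\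
  forall j, dmx (chart_at K x) true j (p q x) x =
    p q x x *m mconn K x (gram_at E h1 x) j x - mconn K x (gram_at E h1 x) j x *m p q x x.
Proof.
have Cb := csx_ratio_at x.
have db0 l : dmx (chart_at K x) false l (ratio_at x) x = 0.
  rewrite (dmx_false_ratio (oN x) (@Nd x) (csx_gram_at x hh1) (csx_gram_at x hh2) (@pd1 x) (@pd2 x) l (Nx x)).
  by rewrite mconn_eq subrr adjmx0 mulmx0 mul0mx.
have db1 j : dmx (chart_at K x) true j (ratio_at x) x = ratio_at x x *m mconn K x (gram_at E h1 x) j x -
    mconn K x (gram_at E h1 x) j x *m ratio_at x x.
  rewrite (dmx_true_ratio (oN x) (@Nd x) (csx_gram_at x hh1) (csx_gram_at x hh2) (@pd1 x) (@pd2 x) j (Nx x)).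
  by rewrite mconn_eq.
rewrite /p; elim/poly_ind: q => [|q e [IH0 IH1]].
  have z s j : dmx (chart_at K x) s j (fun y => rpoly 0 (ratio_at x y)) x = 0.
    rewrite -(dmx_cst (chart_at K x) s j (0 : 'M[C]_r'.+1) x).
    by apply: (dmx_ext hM (oN x) (@Nd x) _ _ (Nx x)) => y _; rewrite rpoly0.
  by split=> [l|j]; rewrite z// rpoly0 mul0mx mulmx0 subrr.
have dE s j : dmx (chart_at K x) s j (fun y => rpoly (q * 'X + e%:P) (ratio_at x y)) x =
    dmx (chart_at K x) s j (fun y => rpoly q (ratio_at x y)) x *m ratio_at x x +
    rpoly q (ratio_at x x) *m dmx (chart_at K x) s j (ratio_at x) x.
  have -> : dmx (chart_at K x) s j (fun y => rpoly (q * 'X + e%:P) (ratio_at x y)) x =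
    dmx (chart_at K x) s j (fun y => rpoly q (ratio_at x y) *m ratio_at x y + (e%:C%C)%:M) x.
    by apply: (dmx_ext hM (oN x) (@Nd x) _ _ (Nx x)) => y _; rewrite rpoly_rec.
  have Cq := csx_rpoly q x.
  rewrite (dmxD hM (oN x) (@Nd x) _ _ (csxM hM (oN x) (@Nd x) Cq Cb) (csx_cst _ _ _) (Nx x)) dmx_cst addr0.
  by rewrite (dmxM hM (oN x) (@Nd x) _ _ Cq Cb (Nx x)).
split=> [l|j]; first by rewrite dE IH0 db0 mul0mx mulmx0 addr0.
have alg (Q b A : 'M[C]_r'.+1) z : (Q *m A - A *m Q) *m b + Q *m (b *m A - A *m b) =
    (Q *m b + z%:M) *m A - A *m (Q *m b + z%:M).
  rewrite mulmxBl mulmxBr [in RHS]mulmxDl [in RHS]mulmxDr mul_scalar_mx mul_mx_scalar !mulmxA.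
  by rewrite [LHS]addrC addrA subrK opprD [RHS]addrACA subrr addr0.
by rewrite dE IH1 db1 rpoly_rec; exact: alg.
Qed.

Hypothesis cX : connected [set: X].

(** The derivatives given by [dmx_rpoly] are 0 or a commutator, so the trace has zero derivative. *)
Lemma tr_rpoly_cst q x y : \tr (rpoly q (metric_ratio x)) = \tr (rpoly q (metric_ratio y)).
Proof.
apply: (@dd_eq0_constant _ _ _ _ hC (fun x => \tr (rpoly q (metric_ratio x))) cX).
  have H z : setT z -> exists V, [/\ open V, V z & csmooth_on K V (fun x => \tr (rpoly q (metric_ratio x)))].
    move=> _; exists (chart_frame_dom E z); split; [exact: oN|exact: Nx|].
    have Ctr := csx_tr hM (oN z) (@Nd z) (csx_rpoly q z).
    have [s1 s2] := csm_csmooth hM (oN z) (@Nd z) Ctr.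
    by split; [apply: (smooth_on_ext hM (oN z) _ s1)|apply: (smooth_on_ext hM (oN z) _ s2)] => w Nw;
      rewrite /p tr_rpoly_ratio.
  by split; apply: smooth_on_local => z /H[V [oV Vz [? ?]]]; exists V.
move=> z s j; have -> : dd (chart_at K z) s j (fun x => \tr (rpoly q (metric_ratio x))) z =
    dd (chart_at K z) s j (fun x => \tr (p q z x)) z.
  by apply: (dd_ext hM (oN z) (@Nd z) _ _ (Nx z)) => w Nw; rewrite /p tr_rpoly_ratio.
rewrite (dd_tr hM (oN z) (@Nd z) _ _ (csx_rpoly q z) (Nx z)).
have [d0 d1] := dmx_rpoly q z; case: s; last by rewrite d0 mxtrace0.
have trB (A B : 'M[C]_r'.+1) : \tr (A - B) = \tr A - \tr B by exact: raddfB.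
by rewrite d1 trB mxtrace_mulC subrr.
Qed.

(** Near [x] the matrix in the frame [j] is conjugate, by the holomorphic transition [T x], to the
    one in the frame chosen at [x], whose conjugate derivatives vanish at [x]. *)
Lemma holo_rpoly q (j : vidx E) :
  holo_mx K (vdom j) (fun x => invmx (frame j x) *m rpoly q (metric_ratio x) *m frame j x).
Proof.
move=> u v; have oj : open (vdom j) by exact: vdom_open.
pose T x y := invmx (frame (frame_at E x) y) *m frame j y.
have TE x y : chart_frame_dom E x y -> vdom j y -> invmx (frame j y) *m rpoly q (metric_ratio y) *m frame j y =
    invmx (T x y) *m p q x y *m T x y.
  move=> Ny jy; have ue := frame_unit (proj2 Ny); have uj := frame_unit jy.
  rewrite /T invmx_mul ?unitmx_inv// invmxK /p ratio_atE// rpoly_conj//.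
  have alg (A B M : 'M[C]_r'.+1) : A \in unitmx ->
      invmx B *m M *m B = invmx B *m A *m (invmx A *m M *m A) *m (invmx A *m B).
    by move=> uA; rewrite !mulmxA !mulmxK.
  exact: alg.
pose W x := chart_frame_dom E x `&` vdom j.
have oW x : open (W x) by exact: openI.
have Wd x : W x `<=` dom (chart_at K x) by move=> y [/Nd].
have uT x y : W x y -> T x y \in unitmx.
  by move=> [[_ iy] jy]; rewrite unitmx_mul unitmx_inv !frame_unit.
have hT x : holo_mx K (W x) (T x).
  by move=> s t; apply: holo_sub (frame_holo _ _ _ _) => y [[_ iy] jy]; split.
have hTi x := holo_mx_inv hM (oW x) (@uT x) (hT x).
have CTx x := csx_holo (@Wd x) (hT x).
have CTi x := csx_holo (@Wd x) (hTi x).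
have Cp x : csx (chart_at K x) (W x) (p q x) by apply: csx_sub (csx_rpoly q x) => y [].
have CF x : csx (chart_at K x) (W x) (fun y => invmx (T x y) *m p q x y *m T x y).
  apply: (csxM hM (oW x) (@Wd x)); last exact: (CTx x).1.
  by apply: (csxM hM (oW x) (@Wd x)); [exact: (CTi x).1|exact: Cp].
have FE x y : W x y -> (invmx (T x y) *m p q x y *m T x y) u v =
    (invmx (frame j y) *m rpoly q (metric_ratio y) *m frame j y) u v.
  by move=> [Ny jy]; rewrite -TE.
apply: (holo_on_chart_at hC) => //.
  have H z : vdom j z -> exists V, [/\ open V, V z & csmooth_on K V
      (fun x => (invmx (frame j x) *m rpoly q (metric_ratio x) *m frame j x) u v)].
    move=> jz; exists (W z); split; [exact: oW|by split|].
    have [s1 s2] := csm_csmooth hM (oW z) (@Wd z) (CF z u v).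
    by split; [apply: (smooth_on_ext hM (oW z) _ s1)|apply: (smooth_on_ext hM (oW z) _ s2)] => w Nw;
      rewrite FE.
  by split; apply: smooth_on_local => z /H[V [oV Vz [? ?]]]; exists V.
move=> x l jx; have Wx : W x x by split.
have -> : dd (chart_at K x) false l (fun x => (invmx (frame j x) *m rpoly q (metric_ratio x) *m frame j x) u v) x =
    dmx (chart_at K x) false l (fun y => invmx (T x y) *m p q x y *m T x y) x u v.
  by rewrite mxE; apply: (dd_ext hM (oW x) (@Wd x) _ _ Wx) => y Wy; rewrite FE.
have C1 := csxM hM (oW x) (@Wd x) (CTi x).1 (Cp x).
rewrite (dmxM hM (oW x) (@Wd x) _ _ C1 (CTx x).1 Wx) (dmxM hM (oW x) (@Wd x) _ _ (CTi x).1 (Cp x) Wx).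
have e1 := (CTx x).2 l x Wx; have e2 := (CTi x).2 l x Wx; have e3 := (dmx_rpoly q x).1 l.
by rewrite e1 e2 e3 !mul0mx !mulmx0 !addr0 !mul0mx mxE.
Qed.

End TwoBundleMetrics.

(** * Degree densities *)

(** [P] is the [H]-orthogonal projection onto the span of the columns of [s]. *)
Lemma gram_projection (R : realType) r k (H : 'M[R[i]]_r) (s : 'M[R[i]]_(r, k)) : adjmx H = H ->
  adjmx s *m H *m s \in unitmx ->
  let P := s *m invmx (adjmx s *m H *m s) *m adjmx s *m H in
  [/\ P *m P = P, adjmx P *m H = H *m P, \tr P = k%:R & P *m s = s].
Proof.
move=> aH uQ; have aQ : adjmx (adjmx s *m H *m s) = adjmx s *m H *m s.
  by rewrite !adjmxM adjmxK aH mulmxA.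
move QE : (adjmx s *m H *m s) uQ aQ => Q uQ aQ P.
have Ps : P *m s = s.
  have -> : P *m s = s *m invmx Q *m (adjmx s *m H *m s) by rewrite /P !mulmxA.
  by rewrite QE -mulmxA mulVmx// mulmx1.
split => //.
- by rewrite {2}/P !mulmxA Ps.
- by rewrite /P !adjmxM adjmxK adjmx_inv aQ aH !mulmxA.
- have -> : P = (s *m invmx Q) *m (adjmx s *m H) by rewrite /P !mulmxA.
  by rewrite mxtrace_mulC mulmxA QE mulmxV// mxtrace1.
Qed.

Section GramDegree.
Variables (R : realType) (n : nat) (X : ptopologicalType) (K : kahler R n X).
Local Notation C := (R[i]).
Local Notation hC := (kmanifold K).
Local Notation hM := (kmanifold K).1.
Variables (r : nat) (E : vbundle K r) (h : X -> 'M[C]_r).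
Hypothesis hh : hermitian_metric E h.
Variables (k : nat) (s0 : X -> 'M[C]_(r, k)) (U : set X) (x : X).
Hypotheses (oU : open U) (Ux : U x) (hs : holo_secs E U s0) (rs : forall y, U y -> \rank (s0 y) = k).

Let a := chart_at K x.
Let e := frame (frame_at E x).
Let V := U `&` chart_frame_dom E x.
Let oV : open V. Proof. by apply: openI => //; exact: chart_frame_dom_open. Qed.
Let Vx : V x. Proof. by split => //; exact: chart_frame_dom_self. Qed.
Let Va : V `<=` dom a. Proof. by move=> y [_ []]. Qed.
Let H := gram_at E h x.
Let sig y := invmx (e y) *m s0 y.
Let ue y : V y -> e y \in unitmx. Proof. by move=> [_ [_ jy]]; exact: frame_unit. Qed.
Let hsig : holo_mx K V sig.
Proof. by apply: holo_mx_sub (hs (frame_at E x)) => y [? []]. Qed.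
Let CH : csx a V H. Proof. by apply: csx_sub (csx_gram_at x hh) => y []. Qed.
Let pH y : V y -> posdef (H y). Proof. by move=> [_ Ny]; exact: posdef_gram_at. Qed.
Let Cs := (csx_holo Va hsig).1.
Let ds := (csx_holo Va hsig).2.
Let Q y := adjmx (sig y) *m H y *m sig y.

Let QE y : V y -> Q y = gram h s0 y.
Proof.
move=> Vy; rewrite /Q /H /gram_at -/e /gram /sig !mulmxA mulmxK ?ue// -mulmxA -[_ *m h y *m _]mulmxA.
rewrite adjmxM -!mulmxA; congr (_ *m _); rewrite mulmxA -adjmxM mulmxV ?ue// adjmx1 mul1mx.
by [].
Qed.

Let rsig y : V y -> \rank (sig y) = k.
Proof. by move=> Vy; rewrite mxrank_unit_mul ?unitmx_inv ?ue ?rs//; case: Vy. Qed.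

Let pQ y : V y -> posdef (Q y).
Proof. by move=> Vy; apply: posdef_gram; [exact: pH|exact: rsig]. Qed.

Let CQ : csx a V Q.
Proof. by apply: (csxM hM oV Va _ Cs); apply: (csxM hM oV Va) => //; exact: (csx_adj hM oV Va Cs). Qed.

Lemma degree_density_gram_lap :
  degree_density K (gram h s0) x = lap K (fun y => ln (complex.Re (\det (gram h s0 y)))) x.
Proof.
apply: (degree_density_lap oV Vx Va) => [|y Vy]; last by rewrite -QE//; exact: pQ.
by apply: (csx_ext hM oV Va _ CQ) => y /QE.
Qed.

Lemma smooth_ln_det_gram : smooth_on K V (fun y => ln (complex.Re (\det (gram h s0 y)))).
Proof.
have [s1 _] := csm_csmooth hM oV Va (csx_det hM oV Va CQ).
apply: (smooth_on_ext hM oV _ (smooth_on_ln hM oV _ s1)) => [y Vy|y Vy]; first by rewrite QE.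
by case: (det_posdef (pQ Vy)).
Qed.

Let P := sig x *m invmx (Q x) *m adjmx (sig x) *m H x.
Let N i := dmx a true i sig x + mconn K x H i x *m sig x.

Lemma degree_density_gram : degree_density K (gram h s0) x =
  complex.Re (\tr (contraction K x (chern_curvature K H x) *m P)) -
  complex.Re (\sum_l \sum_j invmx (gmx K x) l j *
    \tr (invmx (Q x) *m adjmx (N l - P *m N l) *m H x *m (N j - P *m N j))).
Proof.
have -> : degree_density K (gram h s0) x = degree_density K Q x.
  rewrite degree_density_gram_lap (degree_density_lap oV Vx Va CQ pQ).
  by apply: (laplacian_ext K oV Vx) => y /QE ->.
rewrite degree_densityE -[contraction _ _ _]mulmx1 !tr_contraction -cReN -cReD -sumrN -big_split.
apply: (congr1 (@complex.Re R)); apply: eq_bigr => l _; rewrite -sumrN -big_split.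
apply: eq_bigr => j _ /=; rewrite mulmx1 -mulrN -mulrDr; apply: (congr1 (fun z => _ * z)).
apply: (tr_curvature_gram oV Vx Va j l CH pH Cs ds) => y Vy; exact/posdef_unit/pQ.
Qed.

Lemma projection_facts : [/\ P *m P = P, adjmx P *m H x = H x *m P, \tr P = k%:R & P *m sig x = sig x].
Proof.
apply: gram_projection; [by have [] := pH Vx|exact/posdef_unit/pQ].
Qed.

(** The second fundamental form can only lower the degree density of a subbundle. *)
Lemma degree_density_gram_le : degree_density K (gram h s0) x <=
  complex.Re (\tr (contraction K x (chern_curvature K H x) *m P)).
Proof.
rewrite degree_density_gram gerBl; apply: trace_form_ge0; [|exact: pQ|exact: pH].
by apply: kmetric_posdef; exact: (dom_chart_at hM).
Qed.

(** The hypothesis says that the second fundamental form vanishes at [x]: the covariant derivative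
    of the frame stays in the subbundle. *)
Lemma degree_density_gram_eq : (forall i, P *m N i = N i) -> degree_density K (gram h s0) x =
  complex.Re (\tr (contraction K x (chern_curvature K H x) *m P)).
Proof.
move=> PN; rewrite degree_density_gram big1 ?subr0// => l _; rewrite big1// => j _.
have z (g : C) (A : 'M[C]_(k, r)) (B : 'M[C]_(r, k)) : B = 0 -> g * \tr (A *m B) = 0.
  by move=> ->; rewrite mulmx0 mxtrace0 mulr0.
by apply: z; apply/eqP; rewrite subr_eq0 eq_sym; apply/eqP; exact: PN.
Qed.

Lemma degree_density_gram_bound : (0 < k)%N -> degree_density K (gram h s0) x <=
  endo_norm (H x) (LambdaF K H x) * Num.sqrt k%:R.
Proof.
move=> k0; have [PP PH trP _] := projection_facts.
apply: (le_trans degree_density_gram_le).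
have := Re_tr_proj_le (LambdaF K H x) (pH Vx) PP PH trP k0; apply: le_trans; apply: le_trans (ler_norm _).
rewrite le_eqVlt; apply/orP; left; apply/eqP; apply: (congr1 (@complex.Re R)).
rewrite /LambdaF Lambda_mxE -scalemxAl mxtraceZ mulrA.
suff -> : Complex 0 1 * - Complex 0 1 = 1 :> C by rewrite mul1r.
by apply: complex_eq => /=; ring.
Qed.

End GramDegree.

Section BundleDegree.
Variables (R : realType) (n : nat) (X : ptopologicalType) (K : kahler R n X).
Local Notation C := (R[i]).
Local Notation hC := (kmanifold K).
Local Notation hM := (kmanifold K).1.
Variables (r : nat) (E : vbundle K r) (h : X -> 'M[C]_r).
Hypothesis hh : hermitian_metric E h.

(** A frame of the whole bundle is a subframe of full rank: its projection is the identity and its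
    second fundamental form is 0. *)
Lemma degree_density_frame (j : vidx E) x : vdom j x ->
  degree_density K (gram h (frame j)) x = degree_density K (gram_at E h x) x.
Proof.
move=> jx; have hs := holo_secs_frame_cols j.
have rs y : vdom j y -> \rank (frame j y) = r by move=> jy; exact/mxrank_unit/frame_unit.
have oj : open (vdom j) by exact: vdom_open.
have [PP _ _ Ps] := projection_facts hh jx rs.
set P := (X in X *m _ = _) in Ps.
have P1 : P = 1%:M.
  have us : invmx (frame (frame_at E x) x) *m frame j x \in unitmx.
    by rewrite unitmx_mul unitmx_inv !frame_unit//; exact: vdom_frame_at.
  have gen (S B : 'M[C]_r) : S \in unitmx -> B *m S = S -> B = 1%:M.
    by move=> uS BS; rewrite -[LHS](mulmxK uS) BS mulmxV.
  exact: gen us Ps.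
rewrite (degree_density_gram_eq hh oj jx hs rs) => [|i]; first by rewrite -/P P1 mulmx1 degree_densityE.
by rewrite -/P P1 mul1mx.
Qed.

(** The frame in [gram_at E h x] changes with [x] in an uncontrolled way; [degree_density_frame]
    replaces it near a point by one fixed frame, where the density is the Laplacian of a smooth
    function. *)
Lemma degree_density_continuous : continuous (fun x => degree_density K (gram_at E h x) x).
Proof.
move=> x; pose j := frame_at E x; have jx : vdom j x by exact: vdom_frame_at.
have oj : open (vdom j) by exact: vdom_open.
have hs := holo_secs_frame_cols j.
have rs y : vdom j y -> \rank (frame j y) = r by move=> jy; exact/mxrank_unit/frame_unit.
have sl := smooth_ln_det_gram hh x oj hs rs.
have oV : open (vdom j `&` chart_frame_dom E x) by apply: openI => //; exact: chart_frame_dom_open.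
have Vx : (vdom j `&` chart_frame_dom E x) x by split => //; exact: chart_frame_dom_self.
have sL := laplacian_smooth oV sl.
have [cL _] := sL (chart_at K x) 0%N.
have {}cL := cL x (conj Vx (dom_chart_at hM x)).
have E1 y : vdom j y -> degree_density K (gram_at E h y) y =
    lap K (fun y => ln (complex.Re (\det (gram h (frame j) y)))) y.
  by move=> jy; rewrite -(degree_density_frame jy) (degree_density_gram_lap hh oj jy hs rs).
rewrite /continuous_at E1//; apply: cvg_trans cL; apply: near_eq_cvg.
by apply: filterS (open_nbhs_nbhs (conj oj jx)) => y jy; rewrite E1.
Qed.

End BundleDegree.

(** * The degree of a projection *)

Section ProjectionDegree.
Variables (R : realType) (n : nat) (X : ptopologicalType) (K : kahler R n X).
Local Notation C := (R[i]).
Local Notation mu := (dvol K).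
Local Notation hC := (kmanifold K).
Local Notation hM := (kmanifold K).1.
Variables (r' : nat) (E : vbundle K r'.+1) (h0 h1 : X -> 'M[C]_r'.+1) (c : R).
Hypotheses (hh0 : hermitian_metric E h0) (hh1 : hermitian_metric E h1).
Hypotheses (he1 : hermitian_einstein E h1) (sd : same_det h1 h0).
Hypothesis h01 : forall x v, hsqnorm (h0 x) v <= c * hsqnorm (h1 x) v.
Hypothesis h10 : forall x v, hsqnorm (h1 x) v <= c * hsqnorm (h0 x) v.
Hypothesis c1 : 1 <= c.
Variables (P : X -> 'M[C]_r'.+1) (k : nat).
Hypothesis PP : forall x, P x *m P x = P x.
Hypothesis rkP : forall x, \rank (P x) = k.
Hypothesis hP : forall j : vidx E,
  holo_mx K (vdom j) (fun x => invmx (frame j x) *m P x *m frame j x).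
Hypothesis k0 : (0 < k)%N.
Let pe x y := invmx (frame (frame_at E x) y) *m P y *m frame (frame_at E x) y.
Hypothesis dP : forall x j, dmx (chart_at K x) true j (pe x) x =
  pe x x *m mconn K x (gram_at E h1 x) j x - mconn K x (gram_at E h1 x) j x *m pe x x.

Let W := proj_submodule PP hP.
Let sl x := local_subframe W k x.

Let sl_near x : exists U, [/\ open U, U x & subframe W U (sl x)].
Proof. exact: (xgetPex _ (proj_subframe_near PP rkP hP x)). Qed.

Let subframe_secs U (s : X -> 'M[C]_(r'.+1, k)) : subframe W U s ->
  [/\ holo_secs E U s, forall y, U y -> P y *m s y = s y & forall y, U y -> \rank (s y) = k].
Proof.
move=> [cs rs _]; split => //.
  move=> j u v; have [hv _] := cs v.
  have -> : (fun x => (invmx (frame j x) *m s x) u v) =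
    (fun x => (invmx (frame j x) *m col v (s x)) u 0); last exact: hv.
  by apply/funext => y; rewrite colE mulmxA -colE [RHS]mxE.
move=> y Uy; apply/matrixP => u v; have [_ /(_ y Uy)] := cs v.
by rewrite colE mulmxA -!colE => /(congr1 (fun A : 'cV[C]_r'.+1 => A u 0)); rewrite !mxE.
Qed.

Let rank_pe x y : chart_frame_dom E x y -> \rank (pe x y) = k.
Proof.
move=> [_ jy]; have ue := frame_unit jy; rewrite /pe mxrankMfree ?row_free_unit//.
by rewrite mxrank_unit_mul ?unitmx_inv// rkP.
Qed.

(** As [P] is parallel, the second fundamental form of its image for [h1] vanishes. What remains is
    the trace of the contracted curvature against a projection of rank [k]; that curvature is
    scalar, whence the ratio of ranks. *)
Lemma degree_density_einstein x U (s : X -> 'M[C]_(r'.+1, k)) : open U -> U x -> subframe W U s ->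
  degree_density K (gram h1 s) x = k%:R / r'.+1%:R * degree_density K (gram_at E h1 x) x.
Proof.
move=> oU Ux /subframe_secs[hs Ps rs].
have [_ _ trP Psig] := projection_facts hh1 Ux rs.
pose e := frame (frame_at E x); pose sig y := invmx (e y) *m s y.
pose V := U `&` chart_frame_dom E x.
have oV : open V by apply: openI => //; exact: chart_frame_dom_open.
have Vx : V x by split => //; exact: chart_frame_dom_self.
have Va : V `<=` dom (chart_at K x) by move=> y [_ []].
have ue y : V y -> e y \in unitmx by move=> [_ [_ jy]]; exact: frame_unit.
have pesig y : V y -> pe x y *m sig y = sig y.
  move=> Vy; have := ue y Vy; have [Uy _] := Vy; rewrite /pe /sig -/e => uey.
  by rewrite -!mulmxA mulKVmx// Ps.
have hsig : holo_mx K V sig by apply: holo_mx_sub (hs (frame_at E x)) => y [? []].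
have hpe : holo_mx K V (pe x) by apply: holo_mx_sub (hP (frame_at E x)) => y [_ []].
have [Cs _] := csx_holo Va hsig; have [Cp _] := csx_holo Va hpe.
have rsig : \rank (sig x) = k by rewrite mxrank_unit_mul ?unitmx_inv ?ue ?rs.
have [Z peZ] := col_span (pesig x Vx) (rank_pe (chart_frame_dom_self E x)) rsig.
(* With [B] the matrix of [P] and [A] the orthogonal projection, which have the same image:
   differentiating [B S = S] by the formula [dP] shows that [B] fixes the covariant derivative
   [T + F S], hence so does [A]. *)
have gen (A B D F : 'M[C]_r'.+1) (S T : 'M[C]_(r'.+1, k)) (Y : 'M[C]_(k, r'.+1)) :
    A *m S = S -> B *m S = S -> B = S *m Y -> (B *m F - F *m B) *m S + B *m T = T ->
    A *m (T + F *m S) = T + F *m S.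
  move=> AS BS BE dS; have AB : A *m B = B by rewrite BE mulmxA AS.
  suff BN : B *m (T + F *m S) = T + F *m S by rewrite -BN mulmxA AB.
  by rewrite mulmxDr -[in RHS]dS mulmxBl -[F *m B *m S]mulmxA BS addrAC subrK addrC mulmxA.
rewrite (degree_density_gram_eq hh1 oU Ux hs rs) => [|i]; last first.
  apply: (gen _ _ 0 _ _ _ _ Psig (pesig x Vx) peZ).
  rewrite -dP -(dmxM hM oV Va _ _ Cp Cs Vx).
  by apply: (dmx_ext hM oV Va _ _ Vx) => y Vy; exact: pesig.
rewrite degree_densityE.
have trace (A B : 'M[C]_r'.+1) : A = (\tr A / r'.+1%:R)%:M -> \tr B = k%:R ->
    complex.Re (\tr (A *m B)) = k%:R / r'.+1%:R * complex.Re (\tr A).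
  move=> AE tB; rewrite [in LHS]AE mul_scalar_mx mxtraceZ tB.
  have -> : r'.+1%:R^-1 = (r'.+1%:R^-1 : R)%:C%C :> C by rewrite fmorphV rmorph_nat.
  have -> : k%:R = (k%:R : R)%:C%C :> C by rewrite rmorph_nat.
  by case: (\tr A) => p q /=; ring.
exact: trace (contraction_einstein x he1) trP.
Qed.

Lemma degree_density_bound x :
  `|degree_density K (gram_at E h0 x) x| <= endo_norm (gram_at E h0 x x) (LambdaF K (gram_at E h0 x) x)
     * Num.sqrt r'.+1%:R.
Proof.
have pH := posdef_gram_at hh0 (chart_frame_dom_self E x).
have := @Re_tr_proj_le _ _ _ (LambdaF K (gram_at E h0 x) x) 1%:M r'.+1 pH.
by rewrite mulmx1 adjmx1 mul1mx !mulmx1 mxtrace1; exact.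
Qed.

Let L h x y := ln (complex.Re (\det (gram h (sl x) y))).

Let gram_pos h U x y : hermitian_metric E h -> subframe W U (sl x) -> U y -> 0 < complex.Re (\det (gram h (sl x) y)).
Proof.
move=> [ph _] /subframe_secs[_ _ rs] Uy.
by have [] := det_posdef (posdef_gram (ph y) (rs y Uy)).
Qed.

(** Two frames of the image at [y] differ by an invertible [D], which shifts the logarithm by the
    same [t] for every metric. The difference for two metrics is therefore independent of the frame,
    and smooth although [sl] is chosen point by point. *)
Let L_change x y U : open U -> U y -> subframe W U (sl x) ->
  exists t, forall h, hermitian_metric E h -> L h y y = t + L h x y.
Proof.
move=> oU Uy sU; have [U' [oU' U'y sU']] := sl_near y.
have [_ Ps rs] := subframe_secs sU; have [_ Ps' rs'] := subframe_secs sU'.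
have [Z PE] := col_span (Ps y Uy) (rkP y) (rs y Uy).
have sE : sl y y = sl x y *m (Z *m sl y y) by rewrite mulmxA -PE Ps'.
move: sE; set D := Z *m _ => sE.
have uD : D \in unitmx.
  rewrite -row_free_unit /row_free eqn_leq rank_leq_row /= -{1}(rs' y U'y).
  by rewrite {1}sE mxrankM_maxr.
exists (ln (sqmod (\det D))) => h hh.
have GE : complex.Re (\det (gram h (sl y) y)) = sqmod (\det D) * complex.Re (\det (gram h (sl x) y)).
  rewrite /gram [in LHS]sE adjmxM.
  have -> : adjmx D *m adjmx (sl x y) *m h y *m (sl x y *m D) =
    adjmx D *m (adjmx (sl x y) *m h y *m sl x y) *m D by rewrite !mulmxA.
  rewrite !det_mulmx det_adjmx mulrAC [Num.conj _ * _]mulrC sqmodE.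
  by move: (\det (_ *m _ *m _)) => z; case: z => p q /=; ring.
have q0 : 0 < sqmod (\det D).
  rewrite lt0r sqmod_ge0 andbT; apply: contraTneq uD => /sqmod_eq0 D0.
  by rewrite unitmxE D0 unitr0.
by rewrite /L GE lnM// posrE//; exact: gram_pos sU Uy.
Qed.

Let f x := L h0 x x - L h1 x x.
Let fE x y U : open U -> U y -> subframe W U (sl x) -> f y = L h0 x y - L h1 x y.
Proof.
move=> oU Uy sU; have [t tE] := L_change oU Uy sU.
by rewrite /f !tE// opprD addrACA subrr add0r.
Qed.

(** A bound for [|f|]: exchanging [h0] and [h1] multiplies a k-by-k Gram determinant by at most
    [c ^+ k]. *)
Let M := ln (c ^+ k).
Let c0 : 0 < c. Proof. by apply: lt_le_trans c1. Qed.

Let L_le h h' x : hermitian_metric E h -> hermitian_metric E h' ->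
  (forall x v, hsqnorm (h x) v <= c * hsqnorm (h' x) v) -> L h x x <= M + L h' x x.
Proof.
move=> hh hh' hle; have [U [oU Ux sU]] := sl_near x; have [_ _ rs] := subframe_secs sU.
have p0 := gram_pos hh sU Ux; have p1 := gram_pos hh' sU Ux.
rewrite /M /L -lnM ?posrE ?exprn_gt0// ler_ln ?posrE ?mulr_gt0 ?exprn_gt0//.
apply: det_le_posdef; [exact: posdef_gram (hh'.1 x) (rs x Ux)|exact: posdef_gram (hh.1 x) (rs x Ux)|].
move=> v; have hE g : hsqnorm (gram g (sl x) x) v = hsqnorm (g x) (sl x x *m v).
  by rewrite /gram /hsqnorm adjmxM !mulmxA.
by rewrite !hE.
Qed.

(** Shifted to be nonnegative, as [integral_laplacian_eq0] asks; the Laplacian does not change. *)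
Let F x := f x + M.
Let F_bound x : 0 <= F x <= M + M.
Proof.
have := L_le x hh0 hh1 h01; have := L_le x hh1 hh0 h10; rewrite /F /f.
by move: (L _ _ _) (L _ _ _) => u v; move=> ? ?; apply/andP; split; lra.
Qed.

Let sL h U x : hermitian_metric E h -> open U -> U x -> subframe W U (sl x) ->
  smooth_on K (U `&` chart_frame_dom E x) (L h x).
Proof.
move=> hh oU Ux /subframe_secs[hs Ps rs]; exact: smooth_ln_det_gram.
Qed.

Let oVn U x : open U -> open (U `&` chart_frame_dom E x).
Proof. by move=> oU; apply: openI => //; exact: chart_frame_dom_open. Qed.

Let sF : smooth_on K setT F.
Proof.
apply: smooth_on_local => x _; have [U [oU Ux sU]] := sl_near x.
have oV := oVn x oU; exists (U `&` chart_frame_dom E x); split => //; first by split => //; exact: chart_frame_dom_self.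
apply: (smooth_on_ext hM oV _ (smooth_onD hM oV (smooth_onD hM oV (sL hh0 oU Ux sU)
  (smooth_onN hM oV (sL hh1 oU Ux sU))) (smooth_on_cst _ M))) => y [Uy _].
by rewrite /F (fE oU Uy sU).
Qed.

Let dE x := degree_density K (gram_at E h0 x) x.
Let ds x := degree_density K (gram h0 (sl x)) x.

(** The [h0] part is the density of the subbundle. The [h1] part is [k / r] times the density of the
    whole bundle for [h1], which equals that for [h0] because the determinants agree. *)
Let lapF x : lap K F x = ds x - k%:R / r'.+1%:R * dE x.
Proof.
have [U [oU Ux sU]] := sl_near x; have oV := oVn x oU.
have Vx : (U `&` chart_frame_dom E x) x by split => //; exact: chart_frame_dom_self.
have [hs Ps rs] := subframe_secs sU.
have s0 := sL hh0 oU Ux sU; have s1 := sL hh1 oU Ux sU; have sN := smooth_onN hM oV s1.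
have -> : lap K F x = lap K (fun y => (L h0 x y + - L h1 x y) + M) x.
  by apply: (laplacian_ext K oV Vx) => y [Uy _]; rewrite /F (fE oU Uy sU).
rewrite (laplacianD oV Vx (smooth_onD hM oV s0 sN) (smooth_on_cst _ M)) laplacian_cst addr0.
rewrite (laplacianD oV Vx s0 sN).
have -> : lap K (fun y => - L h1 x y) x = - lap K (L h1 x) x.
  apply/eqP; rewrite -subr_eq0 opprK -(laplacianD oV Vx sN s1) -(laplacian_cst K 0 x).
  by apply/eqP; apply: (laplacian_ext K oV Vx) => y _; rewrite addNr.
have l0 := degree_density_gram_lap hh0 oU Ux hs rs; have l1 := degree_density_gram_lap hh1 oU Ux hs rs.
have e1 : lap K (L h1 x) x = k%:R / r'.+1%:R * dE x.
  apply: (etrans (esym l1)); apply: (etrans (degree_density_einstein oU Ux sU)).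
  by apply: (congr1 (fun z => _ * z)); exact: degree_density_same_det.
have e0 : lap K (L h0 x) x = ds x by exact: esym l0.
exact: (f_equal2 (fun u v : R => u - v) e0 e1).
Qed.

Variables (phi rho : X -> R) (B : R).
Hypotheses (mphi : measurable_fun setT (phi : borel X -> R)) (phi0 : forall x, 0 < phi x).
Hypothesis iphi : (\int[mu]_x (phi x)%:E < +oo)%E.
Hypothesis B0 : 0 < B.
Hypothesis cb : curvature_bound E h0 (fun x => B * phi x).
Hypotheses (hrho : exhaustion K rho) (rho_gt0 : forall x, 0 < rho x).
Hypothesis rhoL2 : (\int[mu]_x (dbar_sqnorm K (fun y => ln (rho y)) x)%:E < +oo)%E.

Let kr : R := k%:R / r'.+1%:R.
(** The square roots are the Hilbert-Schmidt norms of the identity and of a projection of rank [k],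
    from [Re_tr_proj_le]. In units of [phi], [C1] bounds the density of the bundle and [C2] the
    Laplacian of [F]. *)
Let C1 := B * Num.sqrt r'.+1%:R.
Let C2 := B * Num.sqrt k%:R + kr * C1.
Let kr0 : 0 <= kr. Proof. by rewrite divr_ge0. Qed.
Let C10 : 0 <= C1. Proof. by rewrite mulr_ge0 ?sqrtr_ge0// ltW. Qed.
Let C20 : 0 <= C2. Proof. by rewrite addr_ge0// mulr_ge0 ?sqrtr_ge0// ltW. Qed.

Let aeF : Filter (almost_everywhere mu). Proof. exact: ae_filter_ringOfSetsType. Qed.

Let dE_le : {ae mu, forall x, `|dE x| <= C1 * phi x}.
Proof.
apply: (@filterS _ _ aeF _ _ _ cb) => x xb; apply: (le_trans (degree_density_bound x)).
rewrite /C1 mulrAC; apply: ler_wpM2r; [exact: sqrtr_ge0|exact: xb].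
Qed.

Let lapF_le : {ae mu, forall x, lap K F x <= C2 * phi x}.
Proof.
apply: (@filterS2 _ _ aeF _ _ _ _ cb dE_le) => x xb dEx; have [U [oU Ux sU]] := sl_near x.
have [hs Ps rs] := subframe_secs sU.
have db := degree_density_gram_bound hh0 oU Ux hs rs k0.
have d1 : ds x <= B * Num.sqrt k%:R * phi x.
  by apply: (le_trans db); rewrite mulrAC; apply: ler_wpM2r; [exact: sqrtr_ge0|exact: xb].
have d2 : - (kr * dE x) <= kr * (C1 * phi x).
  rewrite -mulrN; apply: ler_wpM2l => //; apply: le_trans dEx; rewrite -normrN; exact: ler_norm.
rewrite lapF -/kr [leRHS]mulrDl; apply: lerD; first exact: d1.
by rewrite -[leRHS]mulrA; exact: d2.
Qed.

Let mdE : measurable_fun setT (dE : borel X -> R).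
Proof. by apply: measurable_fun_continuous; exact: degree_density_continuous. Qed.

Let int_phi (d : R) : 0 <= d -> (\int[mu]_x (d * phi x)%:E < +oo)%E.
Proof.
move=> d0; under eq_integral do rewrite EFinM.
rewrite ge0_integralZl_EFin//; last 2 first.
- by move=> x _; rewrite lee_fin ltW.
- exact/measurable_EFinP.
by rewrite lte_mul_pinfty// lee_fin.
Qed.

Let mcphi (d : R) : measurable_fun setT ((fun x => d * phi x) : borel X -> R).
Proof. by apply: measurable_funM => //; exact: measurable_cst. Qed.

Let idE : mu.-integrable setT (fun x => (dE x)%:E).
Proof.
apply/integrableP; split; first exact/measurable_EFinP.
apply: (@le_lt_trans _ _ (\int[mu]_x (C1 * phi x)%:E)%E); last exact: int_phi.
apply: ae_ge0_le_integral => //.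
- by apply/measurable_EFinP; exact: measurableT_comp.
- by move=> x _; rewrite lee_fin mulr_ge0// ltW.
- by apply/measurable_EFinP; exact: mcphi.
- by apply: (@filterS _ _ aeF _ _ _ dE_le) => x dx _; rewrite lee_fin.
Qed.

(** The curvature bound holds almost everywhere, but [integral_laplacian_eq0] wants a pointwise
    bound on the Laplacian. This maximum is one, and it equals [C2 * phi] almost everywhere, hence
    is integrable. *)
Let w x := Num.max (C2 * phi x) (lap K F x).

Lemma sub_degree_proj : sub_degree h0 W k = ((k%:R / r'.+1%:R)%:E * degree E h0)%E.
Proof.
have slF : smooth_on K setT (lap K F) by exact: (laplacian_smooth (@openT X) sF).
have mlF : measurable_fun setT (lap K F : borel X -> R).
  by apply: measurable_fun_continuous; exact: (smooth_on_continuous hM slF).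
have mw : measurable_fun setT (w : borel X -> R).
  by apply: measurable_maxr => //; exact: mcphi.
have w0 x : 0 <= w x by rewrite le_max mulr_ge0// ltW.
have iw : (\int[mu]_x (w x)%:E < +oo)%E.
  apply: (@le_lt_trans _ _ (\int[mu]_x (C2 * phi x)%:E)%E); last exact: int_phi.
  apply: ae_ge0_le_integral => //.
  - by move=> x _; rewrite lee_fin.
  - exact/measurable_EFinP.
  - by move=> x _; rewrite lee_fin mulr_ge0// ltW.
  - by apply/measurable_EFinP; exact: mcphi.
  - by apply: (@filterS _ _ aeF _ _ _ lapF_le) => x lx _; rewrite lee_fin /w ge_max lexx.
have lw x : lap K F x <= w x by rewrite le_max lexx orbT.
have [iF IF] := integral_laplacian_eq0 hrho rho_gt0 rhoL2 sF F_bound mw w0 iw lw.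
rewrite /sub_degree proj_regular_locus; last exact: rkP.
have -> : (\int[mu]_x (degree_density K (gram h0 (local_subframe W k x)) x)%:E =
    \int[mu]_x ((lap K F x)%:E + (kr)%:E * (dE x)%:E))%E.
  apply: eq_integral => x _; rewrite -EFinM -EFinD lapF -/kr subrK; by [].
rewrite integralD//; last exact: integrableZl.
by rewrite IF add0e integralZl.
Qed.

End ProjectionDegree.

(** * Uniqueness of the Hermitian-Einstein metric *)

Lemma scalar_ratio_eq (R : realType) r (H1 H2 : 'M[R[i]]_r.+1) z : posdef H1 -> posdef H2 ->
  \det H1 = \det H2 -> invmx H1 *m H2 = z%:M -> H1 = H2.
Proof.
move=> p1 p2 dE E; have u1 := posdef_unit p1.
have H2E : H2 = z *: H1 by rewrite -[LHS](mulKVmx u1) E mul_mx_scalar.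
have d0 : \det H1 != 0 by rewrite -unitfE -unitmxE.
have z1 : z ^+ r.+1 = 1.
  by apply: (mulIf d0); rewrite mul1r -detZ -H2E.
have e0 : (delta_mx 0 0 : 'cV[R[i]]_r.+1) != 0.
  by apply/eqP => /matrixP/(_ 0 0); rewrite !mxE eqxx => /eqP; rewrite oner_eq0.
have [a1 /(_ _ e0) q1] := p1; have [a2 /(_ _ e0) q2] := p2.
have zc : Num.conj z = z.
  (* Both metrics are Hermitian, so [z] is real; it is positive by definiteness, and then
     [z ^+ r.+1 = 1] forces [z = 1]. *)
  have : (Num.conj z - z) *: H1 = 0 by rewrite scalerBl -H2E -a2 H2E adjmxZ a1 subrr.
  move=> /eqP; rewrite scaler_eq0 subr_eq0 => /orP[/eqP//|/eqP H10].
  by move: u1; rewrite H10 unitmxE det0 unitr0.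
have zr : z = (complex.Re z)%:C%C by apply: complex_real_eq; case: (z) zc => p q [] /=; lra.
have z0 : 0 < complex.Re z.
  move: q2; rewrite H2E /hsqnorm -scalemxAr -scalemxAl mxE zr.
  have -> (t : R) (w : R[i]) : complex.Re (t%:C%C * w) = t * complex.Re w by case: w => p q /=; ring.
  by rewrite pmulr_lgt0.
suff z_1 : z = 1 by rewrite H2E z_1 scale1r.
rewrite zr; suff -> : complex.Re z = 1 by [].
have : complex.Re z ^+ r.+1 = 1.
  by have := z1; rewrite {1}zr -rmorphXn => /(congr1 (@complex.Re R)).
by move=> /eqP; rewrite pexpr_eq1// ?ltW// => /eqP.
Qed.

Theorem proposition2p12 (R : realType) (m n r : nat)
    (G : topologicalType) (L : lie_group R m G)
    (X : ptopologicalType) (K : kahler R n X) (kappa : action L K)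
    (E : vbundle K r) (T : equivariant kappa E)
    (phi rho1 : X -> R) (h0 h1 h2 : X -> 'M[R[i]]_r) :
  compact [set: G] ->
  connected [set: X] ->
  standing_assumption kappa phi ->
  exhaustion K rho1 -> (forall x, 0 < rho1 x) ->
  (\int[dvol K]_x (dbar_sqnorm K (fun y => ln (rho1 y)) x)%:E < +oo)%E ->
  hermitian_metric E h0 -> invariant_metric T h0 ->
  (exists2 B : R, 0 < B & curvature_bound E h0 (fun x => B * phi x)) ->
  analytically_stable T h0 ->
  hermitian_metric E h1 -> invariant_metric T h1 ->
  hermitian_einstein E h1 -> same_det h1 h0 -> mutually_bounded h1 h0 ->
  hermitian_metric E h2 -> invariant_metric T h2 ->
  hermitian_einstein E h2 -> same_det h2 h0 -> mutually_bounded h2 h0 ->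
  h1 = h2.
Proof.
case: r E T h0 h1 h2 => [|r] E T h0 h1 h2 _ cX [[mphi phi0] _ iphi _ maxp] hrho rho0 rhoL2
  hh0 inv0 [B B0 cb] st hh1 inv1 he1 sd1 [c c1 mb1] hh2 inv2 he2 sd2 [c' c1' mb2].
  by apply/funext => x; apply/matrixP => -[].
have c0 : 0 < c by apply: lt_le_trans c1.
have c0' : 0 < c' by apply: lt_le_trans c1'.
have sd12 : same_det h1 h2 by move=> x; rewrite sd1 sd2.
have h12 x v : hsqnorm (h2 x) v <= c' * c * hsqnorm (h1 x) v.
  have /andP[_ b1] := mb1 x v; have /andP[b2 _] := mb2 x v.
  rewrite -mulrA -ler_pdivrMl//; exact: le_trans b2 b1.
have ratio_cst := tr_rpoly_cst hh1 hh2 he1 he2 sd12 h12 maxp cX.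
have [sc|nsc] := pselect (forall x, exists z, metric_ratio h1 h2 x = z%:M).
  apply/funext => x; have [z zE] := sc x.
  exact: scalar_ratio_eq (hh1.1 x) (hh2.1 x) (sd12 x) zE.
have [x0 nz] : exists x0, forall z, invmx (h1 x0) *m h2 x0 <> z%:M.
  apply: contrapT => H; apply: nsc => x; apply: contrapT => Hx; apply: H; exists x => z zE.
  by apply: Hx; exists z.
have [q [PP0 /andP[rk0 rkr]]] := exists_spectral_projection (hh1.1 x0) (hh2.1 x0).1 nz.
pose P x := rpoly q (metric_ratio h1 h2 x); pose k := \rank (P x0).
(* [P^2 - P] is [h1]-selfadjoint and the trace of its square is constant, equal to its value 0 at
   [x0]; hence it vanishes everywhere. *)
have PP x : P x *m P x = P x.
  have sa : adjmx (metric_ratio h1 h2 x) *m h1 x = h1 x *m metric_ratio h1 h2 x.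
    have u1 := posdef_unit (hh1.1 x).
    rewrite /metric_ratio adjmxM adjmx_inv (hh1.1 x).1 (hh2.1 x).1 mulmxA mulmxV// mul1mx.
    by rewrite mulmxKV.
  have qE y : rpoly (q * q - q) (metric_ratio h1 h2 y) = P y *m P y - P y by rewrite rpolyB rpolyM.
  apply/eqP; rewrite -subr_eq0 -qE; apply/eqP; apply: (selfadjoint_idem_eq0 (hh1.1 x)).
    exact: rpoly_selfadjoint.
  by rewrite -rpolyM (ratio_cst _ x x0) rpolyM qE PP0 subrr mul0mx mxtrace0.
(* The rank of a projection is its trace, which is constant. *)
have rkP x : \rank (P x) = k.
  have := ratio_cst q x x0; rewrite -!/(P _) (mxtrace_idem (PP x)) (mxtrace_idem (PP x0)).
  by move=> /eqP; rewrite eqr_nat => /eqP.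
have hP (j : vidx E) := holo_rpoly hh1 hh2 he1 he2 sd12 h12 maxp q j.
(* Invariance of both metrics makes their ratio transform by conjugation with [T g x], and
   polynomials in it do likewise. *)
have PT g x : T g x *m P (kappa g x) = P x *m T g x.
  have uT := Theta_unit T g x; have ua : adjmx (T g x) \in unitmx by rewrite adjmx_unit.
  have u1 := posdef_unit (hh1.1 x).
  have rE : metric_ratio h1 h2 (kappa g x) = invmx (T g x) *m metric_ratio h1 h2 x *m T g x.
    rewrite /metric_ratio -inv1 -inv2 invmx_mul ?unitmx_mul ?ua// invmx_mul// -!mulmxA.
    by rewrite mulKmx.
  by rewrite /P rE rpoly_conj// -mulmxA mulKVmx.
have dP x j : dmx (chart_at K x) true j
    (fun y => invmx (frame (frame_at E x) y) *m P y *m frame (frame_at E x) y) x =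
    (invmx (frame (frame_at E x) x) *m P x *m frame (frame_at E x) x) *m mconn K x (gram_at E h1 x) j x -
    mconn K x (gram_at E h1 x) j x *m (invmx (frame (frame_at E x) x) *m P x *m frame (frame_at E x) x).
  have [_ /(_ j)] := dmx_rpoly hh1 hh2 he1 he2 sd12 h12 maxp q x.
  have Nx := chart_frame_dom_self E x.
  have pE y : chart_frame_dom E x y -> rpoly q (ratio_at E h1 h2 x y) =
      invmx (frame (frame_at E x) y) *m P y *m frame (frame_at E x) y.
    by move=> Ny; rewrite ratio_atE// rpoly_conj//; apply: frame_unit; exact: (proj2 Ny).
  rewrite (pE x Nx) => <-.
  by apply: (dmx_ext (kmanifold K).1 (chart_frame_dom_open E x) (@chart_frame_dom_sub _ _ _ _ _ E x) _ _ Nx) => y /pE ->.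
have k0 : (0 < k)%N by [].
have h01 x v : hsqnorm (h0 x) v <= c * hsqnorm (h1 x) v by have /andP[] := mb1 x v.
have h10 x v : hsqnorm (h1 x) v <= c * hsqnorm (h0 x) v.
  by have /andP[+ _] := mb1 x v; rewrite ler_pdivrMl.
have dE := sub_degree_proj hh0 hh1 he1 sd1 h01 h10 c1 PP rkP hP k0 dP mphi phi0 iphi B0 cb
  hrho rho0 rhoL2.
(* Stability demands a strict inequality between the two slopes, which [dE] shows to be equal. *)
have := st (proj_submodule PP hP) k (@proj_submodule_saturated _ _ _ _ _ E P PP hP)
  (@proj_submodule_equivariant _ _ _ _ _ _ _ _ _ _ T P PP hP PT) (proj_has_rank PP rkP hP).
rewrite k0 rkr => /(_ isT); rewrite dE muleA -EFinM mulrA mulVf ?pnatr_eq0 -?lt0n// mul1r.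
by rewrite ltxx.
Qed.
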